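(* Let $T>0$ (including the case $T=\infty$). Then for all $w^0,\theta^0\in H^2\cap H^1_0(0,L)$ and $w^1,\theta^1\in L^2(0,L)$ there exists a unique (global in time) weak solution $(w,\theta)\in X_T^2=X_T\times X_T$ of the system $$\begin{cases} M w_{tt}=-EI\,w_{xxxx}-\big[h_\alpha(w,\theta)+h_\beta(w,\theta)\big]_x+Mg,\\[1mm] \dfrac{M\ell^2}{3}\theta_{tt}=-EJ\,\theta_{xxxx}+GK\,\theta_{xx}-\ell\cos\theta\,\big[h_\alpha(w,\theta)-h_\beta(w,\theta)\big]_x,\end{cases}\qquad x\in(0,L),\ t\in(0,T),$$ with boundary conditions $w=w_{xx}=\theta=\theta_{xx}=0$ at $x=0$ and $x=L$, which satisfies the initial conditions $$w(x,0)=w^0(x),\quad \theta(x,0)=\theta^0(x),\quad w_t(x,0)=w^1(x),\quad \theta_t(x,0)=\theta^1(x)\qquad \text{for } x\in(0,L).$$ Here the nonlinear nonlocal terms $h_\alpha,h_\beta$, the space $X_T$ and the notion of weak solution are those defined in the context.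
   Context: Constants: $L,\ell,M,g,E,I,J,G,K,H,A,E_c,y_0$ are fixed positive real numbers. (They are mechanical parameters; $H$ is given by $H=\frac{MgL^2}{16f}$, where $f>0$ is the cable sag.) Subscripts $x,t$ denote partial derivatives in $x\in(0,L)$ and in time $t$. Cable shape: for $x\in(0,L)$, $$y(x)=-\frac{Mg}{4H}x^2+\frac{MgL}{4H}x-y_0,\qquad \xi(x)=\sqrt{1+y'(x)^2},\qquad L_c=\int_0^L\sqrt{1+y'(x)^2}\,dx .$$ Functionals: for $u\in C^1[0,L]$, $$\Gamma(u)=\int_0^L\Big(\sqrt{1+[(u+y)_x]^2}-\sqrt{1+(y')^2}\Big)dx\in\mathbb{R},\qquad \boldsymbol{\chi}(u)=\frac{(u+y)_x}{\sqrt{1+[(u+y)_x]^2}}\in C^0[0,L].$$ Nonlinear terms (for $w,\theta$ evaluated at a fixed time): $$h_\alpha(w,\theta)=-\Big(H\xi+\frac{AE_c}{L_c}\Gamma(w+\ell\sin\theta)\Big)\boldsymbol{\chi}(w+\ell\sin\theta),$$ $$h_\beta(w,\theta)=-\Big(H\xi+\frac{AE_c}{L_c}\Gamma(w-\ell\sin\theta)\Big)\boldsymbol{\chi}(w-\ell\sin\theta).$$ Function spaces: the real Hilbert spaces $L^2(0,L)$, $H^1_0(0,L)$, $H^2\cap H^1_0(0,L)$ are endowed respectively with the scalar products $(u,v)_2=\int_0^L uv\,dx$, $(u,v)_{H^1}=\int_0^L u'v'\,dx$, $(u,v)_{H^2}=\int_0^L u''v''\,dx$. $H^*(0,L)$ denotes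 the dual space of $H^2\cap H^1_0(0,L)$, with duality pairing $\langle\cdot,\cdot\rangle_*$; $L^2(0,L)$ is regarded as a subspace of $H^*(0,L)$ in the usual way (via $(\cdot,\cdot)_2$). Define $$X_T=C^0\big([0,T];H^2\cap H^1_0(0,L)\big)\cap C^1\big([0,T];L^2(0,L)\big)\cap C^2\big([0,T];H^*(0,L)\big),$$ where $[0,T]$ is read as $[0,\infty)$ if $T=\infty$. Weak solution: $(w,\theta)$ is a weak solution of the system if $(w,\theta)\in X_T^2$ and, for all $\varphi,\psi\in H^2\cap H^1_0(0,L)$ and all $t\in(0,T)$, $$\begin{cases} M\langle w_{tt},\varphi\rangle_*+EI\,(w,\varphi)_{H^2}=\big(h_\alpha(w,\theta)+h_\beta(w,\theta),\varphi_x\big)_2+(Mg,\varphi)_2,\\[1mm] \dfrac{M\ell^2}{3}\langle\theta_{tt},\psi\rangle_*+EJ\,(\theta,\psi)_{H^2}+GK\,(\theta,\psi)_{H^1}=\ell\big(h_\alpha(w,\theta)-h_\beta(w,\theta),(\psi\cos\theta)_x\big)_2.\end{cases}$$ The boundary conditions are regarded as included in this weak formulation (through the space $X_T$ and the test functions) and are not imposed separately. *)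

(* Defs.v *)
From mathcomp Require Import all_boot all_order all_algebra.
From mathcomp Require Import all_classical all_reals all_analysis.

Set Implicit Arguments.
Unset Strict Implicit.
Unset Printing Implicit Defensive.
Import Order.TTheory GRing.Theory Num.Theory.
Import numFieldNormedType.Exports.
Local Open Scope classical_set_scope.
Local Open Scope ring_scope.

(* Elements of the spaces over (0, L) are represented by functions R -> R; only
   their restriction to (0, L) matters, and it matters up to almost-everywhere
   equality. *)
Section Spaces.
Context {R : realType}.
Variable L : R.
Implicit Types (u v phi : R -> R) (F : (R -> R) -> R).
Local Notation mu := (@lebesgue_measure R).
Local Notation D := (`]0, L[%classic : set R).

Definition L2 : set (R -> R) :=
  [set u : R -> R | measurable_fun D u /\
           mu.-integrable D (EFin \o (fun x => u x ^+ 2))].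

Definition ip2 u v : R := \int[mu]_(x in D) (u x * v x).
Definition norm2 u : R := Num.sqrt (ip2 u u).

(* C^1_c(0, L): continuously differentiable, compact support in (0, L). *)
Definition C1c : set (R -> R) :=
  [set phi : R -> R | [/\ forall x : R, derivable phi x 1, continuous (derive1 phi) &
    exists K : set R,
      [/\ compact K, K `<=` D & forall x : R, ~ K x -> phi x = 0]]].

Definition weak_deriv u : set (R -> R) :=
  [set v : R -> R | L2 v /\ forall phi, C1c phi -> ip2 u (derive1 phi) = - ip2 v phi].

(* A chosen representative of the weak derivative u_x (0 if there is none);
   weak derivatives are unique up to a.e. equality, and for u in C^1[0, L]
   they coincide with the classical one. *)
Definition wD u : R -> R := xget (cst 0) (weak_deriv u).

Definition H1 : set (R -> R) := [set u : R -> R | L2 u /\ weak_deriv u !=set0].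
Definition H2 : set (R -> R) := [set u : R -> R | H1 u /\ H1 (wD u)].

(* H^1_0(0, L): closure of C^1_c(0, L) in H^1(0, L) for the full H^1 norm. *)
Definition H10 : set (R -> R) :=
  [set u : R -> R | H1 u /\ forall e : R, 0 < e -> exists2 phi, C1c phi &
     norm2 (u - phi) ^+ 2 + norm2 (wD (u - phi)) ^+ 2 < e].

Definition H2H10 : set (R -> R) := H2 `&` H10.

Definition ipH1 u v : R := ip2 (wD u) (wD v).
Definition ipH2 u v : R := ip2 (wD (wD u)) (wD (wD v)).
Definition normH2 u : R := Num.sqrt (ipH2 u u).

(* H^*(0, L): only the values of F on H^2 \cap H^1_0 matter, and the duality
   pairing <F, u>_* is F u. *)
Definition Hstar : set ((R -> R) -> R) :=
  [set F | (forall (a : R) u v, H2H10 u -> H2H10 v ->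
              F (a *: u + v) = a * F u + F v) /\
           exists C : R, forall u, H2H10 u -> `|F u| <= C * normH2 u].

Definition normstar F : R :=
  sup [set r | exists u, [/\ H2H10 u, normH2 u <= 1 & r = `|F u|]].

Definition L2_to_Hstar u : (R -> R) -> R := fun phi => ip2 u phi.

End Spaces.

(* C^k(I; X) for an interval I and a space X with (semi)norm N; at an end point
   of I belonging to I the derivative is one-sided. *)
Section TimeRegularity.
Context {R : realType} {V : lmodType R}.
Variables (X : set V) (N : V -> R) (I : set R).
Implicit Types f df : R -> V.

Definition time_continuous f : Prop :=
  (forall t, I t -> X (f t)) /\
  forall t, I t -> N (f s - f t) @[s --> within I (nbhs t)] --> (0 : R).

Definition time_deriv f df : Prop :=
  [/\ forall t, I t -> X (f t), forall t, I t -> X (df t) &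
      forall t, I t ->
        N ((s - t)^-1 *: (f s - f t) - df t) @[s --> within I (dnbhs t)]
          --> (0 : R)].

Fixpoint time_C (k : nat) f : Prop :=
  time_continuous f /\
  if k is k'.+1 then exists2 df, time_deriv f df & time_C k' df else True.

End TimeRegularity.

(* [0, T], read as [0, +oo) when T = +oo *)
Definition time_interval {R : realType} (T : \bar R) : set R :=
  [set t : R | 0 <= t /\ (t%:E <= T)%E].

Section Solutions.
Context {R : realType}.
Variable L : R.

Definition XT (T : \bar R) (w : R -> R -> R) : Prop :=
  [/\ time_C (H2H10 L) (normH2 L) (time_interval T) 0 w,
      time_C (L2 L) (norm2 L) (time_interval T) 1 w &
      time_C (Hstar L) (normstar L) (time_interval T) 2
        (fun t => L2_to_Hstar L (w t))].

Definition L2_t_deriv (T : \bar R) (w wt : R -> R -> R) : Prop :=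
  time_deriv (L2 L) (norm2 L) (time_interval T) w wt.

Definition Hstar_tt_deriv (T : \bar R) (w : R -> R -> R)
    (wtt : R -> (R -> R) -> R) : Prop :=
  exists2 F : R -> (R -> R) -> R,
    time_deriv (Hstar L) (normstar L) (time_interval T)
      (fun t => L2_to_Hstar L (w t)) F &
    time_deriv (Hstar L) (normstar L) (time_interval T) F wtt.

Variables (l M g E I J G K A Ec y0 f : R).
Local Notation mu := (@lebesgue_measure R).
Local Notation D := (`]0, L[%classic : set R).

Definition Hc : R := M * g * L ^+ 2 / (16 * f).

Definition ycable (x : R) : R :=
  - (M * g / (4 * Hc)) * x ^+ 2 + M * g * L / (4 * Hc) * x - y0.

Definition xi (x : R) : R := Num.sqrt (1 + (derive1 ycable x) ^+ 2).

Definition Lc : R := \int[mu]_(x in D) Num.sqrt (1 + (derive1 ycable x) ^+ 2).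

Definition Gam (u : R -> R) : R :=
  \int[mu]_(x in D) (Num.sqrt (1 + (wD L (u + ycable) x) ^+ 2) -
                     Num.sqrt (1 + (derive1 ycable x) ^+ 2)).

Definition chi (u : R -> R) (x : R) : R :=
  wD L (u + ycable) x / Num.sqrt (1 + (wD L (u + ycable) x) ^+ 2).

Definition h_alpha (w th : R -> R) (x : R) : R :=
  - (Hc * xi x + A * Ec / Lc * Gam (w + l *: (sin \o th))) *
    chi (w + l *: (sin \o th)) x.

Definition h_beta (w th : R -> R) (x : R) : R :=
  - (Hc * xi x + A * Ec / Lc * Gam (w - l *: (sin \o th))) *
    chi (w - l *: (sin \o th)) x.

Definition weak_solution (T : \bar R) (w th : R -> R -> R) : Prop :=
  [/\ XT T w, XT T th &
   exists wtt thtt : R -> (R -> R) -> R,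
   [/\ Hstar_tt_deriv T w wtt, Hstar_tt_deriv T th thtt &
    forall phi psi : R -> R, H2H10 L phi -> H2H10 L psi ->
    forall t : R, 0 < t -> (t%:E < T)%E ->
      M * wtt t phi + E * I * ipH2 L (w t) phi =
        ip2 L (h_alpha (w t) (th t) + h_beta (w t) (th t)) (wD L phi)
        + ip2 L (cst (M * g)) phi
      /\
      M * l ^+ 2 / 3 * thtt t psi + E * J * ipH2 L (th t) psi
        + G * K * ipH1 L (th t) psi =
        l * ip2 L (h_alpha (w t) (th t) - h_beta (w t) (th t))
                  (wD L (psi * (cos \o th t)))]].

Definition initial_conditions (T : \bar R) (w : R -> R -> R)
    (w0 w1 : R -> R) : Prop :=
  ae_eq mu D (w 0) w0 /\
  exists2 wt, L2_t_deriv T w wt & ae_eq mu D (wt 0) w1.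

End Solutions.

(* Main.v *)
(** In the scaled sine coefficients u_j of (w, theta) the system is a sequence of
    oscillators u_j'' + om_j^2 u_j = F_j(u), where F is minus the gradient of a
    potential P and is locally Lipschitz from the energy space
    { sum om_j^2 u_j^2 < oo } to l^2.  Composing F with the radial retraction onto
    a ball makes it globally Lipschitz, and Picard iteration with Duhamel's
    formula gives a global solution.  The energy
    sum (u_j'^2 + om_j^2 u_j^2) / 2 + P(u) is conserved: P is only differentiated
    along the solution up to an error |E(s) - E(t)| <= C |s - t|^(3/2), which
    suffices.  As P is coercive, the solution stays in a ball that does not depend
    on its radius of truncation, so the retraction is inactive.  Conversely, testing
    a weak solution with the sine functions shows that its coefficients solve these
    oscillators; the energy inequality for the difference of two solutions improves
    any bound of the form q e^(2 La t) by a fixed factor, whence uniqueness. *)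
Require Import Defs.
From mathcomp Require Import all_boot all_order all_algebra.
From mathcomp Require Import all_classical all_reals all_analysis.
From mathcomp Require Import measurable_realfun ring lra.
Import Order.TTheory GRing.Theory Num.Theory.
Import numFieldNormedType.Exports.
Local Open Scope classical_set_scope.
Local Open Scope ring_scope.

(** Both unknowns are carried by one real sequence, so the evolution is solved mode by mode without
    Galerkin approximation or compactness. This requires the force to land in $l^2$: its
    coefficients are those of $-h_x$, and $h_x$ lies in $L^2$ because h is a smooth function of the
    slope $(w \pm l \sin\theta + y)_x$, whose derivative enters linearly. The integration by parts
    leaves no boundary terms since the sines vanish at both ends. The obstacle is the energy
    identity. Velocities lie only in $L^2$, so a trajectory is Lipschitz in time for the $l^2$ norm
    but merely continuous for the energy norm, whereas the Taylor remainder of the potential is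
    quadratic in first x-derivatives. The interpolation $|u_x|^2 \le |u| |u_{xx}|$ splits this
    square into one factor of each kind, which makes the remainder $o(|s - t|)$. The potential is
    the sum of two nonnegative cable energies minus a gravity term linear in w. This gives
    coercivity, and the ball of truncation depends only on the initial energy and on constants of
    the system. *)

(** * Cauchy-Schwarz inequality and the space L^2(0, L) *)

(** For b = 0 the choice t = -(a + 1) / (2c) gives the value -1; for b > 0 the minimiser -c / b
    gives the claim. Serves both the finite and the integral Cauchy-Schwarz inequality. *)
Lemma discriminant_le (R : realFieldType) (a b c : R) : 0 <= a -> 0 <= b ->
  (forall t, 0 <= a + 2 * t * c + t ^+ 2 * b) -> c ^+ 2 <= a * b.
Proof.
move=> a0 b0 q; move: b0; rewrite le_eqVlt => /orP[/eqP b0|b0].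
  rewrite -b0 mulr0; have [->|c0] := eqVneq c 0; first by rewrite expr0n.
  have := q (- (a + 1) / (2 * c)); rewrite -b0 mulr0 addr0.
  have -> : 2 * (- (a + 1) / (2 * c)) * c = - (a + 1) by field.
  by lra.
have := q (- c / b).
have -> : a + 2 * (- c / b) * c + (- c / b) ^+ 2 * b = (a * b - c ^+ 2) / b.
  by field; rewrite gt_eqF.
by rewrite pmulr_lge0 ?invr_gt0// subr_ge0.
Qed.

Lemma CS_sum (R : realFieldType) (I : Type) (r : seq I) (x y : I -> R) :
  (\sum_(i <- r) x i * y i) ^+ 2 <= (\sum_(i <- r) x i ^+ 2) * (\sum_(i <- r) y i ^+ 2).
Proof.
apply: discriminant_le => [||t].
- by apply: sumr_ge0 => i _; exact: sqr_ge0.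
- by apply: sumr_ge0 => i _; exact: sqr_ge0.
have -> : \sum_(i <- r) x i ^+ 2 + 2 * t * (\sum_(i <- r) x i * y i) +
    t ^+ 2 * (\sum_(i <- r) y i ^+ 2) = \sum_(i <- r) (x i + t * y i) ^+ 2.
  by rewrite !big_distrr/= -!big_split/=; apply: eq_bigr => i _; ring.
by apply: sumr_ge0 => i _; exact: sqr_ge0.
Qed.

Section L2_interval.
Context {R : realType} {L : R}.
Hypothesis L_gt0 : 0 < L.
Local Notation mu := (@lebesgue_measure R).
Local Notation D := (`]0, L[%classic : set R).
Implicit Types u v w : R -> R.

Definition intD u : Prop := mu.-integrable D (EFin \o u).

Lemma mD : measurable (D : set (measurableTypeR R)). Proof. exact: measurable_itv. Qed.

Lemma muD : mu D = L%:E.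
Proof. by rewrite lebesgue_measure_itv/= lte_fin L_gt0 sube0. Qed.

Lemma intD_meas u : intD u -> measurable_fun D u.
Proof. by move=> /integrableP[/measurable_EFinP]. Qed.

Lemma intD_le u v : measurable_fun D u -> intD v ->
  (forall x, D x -> `|u x| <= `|v x|) -> intD u.
Proof.
move=> mu_ iv h; apply: le_integrable iv; first exact: mD.
  exact/measurable_EFinP.
by move=> x Dx /=; rewrite lee_fin h.
Qed.

Lemma intD_bounded u (C : R) : measurable_fun D u ->
  (forall x, D x -> `|u x| <= C) -> intD u.
Proof.
move=> mu_ uC; apply: measurable_bounded_integrable => //.
  by rewrite [X in (X < _)%E]muD ltry.
by exists C; split; [exact: num_real | move=> M CM x Dx; apply: le_trans (ltW CM); exact: uC].
Qed.

Lemma cont_meas u : continuous u -> measurable_fun D u.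
Proof. by move=> cu; apply: measurable_funS (continuous_measurable_fun cu). Qed.

Lemma cont_bounded u : continuous u ->
  exists2 C, 0 <= C & forall x, 0 <= x <= L -> `|u x| <= C.
Proof.
move=> cu.
have cu' : {within `[0, L], continuous (fun x => `|u x|)}.
  by apply: continuous_subspaceT => x; apply: continuous_comp; [exact: cu|exact: norm_continuous].
have [c _ h] := EVT_max (ltW L_gt0) cu'.
by exists `|u c| => // x x0L; apply: h; rewrite in_itv.
Qed.

Lemma cont_intD u : continuous u -> intD u.
Proof.
move=> cu; have [C _ h] := cont_bounded u cu.
apply: (intD_bounded u C); first exact: cont_meas.
by move=> x /=; rewrite in_itv/= => /andP[x0 xL]; apply: h; rewrite !ltW.
Qed.

Lemma intDD u v : intD u -> intD v -> intD (u + v).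
Proof.
move=> iu iv; have := integrableD mD iu iv; congr (_.-integrable _ _).
Qed.

Lemma intDZ (a : R) u : intD u -> intD (a *: u).
Proof.
move=> iu; have := integrableZl mD a iu; congr (_.-integrable _ _).
Qed.

Lemma L2_meas u : L2 L u -> measurable_fun D u. Proof. by case. Qed.

Lemma L2_sqr u : L2 L u -> intD (u * u).
Proof. by case=> _; congr (_.-integrable _ _). Qed.

Lemma L2_mul u v : L2 L u -> L2 L v -> intD (u * v).
Proof.
move=> hu hv; apply: (intD_le (u * v) (u * u + v * v)).
- by apply: measurable_funM; exact: L2_meas.
- by apply: intDD; exact: L2_sqr.
move=> x _ /=; rewrite /GRing.mul/= /GRing.add/= ler_norml.
rewrite ger0_norm; last by rewrite addr_ge0// -expr2 sqr_ge0.
by apply/andP; split; nra.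
Qed.

Lemma L2P u : measurable_fun D u -> intD (u * u) -> L2 L u.
Proof. by move=> mu_ iu; split=> //; move: iu; congr (_.-integrable _ _). Qed.

Lemma L2D u v : L2 L u -> L2 L v -> L2 L (u + v).
Proof.
move=> hu hv; apply: L2P; first by apply: measurable_funD; exact: L2_meas.
have -> : (u + v) * (u + v) = u * u + (2%:R *: (u * v) + v * v).
  by apply/funext => x; rewrite !fctE /GRing.scale/=; ring.
apply: intDD; first exact: L2_sqr.
by apply: intDD; [apply: intDZ; exact: L2_mul| exact: L2_sqr].
Qed.

Lemma L2Z (a : R) u : L2 L u -> L2 L (a *: u).
Proof.
move=> hu; apply: L2P; first by apply: measurable_funM => //; exact: L2_meas.
have -> : (a *: u) * (a *: u) = (a ^+ 2) *: (u * u).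
  by apply/funext => x; rewrite !fctE /GRing.scale/=; ring.
by apply: intDZ; exact: L2_sqr.
Qed.

Lemma L2N u : L2 L u -> L2 L (- u).
Proof. by move=> hu; rewrite -scaleN1r; exact: L2Z. Qed.

Lemma L2B u v : L2 L u -> L2 L v -> L2 L (u - v).
Proof. by move=> hu hv; apply: L2D => //; exact: L2N. Qed.

Lemma cont_L2 u : continuous u -> L2 L u.
Proof.
move=> cu; apply: L2P; first exact: cont_meas.
by apply: cont_intD => x; apply: continuousM; exact: cu.
Qed.

Lemma bounded_L2 u (C : R) : measurable_fun D u ->
  (forall x, D x -> `|u x| <= C) -> L2 L u.
Proof.
move=> mu_ uC; apply: L2P => //; apply: (intD_bounded _ (C * C)).
  exact: measurable_funM.
by move=> x Dx; rewrite normrM; apply: ler_pM => //; exact: uC.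
Qed.

Lemma L2_intD u : L2 L u -> intD u.
Proof.
move=> hu; have -> : u = u * cst 1 by rewrite mulr1.
by apply: L2_mul => //; apply: cont_L2 => x; exact: cst_continuous.
Qed.

Local Notation ip := (ip2 L).

Lemma ip2C u v : ip u v = ip v u.
Proof. by apply: eq_Rintegral => x _; rewrite mulrC. Qed.

Lemma ip2Dl u v w : L2 L u -> L2 L v -> L2 L w -> ip (u + v) w = ip u w + ip v w.
Proof.
move=> hu hv hw; rewrite /ip2 -RintegralD//; first last.
- exact: (L2_mul v w).
- exact: (L2_mul u w).
by apply: eq_Rintegral => x _; rewrite [(u + v) x]/GRing.add/= mulrDl.
Qed.

Lemma ip2Zl (a : R) u w : L2 L u -> L2 L w -> ip (a *: u) w = a * ip u w.
Proof.
move=> hu hw; rewrite /ip2 -RintegralZl//; first last.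
- exact: (L2_mul u w).
by apply: eq_Rintegral => x _; rewrite [(a *: u) x]/GRing.scale/= mulrA.
Qed.

Lemma ip2Nl u w : L2 L u -> L2 L w -> ip (- u) w = - ip u w.
Proof. by move=> hu hw; rewrite -scaleN1r ip2Zl// mulN1r. Qed.

Lemma ip2Bl u v w : L2 L u -> L2 L v -> L2 L w -> ip (u - v) w = ip u w - ip v w.
Proof. by move=> hu hv hw; rewrite ip2Dl// ?ip2Nl//; exact: L2N. Qed.

Lemma ip2Dr u v w : L2 L u -> L2 L v -> L2 L w -> ip w (u + v) = ip w u + ip w v.
Proof. by move=> hu hv hw; rewrite ip2C ip2Dl// ip2C (ip2C v). Qed.

Lemma ip2Zr (a : R) u w : L2 L u -> L2 L w -> ip w (a *: u) = a * ip w u.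
Proof. by move=> hu hw; rewrite ip2C ip2Zl// ip2C. Qed.

Lemma ip2Br u v w : L2 L u -> L2 L v -> L2 L w -> ip w (u - v) = ip w u - ip w v.
Proof. by move=> hu hv hw; rewrite ip2C ip2Bl// ip2C (ip2C v). Qed.

Lemma ip2_ge0 u : 0 <= ip u u.
Proof. by apply: Rintegral_ge0 => x _; rewrite -expr2 sqr_ge0. Qed.

Lemma L2_0 : L2 L (0 : R -> R).
Proof. by apply: cont_L2 => x; exact: cst_continuous. Qed.

Lemma ip20l u : ip 0 u = 0.
Proof.
rewrite /ip2 (_ : (fun x => _) = fun=> 0) ?Rintegral_cst ?mul0r//.
by apply/funext => x; rewrite mul0r.
Qed.

Lemma ip20r u : ip u 0 = 0. Proof. by rewrite ip2C ip20l. Qed.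

Lemma L2_sum (I : Type) (r : seq I) (F : I -> R -> R) :
  (forall i, L2 L (F i)) -> L2 L (\sum_(i <- r) F i).
Proof.
by move=> h; elim: r => [|i r ih]; rewrite ?big_nil ?big_cons; [exact: L2_0|exact: L2D].
Qed.

Lemma ip2_suml (I : Type) (r : seq I) (F : I -> R -> R) w :
  (forall i, L2 L (F i)) -> L2 L w ->
  ip (\sum_(i <- r) F i) w = \sum_(i <- r) ip (F i) w.
Proof.
move=> h hw; elim: r => [|i r ih]; rewrite ?big_nil ?big_cons ?ip20l//.
by rewrite ip2Dl// ?ih//; exact: L2_sum.
Qed.

Lemma ip2_sqrD u v (t : R) : L2 L u -> L2 L v ->
  ip (u + t *: v) (u + t *: v) = ip u u + 2 * t * ip u v + t ^+ 2 * ip v v.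
Proof.
move=> hu hv; have htv := L2Z t _ hv.
by rewrite ip2Dl ?ip2Dr ?ip2Zr ?ip2Zl ?(ip2C v u)//; [ring | exact: L2D].
Qed.

Lemma ip2_CS2 u v : L2 L u -> L2 L v -> ip u v ^+ 2 <= ip u u * ip v v.
Proof.
move=> hu hv; apply: discriminant_le => [||t]; rewrite ?ip2_ge0//.
by rewrite -ip2_sqrD// ip2_ge0.
Qed.

Local Notation nrm := (norm2 L).

Lemma norm2_ge0 u : 0 <= nrm u. Proof. exact: sqrtr_ge0. Qed.

Lemma norm2_sqr u : nrm u ^+ 2 = ip u u.
Proof. by rewrite sqr_sqrtr// ip2_ge0. Qed.

Lemma ip2_CS u v : L2 L u -> L2 L v -> `|ip u v| <= nrm u * nrm v.
Proof.
move=> hu hv; rewrite -(@ler_pXn2r _ 2)// ?nnegrE ?mulr_ge0 ?norm2_ge0//.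
by rewrite exprMn !norm2_sqr real_normK ?num_real// ip2_CS2.
Qed.

Lemma norm2_tri u v : L2 L u -> L2 L v -> nrm (u + v) <= nrm u + nrm v.
Proof.
move=> hu hv; rewrite -(@ler_pXn2r _ 2)// ?nnegrE ?addr_ge0 ?norm2_ge0//.
rewrite norm2_sqr -[v in u + v]scale1r ip2_sqrD// -!norm2_sqr.
have := ip2_CS u v hu hv; move/ler_normlP => [_]; nra.
Qed.

Lemma norm2N u : nrm (- u) = nrm u.
Proof.
by rewrite /norm2; congr Num.sqrt; apply: eq_Rintegral => x _; rewrite [(- u) x]/GRing.opp/= mulrNN.
Qed.

Lemma norm2_triB u v : L2 L u -> L2 L v -> nrm (u - v) <= nrm u + nrm v.
Proof. by move=> hu hv; rewrite -(norm2N v); apply: norm2_tri => //; exact: L2N. Qed.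

Lemma norm2BC u v : nrm (u - v) = nrm (v - u).
Proof. by rewrite -norm2N opprB. Qed.

Lemma norm2_0 : nrm 0 = 0.
Proof. by rewrite /norm2 ip20l sqrtr0. Qed.

Lemma Rint_ae u v : measurable_fun D u -> measurable_fun D v -> ae_eq mu D u v ->
  \int[mu]_(x in D) u x = \int[mu]_(x in D) v x.
Proof.
move=> m1 m2 h; rewrite /Rintegral; congr fine; apply: ae_eq_integral => //.
- exact/measurable_EFinP.
- exact/measurable_EFinP.
by apply: filterS h => x h Dx /=; rewrite h.
Qed.

Lemma intD_ae u v : measurable_fun D v -> ae_eq mu D u v -> intD u -> intD v.
Proof.
move=> m2 h iu; have m1 := intD_meas _ iu.
apply/integrableP; split; first exact/measurable_EFinP.
have /integrableP[_] := iu; congr (_ < _)%E; apply: ae_eq_integral => //.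
- by apply: measurableT_comp => //; exact/measurable_EFinP.
- by apply: measurableT_comp => //; exact/measurable_EFinP.
by apply: filterS h => x h Dx /=; rewrite h.
Qed.

Lemma ae_eqM u u' v v' : ae_eq mu D u u' -> ae_eq mu D v v' -> ae_eq mu D (u * v) (u' * v').
Proof. by apply: filterS2 => x h h' Dx; rewrite /GRing.mul/= h ?h'. Qed.

Lemma ae_eqD u u' v v' : ae_eq mu D u u' -> ae_eq mu D v v' -> ae_eq mu D (u + v) (u' + v').
Proof. by apply: filterS2 => x h h' Dx; rewrite /GRing.add/= h ?h'. Qed.

Lemma ae_eqZ (a : R) u u' : ae_eq mu D u u' -> ae_eq mu D (a *: u) (a *: u').
Proof. by apply: filterS => x h Dx; rewrite /GRing.scale/= h. Qed.

Lemma ae_eqN u u' : ae_eq mu D u u' -> ae_eq mu D (- u) (- u').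
Proof. by apply: filterS => x h Dx; rewrite /GRing.opp/= h. Qed.

Lemma ae_eqB u u' v v' : ae_eq mu D u u' -> ae_eq mu D v v' -> ae_eq mu D (u - v) (u' - v').
Proof. by move=> h h'; apply: ae_eqD => //; exact: ae_eqN. Qed.

Lemma ae_eqB0 u v : ae_eq mu D (u - v) 0 -> ae_eq mu D u v.
Proof. by apply: filterS => x h Dx; apply/eqP; rewrite -subr_eq0; apply/eqP; exact: h. Qed.

Lemma ip2_ae u u' v v' : L2 L u -> L2 L u' -> L2 L v -> L2 L v' ->
  ae_eq mu D u u' -> ae_eq mu D v v' -> ip u v = ip u' v'.
Proof.
move=> hu hu' hv hv' h1 h2; rewrite /ip2; apply: (Rint_ae (u * v) (u' * v')).
- by apply: measurable_funM; exact: L2_meas.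
- by apply: measurable_funM; exact: L2_meas.
exact: ae_eqM.
Qed.

Lemma norm2_ae u u' : L2 L u -> L2 L u' -> ae_eq mu D u u' -> nrm u = nrm u'.
Proof. by move=> hu hu' h; rewrite /norm2 (ip2_ae u u' u u'). Qed.

Lemma norm2_le_sup u (C : R) : 0 <= C -> L2 L u ->
  (forall x, D x -> `|u x| <= C) -> nrm u <= C * Num.sqrt L.
Proof.
move=> C0 hu uC; rewrite -(@ler_pXn2r _ 2)// ?nnegrE ?mulr_ge0 ?norm2_ge0 ?sqrtr_ge0//.
rewrite norm2_sqr exprMn (sqr_sqrtr (ltW L_gt0)).
have -> : C ^+ 2 * L = \int[mu]_(x in D) C ^+ 2.
  by rewrite Rintegral_cst// [X in fine X]muD.
apply: le_Rintegral => //.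
- exact: (L2_sqr u).
- by apply: (intD_bounded _ (C ^+ 2)) => // x _; rewrite normrX ger0_norm.
move=> x Dx; rewrite -expr2 -[leLHS]real_normK ?num_real//.
by rewrite ler_pXn2r ?nnegrE// uC.
Qed.

Lemma Rint_cont_norm_le u (C : R) : intD u -> 0 <= C -> (forall x, D x -> `|u x| <= C) ->
  `|\int[mu]_(x in D) u x| <= C * L.
Proof.
move=> iu C0 uC; apply: le_trans (le_normr_Rintegral mD iu) _.
have -> : C * L = \int[mu]_(x in D) C.
  by rewrite Rintegral_cst// [X in fine X]muD.
apply: le_Rintegral => //.
- exact: integrable_norm.
- by apply: (intD_bounded _ C) => // x _; rewrite ger0_norm.
Qed.

Lemma L2_cvg_ip (u_ : nat -> R -> R) u v : (forall n, L2 L (u_ n)) -> L2 L u -> L2 L v ->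
  nrm (u_ n - u) @[n --> \oo] --> 0 -> ip (u_ n) v @[n --> \oo] --> ip u v.
Proof.
move=> hn hu hv h; apply/cvgrPdist_lt => e e0.
have e1 : 0 < e / (nrm v + 1) by rewrite divr_gt0// ltr_wpDl// norm2_ge0.
have := h; move/cvgrPdist_lt => /(_ _ e1); apply: filterS => n.
rewrite sub0r normrN ger0_norm ?norm2_ge0// => hlt.
rewrite distrC -ip2Bl//; apply: le_lt_trans (ip2_CS _ _ _ _) _ => //; first exact: L2B.
have := norm2_ge0 v => v0.
apply: (@le_lt_trans _ _ (nrm (u_ n - u) * (nrm v + 1))).
  by apply: ler_wpM2l; rewrite ?norm2_ge0// lerDl.
by rewrite -ltr_pdivlMr// ltr_wpDl.
Qed.

(** Differentiability is asked on the whole line, not only on (0, L): the functions used are series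
    or closed formulas that make sense everywhere, and the end points then need no one-sided
    derivatives. *)
Definition der (f f' : R -> R) := forall x, is_derive x (1 : R) f (f' x).

Lemma der_cont f f' : der f f' -> continuous f.
Proof.
move=> h x; apply: differentiable_continuous; apply/derivable1_diffP.
by case: (h x).
Qed.

Lemma derM f f' g g' : der f f' -> der g g' -> der (f * g) (f * g' + g * f').
Proof.
by move=> hf hg x; have := hf x; have := hg x => ? ?; apply: is_deriveM.
Qed.

Lemma FTC_D f f' : der f f' -> continuous f' ->
  \int[mu]_(x in D) f' x = f L - f 0.
Proof.
move=> hf cf'; have cf := der_cont _ _ hf.
rewrite Rintegral_itv_bndo_bndc; last exact: cont_intD.
rewrite Rintegral_itv_obnd_cbnd; last first.
  apply: (@integrableS _ _ _ mu `[0, L]) => //; first exact: subset_itv_oc_cc.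
  by apply: continuous_compact_integrable; [exact: segment_compact|exact: continuous_subspaceT].
rewrite /Rintegral (@continuous_FTC2 _ f' f 0 L)//.
- exact: continuous_subspaceT.
- split; [by move=> x _; case: (hf x)|exact: cvg_at_right_filter (cf _)|exact: cvg_at_left_filter (cf _)].
by move=> x _; rewrite derive1E; case: (hf x).
Qed.

Lemma ibp_D f f' g g' : der f f' -> der g g' -> continuous f' -> continuous g' ->
  ip2 L f g' = f L * g L - f 0 * g 0 - ip2 L f' g.
Proof.
move=> hf hg cf' cg'; have cf := der_cont _ _ hf; have cg := der_cont _ _ hg.
have := FTC_D _ _ (derM _ _ _ _ hf hg).
have -> : \int[mu]_(x in D) (f * g' + g * f') x = ip2 L f g' + ip2 L g f'.
  rewrite /ip2 -RintegralD//.
  - by apply: (L2_mul f g'); exact: cont_L2.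
  - by apply: (L2_mul g f'); exact: cont_L2.
rewrite (ip2C f' g) => h; rewrite -[f L * g L - _]h ?addrK//.
by move=> x; apply: continuousD; apply: continuousM; [exact: cf|exact: cg'|exact: cg|exact: cf'].
Qed.

End L2_interval.

Ltac l2 := repeat first [ assumption | apply: L2D | apply: L2B | apply: L2Z | apply: L2N | apply: L2_0 | (apply: L2_sum; [assumption | move=> ?]) ].
#[global] Hint Extern 0 (L2 _ _) => solve [l2] : core.

(** * The sine system: orthogonality and completeness *)

Section sine_system.
Context {R : realType} {L : R}.
Hypothesis L_gt0 : 0 < L.
Local Notation mu := (@lebesgue_measure R).
Local Notation D := (`]0, L[%classic : set R).
Local Notation ip := (ip2 L).
Implicit Types u v w : R -> R.

(** Indices start at the first mode: [kap 0] is the lowest frequency and is positive. *)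
Definition kap (k : nat) : R := k.+1%:R * pi / L.
Definition es (k : nat) (x : R) : R := sin (kap k * x).
Definition cs (k : nat) (x : R) : R := cos (kap k * x).

Lemma kap_gt0 k : 0 < kap k.
Proof. by rewrite /kap divr_gt0// mulr_gt0// ?pi_gt0// ltr0Sn. Qed.

Lemma kapL k : kap k * L = k.+1%:R * pi.
Proof. by rewrite /kap divfK// gt_eqF. Qed.

Lemma kap_inj : injective kap.
Proof.
move=> j k /(congr1 (fun z => z * L / pi)); rewrite !kapL !mulfK ?gt_eqF ?pi_gt0//.
by move/eqP; rewrite eqr_nat => /eqP [].
Qed.

Lemma derZ (a : R) u u' : der u u' -> der (a *: u) (a *: u').
Proof. by move=> h x; have := h x => ?; exact: is_deriveZ. Qed.

Lemma derD u u' v v' : der u u' -> der v v' -> der (u + v) (u' + v').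
Proof. by move=> h h' x; have := h x; have := h' x => ? ?; exact: is_deriveD. Qed.

Lemma der_sum n (F F' : nat -> R -> R) : (forall k, der (F k) (F' k)) ->
  der (\sum_(k < n) F k) (\sum_(k < n) F' k).
Proof.
move=> h; elim: n => [|n ih]; first by rewrite !big_ord0 => x; exact: is_derive_cst.
by rewrite !big_ord_recr/=; exact: derD.
Qed.

Lemma der_lin (a : R) : der (fun x => a * x) (cst a).
Proof.
move=> x; have := is_deriveZ a (is_derive_id x (1 : R)).
by rewrite /GRing.scale/= mulr1.
Qed.

Lemma der_comp (f f' g g' : R -> R) : der f f' -> der g g' ->
  der (f \o g) ((f' \o g) * g').
Proof.
move=> hf hg x; have := hf (g x); have := hg x => ? ?.
by apply: (@is_derive_eq _ _ _ _ _ _ _ _ (is_derive1_comp _ _)) => //; rewrite mulrC.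
Qed.

Lemma der_es k : der (es k) (kap k *: cs k).
Proof.
have -> : kap k *: cs k = (cos \o (fun x => kap k * x)) * cst (kap k).
  by apply/funext => x; rewrite !fctE /cs /GRing.scale/= mulrC.
by apply: der_comp (der_lin _) => x; exact: is_derive_sin.
Qed.

Lemma der_cs k : der (cs k) (- kap k *: es k).
Proof.
have -> : - kap k *: es k = ((fun y => - sin y) \o (fun x => kap k * x)) * cst (kap k).
  by apply/funext => x; rewrite !fctE /es /GRing.scale/=; ring.
by apply: der_comp (der_lin _) => x; exact: is_derive_cos.
Qed.

Lemma cont_es k : continuous (es k). Proof. exact: der_cont (der_es k). Qed.
Lemma cont_cs k : continuous (cs k). Proof. exact: der_cont (der_cs k). Qed.

Lemma contZ (a : R) u : continuous u -> continuous (a *: u).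
Proof. by move=> cu x; apply: (@continuousM _ _ (cst a)); [exact: cst_continuous|exact: cu]. Qed.

Lemma contM u v : continuous u -> continuous v -> continuous (u * v).
Proof. by move=> cu cv x; apply: continuousM; [exact: cu|exact: cv]. Qed.

Lemma contD u v : continuous u -> continuous v -> continuous (u + v).
Proof. by move=> cu cv x; apply: continuousD; [exact: cu|exact: cv]. Qed.

Lemma contB u v : continuous u -> continuous v -> continuous (u - v).
Proof. by move=> cu cv x; apply: continuousB; [exact: cu|exact: cv]. Qed.

Lemma L2_es k : L2 L (es k). Proof. exact: cont_L2 (cont_es k). Qed.
Lemma L2_cs k : L2 L (cs k). Proof. exact: cont_L2 (cont_cs k). Qed.

Local Ltac l2' := repeat first [ assumption | apply: L2D | apply: L2B | apply: L2Z | apply: L2N | apply: L2_0 | apply: L2_es | apply: L2_cs | (apply: L2_sum; [assumption | move=> ?]) ].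
#[local] Hint Extern 0 (L2 _ _) => solve [l2'] : core.

Lemma es0 k : es k 0 = 0. Proof. by rewrite /es mulr0 sin0. Qed.

Lemma sin_natpi n : sin (n%:R * pi) = 0 :> R.
Proof.
elim: n => [|n ih]; first by rewrite mul0r sin0.
by rewrite -natr1 mulrDl mul1r sinDpi ih oppr0.
Qed.

Lemma esL k : es k L = 0. Proof. by rewrite /es kapL sin_natpi. Qed.

Lemma es_le1 k x : `|es k x| <= 1.
Proof. by rewrite ler_norml sin_geN1 sin_le1. Qed.
Lemma cs_le1 k x : `|cs k x| <= 1.
Proof. by rewrite ler_norml cos_geN1 cos_le1. Qed.

Lemma ip_es_cs u u' k : der u u' -> continuous u' ->
  ip u' (es k) = - (kap k * ip u (cs k)).
Proof.
move=> hu cu'; have cu := der_cont _ _ hu.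
have := ibp_D L_gt0 _ _ _ _ hu (der_es k) cu' (contZ _ _ (cont_cs k)).
by rewrite esL es0 !mulr0 subrr sub0r ip2Zr//; [move=> ->; rewrite opprK|exact: cont_L2].
Qed.

Lemma ip_cs_cs j k : kap j * kap k * ip (cs j) (cs k) = kap j ^+ 2 * ip (es j) (es k).
Proof.
have := ip_es_cs _ _ k (der_cs j) (contZ _ _ (cont_es j)).
rewrite ip2Zl// => h; have := congr1 (fun z => kap j * z) h => /= h'.
by rewrite -mulrA; apply: oppr_inj; rewrite -mulrN -h'; ring.
Qed.

(** The cosine product is symmetric in j and k, so [kap j ^+ 2] and [kap k ^+ 2] times the sine
    product coincide; this is the self-adjointness of the Laplacian. *)
Lemma es_orth j k : j != k -> ip (es j) (es k) = 0.
Proof.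
move=> jk; have h1 := ip_cs_cs j k; have h2 := ip_cs_cs k j.
have : (kap j ^+ 2 - kap k ^+ 2) * ip (es j) (es k) = 0.
  rewrite mulrBl -h1 (ip2C (es j)) -h2 (ip2C (cs k)); ring.
move/eqP; rewrite mulf_eq0 subr_eq0 eqrXn2 ?(ltW (kap_gt0 _))//.
by case/orP => /eqP // /kap_inj jk'; rewrite jk' eqxx in jk.
Qed.

(** Sine and cosine have equal norms, and their squares add up to 1. *)
Lemma es_norm k : ip (es k) (es k) = L / 2.
Proof.
have h := ip_cs_cs k k; have k0 := kap_gt0 k.
have h' : ip (cs k) (cs k) = ip (es k) (es k).
  by apply: (mulfI (x := kap k ^+ 2)); rewrite ?expf_neq0 ?gt_eqF// -h expr2.
have : ip (cs k) (cs k) + ip (es k) (es k) = L.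
  rewrite /ip2 -RintegralD//; first last.
  - exact: (L2_mul (es k) (es k)).
  - exact: (L2_mul (cs k) (cs k)).
  under eq_Rintegral => x _ do rewrite -!expr2 cos2Dsin2.
  by rewrite Rintegral_cst// [X in fine X]muD// mul1r.
by rewrite h'; lra.
Qed.

Lemma ip_es j k : ip (es j) (es k) = if j == k then L / 2 else 0.
Proof. by case: eqP => [->|/eqP]; [exact: es_norm|exact: es_orth]. Qed.

Definition sc u (k : nat) : R := 2 / L * ip u (es k).

Lemma scE u k : ip u (es k) = L / 2 * sc u k.
Proof. by rewrite /sc; field; rewrite gt_eqF. Qed.

Definition psum (a : nat -> R) n : R -> R := \sum_(k < n) a k *: es k.

Lemma psumE a n x : psum a n x = \sum_(k < n) a k * es k x.
Proof. by rewrite /psum fct_sumE. Qed.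

Lemma L2_psum a n : L2 L (psum a n).
Proof. rewrite /psum; l2'. Qed.

Lemma ip_psum_es a n k : ip (psum a n) (es k) = if (k < n)%N then L / 2 * a k else 0.
Proof.
rewrite /psum ip2_suml//.
under eq_bigr do rewrite ip2Zl// ip_es.
case: ltnP => kn.
  rewrite (bigD1 (Ordinal kn))//= eqxx big1 ?addr0 ?(mulrC (a k))// => i ik.
  by rewrite ifF ?mulr0//; apply/negbTE; apply: contraNneq ik => ik; apply/eqP/val_inj.
rewrite big1// => i _; rewrite ifF ?mulr0//; apply/eqP => ik.
by have := ltn_ord i; rewrite ik ltnNge kn.
Qed.

Lemma sc_psum a n k : sc (psum a n) k = if (k < n)%N then a k else 0.
Proof. by rewrite /sc ip_psum_es; case: ifP => _; rewrite ?mulr0//; field; rewrite gt_eqF. Qed.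

Lemma ip_psumr u a n : L2 L u -> ip u (psum a n) = L / 2 * \sum_(k < n) a k * sc u k.
Proof.
move=> hu; rewrite ip2C /psum ip2_suml//.
rewrite big_distrr/=; apply: eq_bigr => i _.
by rewrite ip2Zl// ip2C scE; ring.
Qed.

Lemma ip_psum a b n : ip (psum a n) (psum b n) = L / 2 * \sum_(k < n) a k * b k.
Proof.
rewrite ip_psumr; last exact: L2_psum.
by congr (_ * _); apply: eq_bigr => i _; rewrite sc_psum ltn_ord mulrC.
Qed.

Lemma ip_sub_psum u n : L2 L u ->
  ip (u - psum (sc u) n) (u - psum (sc u) n) = ip u u - L / 2 * \sum_(k < n) sc u k ^+ 2.
Proof.
move=> hu; have hp := L2_psum (sc u) n.
rewrite ip2Bl ?ip2Br// ?(ip2C (psum _ _) u) ?ip_psum ?ip_psumr//.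
by under eq_bigr do rewrite -expr2; ring.
Qed.

Lemma bessel u n : L2 L u -> \sum_(k < n) sc u k ^+ 2 <= 2 / L * ip u u.
Proof.
move=> hu; have := ip2_ge0 (L := L) (u - psum (sc u) n); rewrite ip_sub_psum//.
rewrite subr_ge0 => h; rewrite -ler_pdivrMl ?divr_gt0//.
by rewrite invf_div.
Qed.

Lemma cs0M x k : cs 0 x * es k.+1 x = 2^-1 * (es k.+2 x + es k x).
Proof.
have e2 : kap k.+2 * x = kap k.+1 * x + kap 0 * x by rewrite /kap -natr1; field; rewrite gt_eqF.
have e0 : kap k * x = kap k.+1 * x + - (kap 0 * x) by rewrite /kap -[k.+2%:R]natr1; field; rewrite gt_eqF.
by rewrite /es /cs e2 e0 !sinD cosN sinN; field.
Qed.

Lemma cs0M0 x : cs 0 x * es 0 x = 2^-1 * es 1 x.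
Proof.
have e2 : kap 1 * x = kap 0 * x + kap 0 * x by rewrite /kap; field; rewrite gt_eqF.
by rewrite /es /cs e2 sinD; field.
Qed.

Lemma cont_poly_cs (p : {poly R}) : continuous (fun x => p.[cs 0 x]).
Proof.
move=> x; apply: (@continuous_comp _ _ _ (cs 0) (fun z => p.[z])); first exact: cont_cs.
exact: continuous_horner.
Qed.

(** Multiplying a sine by cos(pi x / L) gives a combination of the neighbouring sines, so a
    polynomial in that cosine times a sine stays in the span. For k = 0 the lower neighbour
    vanishes. *)
Lemma ip_poly_cs u (p : {poly R}) k : L2 L u -> (forall j, ip u (es j) = 0) ->
  ip u ((fun x => p.[cs 0 x]) * es k) = 0.
Proof.
move=> hu h; elim/poly_ind: p k => [|p c ih] k.
  rewrite (_ : _ * _ = 0) ?ip20r//.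
  by apply/funext => x; rewrite !fctE horner0 mul0r.
have hL j : L2 L ((fun x => p.[cs 0 x]) * es j).
  by apply: (cont_L2 L_gt0); apply: contM; [exact: cont_poly_cs|exact: cont_es].
case: k => [|k].
  have -> : (fun x => (p * 'X + c%:P).[cs 0 x]) * es 0 =
      2^-1 *: ((fun x => p.[cs 0 x]) * es 1) + c *: es 0.
    apply/funext => x; rewrite !fctE !hornerE mulrDl -mulrA cs0M0 /GRing.scale/=; ring.
  by have hL1 := hL 1%N; rewrite ip2Dr ?ip2Zr ?ih ?h ?mulr0 ?addr0//.
have -> : (fun x => (p * 'X + c%:P).[cs 0 x]) * es k.+1 =
    2^-1 *: ((fun x => p.[cs 0 x]) * es k.+2 + (fun x => p.[cs 0 x]) * es k) + c *: es k.+1.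
  apply/funext => x; rewrite !fctE !hornerE mulrDl -mulrA cs0M /GRing.scale/=; ring.
by have hL1 := hL k; have hL2 := hL k.+2; rewrite ip2Dr ?ip2Zr ?ip2Dr ?ih ?h ?addr0 ?mulr0 ?addr0//.
Qed.

(** The sequence $(1 - s^n)^{2^n}$ is a polynomial step at s = 1/2, as in the Brosowski-Deutsch
    proof of the Stone-Weierstrass theorem. Below the step, Bernoulli's inequality bounds it from
    below by $1 - (2s)^n$. *)
Lemma cvg_pow_peak0 (s : R) : 0 <= s < 2^-1 ->
  (1 - s ^+ n) ^+ (2 ^ n) @[n --> \oo] --> (1 : R).
Proof.
move=> /andP[s0 s1].
have bern (t : R) m : 0 <= t <= 1 -> 1 - m%:R * t <= (1 - t) ^+ m.
  move=> /andP[t0 t1]; elim: m => [|m ih]; first by rewrite mul0r subr0 expr0.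
  rewrite exprS; apply: le_trans (_ : (1 - t) * (1 - m%:R * t) <= _); last first.
    by apply: ler_wpM2l => //; rewrite subr_ge0.
  rewrite -natr1; have : 0 <= m%:R * t * t by rewrite !mulr_ge0.
  nra.
have sn n : 0 <= s ^+ n <= 1.
  by rewrite exprn_ge0//= exprn_ile1//; lra.
apply: (@squeeze_cvgr _ _ _ _ (fun n => 1 - (2 * s) ^+ n) (cst 1)).
- near=> n; apply/andP; split; last first.
    by have /andP[? ?] := sn n; rewrite exprn_ile1 ?subr_ge0 ?gerBl.
  by have := bern (s ^+ n) (2 ^ n)%N (sn n); rewrite exprMn natrX.
- rewrite -[X in _ --> X]subr0; apply: cvgB; first exact: cvg_cst.
  by apply: cvg_expr; rewrite ger0_norm; lra.
- exact: cvg_cst.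
Unshelve. all: by end_near. Qed.

(** Above the step, multiplication by $(1 + s^n)^{2^n} \ge (2s)^n$ leaves a product that is at most
    1. *)
Lemma cvg_pow_peak1 (s : R) : 2^-1 < s <= 1 ->
  (1 - s ^+ n) ^+ (2 ^ n) @[n --> \oo] --> (0 : R).
Proof.
move=> /andP[s0 s1].
have bern (t : R) m : 0 <= t -> 1 + m%:R * t <= (1 + t) ^+ m.
  move=> t0; elim: m => [|m ih]; first by rewrite mul0r addr0 expr0.
  rewrite exprS; apply: le_trans (_ : (1 + t) * (1 + m%:R * t) <= _); last first.
    by apply: ler_wpM2l => //; rewrite addr_ge0.
  rewrite -natr1; have : 0 <= m%:R * t * t by rewrite !mulr_ge0.
  nra.
have sn n : 0 <= s ^+ n <= 1.
  by rewrite exprn_ge0/= ?exprn_ile1//; lra.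
apply: (@squeeze_cvgr _ _ _ _ (cst 0) (fun n => (2 * s)^-1 ^+ n)).
- near=> n; apply/andP; split.
    by have /andP[? ?] := sn n; rewrite exprn_ge0 ?subr_ge0.
  have /andP[a0 a1] := sn n.
  have b := bern (s ^+ n) (2 ^ n)%N a0.
  have p0 : 0 < (2 * s) ^+ n by rewrite exprn_gt0//; lra.
  rewrite exprVn -[leRHS]mul1r ler_pdivlMr//.
  apply: le_trans (_ : (1 - s ^+ n) ^+ (2 ^ n) * (1 + s ^+ n) ^+ (2 ^ n) <= _).
    apply: ler_wpM2l; first by rewrite exprn_ge0 ?subr_ge0.
    by apply: le_trans b; rewrite natrX -exprMn lerDr.
  rewrite -exprMn exprn_ile1//; nra.
- exact: cvg_cst.
- apply: cvg_expr; rewrite normfV ger0_norm; last by lra.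
  by rewrite invf_lt1; lra.
Unshelve. all: by end_near. Qed.

Lemma cs0_decr x y : 0 <= x -> x < y -> y <= L -> cs 0 y < cs 0 x.
Proof.
move=> x0 xy yL; have k0 := kap_gt0 0.
have kl : kap 0 * L = pi by rewrite kapL mul1r.
have itv z : 0 <= z <= L -> kap 0 * z \in `[0, pi].
  by move=> /andP[z0 zL]; rewrite in_itv/= mulr_ge0 ?(ltW k0)//= -kl ler_pM2l.
by rewrite /cs ltr_cos ?ltr_pM2l//; apply: itv; apply/andP; split; lra.
Qed.

(** Polynomials in the decreasing function cos(pi x / L) approximate the indicator of (0, y)
    boundedly, and pointwise off the point y. Orthogonality to all sines thus passes to the cut
    function by dominated convergence. *)
Lemma ip_cut u y : L2 L u -> (forall j, ip u (es j) = 0) -> D y ->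
  \int[mu]_(x in D) ((u * es 0) \_ `]0, y]) x = 0.
Proof.
move=> hu h; rewrite /= in_itv/= => /andP[y0 yL].
(* The affine change of variable sends the values of the cosine into [0, 1] and its value at y to
   the step 1/2. *)
pose S : {poly R} := (4^-1)%:P * ('X - (cs 0 y)%:P) + (2^-1)%:P.
pose P n : {poly R} := 1 - (1 - S ^+ n) ^+ (2 ^ n).
pose s x := 4^-1 * (cs 0 x - cs 0 y) + 2^-1.
have PE n x : (P n).[cs 0 x] = 1 - (1 - s x ^+ n) ^+ (2 ^ n).
  by rewrite /P /S !hornerE.
have s01 x : 0 <= s x <= 1.
  have := cs_le1 0 x; have := cs_le1 0 y; rewrite !ler_norml /s.
  by move=> /andP[? ?] /andP[? ?]; apply/andP; split; lra.
have P01 n x : 0 <= (P n).[cs 0 x] <= 1.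
  have /andP[a b] := s01 x.
  have a1 : 0 <= s x ^+ n <= 1 by rewrite exprn_ge0//= exprn_ile1.
  have : 0 <= (1 - s x ^+ n) ^+ (2 ^ n) <= 1.
    by rewrite exprn_ge0/= ?exprn_ile1//; lra.
  by rewrite PE; lra.
pose g : R -> R := u * es 0.
have ig : intD (L := L) g by exact: L2_mul.
have mg : measurable_fun D g by exact: intD_meas.
have h0 n : (\int[mu]_(x in D) ((P n).[cs 0 x] * g x)%:E = 0)%E.
  have hi : intD (L := L) (u * ((fun x => (P n).[cs 0 x]) * es 0)).
    apply: L2_mul => //; apply: (cont_L2 L_gt0).
    by apply: contM; [exact: cont_poly_cs|exact: cont_es].
  have := ip_poly_cs u (P n) 0 hu h; rewrite /ip2 /Rintegral => h0.
  have -> : (fun x => ((P n).[cs 0 x] * g x)%:E) =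
      (fun x => (u x * ((fun x0 => (P n).[cs 0 x0]) * es 0) x)%:E).
    by apply/funext => x; rewrite /g !fctE; congr EFin; ring.
  have hf := integrable_fin_num (mD (L := L)) hi.
  by rewrite -[LHS](fineK hf) h0.
have mfn n : measurable_fun D (fun x => ((P n).[cs 0 x] * g x)%:E).
  apply/measurable_EFinP; apply: measurable_funM => //.
  by apply: cont_meas; exact: cont_poly_cs.
have mf : measurable_fun D (fun x => ((g \_ `]0, y]) x)%:E).
  apply/measurable_EFinP; apply/measurable_restrict => //.
  by apply: measurable_funS mg => // x [].
have cvf : {ae mu, forall x, D x ->
    ((P n).[cs 0 x] * g x)%:E @[n --> \oo] --> ((g \_ `]0, y]) x)%:E}.
  exists [set y]; split => //; first exact: lebesgue_measure_set1.
  move=> x /= /not_implyP[]; rewrite in_itv/= => /andP[x0 xL] nc; apply: contrapT => xy.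
  apply: nc; apply: cvg_EFin; first by near=> n.
  rewrite /comp /=; have [xy'|yx] := ltP x y.
    rewrite patchE ifT; last by rewrite inE/= in_itv/= x0 ltW.
    rewrite -[X in _ --> X]mul1r; apply: cvgM; last exact: cvg_cst.
    rewrite (_ : (fun n => _) = (fun n => 1 - (1 - s x ^+ n) ^+ (2 ^ n))); last by apply/funext.
    rewrite -[X in _ --> X]subr0; apply: cvgB; first exact: cvg_cst.
    apply: cvg_pow_peak1; have /andP[_ ->] := s01 x; rewrite andbT /s.
    by have := cs0_decr x y (ltW x0) xy' (ltW yL); lra.
  have {}yx : y < x by rewrite lt_neqAle yx andbT eq_sym; apply/eqP.
  rewrite patchE ifF; last by apply/negbTE; rewrite notin_setE/= in_itv/= x0/=; apply/negP; rewrite -ltNge.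
  rewrite -[X in _ --> X](mul0r (g x)); apply: cvgM; last exact: cvg_cst.
  rewrite (_ : (fun n => _) = (fun n => 1 - (1 - s x ^+ n) ^+ (2 ^ n))); last by apply/funext.
  rewrite -[X in _ --> X](subrr 1); apply: cvgB; first exact: cvg_cst.
  apply: cvg_pow_peak0; have /andP[-> _] := s01 x; rewrite /s/=.
  by have := cs0_decr y x (ltW y0) yx (ltW xL); lra.
have fg : {ae mu, forall x n, D x -> (`|((P n).[cs 0 x] * g x)%:E| <= `|g x|%:E)%E}.
  apply: nearW => x n _; rewrite lee_fin normrM ler_piMl//.
  by have /andP[a b] := P01 n x; rewrite ger0_norm.
have ig' : mu.-integrable D (fun x => `|g x|%:E) by exact: integrable_norm.
have [i1 _ cv] := dominated_convergence (mD (L := L)) mfn mf cvf ig' fg.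
rewrite /Rintegral (_ : (\int[mu]_(x in D) _)%E = 0%E)//.
apply: (cvg_unique _ cv) => //.
rewrite (_ : [sequence _]_n = cst 0%E); first exact: cvg_cst.
by apply/funext => n; exact: h0.
Unshelve. all: by end_near. Qed.

(** All integrals of u times the first sine over (0, y) vanish, so Lebesgue differentiation makes
    this product zero a.e., and the first sine is positive on (0, L). *)
Theorem sine_complete u : L2 L u -> (forall j, ip u (es j) = 0) -> ae_eq mu D u 0.
Proof.
move=> hu h; pose g : R -> R := u * es 0; pose f := g \_ D.
have ig : intD (L := L) g by exact: L2_mul.
have fi : mu.-integrable setT (EFin \o f).
  by rewrite -restrict_EFin; apply/(integrable_mkcond _ _).1 => //; exact: mD.
have fiy y : mu.-integrable `]-oo, y] (EFin \o f) by apply: integrableS fi.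
have fl : locally_integrable [set: R] f by apply: integrable_locally ig; exact: mD.
have F0 y : D y -> \int[mu]_(t in `]-oo, y]) f t = 0.
  move=> Dy; apply: etrans (ip_cut u y hu h Dy); rewrite /f -!Rintegral_mkcondr.
  congr (Rintegral _ _ _); apply/seteqP; split => x /=; rewrite !in_itv/=.
    by move=> [-> /andP[-> ->]].
  by move: Dy; rewrite /= in_itv/= => /andP[y0 yL] [/andP[-> ->] /andP[_ ->]].
have := FTC1Ny fiy fl; apply: (@filterS _ _ (ae_filter_ringOfSetsType mu)) => x [_ ftc] Dx.
have : f x = 0.
  rewrite -ftc derive1E; apply: (@derive_val _ _ _ _ _ _ _ _).
  apply: near_eq_is_derive (is_derive_cst (0 : R) x 1) => //.
  near=> z; rewrite F0//.
  near: z; apply: open_nbhs_nbhs; split => //; exact: interval_open.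
rewrite /f patchE mem_set// /g fctE => /eqP; rewrite mulf_eq0 => /orP[/eqP //|/eqP].
move: Dx; rewrite /= in_itv/= => /andP[x0 xL].
have : 0 < es 0 x.
  rewrite /es sin_gt0_pi// mulr_gt0 ?kap_gt0//=.
  by rewrite -[ltRHS]mul1r -(kapL 0) ltr_pM2l ?kap_gt0.
by move=> /[swap] ->; rewrite ltxx.
Unshelve. all: by end_near. Qed.

End sine_system.

Ltac l2 ::= repeat first [ assumption | apply: L2D | apply: L2B | apply: L2Z | apply: L2N | apply: L2_0 | apply: L2_es | apply: L2_cs | apply: L2_psum | (apply: L2_sum; [assumption | move=> ?]) ].

(** * Square-summable sequences *)

Section partial_sum_bounds.
Context {R : realType}.
Implicit Types a b : nat -> R.

(** A bound on the squared $l^2$ norm that never forms the infinite sum; it passes to coordinatewise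
    limits ([bnd_lim]). *)
Definition bnd a (C : R) := forall n, \sum_(k < n) a k ^+ 2 <= C.

Definition sq a n := \sum_(k < n) a k ^+ 2.

Lemma sq_nd a : nondecreasing_seq (sq a).
Proof.
by apply/nondecreasing_seqP => n; rewrite /sq big_ord_recr/= lerDl sqr_ge0.
Qed.

Lemma sq_ge0 a n : 0 <= sq a n.
Proof. by apply: sumr_ge0 => i _; exact: sqr_ge0. Qed.

Lemma bnd_ge0 a C : bnd a C -> 0 <= C.
Proof. by move=> /(_ 0%N); rewrite big_ord0. Qed.

Lemma bnd_cvg a C : bnd a C -> cvgn (sq a).
Proof.
move=> h; apply: nondecreasing_is_cvgn; first exact: sq_nd.
by exists C => _ [n _ <-]; exact: h.
Qed.

Definition sqn a : R := limn (sq a).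

Lemma sq_le_sqn a C n : bnd a C -> sq a n <= sqn a.
Proof. by move=> /bnd_cvg h; apply: nondecreasing_cvgn_le h n; exact: sq_nd. Qed.

Lemma sqn_le a C : bnd a C -> sqn a <= C.
Proof. by move=> h; rewrite /sqn; apply: limr_le; [exact: bnd_cvg h|near=> n; exact: h]. Unshelve. all: by end_near. Qed.

Lemma bnd_sqn a C : bnd a C -> bnd a (sqn a).
Proof. by move=> h n; exact: sq_le_sqn h. Qed.

Lemma sqn_ge0 a C : bnd a C -> 0 <= sqn a.
Proof. by move=> /bnd_sqn/bnd_ge0. Qed.

Lemma bnd_le a C C' : C <= C' -> bnd a C -> bnd a C'.
Proof. by move=> h b n; apply: le_trans (b n) h. Qed.

End partial_sum_bounds.

(** * Riesz-Fischer theorem and Parseval identity *)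

Section riesz_fischer.
Context {R : realType} {L : R}.
Hypothesis L_gt0 : 0 < L.
Local Notation mu := (@lebesgue_measure R).
Local Notation D := (`]0, L[%classic : set R).
Local Notation ip := (ip2 L).
Local Notation nrm := (norm2 L).
Local Notation ps := (psum (L := L)).
Implicit Types u v w : R -> R.

Lemma nrm_psumB (a : nat -> R) m n : (m <= n)%N ->
  nrm (ps a n - ps a m) ^+ 2 = L / 2 * (sq a n - sq a m).
Proof.
move=> mn; rewrite norm2_sqr ip2Bl// !ip2Br// (ip2C (ps a m) (ps a n)) !ip_psum//.
have -> : ip (ps a n) (ps a m) = L / 2 * sq a m.
  rewrite ip_psumr//; congr (_ * _); apply: eq_bigr => i _.
  by rewrite sc_psum// (leq_trans (ltn_ord i) mn) expr2.
by rewrite /sq; under eq_bigr do rewrite -expr2; under [X in _ - _ - (_ - _ * X)]eq_bigr do rewrite -expr2; ring.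
Qed.

Lemma nrm_psum (a : nat -> R) n : nrm (ps a n) ^+ 2 = L / 2 * sq a n.
Proof. by rewrite norm2_sqr ip_psum//; under eq_bigr do rewrite -expr2. Qed.

(* A fast subsequence of the partial sums converges almost everywhere, and Fatou's lemma bounds the distance from its terms to the limit. *)
Theorem riesz_fischer (a : nat -> R) C : bnd a C ->
  exists2 v, L2 L v & nrm (v - ps a n) @[n --> \oo] --> 0.
Proof.
move=> ba; pose l := sqn a.
have cT : sq a @ \oo --> l by exact: bnd_cvg ba.
have Nex i : exists N, l - sq a N <= (4^-1) ^+ i.
  have e0 : 0 < (4^-1 : R) ^+ i by rewrite exprn_gt0.
  move/cvgrPdist_le : cT => /(_ _ e0) [N _ hN]; exists N.
  by have := hN N (leqnn N); exact: le_trans (ler_norm _).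
have {Nex} [N hN] := choice Nex.
have L2_ge0 : 0 <= L / 2 by rewrite divr_ge0// ltW.
have q4 i : (Num.sqrt (L / 2) * (2^-1) ^+ i) ^+ 2 = L / 2 * 4^-1 ^+ i.
  by rewrite exprMn sqr_sqrtr// -exprM mulnC exprM expr2 -invfM -natrM.
(* Summing the [N j] makes the indices nondecreasing while keeping [N i <= m i]. *)
pose m i := (\sum_(j < i.+1) N j)%N.
have mS i : (m i <= m i.+1)%N by rewrite /m [leqRHS]big_ord_recr/= leq_addr.
have md i j : (m i <= m (i + j))%N.
  by elim: j => [|j ih]; rewrite ?addn0 ?addnS// (leq_trans ih).
have Tm i n : (m i <= n)%N -> l - sq a n <= (4^-1) ^+ i.
  move=> h; apply: le_trans (hN i); rewrite lerD2l lerN2; apply: sq_nd.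
  by apply: leq_trans h; rewrite /m big_ord_recr/= leq_addl.
have Tl n : sq a n <= l by apply: sq_le_sqn ba.
pose f i : R -> R := ps a (m i).
have fL i : L2 L (f i) by rewrite /f.
have fd i j : nrm (f (i + j)%N - f i) ^+ 2 <= L / 2 * (4^-1) ^+ i.
  rewrite nrm_psumB//; apply: ler_wpM2l => //.
  by have := Tm i _ (leqnn _); have := Tl (m (i + j)%N); lra.
have c1L : L2 L (cst 1) by apply: (cont_L2 L_gt0) => x; exact: cst_continuous.
pose g i : R -> R := fun x => `|f i.+1 x - f i x|.
have g0 i x : (0 <= (g i x)%:E)%E by rewrite lee_fin /g normr_ge0.
have ig i : intD (L := L) (g i).
  by apply: (@integrable_norm _ _ _ mu); apply: L2_intD => //; apply: (L2B _ _ (fL i.+1) (fL i)).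
have gL i : L2 L (g i).
  apply: (L2P (g i)); first exact: intD_meas.
  have -> : g i * g i = (f i.+1 - f i) * (f i.+1 - f i).
    by apply/funext => x; rewrite !fctE /g -expr2 real_normK ?num_real// expr2.
  by apply: L2_sqr; l2.
pose K : R := Num.sqrt (L / 2) * nrm (cst 1).
have K0 : 0 <= K by rewrite mulr_ge0 ?sqrtr_ge0.
have Ig i : \int[mu]_(x in D) g i x <= K * (2^-1) ^+ i.
  have := ip2_CS _ _ (gL i) c1L; move/(le_trans (ler_norm _)).
  have -> : ip (g i) (cst 1) = \int[mu]_(x in D) g i x.
    by apply: eq_Rintegral => x _; rewrite mulr1.
  move/le_trans; apply; rewrite /K mulrAC; apply: ler_wpM2r; first exact: norm2_ge0.
  have -> : nrm (g i) = nrm (f i.+1 - f i).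
    rewrite /norm2; congr Num.sqrt; apply: eq_Rintegral => x _.
    by rewrite /g -expr2 real_normK ?num_real// expr2.
  rewrite -(@ler_pXn2r _ 2)// ?nnegrE ?norm2_ge0 ?mulr_ge0 ?sqrtr_ge0//.
  by rewrite q4; have := fd i 1%N; rewrite addn1.
have mg i : measurable_fun D (fun x => (g i x)%:E).
  by apply/measurable_EFinP; exact: intD_meas.
have geo n : \sum_(0 <= i < n) (2^-1 : R) ^+ i = 2 - 2 * 2^-1 ^+ n.
  elim: n => [|k ih]; first by rewrite big_nil expr0; ring.
  by rewrite big_nat_recr//= ih exprS; field.
(* Each increment has integral at most $K 2^{-i}$ by Cauchy-Schwarz against the constant 1. The
   finite total makes the increments absolutely summable almost everywhere. *)
have IG : (\int[mu]_(x in D) (\sum_(i <oo) (g i x)%:E) <= (2 * K)%:E)%E.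
  rewrite integral_nneseries//.
  apply: lime_le; first by apply: is_cvg_nneseries => n _ _; apply: integral_ge0 => x _; exact: g0.
  near=> n; rewrite (eq_bigr (fun i => (\int[mu]_(x in D) g i x)%:E)); last first.
    by move=> i _; rewrite /Rintegral fineK//; apply: integrable_fin_num => //; exact: ig.
  rewrite sumEFin lee_fin.
  apply: le_trans (_ : \sum_(0 <= i < n) K * 2^-1 ^+ i <= _); first exact: ler_sum.
  rewrite -big_distrr/= mulrC; apply: ler_wpM2r => //.
  by rewrite geo gerBl mulr_ge0// exprn_ge0.
have iG : mu.-integrable D (fun x => \sum_(i <oo) (g i x)%:E)%E.
  apply/integrableP; split.
    apply: (@ge0_emeasurable_sum _ _ _ D (fun k x => (g k x)%:E) predT); by [move=> k x _ _; exact: g0|move=> k _; exact: mg].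
  apply: le_lt_trans (ltry (2 * K)); apply: le_trans IG.
  rewrite le_eqVlt; apply/orP; left; apply/eqP; apply: eq_integral => x _.
  by rewrite gee0_abs// nneseries_ge0// => n _ _; exact: g0.
(* An upper limit is measurable without knowing where the sequence converges; it agrees with the
   limit a.e. *)
pose v (x : R) : R := fine (limn_esup (fun i => (f i x)%:E)).
have cvf : {ae mu, forall x, D x -> f i x @[i --> \oo] --> v x}.
  have := integrable_ae (mD (L := L)) iG.
  apply: (@filterS _ _ (ae_filter_ringOfSetsType mu)) => x Gx Dx.
  have {}Gx := Gx Dx.
  have cv : cvgn (fun i => f i x).
    have -> : (fun i => f i x) = (fun n => f 0%N x + series (fun i => f i.+1 x - f i x) n).
      apply/funext => n; rewrite [LHS](eq_sum_telescope (fun i => f i x) n).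
      by congr (_ + _).
    apply: is_cvgD; first exact: is_cvg_cst.
    apply: normed_cvg; apply: nondecreasing_is_cvgn.
      by apply: nondecreasing_series => k _ _; exact: normr_ge0.
    exists (fine (\sum_(i <oo) (g i x)%:E)%E) => _ [n _ <-].
    rewrite -lee_fin fineK// /series/= -sumEFin.
    by apply: nneseries_lim_ge => k _ _; exact: g0.
  have /cvg_ex[z cz] := cv.
  have cz' : (f i x)%:E @[i --> \oo] --> z%:E by apply: cvg_EFin cz; near=> i.
  by rewrite /v (is_cvg_limn_esupE (cvgP _ cz')) (cvg_lim _ cz').
have mv : measurable_fun D v.
  apply: measurableT_comp; last by apply: measurable_fun_limn_esup => n; apply/measurable_EFinP; exact: L2_meas.
  by [].
have fat i : intD (L := L) ((v - f i) * (v - f i)) /\ ip (v - f i) (v - f i) <= L / 2 * (4^-1) ^+ i.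
  pose h j x := (((f (i + j)%N x - f i x) ^+ 2)%R)%:E.
  have mvf : measurable_fun D (v - f i) by apply: measurable_funB => //; exact: L2_meas.
  have mh j : measurable_fun D (h j).
    apply/measurable_EFinP; apply: measurable_funX; apply: measurable_funB; exact: L2_meas.
  have F := @fatou _ _ _ mu D (mD (L := L)) h mh (fun j x _ => eq_ind_r is_true (sqr_ge0 (f (i + j)%N x - f i x)) (lee_fin _ _)).
  have E : (\int[mu]_(x in D) limn_einf (h ^~ x) = \int[mu]_(x in D) (((v - f i) x ^+ 2)%R)%:E)%E.
    apply: ae_eq_integral => //.
    - have -> : (fun x => limn_einf (h ^~ x)) = (fun x => - limn_esup (fun j => - h j x))%E.
        by apply/funext => x; rewrite (limn_esupN (h ^~ x)) oppeK.
      apply: measurableT_comp => //; apply: measurable_fun_limn_esup => j.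
      by apply: measurableT_comp; [|exact: (mh j)].
    - by apply/measurable_EFinP; exact: measurable_funX.
    move: cvf; apply: (@filterS _ _ (ae_filter_ringOfSetsType mu)) => x cx Dx.
    have cx' : h j x @[j --> \oo] --> (((v - f i) x ^+ 2)%R)%:E.
      apply: cvg_EFin; first by near=> j.
      rewrite (_ : _ \o _ = (fun j => (f (i + j)%N x - f i x) * (f (i + j)%N x - f i x))); last first.
        by apply/funext => j; rewrite /h /= expr2.
      have cd : f (i + j)%N x - f i x @[j --> \oo] --> (v - f i) x.
        apply: cvgB; last exact: cvg_cst.
        by have := cx Dx; rewrite -(cvg_shiftn i); under eq_fun do rewrite addnC.
      by rewrite expr2; exact: cvgM.
    by rewrite is_cvg_limn_einfE ?(cvg_lim _ cx')//; exact: cvgP cx'.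
  have B : (\int[mu]_(x in D) (((v - f i) x ^+ 2)%R)%:E <= (L / 2 * (4^-1) ^+ i)%:E)%E.
    rewrite -E; apply: le_trans F _; rewrite limn_einf_lim; apply: lime_le; first exact: is_cvg_einfs.
    near=> n; apply: le_trans (_ : (\int[mu]_(x in D) h n x <= _)%E).
      by apply: ereal_inf_lbound; exists n => //=.
    have hi : intD (L := L) ((f (i + n)%N - f i) * (f (i + n)%N - f i)) by apply: L2_sqr; l2.
    have := fd i n; rewrite norm2_sqr -lee_fin; congr (_ <= _)%E.
    by rewrite /ip2/Rintegral fineK; [apply: eq_integral => x _; rewrite -expr2|exact: integrable_fin_num hi].
  have I : intD (L := L) ((v - f i) * (v - f i)).
    apply/integrableP; split; first by apply/measurable_EFinP; exact: measurable_funM.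
    apply: le_lt_trans (ltry (L / 2 * (4^-1) ^+ i)); apply: le_trans B.
    rewrite le_eqVlt; apply/orP; left; apply/eqP; apply: eq_integral => x _ /=.
    by rewrite fctE expr2 ger0_norm// -expr2 sqr_ge0.
  split => //; rewrite -lee_fin; apply: le_trans B.
  rewrite le_eqVlt; apply/orP; left; apply/eqP; rewrite /ip2 /Rintegral fineK; last exact: integrable_fin_num I.
  by apply: eq_integral => x _; rewrite expr2.
have vfL i : L2 L (v - f i).
  by apply: L2P; [apply: measurable_funB => //; exact: L2_meas|case: (fat i)].
have vL : L2 L v by rewrite -(subrK (f 0%N) v); apply: L2D.
exists v => //; apply/cvgrPdist_le => e e0.
have [i hi] : exists i, Num.sqrt (L / 2) * (2^-1) ^+ i <= e / 2.
  have : Num.sqrt (L / 2) * (2^-1) ^+ i @[i --> \oo] --> Num.sqrt (L / 2) * 0.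
    apply: cvgM; first exact: cvg_cst.
    by apply: cvg_expr; rewrite ger0_norm; lra.
  rewrite mulr0 => /cvgrPdist_le /(_ _ (divr_gt0 e0 (ltr0Sn _ 1))) [i _ h]; exists i.
  have := h i (leqnn _); rewrite sub0r normrN; apply: le_trans; exact: ler_norm.
exists (m i) => // n /= mn; rewrite sub0r normrN ger0_norm ?norm2_ge0//.
have -> : v - ps a n = (v - f i) - (ps a n - f i) by rewrite opprB addrA subrK.
apply: le_trans (norm2_triB _ _ (vfL i) _) _; first by l2.
rewrite [e]splitr; apply: lerD; apply: le_trans hi;
  rewrite -(@ler_pXn2r _ 2)// ?nnegrE ?norm2_ge0 ?mulr_ge0 ?sqrtr_ge0// q4.
  by rewrite norm2_sqr; case: (fat i).
rewrite nrm_psumB//; apply: ler_wpM2l => //.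
by have := Tm i _ (leqnn _); have := Tl n; lra.
Unshelve. all: by end_near. Qed.

(** The Riesz-Fischer limit of the partial sums has the sine coefficients of u, so completeness
    identifies it with u a.e. *)
Theorem psum_cvg u : L2 L u -> nrm (u - ps (sc (L := L) u) n) @[n --> \oo] --> 0.
Proof.
move=> hu; have hb : bnd (sc (L := L) u) (2 / L * ip u u) by move=> n; exact: bessel.
have [v vL cv] := riesz_fischer _ _ hb.
have vs k : sc (L := L) v k = sc (L := L) u k.
  rewrite /sc; congr (_ * _).
  have h1 : ip (ps (sc (L := L) u) n) (es (L := L) k) @[n --> \oo] --> ip v (es (L := L) k).
    apply: L2_cvg_ip => //.
    by move: cv; under eq_fun do rewrite norm2BC.
  have h2 : ip (ps (sc (L := L) u) n) (es (L := L) k) @[n --> \oo] --> ip u (es (L := L) k).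
    apply: cvg_near_cst; exists k.+1 => // n /= kn.
    by rewrite ip_psum_es// kn -scE.
  exact: cvg_unique h1 h2.
have uv : ae_eq mu D (u - v) 0.
  apply: sine_complete => //.
  by move=> j; rewrite ip2Bl// !scE// vs subrr.
have {}uv := ae_eqB0 _ _ uv.
rewrite (_ : (fun n => _) = (fun n => nrm (v - ps (sc (L := L) u) n)))//.
apply/funext => n; apply: norm2_ae => //.
by apply: ae_eqB => //; exact: nearW.
Qed.

Theorem parseval u : L2 L u -> L / 2 * sq (sc (L := L) u) n @[n --> \oo] --> ip u u.
Proof.
move=> hu; have h := psum_cvg _ hu.
have -> : (fun n => L / 2 * sq (sc (L := L) u) n) =
    (fun n => ip u u - nrm (u - ps (sc (L := L) u) n) ^+ 2).
  by apply/funext => n; rewrite norm2_sqr ip_sub_psum//; rewrite /sq; ring.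
rewrite -[X in _ --> X]subr0; apply: cvgB; first exact: cvg_cst.
by rewrite -[X in _ --> X](mul0r 0); under eq_fun do rewrite expr2; exact: cvgM.
Qed.

End riesz_fischer.

(** * Mean value inequality and differentiation of limits *)

Section calculus.
Context {R : realType}.
Implicit Types f g : R -> R.

Lemma near_dist (x e : R) : 0 < e -> \forall y \near x, `|y - x| < e.
Proof. by move=> e0; apply/nbhs_ballP; exists e => // y; rewrite /ball/= distrC. Qed.

Lemma is_derive_eps f (x d : R) :
  (forall e, 0 < e -> \forall y \near x, `|f y - f x - d * (y - x)| <= e * `|y - x|) ->
  is_derive x (1 : R) f d.
Proof.
move=> h.
have c : (fun z => z^-1 *: (f (z *: 1 + x) - f x)) @ 0^' --> d.
  apply/cvgrPdist_le => e e0.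
  have := h _ e0; rewrite (near_shift 0) => H.
  near=> z.
  have z0 : z != 0 by near: z; exact: nbhs_dnbhs_neq.
  have : `|f (z + x) - f x - d * (z + x - x)| <= e * `|z + x - x|.
    near: z; apply: nbhs_dnbhs; move: H; apply: filterS => z.
    by rewrite /= subr0.
  rewrite addrK /GRing.scale/= mulr1 => h1; rewrite distrC.
  have -> : z^-1 * (f (z + x) - f x) - d = z^-1 * (f (z + x) - f x - d * z).
    by field.
  by rewrite normrM normfV ler_pdivrMl ?normr_gt0// [leRHS]mulrC.
apply: DeriveDef; first by apply/cvg_ex; exists d.
by apply: cvg_lim.
Unshelve. all: by end_near. Qed.

Lemma MVT_le f f' (x y C : R) : der f f' ->
  (forall z, `|z - x| <= `|y - x| -> `|f' z| <= C) ->
  `|f y - f x| <= C * `|y - x|.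
Proof.
move=> hf hC; have cf := der_cont _ _ hf.
wlog xy : / x != y => [h|].
  by have [->|] := eqVneq x y; [rewrite !subrr normr0 mulr0|exact: h].
have seg a b : exists2 c, c \in `[Num.min a b, Num.max a b] & f b - f a = f' c * (b - a).
  have [ab|ba] := leP a b.
    by apply: MVT_segment => //; exact: continuous_subspaceT.
  have [c cb h] := MVT_segment (ltW ba) (fun z _ => hf z) (continuous_subspaceT cf).
  by exists c => //; rewrite -opprB h; ring.
have [c cxy ->] := seg x y; rewrite normrM; apply: ler_wpM2r => //; apply: hC.
move: cxy; rewrite in_itv/=; have [xy'|yx] := leP x y => /andP[h1 h2].
  by rewrite !ger0_norm; lra.
by rewrite !ler0_norm; lra.
Qed.

(** At fixed n the mean value inequality is applied to [F n] minus its expected tangent; the bound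
    obtained is uniform in large n and survives the limit. *)
Lemma der_limit (F G : nat -> R -> R) f g :
  (forall n, der (F n) (G n)) -> continuous g ->
  (forall x, F n x @[n --> \oo] --> f x) ->
  (forall e, 0 < e -> \forall n \near \oo, forall x, `|G n x - g x| <= e) ->
  der f g.
Proof.
move=> hF cg cF cG x; apply: is_derive_eps => e e0.
have e2 : 0 < e / 2 by rewrite divr_gt0.
have [d /= d0 hd] : exists2 d : R, 0 < d & forall z, `|z - x| < d -> `|g z - g x| <= e / 2.
  have := cg x; move/cvgrPdist_le => /(_ _ e2) /nbhs_ballP[d d0 h]; exists d => // z zd.
  by rewrite distrC; apply: h; rewrite /ball/= distrC.
near=> y.
have yd : `|y - x| < d by near: y; apply/nbhs_ballP; exists d => // y; rewrite /ball/= distrC.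
have key : \forall n \near \oo, `|F n y - F n x - g x * (y - x)| <= e * `|y - x|.
  have := cG _ e2; apply: filterS => n hn.
  have hH : der (fun z => F n z - g x * z) (fun z => G n z - g x).
    move=> z; have h1 := hF n z; have h2 := der_lin (g x) z.
    exact: is_deriveB.
  have := MVT_le _ _ x y e hH; rewrite (_ : F n y - g x * y - (F n x - g x * x) = F n y - F n x - g x * (y - x)); last by ring.
  apply=> z zy; have -> : G n z - g x = (G n z - g z) + (g z - g x) by ring.
  apply: le_trans (ler_normD _ _) _; rewrite [e]splitr; apply: lerD => //.
  by apply: hd; apply: le_lt_trans yd.
have cv : `|F n y - F n x - g x * (y - x)| @[n --> \oo] --> `|f y - f x - g x * (y - x)|.
  by apply: cvg_norm; apply: cvgB; [apply: cvgB; exact: cF|exact: cvg_cst].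
by rewrite -(cvg_lim _ cv)//; apply: limr_le => //; exact: cvgP cv.
Unshelve. all: by end_near. Qed.

End calculus.

(** * Approximation by compactly supported C^1 functions *)

Section weak_derivatives.
Context {R : realType} {L : R}.
Hypothesis L_gt0 : 0 < L.
Local Notation mu := (@lebesgue_measure R).
Local Notation D := (`]0, L[%classic : set R).
Local Notation ip := (ip2 L).
Local Notation nrm := (norm2 L).
Local Notation es := (es (L := L)).
Local Notation cs := (cs (L := L)).
Local Notation kap := (kap (L := L)).
Implicit Types u v w : R -> R.

Lemma C1c_der phi : C1c L phi -> der phi (derive1 phi).
Proof.
by case=> h _ _ x; rewrite derive1E; split => //; exact: h.
Qed.

Lemma C1c_cont1 phi : C1c L phi -> continuous (derive1 phi). Proof. by case. Qed.

Lemma C1c_cont phi : C1c L phi -> continuous phi.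
Proof. by move=> /C1c_der/der_cont. Qed.

Lemma C1c_ends phi : C1c L phi -> phi 0 = 0 /\ phi L = 0.
Proof.
by case=> _ _ [K [_ KD h]]; split; apply: h => /KD; rewrite /= in_itv/= ltxx ?andbF.
Qed.

Lemma C1c_L2 phi : C1c L phi -> L2 L phi.
Proof. by move=> /C1c_cont; exact: cont_L2. Qed.

Lemma C1c_L2' phi : C1c L phi -> L2 L (derive1 phi).
Proof. by move=> /C1c_cont1; exact: cont_L2. Qed.

Lemma nrm_cvg0 (g : nat -> R -> R) B : (forall n, continuous (g n)) ->
  (forall n x, D x -> `|g n x| <= B) -> (forall x, D x -> g n x @[n --> \oo] --> 0) ->
  nrm (g n) @[n --> \oo] --> 0.
Proof.
move=> cg gB g0.
have iB : mu.-integrable D (fun x => (B ^+ 2)%:E).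
  by apply: (intD_bounded L_gt0 (cst (B ^+ 2)) (B ^+ 2)) => // x _; rewrite ger0_norm ?sqr_ge0.
have mg n : measurable_fun D (fun x => ((g n x) ^+ 2)%:E).
  by apply/measurable_EFinP; apply: measurable_funX; exact: cont_meas.
have cg0 : {ae mu, forall x, D x -> ((g n x) ^+ 2)%:E @[n --> \oo] --> (cst 0 x : \bar R)}.
  apply: nearW => x Dx; apply: cvg_EFin; first by near=> n.
  rewrite /comp/= -[X in _ --> X](mul0r 0); under eq_fun do rewrite expr2.
  by apply: cvgM; exact: g0.
have bg : {ae mu, forall x n, D x -> (`|((g n x) ^+ 2)%:E| <= (B ^+ 2)%:E)%E}.
  apply: nearW => x n Dx; rewrite lee_fin normrX ler_pXn2r ?nnegrE//; first exact: gB.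
  by apply: le_trans (gB n x Dx).
have [_ _ cv] := dominated_convergence (mD (L := L)) mg (measurable_cst _) cg0 iB bg.
have cip : ip (g n) (g n) @[n --> \oo] --> 0.
  rewrite integral0 in cv.
  rewrite (_ : (fun n => _) = (fun n => fine (\int[mu]_(x in D) (g n x ^+ 2)%:E)%E)).
    exact: fine_cvg cv.
  by apply/funext => n; rewrite /ip2 /Rintegral; congr fine; apply: eq_integral => x _; rewrite expr2.
rewrite -[X in _ --> X]sqrtr0.
exact: (continuous_cvg _ (@sqrt_continuous _ _)).
Unshelve. all: by end_near. Qed.

Let p (s : R) : R := Num.max 0 s ^+ 2.
Let p' (s : R) : R := 2 * Num.max 0 s.

Lemma max0_cont : continuous (fun s : R => Num.max 0 s).
Proof.
by move=> s; apply: (@continuous_max _ _ (cst 0) id) => //; exact: cst_continuous.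
Qed.

Lemma der_max0_sqr : der p p'.
Proof.
move=> x; apply: is_derive_eps => e e0; near=> y.
have ye : `|y - x| <= e by apply: ltW; near: y; exact: near_dist.
have key : `|p y - p x - p' x * (y - x)| <= `|y - x| * `|y - x|.
  rewrite /p /p' -normrM.
  have [x0|x0] := leP x 0; have [y0|y0] := leP y 0; rewrite ?expr0n/=.
  - by rewrite mulr0 mul0r !subr0 normr0.
  - rewrite !subr0 mulr0 mul0r subr0 !ger0_norm; nra.
  - by rewrite sub0r !ger0_norm; nra.
  - by rewrite (_ : _ - _ - _ = (y - x) * (y - x)); last by ring.
by apply: le_trans key _; apply: ler_wpM2r.
Unshelve. all: by end_near. Qed.

(* A C^1 profile vanishing on s <= 0 and tending to 1 at +oo. *)
Let q (s : R) : R := p s / (1 + p s).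
Let q' (s : R) : R := p' s / (1 + p s) ^+ 2.

Let p_ge0 s : 0 <= p s. Proof. exact: sqr_ge0. Qed.

Let der_q : der q q'.
Proof.
move=> s; have hp := der_max0_sqr s.
have p1 : 1 + p s != 0 by rewrite gt_eqF// ltr_wpDr.
have h1 : is_derive s (1 : R) (fun s => 1 + p s) (p' s).
  by rewrite -[X in is_derive _ _ _ X]add0r; apply: is_deriveD.
have h2 := @is_deriveV _ (fun s => 1 + p s) _ _ _ p1 h1.
have h3 := is_deriveM hp h2.
apply: (is_derive_eq h3).
by rewrite /q' /GRing.scale/=; field.
Qed.

(** The approximations are u times the cut-off [q \o s n], which vanishes where $(n+1) x (L-x) \le
    1$ and tends to 1 inside. The derivative of the cut-off has a factor n + 1, offset by the linear
    vanishing of u at the ends. All errors are then at most a constant times [W n x], which is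
    bounded by 1 and tends to 0, so dominated convergence applies. *)
Lemma C1c_dense u u' : der u u' -> continuous u' -> u 0 = 0 -> u L = 0 ->
  exists phi : nat -> R -> R, [/\ forall n, C1c L (phi n),
    nrm (u - phi n) @[n --> \oo] --> 0 & nrm (u' - derive1 (phi n)) @[n --> \oo] --> 0].
Proof.
move=> hu cu' u0 uL; have cu := der_cont _ _ hu.
pose s (n : nat) x := n.+1%:R * (x * (L - x)) - 1.
have ds n : der (s n) (fun x => n.+1%:R * (L - 2 * x)).
  move=> x; apply: is_derive_eq; rewrite /GRing.scale/=; ring.
pose phi n := u * (q \o s n).
pose phi' n := u * ((q' \o s n) * (fun x => n.+1%:R * (L - 2 * x))) + (q \o s n) * u'.
have dphi n : der (phi n) (phi' n).
  by apply: derM => //; exact: der_comp.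
have cp : continuous p by exact: der_cont der_max0_sqr.
have cq : continuous q by exact: der_cont der_q.
have p1 z : 0 < 1 + p z by rewrite ltr_wpDr.
have cq' : continuous q'.
  move=> z; apply: continuousM.
    by apply: continuousM; [exact: cst_continuous|exact: max0_cont].
  apply: continuousV; first by rewrite expf_neq0// gt_eqF.
  by apply: (@continuousM _ _ (fun z => 1 + p z) (fun z => 1 + p z));
    apply: continuousD; by [exact: cst_continuous|exact: cp].
have cs_ n : continuous (s n) by exact: der_cont (ds n).
have cphi' n : continuous (phi' n).
  apply: contD; apply: contM => //.
    apply: contM; first by move=> x; apply: continuous_comp; [exact: cs_|exact: cq'].
    by apply: (@der_cont _ _ (fun=> - 2 * n.+1%:R)) => x; apply: is_derive_eq; rewrite /GRing.scale/=; ring.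
  by move=> x; apply: continuous_comp; [exact: cs_|exact: cq].
have phiE n : derive1 (phi n) = phi' n.
  by apply/funext => x; rewrite derive1E; case: (dphi n x).
pose t n x : R := Num.max 0 (s n x).
pose W n x : R := (1 + t n x ^+ 2)^-1.
have t0 n x : 0 <= t n x by rewrite le_max lexx.
have st n x : s n x <= t n x by rewrite le_max lexx orbT.
have W0 n x : 0 <= W n x by rewrite invr_ge0 addr_ge0// sqr_ge0.
have W1 n x : W n x <= 1 by rewrite invf_le1 ?ltr_wpDr ?sqr_ge0// lerDl sqr_ge0.
have qW n x : 1 - q (s n x) = W n x.
  by rewrite /q /W /t /p; field; rewrite gt_eqF// ltr_wpDr ?sqr_ge0.
have Wlim x : D x -> W n x @[n --> \oo] --> 0.
  rewrite /= in_itv/= => /andP[x0 xL].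
  have c0 : 0 < x * (L - x) by rewrite mulr_gt0// subr_gt0.
  apply: (@squeeze_cvgr _ _ _ _ (cst 0) (fun n => 2 / (x * (L - x)) * harmonic n)).
  - near=> n; rewrite W0/= /harmonic.
    have -> : 2 / (x * (L - x)) * n.+1%:R^-1 = (n.+1%:R * (x * (L - x)) / 2)^-1.
      by rewrite !invfM invrK; ring.
    rewrite lef_pV2 ?posrE ?divr_gt0 ?mulr_gt0// ?subr_gt0 ?ltr_wpDr ?sqr_ge0//.
    by have := st n x; have := t0 n x; rewrite /s; nra.
  - exact: cvg_cst.
  - rewrite -[X in _ --> X](mulr0 (2 / (x * (L - x)))); apply: cvgM; first exact: cvg_cst.
    exact: cvg_harmonic.
(* Linear vanishing at the nearer end, by the mean value inequality. Its ball around an end point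
   reaches outside [0, L], hence the maximum of u' over [-L, 2L]. *)
have [B B0 uB] : exists2 B, 0 <= B & forall x, D x -> `|u x| <= B * (x * (L - x)).
  have cu'' : {within `[- L, 2 * L], continuous (fun x => `|u' x|)}.
    by apply: continuous_subspaceT => x; apply: continuous_comp; [exact: cu'|exact: norm_continuous].
  have LL : - L <= 2 * L by have := L_gt0; lra.
  have [c _] := EVT_max LL cu''; move: (normr_ge0 (u' c)); move: `|u' c| => C C0 hc.
  exists (2 / L * C); first by apply: mulr_ge0; [apply: divr_ge0 => //; exact: ltW|by []].
  move=> x; rewrite /= in_itv/= => /andP[x0 xL].
  have [xl|xl] := leP x (L / 2).
    have := MVT_le u u' 0 x C hu; rewrite u0 !subr0 ger0_norm ?(ltW x0)// => h.
    apply: le_trans (h _) _.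
      move=> z /ler_normlP[z1 z2]; apply: hc; rewrite in_itv/=; apply/andP; split; lra.
    have -> : 2 / L * C * (x * (L - x)) = C * (x * (2 * (L - x) / L)) by field; rewrite gt_eqF.
    apply: ler_wpM2l => //; rewrite -[leLHS]mulr1; apply: ler_wpM2l; first exact: ltW.
    by rewrite ler_pdivlMr//; lra.
  have := MVT_le u u' L x C hu; rewrite uL subr0 distrC (ger0_norm (x := L - x)) ?subr_ge0 ?(ltW xL)// => h.
  apply: le_trans (h _) _.
    move=> z /ler_normlP[z1 z2]; apply: hc; rewrite in_itv/=; apply/andP; split; lra.
  have -> : 2 / L * C * (x * (L - x)) = C * ((L - x) * (2 * x / L)) by field; rewrite gt_eqF.
  apply: ler_wpM2l => //; rewrite -[leLHS]mulr1; apply: ler_wpM2l; first by rewrite subr_ge0 ltW.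
  by rewrite ler_pdivlMr//; lra.
have [C C0 uC] := cont_bounded L_gt0 u cu.
have [C' C'0 uC'] := cont_bounded L_gt0 u' cu'.
have Dx0 x : D x -> 0 <= x <= L by rewrite /= in_itv/= => /andP[? ?]; rewrite !ltW.
have e1 n x : D x -> `|(u - phi n) x| <= C * W n x.
  move=> Dx; have -> : (u - phi n) x = u x * (1 - q (s n x)) by rewrite /phi !fctE /=; ring.
  by rewrite qW normrM (ger0_norm (W0 _ _)) ler_wpM2r// uC// Dx0.
(* The constant 3 comes from $2 T (1 + T) \le 3 (1 + T^2)$, where T is the positive part of [s n x]
   and $1 / (1 + T^2)$ is [W n x]. *)
have e2 n x : D x -> `|(u' - phi' n) x| <= (C' + 3 * B * L) * W n x.
  move=> Dx; have := Dx; rewrite /= in_itv/= => /andP[x0 xL].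
  have -> : (u' - phi' n) x = u' x * (1 - q (s n x)) - u x * (q' (s n x) * (n.+1%:R * (L - 2 * x))).
    by rewrite /phi' !fctE /=; ring.
  apply: le_trans (ler_normB _ _) _; rewrite [leRHS]mulrDl; apply: lerD.
    by rewrite qW normrM (ger0_norm (W0 _ _)) ler_wpM2r// uC'// Dx0.
  have q'E : q' (s n x) = 2 * t n x * W n x ^+ 2.
    by rewrite /q' /p' /p /t /W exprVn.
  have wt : W n x * (1 + t n x ^+ 2) = 1 by rewrite /W mulVf// gt_eqF// ltr_wpDr ?sqr_ge0.
  have q'0 : 0 <= q' (s n x).
    rewrite q'E; apply: mulr_ge0; last exact: sqr_ge0.
    by apply: mulr_ge0; last exact: t0.
  have -> : `|u x * (q' (s n x) * (n.+1%:R * (L - 2 * x)))| =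
      `|u x| * (q' (s n x) * (n.+1%:R * `|L - 2 * x|)).
    move: (q' _) q'0 => Q Q0; rewrite (normrM (u x)) (normrM Q) (normrM n.+1%:R).
    by rewrite (ger0_norm Q0) (ger0_norm (ler0n R n.+1)).
  rewrite q'E.
  have uBx := uB x Dx; have l2 : `|L - 2 * x| <= L by rewrite ler_norml; apply/andP; split; lra.
  have ns : n.+1%:R * (x * (L - x)) <= 1 + t n x by have := st n x; rewrite /s; lra.
  set w := W n x in wt *; set T := t n x in wt ns *; have w0 : 0 <= w := W0 n x; have T0 : 0 <= T := t0 n x.
  apply: le_trans (_ : B * (x * (L - x)) * (2 * T * w ^+ 2 * (n.+1%:R * L)) <= _).
    apply: ler_pM => //; first by rewrite !mulr_ge0 ?sqr_ge0.
    apply: ler_wpM2l; first by rewrite !mulr_ge0 ?sqr_ge0.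
    exact: ler_wpM2l.
  have -> : B * (x * (L - x)) * (2 * T * w ^+ 2 * (n.+1%:R * L)) =
     B * L * w * ((n.+1%:R * (x * (L - x))) * (2 * T * w)) by ring.
  have -> : 3 * B * L * w = B * L * w * 3 by ring.
  apply: ler_wpM2l; first by rewrite !mulr_ge0// ltW.
  apply: le_trans (_ : (1 + T) * (2 * T * w) <= _).
    by apply: ler_wpM2r => //; rewrite !mulr_ge0.
  have -> : (3 : R) = 3 * (w * (1 + T ^+ 2)) by rewrite wt mulr1.
  have -> : (1 + T) * (2 * T * w) = w * ((1 + T) * (2 * T)) by ring.
  have -> : 3 * (w * (1 + T ^+ 2)) = w * (3 * (1 + T ^+ 2)) by ring.
  by apply: ler_wpM2l => //; nra.
have sq_lim K x (g : nat -> R) : D x -> (forall n, `|g n| <= K * W n x) -> g n @[n --> \oo] --> 0.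
  move=> Dx h; apply/norm_cvg0P.
  apply: (@squeeze_cvgr _ _ _ _ (cst 0) (fun n => K * W n x)).
  - by near=> n; rewrite normr_ge0 h.
  - exact: cvg_cst.
  - by rewrite -[X in _ --> X](mulr0 K); apply: cvgM; [exact: cvg_cst|exact: Wlim].
exists phi; split.
- move=> n; split.
  + by move=> x; case: (dphi n x).
  + by rewrite phiE.
  (* At distance less than d from an end, $(n+1) x (L-x)$ is below 1 and the cut-off vanishes. *)
  pose d := (n.+1%:R * L)^-1.
  have d0 : 0 < d by rewrite invr_gt0 mulr_gt0.
  have dE : n.+1%:R * L * d = 1 by rewrite mulfV// gt_eqF// mulr_gt0.
  exists `[d, L - d]%classic; split.
  + exact: segment_compact.
  + by move=> x /=; rewrite !in_itv/= => /andP[? ?]; apply/andP; split; lra.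
  move=> x /= hx; rewrite /phi fctE /= /q.
  have -> : p (s n x) = 0; last by rewrite mul0r mulr0.
  have sx : s n x <= 0.
    rewrite /s subr_le0.
    have N0 : 0 < n.+1%:R :> R by [].
    apply: (@le_trans _ _ (n.+1%:R * (L * d))); last by rewrite mulrA dE.
    rewrite ler_pM2l//.
    have [x0|x0] := leP x 0; first by have := L_gt0; nra.
    have [xL|xL] := leP L x; first by have := L_gt0; nra.
    move: hx; rewrite in_itv/= => /negP; rewrite negb_and -!ltNge => /orP[h|h]; nra.
  by rewrite /p (max_l sx) expr0n.
- apply: (nrm_cvg0 _ C).
  + by move=> n; apply: contB => //; exact: der_cont (dphi n).
  + by move=> n x Dx; apply: le_trans (e1 n x Dx) _; rewrite ler_piMr.
  + by move=> x Dx; apply: (sq_lim C x) => // n; exact: e1.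
- apply: (nrm_cvg0 _ (C' + 3 * B * L)).
  + by move=> n; rewrite phiE; exact: contB.
  + move=> n x Dx; rewrite phiE; apply: le_trans (e2 n x Dx) _; rewrite ler_piMr//.
    by rewrite addr_ge0// !mulr_ge0// ltW.
  + by move=> x Dx; apply: (sq_lim (C' + 3 * B * L) x) => // n; rewrite phiE; exact: e2.
Unshelve. all: by end_near. Qed.

End weak_derivatives.

(** * Weak derivatives and their sine coefficients *)

Section weak_derivatives2.
Context {R : realType} {L : R}.
Hypothesis L_gt0 : 0 < L.
Local Notation mu := (@lebesgue_measure R).
Local Notation D := (`]0, L[%classic : set R).
Local Notation ip := (ip2 L).
Local Notation nrm := (norm2 L).
Local Notation es := (es (L := L)).
Local Notation cs := (cs (L := L)).
Local Notation kap := (kap (L := L)).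
Local Notation sc := (sc (L := L)).
Implicit Types u v w : R -> R.

(** Sines vanish at both ends, so they are L^2 limits of functions in [C1c], and completeness
    concludes. *)
Lemma C1c_orth0 v : L2 L v -> (forall phi, C1c L phi -> ip v phi = 0) -> ae_eq mu D v 0.
Proof.
move=> hv h; apply: sine_complete => // j.
have [phi [cphi c0 _]] := C1c_dense L_gt0 (es j) _ (der_es j) (contZ _ _ (cont_cs j)) (es0 j) (esL L_gt0 j).
have h1 : ip (phi n) v @[n --> \oo] --> ip (es j) v.
  apply: L2_cvg_ip => //; first by move=> n; exact: C1c_L2.
  by under eq_fun do rewrite norm2BC.
rewrite ip2C; apply/esym; apply: cvg_unique h1 => //.
by rewrite (_ : (fun n => _) = cst 0); [exact: cvg_cst|apply/funext => n; rewrite ip2C h].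
Qed.

Lemma weak_deriv_ae u u' v : L2 L u -> L2 L u' -> ae_eq mu D u u' ->
  weak_deriv L u v -> weak_deriv L u' v.
Proof.
move=> hu hu' e [hv h]; split => // phi hphi; rewrite -h//.
apply/esym/ip2_ae => //; [exact: C1c_L2'|exact: C1c_L2'|exact: nearW].
Qed.

Lemma weak_deriv_uniq u v v' : weak_deriv L u v -> weak_deriv L u v' -> ae_eq mu D v v'.
Proof.
move=> [hv h] [hv' h']; apply: ae_eqB0; apply: C1c_orth0; first by l2.
by move=> phi hphi; rewrite ip2Bl//; [rewrite -[ip v phi]opprK -h// h'// opprK subrr|exact: C1c_L2].
Qed.

Lemma wD_weak u v : weak_deriv L u v -> weak_deriv L u (wD L u).
Proof. by move=> h; rewrite /wD; apply: (xgetI (cst 0)); exact: h. Qed.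

Lemma wD_ae u v : weak_deriv L u v -> ae_eq mu D (wD L u) v.
Proof. by move=> h; apply: weak_deriv_uniq (wD_weak _ _ h) h. Qed.

Lemma wD_L2 u v : weak_deriv L u v -> L2 L (wD L u).
Proof. by move=> /wD_weak []. Qed.

Lemma weak_deriv_lin (a : R) u v u' v' : L2 L u -> L2 L v ->
  weak_deriv L u u' -> weak_deriv L v v' -> weak_deriv L (a *: u + v) (a *: u' + v').
Proof.
move=> hu hv [hu' h] [hv' h']; split; first by l2.
move=> phi hphi; have h1 := C1c_L2 L_gt0 _ hphi; have h2 := C1c_L2' L_gt0 _ hphi.
by rewrite !ip2Dl ?ip2Zl ?h ?h'//; ring.
Qed.

Lemma weak_deriv_classical u u' : der u u' -> continuous u' -> weak_deriv L u u'.
Proof.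
move=> hu cu'; split; first exact: cont_L2.
move=> phi hphi; have [p0 pL] := C1c_ends _ hphi.
rewrite (ibp_D L_gt0 _ _ _ _ hu (C1c_der _ hphi))//; last exact: C1c_cont1 hphi.
by rewrite p0 pL !mulr0 subrr sub0r.
Qed.

(** Boundary terms are killed by g, which [C1c_dense] approximates together with its derivative; u
    may have any boundary behaviour. *)
Lemma weak_deriv_test0 u v g g' : L2 L u -> weak_deriv L u v ->
  der g g' -> continuous g' -> g 0 = 0 -> g L = 0 -> ip u g' = - ip v g.
Proof.
move=> hu [hv h] hg cg' g0 gL; have cg := der_cont _ _ hg.
have [phi [cphi c0 c1]] := C1c_dense L_gt0 g _ hg cg' g0 gL.
have h1 : ip (phi n) v @[n --> \oo] --> ip g v.
  apply: L2_cvg_ip => //; [by move=> n; exact: C1c_L2|exact: cont_L2|].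
  by under eq_fun do rewrite norm2BC.
have h2 : ip (derive1 (phi n)) u @[n --> \oo] --> ip g' u.
  apply: L2_cvg_ip => //; [by move=> n; exact: C1c_L2'|exact: cont_L2|].
  by under eq_fun do rewrite norm2BC.
rewrite (ip2C u) (ip2C v); apply: cvg_unique h2 _ => //.
rewrite (_ : (fun n => _) = (fun n => - ip (phi n) v)); first exact: cvgN.
by apply/funext => n; rewrite ip2C h// ip2C.
Qed.

(** Here u carries the zero boundary values and g is free at the ends, so cosines are allowed. The
    function u is approximated in the H^1 norm by elements of [C1c], for which the formula is
    classical. *)
Lemma weak_deriv_testH10 u v g g' : H10 L u -> weak_deriv L u v ->
  der g g' -> continuous g' -> ip v g = - ip u g'.
Proof.
move=> [[hu _] hd] wv hg cg'; have cg := der_cont _ _ hg; have [hv h] := wv.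
have gL2 : L2 L g by exact: cont_L2.
have gL2' : L2 L g' by exact: cont_L2.
apply/eqP; rewrite -subr_eq0 opprK -normr_le0; apply/ler_addgt0Pl => e e0; rewrite addr0.
set K := nrm g + nrm g' + 1.
have K0 : 0 < K by rewrite ltr_wpDl// addr_ge0 ?norm2_ge0.
have [psi cpsi hpsi] := hd ((e / K) ^+ 2) (exprn_gt0 2 (divr_gt0 e0 K0)).
have pL2 := C1c_L2 L_gt0 _ cpsi; have pL2' := C1c_L2' L_gt0 _ cpsi.
have wu : weak_deriv L (u - psi) (v - derive1 psi).
  have -> : u - psi = (-1) *: psi + u by rewrite scaleN1r addrC.
  have -> : v - derive1 psi = (-1) *: derive1 psi + v by rewrite scaleN1r addrC.
  apply: weak_deriv_lin => //; apply: weak_deriv_classical; [exact: C1c_der cpsi|exact: C1c_cont1 cpsi].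
have nE : nrm (wD L (u - psi)) = nrm (v - derive1 psi).
  by apply: norm2_ae; [exact: wD_L2 wu|l2|exact: wD_ae].
rewrite nE in hpsi.
have n1 : nrm (u - psi) <= e / K.
  rewrite -(@ler_pXn2r _ 2)// ?nnegrE ?norm2_ge0 ?divr_ge0 ?(ltW e0) ?(ltW K0)//.
  by apply: le_trans (ltW hpsi); rewrite lerDl sqr_ge0.
have n2 : nrm (v - derive1 psi) <= e / K.
  rewrite -(@ler_pXn2r _ 2)// ?nnegrE ?norm2_ge0 ?divr_ge0 ?(ltW e0) ?(ltW K0)//.
  by apply: le_trans (ltW hpsi); rewrite lerDr sqr_ge0.
have [p0 pL] := C1c_ends _ cpsi.
have hp := ibp_D L_gt0 _ _ _ _ (C1c_der _ cpsi) hg (C1c_cont1 _ cpsi) cg'.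
rewrite p0 pL !mul0r subrr sub0r in hp.
have -> : ip v g + ip u g' = ip (v - derive1 psi) g + ip (u - psi) g'.
  by rewrite !ip2Bl// hp; ring.
apply: le_trans (ler_normD _ _) _.
apply: le_trans (lerD (ip2_CS _ _ _ gL2) (ip2_CS _ _ _ gL2')) _; [by l2|by l2|].
apply: (@le_trans _ _ (e / K * (nrm g + nrm g'))).
  by rewrite mulrDr; apply: lerD; apply: ler_wpM2r; rewrite ?norm2_ge0.
apply: (@le_trans _ _ (e / K * K)); last by rewrite divfK// gt_eqF.
by apply: ler_wpM2l; [rewrite divr_ge0 ?ltW|rewrite /K lerDl].
Qed.

Lemma wD_weakH1 u : H1 L u -> weak_deriv L u (wD L u).
Proof. by move=> [_ [v hv]]; exact: wD_weak hv. Qed.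

Lemma H2H10_L2 u : H2H10 L u -> L2 L u. Proof. by move=> [[[]]]. Qed.
Lemma H2H10_H10 u : H2H10 L u -> H10 L u. Proof. by case. Qed.
Lemma H2H10_wD u : H2H10 L u -> weak_deriv L u (wD L u).
Proof. by move=> [[h _] _]; exact: wD_weakH1. Qed.
Lemma H2H10_wD2 u : H2H10 L u -> weak_deriv L (wD L u) (wD L (wD L u)).
Proof. by move=> [[_ h] _]; exact: wD_weakH1. Qed.
Lemma H2H10_L2_1 u : H2H10 L u -> L2 L (wD L u).
Proof. by move=> /H2H10_wD []. Qed.
Lemma H2H10_L2_2 u : H2H10 L u -> L2 L (wD L (wD L u)).
Proof. by move=> /H2H10_wD2 []. Qed.

Lemma ip_wD_cs u k : H2H10 L u -> ip (wD L u) (cs k) = kap k * ip u (es k).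
Proof.
move=> hu; have h := H2H10_L2 _ hu.
rewrite (weak_deriv_testH10 _ _ _ _ (H2H10_H10 _ hu) (H2H10_wD _ hu) (der_cs (L := L) k)).
  by rewrite ip2Zr//; ring.
exact: contZ (cont_es k).
Qed.

(** The sine vanishes at both ends, so u_x may be tested against its derivative; the cosine that
    appears is handled by the zero boundary values of u. *)
Lemma ip_wD2_es u k : H2H10 L u -> ip (wD L (wD L u)) (es k) = - kap k ^+ 2 * ip u (es k).
Proof.
move=> hu; have h := H2H10_L2_1 _ hu.
have := weak_deriv_test0 _ _ _ _ h (H2H10_wD2 _ hu) (der_es (L := L) k) (contZ _ _ (cont_cs k)) (es0 k) (esL L_gt0 k).
rewrite ip2Zr// ip_wD_cs// => h1.
by apply: oppr_inj; rewrite -h1; ring.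
Qed.

Lemma sc_wD2 u k : H2H10 L u -> sc (wD L (wD L u)) k = - kap k ^+ 2 * sc u k.
Proof. by move=> hu; rewrite /sc ip_wD2_es//; ring. Qed.

End weak_derivatives2.

(** * Operations on square-summable sequences *)

Section bounded_sums.
Context {R : realType}.
Implicit Types a b c : nat -> R.

(** The crude $(x+y)^2 \le 2x^2 + 2y^2$ keeps square roots out of the bounds; the sharp triangle
    inequality is [sqn_mink]. *)
Lemma bndD a b C C' : bnd a C -> bnd b C' -> bnd (a + b) (2 * C + 2 * C').
Proof.
move=> ha hb n; apply: le_trans (_ : \sum_(k < n) (2 * a k ^+ 2 + 2 * b k ^+ 2) <= _).
  apply: ler_sum => k _; have -> : (a + b) k = a k + b k by [].
  by have := sqr_ge0 (a k - b k); nra.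
by rewrite big_split/= -!big_distrr/=; apply: lerD; apply: ler_wpM2l => //; [exact: ha|exact: hb].
Qed.

Lemma bndZ (s : R) a C : bnd a C -> bnd (s *: a) (s ^+ 2 * C).
Proof.
move=> ha n; have -> : \sum_(k < n) (s *: a) k ^+ 2 = s ^+ 2 * \sum_(k < n) a k ^+ 2.
  by rewrite big_distrr/=; apply: eq_bigr => k _; rewrite fctE /GRing.scale/= exprMn.
by apply: ler_wpM2l; [exact: sqr_ge0|exact: ha].
Qed.

Lemma bndN a C : bnd a C -> bnd (- a) C.
Proof. by move=> ha n; under eq_bigr do rewrite fctE sqrrN; exact: ha. Qed.

Lemma bndB a b C C' : bnd a C -> bnd b C' -> bnd (a - b) (2 * C + 2 * C').
Proof. by move=> ha hb; apply: bndD => //; exact: bndN. Qed.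

Lemma bnd_dom a b C (B : R) : 0 <= B -> (forall k, `|a k| <= B * `|b k|) -> bnd b C -> bnd a (B ^+ 2 * C).
Proof.
move=> B0 h hb n; apply: le_trans (_ : \sum_(k < n) B ^+ 2 * b k ^+ 2 <= _).
  apply: ler_sum => k _; rewrite -exprMn -real_normK ?num_real// -[leRHS]real_normK ?num_real//.
  by rewrite ler_pXn2r ?nnegrE// normrM (ger0_norm B0).
by rewrite -big_distrr/=; apply: ler_wpM2l; [exact: sqr_ge0|exact: hb].
Qed.

End bounded_sums.

(** * Sine series of functions in H^2 and H^1_0 *)

Section function_series.
Context {R : realType} {L : R}.
Hypothesis L_gt0 : 0 < L.
Local Notation kap := (kap (L := L)).
Implicit Types b c : nat -> R.

Definition Kap : R := 2 * (L / pi) ^+ 2.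

Lemma Kap_ge0 : 0 <= Kap.
Proof. by rewrite /Kap mulr_ge0// sqr_ge0. Qed.

(** Telescoping, from $1/j^2 \le 2/j - 2/(j+1)$ for $j \ge 1$. *)
Lemma sum_kapV2 m n : (m <= n)%N -> \sum_(m <= k < n) (kap k)^-1 ^+ 2 <= Kap / m.+1%:R.
Proof.
move=> mn; have pi0 := @pi_gt0 R.
have h k : (kap k)^-1 ^+ 2 <= (L / pi) ^+ 2 * (2 / k.+1%:R - 2 / k.+2%:R).
  have -> : (kap k)^-1 = (L / pi) * k.+1%:R^-1.
    by rewrite /kap invf_div invfM; ring.
  rewrite exprMn; apply: ler_wpM2l; first exact: sqr_ge0.
  have k1 : 1 <= k.+1%:R :> R by rewrite ler1n.
  rewrite -[k.+2%:R]natr1; move: k1; move: k.+1%:R => x x1.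
  have x0 : 0 < x by lra.
  have -> : 2 / x - 2 / (x + 1) = x^-1 ^+ 2 * (2 * x / (x + 1)).
    by field; rewrite !gt_eqF// addr_gt0.
  rewrite -[leLHS]mulr1; apply: ler_wpM2l; first exact: sqr_ge0.
  by rewrite ler_pdivlMr ?addr_gt0// mul1r; lra.
apply: le_trans (ler_sum _ (fun k _ => h k)) _.
rewrite -big_distrr/= (telescope_sumr_eq (fun k => - (2 / k.+1%:R)))//; last first.
  by move=> k _; rewrite opprK addrC.
rewrite opprK /Kap -mulrA [leRHS]mulrCA; apply: ler_wpM2l; first exact: sqr_ge0.
by rewrite addrC gerBl divr_ge0.
Qed.

Section generic.
Variables (t : nat -> R -> R) (B : R).
Hypothesis B_ge0 : 0 <= B.
Hypothesis t_le : forall k x, `|t k x| <= B / kap k.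
Hypothesis t_cont : forall k, continuous (t k).

Definition ssum (s : nat -> R -> R) b n x := \sum_(0 <= k < n) b k * s k x.
Definition ser (s : nat -> R -> R) b x : R := limn (fun n => ssum s b n x).

Let rate (C : R) m := B * Num.sqrt (C * (Kap / m.+1%:R)).

(** Cauchy-Schwarz separates the $l^2$ bound on b from the tail of the sum of $1/kap_k^2$. This
    uniform rate is the Sobolev embedding that makes u and u_x continuous. *)
Lemma abs_sum_le b C x m n : bnd b C -> (m <= n)%N ->
  \sum_(m <= k < n) `|b k * t k x| <= rate C m.
Proof.
move=> hb mn; have C0 := bnd_ge0 _ _ hb.
apply: le_trans (_ : B * \sum_(m <= k < n) `|b k| * (kap k)^-1 <= _).
  rewrite big_distrr/=; apply: ler_sum => k _; rewrite normrM mulrCA.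
  by apply: ler_wpM2l.
apply: ler_wpM2l => //.
have s0 : 0 <= \sum_(m <= k < n) `|b k| * (kap k)^-1.
  by apply: sumr_ge0 => k _; rewrite mulr_ge0// invr_ge0 ltW// kap_gt0.
have K0 : 0 <= C * (Kap / m.+1%:R).
  by apply: mulr_ge0 => //; apply: divr_ge0 => //; exact: Kap_ge0.
rewrite -(@ler_pXn2r _ 2)// ?nnegrE ?sqrtr_ge0// sqr_sqrtr//.
apply: le_trans (CS_sum _ _ _ _ _) _; apply: ler_pM.
- by apply: sumr_ge0 => i _; exact: sqr_ge0.
- by apply: sumr_ge0 => i _; exact: sqr_ge0.
- apply: le_trans (hb n); rewrite -(big_mkord xpredT (fun k => b k ^+ 2)) [leRHS](@big_cat_nat _ _ _ m)//=.
  under eq_bigr do rewrite real_normK ?num_real//.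
  by rewrite lerDr; apply: sumr_ge0 => i _; exact: sqr_ge0.
- exact: sum_kapV2.
Qed.

Lemma ser_cvg b C x : bnd b C -> ssum t b n x @[n --> \oo] --> ser t b x.
Proof.
move=> hb; suff : cvgn (series (fun k => b k * t k x)) by [].
apply: normed_cvg; apply: nondecreasing_is_cvgn.
  by apply: nondecreasing_series => k _ _; exact: normr_ge0.
by exists (rate C 0) => _ [n _ <-]; exact: abs_sum_le.
Qed.

Lemma ssum_dist b C x m n : bnd b C -> (m <= n)%N ->
  `|ssum t b n x - ssum t b m x| <= rate C m.
Proof.
move=> hb mn; rewrite /ssum [X in X - _](@big_cat_nat _ _ _ m)//= addrAC subrr add0r.
by apply: le_trans (ler_norm_sum _ _ _) _; exact: abs_sum_le.
Qed.

Lemma ser_dist b C x m : bnd b C -> `|ser t b x - ssum t b m x| <= rate C m.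
Proof.
move=> hb; have h : `|ssum t b n x - ssum t b m x| @[n --> \oo] --> `|ser t b x - ssum t b m x|.
  by apply: cvg_norm; apply: cvgB; [exact: ser_cvg _ _ _ hb|exact: cvg_cst].
rewrite -(cvg_lim _ h)//; apply: limr_le; first exact: cvgP h.
by near=> n; apply: ssum_dist => //; near: n; exists m.
Unshelve. all: by end_near. Qed.

Lemma ser_bound b C x : bnd b C -> `|ser t b x| <= B * Num.sqrt (C * Kap).
Proof.
move=> /(ser_dist b C x 0).
by rewrite {1}/ssum big_nil subr0 /rate divr1.
Qed.

Lemma rate_cvg0 C : 0 <= C -> rate C m @[m --> \oo] --> 0.
Proof.
move=> C0; rewrite -[X in _ --> X](mulr0 B); apply: cvgM; first exact: cvg_cst.
rewrite -[X in _ --> X]sqrtr0; apply: (continuous_cvg _ (@sqrt_continuous _ _)).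
rewrite -[X in _ --> X](mulr0 C); apply: cvgM; first exact: cvg_cst.
rewrite -[X in _ --> X](mulr0 Kap); apply: cvgM; first exact: cvg_cst.
exact: cvg_harmonic.
Qed.

Lemma ssum_unif b C : bnd b C ->
  forall e, 0 < e -> \forall n \near \oo, forall x, `|ssum t b n x - ser t b x| <= e.
Proof.
move=> hb e e0; have := rate_cvg0 _ (bnd_ge0 _ _ hb); move/cvgrPdist_le => /(_ _ e0).
apply: filterS => n; rewrite sub0r normrN => h x; rewrite distrC.
by apply: le_trans (ser_dist b C x n hb) _; apply: le_trans h; exact: ler_norm.
Qed.

Lemma ssum_cont b n : continuous (ssum t b n).
Proof.
rewrite /ssum; elim: n => [|n ih].
  by under eq_fun do rewrite big_nil; exact: cst_continuous.
under eq_fun do rewrite big_nat_recr//=.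
apply: contD => //; apply: contM; last exact: t_cont.
exact: cst_continuous.
Qed.

Lemma ser_cont b C : bnd b C -> continuous (ser t b).
Proof.
move=> hb x; apply/cvgrPdist_le => e e0; have e3 : 0 < e / 3 by rewrite divr_gt0.
have [n hn] : exists n, forall x, `|ssum t b n x - ser t b x| <= e / 3.
  by have [n _ h] := ssum_unif _ _ hb _ e3; exists n; apply: h => /=.
have := ssum_cont b n x; move/cvgrPdist_le => /(_ _ e3); apply: filterS => y hy.
have -> : ser t b x - ser t b y = (ser t b x - ssum t b n x) + (ssum t b n x - ssum t b n y) + (ssum t b n y - ser t b y) by ring.
have -> : e = e / 3 + e / 3 + e / 3 by field.
apply: le_trans (ler_normD _ _) _; apply: lerD; last exact: hn.
apply: le_trans (ler_normD _ _) _; apply: lerD => //.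
by rewrite distrC.
Qed.

Lemma serD b c C C' : bnd b C -> bnd c C' -> ser t (b + c) = ser t b + ser t c.
Proof.
move=> hb hc; apply/funext => x; apply: cvg_lim => //.
rewrite (_ : (fun n => _) = (fun n => ssum t b n x + ssum t c n x)).
  by apply: cvgD; [exact: ser_cvg _ _ _ hb|exact: ser_cvg _ _ _ hc].
by apply/funext => n; rewrite /ssum -big_split/=; apply: eq_bigr => k _; rewrite fctE mulrDl.
Qed.

Lemma serZ (a : R) b C : bnd b C -> ser t (a *: b) = a *: ser t b.
Proof.
move=> hb; apply/funext => x; apply: cvg_lim => //.
rewrite (_ : (fun n => _) = (fun n => a * ssum t b n x)).
  by apply: cvgM; [exact: cvg_cst|exact: ser_cvg _ _ _ hb].
by apply/funext => n; rewrite /ssum big_distrr/=; apply: eq_bigr => k _; rewrite fctE /GRing.scale/= mulrA.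
Qed.

Lemma serB b c C C' : bnd b C -> bnd c C' -> ser t (b - c) = ser t b - ser t c.
Proof.
move=> hb hc; rewrite -scaleN1r (serD _ _ _ _ hb (bndZ _ _ _ hc)) (serZ _ _ _ hc) scaleN1r.
by [].
Qed.

End generic.

Local Notation mu := (@lebesgue_measure R).
Local Notation D := (`]0, L[%classic : set R).
Local Notation ip := (ip2 L).
Local Notation nrm := (norm2 L).
Local Notation es := (es (L := L)).
Local Notation cs := (cs (L := L)).
Local Notation sc := (sc (L := L)).
Local Notation psum := (psum (L := L)).

Definition sin_k k (x : R) : R := es k x / kap k ^+ 2.
Definition cos_k k (x : R) : R := cs k x / kap k.

(* b is the sequence of sine coefficients of minus the second derivative. *)
Definition fser b : R -> R := ser sin_k b.
Definition fser' b : R -> R := ser cos_k b.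

Lemma kap_le j k : (j <= k)%N -> kap j <= kap k.
Proof.
move=> jk; rewrite /kap -!mulrA; apply: ler_wpM2r; last by rewrite ler_nat.
by rewrite divr_ge0 ?pi_ge0// ltW.
Qed.

Lemma sin_k_le k x : `|sin_k k x| <= (kap 0)^-1 / kap k.
Proof.
have k0 := kap_gt0 L_gt0 k; have k00 := kap_gt0 L_gt0 0.
rewrite /sin_k normrM normfV (ger0_norm (sqr_ge0 _)) expr2 invfM.
rewrite -[leRHS]mul1r; apply: ler_pM => //; first by rewrite mulr_ge0// invr_ge0 ltW.
  exact: es_le1.
apply: ler_wpM2r; first by rewrite invr_ge0 ltW.
by rewrite lef_pV2// kap_le.
Qed.

Lemma cos_k_le k x : `|cos_k k x| <= 1 / kap k.
Proof.
have k0 := kap_gt0 L_gt0 k.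
rewrite /cos_k normrM normfV (ger0_norm (ltW k0)); apply: ler_wpM2r; last exact: cs_le1.
by rewrite invr_ge0 ltW.
Qed.

Lemma kap0V_ge0 : 0 <= (kap 0)^-1.
Proof. by rewrite invr_ge0 ltW// kap_gt0. Qed.

Lemma sin_k_cont k : continuous (sin_k k).
Proof. by move=> x; apply: continuousM; [exact: cont_es|exact: cst_continuous]. Qed.

Lemma cos_k_cont k : continuous (cos_k k).
Proof. by move=> x; apply: continuousM; [exact: cont_cs|exact: cst_continuous]. Qed.

Lemma fser_cont b C : bnd b C -> continuous (fser b).
Proof. exact: (ser_cont _ _ kap0V_ge0 sin_k_le sin_k_cont). Qed.

Lemma fser'_cont b C : bnd b C -> continuous (fser' b).
Proof. exact: (ser_cont _ _ ler01 cos_k_le cos_k_cont). Qed.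

Lemma fserZ (a : R) b C : bnd b C -> fser (a *: b) = a *: fser b.
Proof. exact: (serZ _ _ kap0V_ge0 sin_k_le). Qed.
Lemma fserB b c C C' : bnd b C -> bnd c C' -> fser (b - c) = fser b - fser c.
Proof. exact: (serB _ _ kap0V_ge0 sin_k_le). Qed.
Lemma fser'B b c C C' : bnd b C -> bnd c C' -> fser' (b - c) = fser' b - fser' c.
Proof. exact: (serB _ _ ler01 cos_k_le). Qed.

Lemma fser_le b C x : bnd b C -> `|fser b x| <= (kap 0)^-1 * Num.sqrt (C * Kap).
Proof. exact: (ser_bound _ _ kap0V_ge0 sin_k_le). Qed.
Lemma fser'_le b C x : bnd b C -> `|fser' b x| <= Num.sqrt (C * Kap).
Proof. by move=> h; rewrite -[leRHS]mul1r; apply: (ser_bound _ _ ler01 cos_k_le). Qed.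

Lemma der_ssum b n : der (ssum sin_k b n) (ssum cos_k b n).
Proof.
have -> : ssum sin_k b n = \sum_(k < n) (b k / kap k ^+ 2) *: es k.
  by apply/funext => x; rewrite fct_sumE /ssum big_mkord; apply: eq_bigr => k _; rewrite !fctE /sin_k /GRing.scale/=; ring.
have -> : ssum cos_k b n = \sum_(k < n) (b k / kap k ^+ 2) *: (kap k *: cs k).
  apply/funext => x; rewrite fct_sumE /ssum big_mkord; apply: eq_bigr => k _.
  by rewrite !fctE /cos_k /GRing.scale/=; field; rewrite gt_eqF// kap_gt0.
apply: (der_sum n (fun k => (b k / kap k ^+ 2) *: es k) (fun k => (b k / kap k ^+ 2) *: (kap k *: cs k))) => k.
by apply: derZ; exact: der_es.
Qed.

Lemma der_ssum' b n : der (ssum cos_k b n) (- psum b n).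
Proof.
have -> : ssum cos_k b n = \sum_(k < n) (b k / kap k) *: cs k.
  by apply/funext => x; rewrite fct_sumE /ssum big_mkord; apply: eq_bigr => k _; rewrite !fctE /cos_k /GRing.scale/=; ring.
have -> : - psum b n = \sum_(k < n) (b k / kap k) *: (- kap k *: es k).
  apply/funext => x; rewrite fct_sumE [LHS]/GRing.opp/= psumE -sumrN; apply: eq_bigr => k _.
  by rewrite !fctE /GRing.scale/=; field; rewrite gt_eqF// kap_gt0.
apply: (der_sum n (fun k => (b k / kap k) *: cs k) (fun k => (b k / kap k) *: (- kap k *: es k))) => k.
by apply: derZ; exact: der_cs.
Qed.

Lemma der_fser b C : bnd b C -> der (fser b) (fser' b).
Proof.
move=> hb; apply: (der_limit (ssum sin_k b) (ssum cos_k b)).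
- exact: der_ssum.
- exact: fser'_cont hb.
- by move=> x; exact: (ser_cvg _ _ kap0V_ge0 sin_k_le _ _ _ hb).
- exact: (ssum_unif _ _ ler01 cos_k_le _ _ hb).
Qed.

Lemma fser0 b C : bnd b C -> fser b 0 = 0.
Proof.
move=> hb; apply: cvg_lim => //; rewrite (_ : (fun n => _) = cst 0); first exact: cvg_cst.
by apply/funext => n; rewrite /ssum big1// => k _; rewrite /sin_k es0 mul0r mulr0.
Qed.

Lemma fserL b C : bnd b C -> fser b L = 0.
Proof.
move=> hb; apply: cvg_lim => //; rewrite (_ : (fun n => _) = cst 0); first exact: cvg_cst.
by apply/funext => n; rewrite /ssum big1// => k _; rewrite /sin_k esL// mul0r mulr0.
Qed.

Lemma nrm_unif (F : nat -> R -> R) f : (forall n, L2 L (F n)) -> L2 L f ->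
  (forall e, 0 < e -> \forall n \near \oo, forall x, `|F n x - f x| <= e) ->
  nrm (F n - f) @[n --> \oo] --> 0.
Proof.
move=> hF hf h; apply/cvgrPdist_le => e e0.
have sL : 0 < Num.sqrt L by rewrite sqrtr_gt0.
have := h _ (divr_gt0 e0 sL); apply: filterS => n hn; rewrite sub0r normrN ger0_norm ?norm2_ge0//.
have hFf : L2 L (F n - f) by have := hF n; l2.
apply: le_trans (norm2_le_sup L_gt0 _ (e / Num.sqrt L) _ hFf _) _; first by rewrite divr_ge0 ?ltW.
  by move=> x _; exact: hn.
by rewrite divfK// gt_eqF.
Qed.

Lemma ssum_sin_k b n : ssum sin_k b n = psum (fun k => b k / kap k ^+ 2) n.
Proof.
apply/funext => x; rewrite psumE /ssum big_mkord; apply: eq_bigr => k _.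
by rewrite /sin_k; ring.
Qed.

Lemma fser_L2 b C : bnd b C -> L2 L (fser b).
Proof. by move=> hb; apply: cont_L2 => //; exact: fser_cont hb. Qed.
Lemma fser'_L2 b C : bnd b C -> L2 L (fser' b).
Proof. by move=> hb; apply: cont_L2 => //; exact: fser'_cont hb. Qed.

Lemma sc_fser b C k : bnd b C -> sc (fser b) k = b k / kap k ^+ 2.
Proof.
move=> hb; have h := fser_L2 _ _ hb.
have c0 : nrm (psum (fun k => b k / kap k ^+ 2) n - fser b) @[n --> \oo] --> 0.
  apply: nrm_unif => //.
  move=> e e0; have := ssum_unif _ _ kap0V_ge0 sin_k_le _ _ hb _ e0.
  by apply: filterS => n hn x; rewrite -ssum_sin_k.
have h1 : ip (psum (fun k => b k / kap k ^+ 2) n) (es k) @[n --> \oo] --> ip (fser b) (es k).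
  by apply: L2_cvg_ip.
have h2 : ip (psum (fun k => b k / kap k ^+ 2) n) (es k) @[n --> \oo] --> L / 2 * (b k / kap k ^+ 2).
  by apply: cvg_near_cst; exists k.+1 => // n /= kn; rewrite ip_psum_es// kn.
rewrite /sc (cvg_unique _ h1 h2)//.
by field; rewrite !gt_eqF// kap_gt0.
Qed.

(** The differentiated series converges only in L^2. Its sum is supplied by Riesz-Fischer, and the
    identity defining a weak derivative is the limit of the classical one for partial sums. *)
Lemma fser'_weak b C : bnd b C -> exists2 v, weak_deriv L (fser' b) v & forall k, sc v k = - b k.
Proof.
move=> hb; have [v hv cv] := riesz_fischer L_gt0 _ _ (bndN _ _ hb).
have h' := fser'_L2 _ _ hb.
exists v; last first.
  move=> k; have h1 : ip (psum (- b) n) (es k) @[n --> \oo] --> ip v (es k).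
    by apply: L2_cvg_ip => //; under eq_fun do rewrite norm2BC.
  have h2 : ip (psum (- b) n) (es k) @[n --> \oo] --> L / 2 * (- b) k.
    by apply: cvg_near_cst; exists k.+1 => // n /= kn; rewrite ip_psum_es// kn.
  rewrite /sc (cvg_unique _ h1 h2)// [(- b) k]/GRing.opp/=.
  by field; rewrite gt_eqF.
split=> // phi hphi; have p1 := C1c_L2 L_gt0 _ hphi; have p2 := C1c_L2' L_gt0 _ hphi.
have sL n : L2 L (ssum cos_k b n) by apply: cont_L2 => //; apply: ssum_cont; exact: cos_k_cont.
have h1 : ip (ssum cos_k b n) (derive1 phi) @[n --> \oo] --> ip (fser' b) (derive1 phi).
  apply: L2_cvg_ip => //; apply: nrm_unif => //.
  exact: (ssum_unif _ _ ler01 cos_k_le _ _ hb).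
have h2 : ip (psum (- b) n) phi @[n --> \oo] --> ip v phi.
  by apply: L2_cvg_ip => //; under eq_fun do rewrite norm2BC.
apply: cvg_unique h1 _ => //.
rewrite (_ : (fun n => _) = (fun n => - ip (psum (- b) n) phi)); first exact: cvgN.
apply/funext => n.
have cp : continuous (- psum b n).
  have -> : - psum b n = psum (- b) n.
    by apply/funext => x; rewrite [LHS]/GRing.opp/= !psumE -sumrN; apply: eq_bigr => k _; rewrite fctE mulNr.
  have -> : psum (- b) n = ssum es (- b) n.
    by apply/funext => x; rewrite psumE /ssum big_mkord.
  by apply: ssum_cont; exact: cont_es.
have [_ ->] := weak_deriv_classical L_gt0 _ _ (der_ssum' b n) cp; last by [].
congr (- ip _ _); apply/funext => x; rewrite [LHS]/GRing.opp/= !psumE -sumrN; apply: eq_bigr => k _.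
by rewrite fctE mulNr.
Qed.

(** Membership in the closure of C^1_c comes from [C1c_dense], as the series vanishes at both ends.
    Each of the two squared errors is kept at most e / 4, so that their sum is strictly below e. *)
Lemma fser_H2H10 b C : bnd b C -> H2H10 L (fser b).
Proof.
move=> hb; have hd := der_fser _ _ hb; have cd := fser'_cont _ _ hb.
have hL := fser_L2 _ _ hb; have hL' := fser'_L2 _ _ hb.
have w1 := weak_deriv_classical L_gt0 _ _ hd cd.
have H1b : H1 L (fser b) by split => //; exists (fser' b).
have [v wv _] := fser'_weak _ _ hb.
split; first split => //; first split.
- exact: wD_L2 w1.
- exists v; apply: weak_deriv_ae wv => //; first exact: wD_L2 w1.
  by have := wD_ae L_gt0 _ _ w1; apply: filterS => x h Dx; rewrite h.
split => // e e0.
have [phi [cphi c0 c1]] := C1c_dense L_gt0 _ _ hd cd (fser0 _ _ hb) (fserL _ _ hb).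
have e2 : 0 < Num.sqrt (e / 4) by rewrite sqrtr_gt0 divr_gt0.
have [n [h1 h2]] : exists n, nrm (fser b - phi n) <= Num.sqrt (e / 4) /\ nrm (fser' b - derive1 (phi n)) <= Num.sqrt (e / 4).
  move/cvgrPdist_le : c0 => /(_ _ e2) [n1 _ h1]; move/cvgrPdist_le : c1 => /(_ _ e2) [n2 _ h2].
  exists (maxn n1 n2); split.
    by have := h1 _ (leq_maxl n1 n2); rewrite sub0r normrN ger0_norm ?norm2_ge0.
  by have := h2 _ (leq_maxr n1 n2); rewrite sub0r normrN ger0_norm ?norm2_ge0.
exists (phi n) => //.
have pL := C1c_L2 L_gt0 _ (cphi n); have pL' := C1c_L2' L_gt0 _ (cphi n).
have wu : weak_deriv L (fser b - phi n) (fser' b - derive1 (phi n)).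
  have -> : fser b - phi n = (-1) *: phi n + fser b by rewrite scaleN1r addrC.
  have -> : fser' b - derive1 (phi n) = (-1) *: derive1 (phi n) + fser' b by rewrite scaleN1r addrC.
  apply: weak_deriv_lin => //.
  by apply: (weak_deriv_classical L_gt0); [exact: C1c_der (cphi n)|exact: C1c_cont1 (cphi n)].
have -> : nrm (wD L (fser b - phi n)) = nrm (fser' b - derive1 (phi n)).
  by apply: norm2_ae; [exact: wD_L2 wu|l2|exact: wD_ae].
have sqle x : 0 <= x -> x <= Num.sqrt (e / 4) -> x ^+ 2 <= e / 4.
  move=> x0 hx; have -> : e / 4 = Num.sqrt (e / 4) ^+ 2 by rewrite sqr_sqrtr// divr_ge0// ltW.
  by rewrite ler_pXn2r ?nnegrE ?sqrtr_ge0.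
have := sqle _ (norm2_ge0 _) h1; have := sqle _ (norm2_ge0 _) h2; lra.
Qed.

(** For u in $H^2 \cap H^1_0$ these are the sine coefficients of $-u_{xx}$; together with [fser]
    they identify that space with $l^2$. *)
Definition coef u k : R := kap k ^+ 2 * sc u k.

Lemma sc_wD2E u k : H2H10 L u -> sc (wD L (wD L u)) k = - coef u k.
Proof. by move=> hu; rewrite sc_wD2// mulNr. Qed.

Lemma coef_bnd u : H2H10 L u -> bnd (coef u) (2 / L * normH2 L u ^+ 2).
Proof.
move=> hu n; have h2 := H2H10_L2_2 _ hu.
have := bessel L_gt0 _ n h2; rewrite -norm2_sqr; under eq_bigr do rewrite sc_wD2E// sqrrN.
by [].
Qed.

Lemma coef_fser b C k : bnd b C -> coef (fser b) k = b k.
Proof. by move=> hb; rewrite /coef (sc_fser _ _ _ hb); field; rewrite gt_eqF// kap_gt0. Qed.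

Lemma fser_coef u : H2H10 L u -> ae_eq mu D u (fser (coef u)).
Proof.
move=> hu; have hb := coef_bnd _ hu; have hL := fser_L2 _ _ hb; have hL' := H2H10_L2 _ hu.
apply: ae_eqB0; apply: sine_complete => //.
move=> j; rewrite ip2Bl//.
by rewrite !scE// (sc_fser _ _ _ hb) /coef; field; rewrite gt_eqF// kap_gt0.
Qed.

Lemma wD_coef u : H2H10 L u -> ae_eq mu D (wD L u) (fser' (coef u)).
Proof.
move=> hu; have hb := coef_bnd _ hu.
apply: wD_ae => //; apply: weak_deriv_ae (fser_L2 _ _ hb) (H2H10_L2 _ hu) _ _ => //.
  by have := fser_coef _ hu; apply: filterS => x h Dx; rewrite h.
by apply: weak_deriv_classical => //; [exact: der_fser hb|exact: fser'_cont hb].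
Qed.

Lemma normH2_sqr u : H2H10 L u -> normH2 L u ^+ 2 = L / 2 * sqn (coef u).
Proof.
move=> hu; have h2 := H2H10_L2_2 _ hu; rewrite [LHS]norm2_sqr.
apply: cvg_unique (parseval L_gt0 _ h2) _ => //; apply: cvgM; first exact: cvg_cst.
rewrite (_ : sq _ = sq (coef u)); first exact: bnd_cvg (coef_bnd _ hu).
by apply/funext => n; apply: eq_bigr => k _; rewrite sc_wD2E// sqrrN.
Qed.

End function_series.

(** * Duhamel's formula *)

Section harmonic_oscillator.
Context {R : realType}.
Local Notation mu := (@lebesgue_measure R).

(** Integration starts at -1 so that the primitive is differentiable on both sides of t = 0; the
    subtraction normalises it to 0 there. *)
Definition prim (g : R -> R) (t : R) : R :=
  \int[mu]_(x in `[-1, t]) g x - \int[mu]_(x in `[-1, 0]) g x.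

Lemma prim0 g : prim g 0 = 0. Proof. exact: subrr. Qed.

Lemma prim_derive g (t : R) : continuous g -> -1 < t -> is_derive t (1 : R) (prim g) (g t).
Proof.
move=> cg t1.
have ig : mu.-integrable `[-1, t + 1] (EFin \o g).
  by apply: continuous_compact_integrable; [exact: segment_compact|exact: continuous_subspaceT].
have tt : t < t + 1 by rewrite ltrDl.
have [d1 d2] := continuous_FTC1_closed tt ig t1 (cg t).
have h1 : is_derive t (1 : R) (fun t => \int[mu]_(x in `[-1, t]) g x) (g t).
  by apply: DeriveDef; [exact: d1|rewrite -derive1E; exact: d2].
rewrite /prim -[g t]subr0; apply: is_deriveB.
Qed.

Variables (w : R) (f : R -> R) (a b : R).
Hypothesis w_gt0 : 0 < w.
Hypothesis f_cont : continuous f.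

Let Sf := prim (fun s => sin (w * s) * f s).
Let Cf := prim (fun s => cos (w * s) * f s).

(** Variation of constants for $v'' + w^2 v = f$. Expanding $\sin(w(t-s))$ separates t from s, so
    that only two primitives with fixed integrands occur. *)
Definition duhamel t : R := cos (w * t) * (a - Sf t / w) + sin (w * t) * (b / w + Cf t / w).
Definition duhamel' t : R := w * (cos (w * t) * (b / w + Cf t / w) - sin (w * t) * (a - Sf t / w)).

Let der_sin (t : R) : is_derive t (1 : R) (fun t => sin (w * t)) (cos (w * t) * w).
Proof. by have := der_comp _ _ _ _ (fun x => is_derive_sin x) (der_lin w) t. Qed.

Let der_cos (t : R) : is_derive t (1 : R) (fun t => cos (w * t)) (- sin (w * t) * w).
Proof. by have := der_comp _ _ _ _ (fun x => is_derive_cos x) (der_lin w) t. Qed.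

Let der_S (t : R) : -1 < t -> is_derive t (1 : R) Sf (sin (w * t) * f t).
Proof.
move=> t1; apply: prim_derive => // x; apply: continuousM; last exact: f_cont.
by apply: (der_cont _ _ der_sin).
Qed.

Let der_C (t : R) : -1 < t -> is_derive t (1 : R) Cf (cos (w * t) * f t).
Proof.
move=> t1; apply: prim_derive => // x; apply: continuousM; last exact: f_cont.
by apply: (der_cont _ _ der_cos).
Qed.

Lemma duhamel_derive (t : R) : -1 < t -> is_derive t (1 : R) duhamel (duhamel' t).
Proof.
move=> t1; have h1 := der_S t t1; have h2 := der_C t t1; have h3 := der_sin t; have h4 := der_cos t.
rewrite /duhamel; apply: is_derive_eq.
by rewrite /duhamel' /GRing.scale/=; field; rewrite gt_eqF.
Qed.

Lemma duhamel'_derive (t : R) : -1 < t -> is_derive t (1 : R) duhamel' (f t - w ^+ 2 * duhamel t).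
Proof.
move=> t1; have h1 := der_S t t1; have h2 := der_C t t1; have h3 := der_sin t; have h4 := der_cos t.
rewrite /duhamel'; apply: is_derive_eq.
transitivity ((cos (w * t) ^+ 2 + sin (w * t) ^+ 2) * f t - w ^+ 2 * duhamel t); last first.
  by rewrite cos2Dsin2 mul1r.
rewrite /duhamel /GRing.scale/=.
by field; rewrite gt_eqF.
Qed.

Lemma duhamel0 : duhamel 0 = a.
Proof. by rewrite /duhamel mulr0 cos0 sin0 /Sf prim0; ring. Qed.

Lemma duhamel'0 : duhamel' 0 = b.
Proof. by rewrite /duhamel' mulr0 cos0 sin0 /Cf prim0; field; rewrite gt_eqF. Qed.

End harmonic_oscillator.

(** * Continuity on intervals and the energy of a family of oscillators *)

Section within_continuity.
Context {R : realType} (A : set R).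
Implicit Types f g : R -> R.

Lemma withinD f g : {within A, continuous f} -> {within A, continuous g} ->
  {within A, continuous (fun x => f x + g x)}.
Proof. by move=> cf cg x; apply: continuousD; [exact: cf|exact: cg]. Qed.

Lemma withinB f g : {within A, continuous f} -> {within A, continuous g} ->
  {within A, continuous (fun x => f x - g x)}.
Proof. by move=> cf cg x; apply: continuousB; [exact: cf|exact: cg]. Qed.

Lemma withinM f g : {within A, continuous f} -> {within A, continuous g} ->
  {within A, continuous (fun x => f x * g x)}.
Proof. by move=> cf cg x; apply: continuousM; [exact: cf|exact: cg]. Qed.

Lemma within_cst (c : R) : {within A, continuous (fun=> c)}.
Proof. by apply: continuous_subspaceT => x; exact: cst_continuous. Qed.

End within_continuity.

Section oscillator_energy.
Context {R : realType}.
Variable om : nat -> R.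
Implicit Types p q f : nat -> R.

(** Twice the kinetic plus elastic energy of the first n oscillators, with positions p and
    velocities q. *)
Definition en p q n : R := \sum_(j < n) (q j ^+ 2 + (om j * p j) ^+ 2).

Lemma en_S p q n : en p q n.+1 = en p q n + (q n ^+ 2 + (om n * p n) ^+ 2).
Proof. by rewrite /en big_ord_recr. Qed.

Lemma is_derive_osum (t : R) n (F : nat -> R -> R) (G : nat -> R) :
  (forall j, is_derive t (1 : R) (F j) (G j)) ->
  is_derive t (1 : R) (fun s => \sum_(j < n) F j s) (\sum_(j < n) G j).
Proof.
move=> h; elim: n => [|n ih].
  rewrite big_ord0 (_ : (fun s => _) = cst 0); first exact: is_derive_cst.
  by apply/funext => s; rewrite big_ord0.
rewrite big_ord_recr/= (_ : (fun s => _) = (fun s => \sum_(j < n) F j s) + F n).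
  exact: is_deriveD.
by apply/funext => s; rewrite big_ord_recr.
Qed.

Lemma within_sum (A : set R) n (F : nat -> R -> R) : (forall j, {within A, continuous (F j)}) ->
  {within A, continuous (fun s => \sum_(j < n) F j s)}.
Proof.
move=> h; elim: n => [|n ih].
  rewrite (_ : (fun s => _) = cst 0); first by apply: continuous_subspaceT => x; exact: cst_continuous.
  by apply/funext => s; rewrite big_ord0.
rewrite (_ : (fun s => _) = (fun s => \sum_(j < n) F j s + F n s)).
  by move=> x; apply: continuousD; [exact: ih|exact: h].
by apply/funext => s; rewrite big_ord_recr.
Qed.

(** The restoring force cancels the derivative of the elastic part; only the power of f remains. *)
Lemma en_derive_at (v v' : R -> nat -> R) (f : nat -> R) n (t : R) :
  (forall j, is_derive t (1 : R) (v ^~ j) (v' t j)) ->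
  (forall j, is_derive t (1 : R) (v' ^~ j) (f j - om j ^+ 2 * v t j)) ->
  is_derive t (1 : R) (fun t => en (v t) (v' t) n) (\sum_(j < n) 2 * (f j * v' t j)).
Proof.
move=> hv hv'; apply: (is_derive_osum _ _ (fun j t => v' t j ^+ 2 + (om j * v t j) ^+ 2) (fun j => 2 * (f j * v' t j))) => j.
have h1 := hv j; have h2 := hv' j.
by apply: is_derive_eq; rewrite /GRing.scale/=; ring.
Qed.

Section ode.
Variables (T : R) (v v' f : R -> nat -> R).
Hypothesis v_cont : forall j, {within `[0, T], continuous (v ^~ j)}.
Hypothesis v'_cont : forall j, {within `[0, T], continuous (v' ^~ j)}.
Hypothesis v_derive : forall j t, 0 < t < T -> is_derive t (1 : R) (v ^~ j) (v' t j).
Hypothesis v'_derive : forall j t, 0 < t < T ->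
  is_derive t (1 : R) (v' ^~ j) (f t j - om j ^+ 2 * v t j).

Lemma en_within n : {within `[0, T], continuous (fun t => en (v t) (v' t) n)}.
Proof.
apply: (within_sum _ _ (fun j t => v' t j ^+ 2 + (om j * v t j) ^+ 2)) => j.
apply: withinD.
  by apply: (withinM _ (v' ^~ j) (v' ^~ j)); exact: v'_cont.
by apply: (withinM _ (fun t => om j * v t j) (fun t => om j * v t j));
  apply: withinM; by [exact: within_cst|exact: v_cont].
Qed.

Lemma en_derive n t : 0 < t < T ->
  is_derive t (1 : R) (fun t => en (v t) (v' t) n) (\sum_(j < n) 2 * (f t j * v' t j)).
Proof. by move=> tT; apply: en_derive_at => j; [exact: v_derive|exact: v'_derive]. Qed.

(** The power obeys $|2 f v'| \le f^2 + v'^2$, whose sum is bounded independently of the number of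
    modes. *)
Lemma en_lip B C : (forall n t, 0 <= t <= T -> en (v t) (v' t) n <= B) ->
  (forall t, 0 < t < T -> bnd (f t) C) ->
  forall n s t, 0 <= s -> s <= t -> t <= T ->
  `|en (v t) (v' t) n - en (v s) (v' s) n| <= (B + C) * (t - s).
Proof.
move=> hB hC n s t s0 st tT.
move: st; rewrite le_eqVlt => /orP[/eqP<-|st]; first by rewrite !subrr normr0 mulr0.
have dE x : x \in `]s, t[ -> is_derive x (1 : R) (fun t => en (v t) (v' t) n) (\sum_(j < n) 2 * (f x j * v' x j)).
  rewrite in_itv/= => /andP[sx xt]; apply: en_derive; apply/andP; split; lra.
have cE : {within `[s, t], continuous (fun t => en (v t) (v' t) n)}.
  apply: continuous_subspaceW (en_within n); apply: subset_itv; rewrite bnd_simp//.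
have [c] := MVT st dE cE; rewrite in_itv/= => /andP[sc_ ct] ->.
rewrite normrM (ger0_norm (x := t - s)) ?subr_ge0 ?(ltW st)//.
apply: ler_wpM2r; first by rewrite subr_ge0 ltW.
apply: le_trans (ler_norm_sum _ _ _) _.
apply: le_trans (_ : \sum_(j < n) (v' c j ^+ 2 + f c j ^+ 2) <= _).
  apply: ler_sum => j _; rewrite ler_norml.
  by have := sqr_ge0 (v' c j - f c j); have := sqr_ge0 (v' c j + f c j); move=> *; apply/andP; split; nra.
rewrite big_split/=; apply: lerD; last by apply: hC; apply/andP; split; lra.
have c0T : 0 <= c <= T by apply/andP; split; lra.
apply: le_trans (hB n c c0T); apply: ler_sum => j _.
by rewrite lerDl sqr_ge0.
Qed.

Lemma der_expR (c : R) : der (fun t => expR (c * t)) (fun t => c * expR (c * t)).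
Proof.
have := der_comp _ _ _ _ (fun x => is_derive_expR x) (der_lin c).
move=> h x; have := h x; congr (is_derive _ _ _ _).
by rewrite fctE/= mulrC.
Qed.

(* (e^{-La t} en)' <= (m / La) e^{La t}, by 2 f v' <= f^2 / La + La v'^2. *)
Lemma energy_le (La N0 m : R) : 0 < La -> 0 <= m ->
  (forall n, en (v 0) (v' 0) n <= N0) ->
  (forall t, 0 < t < T -> bnd (f t) (m * expR (2 * La * t))) ->
  forall n t, 0 <= t <= T -> en (v t) (v' t) n <= (N0 + m / La ^+ 2) * expR (2 * La * t).
Proof.
move=> La0 m0 hN hf n t /andP[t0 tT].
have N0_ge0 : 0 <= N0 by have := hN 0%N; rewrite /en big_ord0.
pose E s := en (v s) (v' s) n.
(* The subtracted term is a primitive of the bound $(m / La) e^{La s}$, so [phi] is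
   nonincreasing. *)
pose phi s := expR (- La * s) * E s - m / La ^+ 2 * expR (La * s).
pose phi' s := expR (- La * s) * (\sum_(j < n) 2 * (f s j * v' s j)) + E s * (- La * expR (- La * s)) - m / La ^+ 2 * (La * expR (La * s)).
have dphi s : s \in `]0, T[ -> is_derive s (1 : R) phi (phi' s).
  rewrite in_itv/= => sT; have h1 := en_derive n s sT.
  have h2 := der_expR (- La) s; have h3 := der_expR La s.
  rewrite /phi /E; apply: is_derive_eq; rewrite /phi' /E /GRing.scale/=; ring.
have cphi : {within `[0, T], continuous phi}.
  apply: withinB.
    apply: withinM; last exact: en_within.
    by apply: continuous_subspaceT => z; exact: (der_cont _ _ (der_expR (- La))).
  apply: withinM; first exact: within_cst.
  by apply: continuous_subspaceT => z; exact: (der_cont _ _ (der_expR La)).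
have phi'_le s : s \in `]0, T[ -> derive1 phi s <= 0.
  move=> sI; have [_ phiE] := dphi s sI; rewrite derive1E phiE.
  move: sI; rewrite in_itv/= => sT.
  have eM : expR (- La * s) * expR (2 * La * s) = expR (La * s).
    by rewrite -expRD; congr expR; ring.
  have S1 : \sum_(j < n) 2 * (f s j * v' s j) <= m * expR (2 * La * s) / La + La * E s.
    apply: le_trans (_ : \sum_(j < n) (La^-1 * f s j ^+ 2 + La * v' s j ^+ 2) <= _).
      apply: ler_sum => j _; rewrite -subr_ge0.
      have -> : La^-1 * f s j ^+ 2 + La * v' s j ^+ 2 - 2 * (f s j * v' s j) = La^-1 * (f s j - La * v' s j) ^+ 2.
        by field; rewrite gt_eqF.
      by rewrite mulr_ge0 ?sqr_ge0// invr_ge0 ltW.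
    rewrite big_split/= -!big_distrr/=; apply: lerD.
      by rewrite mulrC; apply: ler_wpM2r; [rewrite invr_ge0 ltW|exact: hf].
    apply: ler_wpM2l; first exact: ltW.
    by apply: ler_sum => j _; rewrite lerDl sqr_ge0.
  have := ler_wpM2l (expR_ge0 (- La * s)) S1; rewrite mulrDr.
  have -> : expR (- La * s) * (m * expR (2 * La * s) / La) = m / La ^+ 2 * (La * expR (La * s)).
    by rewrite -eM; field; rewrite gt_eqF.
  rewrite /phi' => h; rewrite -subr_ge0 in h; rewrite -subr_ge0.
  apply: le_trans h _; rewrite le_eqVlt; apply/orP; left; apply/eqP; ring.
have := ler0_derive1_nincr (fun s sI => @ex_derive _ _ _ _ _ _ _ (dphi s sI)) phi'_le cphi (lexx 0) t0 tT.
rewrite /phi !mulr0 expR0 mul1r mulr1 => h.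
have E0 : E 0 <= N0 by exact: hN.
have K0 : 0 <= m / La ^+ 2 by rewrite divr_ge0// sqr_ge0.
have e1 : 1 <= expR (La * t) by rewrite -expR0 ler_expR; apply: mulr_ge0 => //; exact: ltW.
have e2 : expR (La * t) * expR (- La * t) = 1 by rewrite -expRD mulNr subrr expR0.
have e3 : expR (2 * La * t) = expR (La * t) * expR (La * t) by rewrite -expRD; congr expR; ring.
rewrite e3 -/(E t); move: h e1 e2; move: (expR (La * t)) (expR (- La * t)) => x y h x1 xy.
have -> : E t = x * (y * E t) by rewrite mulrA xy mul1r.
rewrite [leRHS]mulrCA; apply: ler_wpM2l; first by lra.
have : y * E t <= N0 + m / La ^+ 2 * x by lra.
move: K0; move: (m / La ^+ 2) => K K0 h'; nra.
Qed.

End ode.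
End oscillator_energy.

Section epsilon_delta.
Context {R : realType}.

Lemma within_eps (A : set R) (f : R -> R) t : {within A, continuous f} -> A t ->
  forall e : R, 0 < e -> exists2 d : R, 0 < d & forall s, A s -> `|s - t| < d -> `|f s - f t| <= e.
Proof.
move=> /subspace_continuousP cf At e e0; have := cf t At; move=> /cvgrPdist_le /(_ _ e0).
rewrite near_withinE => /nbhs_ballP [d d0 H]; exists d => // s As sd.
by rewrite distrC; apply: H => //; rewrite /ball/= distrC.
Qed.

Lemma cauchy_rate_cvg (x r : nat -> R) : r @ \oo --> 0 ->
  (forall m k, `|x (m + k)%N - x m| <= r m) -> cvgn x.
Proof.
move=> r0 h; apply/cauchy_cvgP/cauchy_exP => e e0.
move/cvgrPdist_lt : r0 => /(_ _ e0) [m _ hm]; exists (x m); exists m => // n /= mn.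
rewrite /ball/= distrC -(subnKC mn); apply: le_lt_trans (h _ _) _.
by have := hm m (leqnn m); rewrite sub0r normrN; apply: le_lt_trans; exact: ler_norm.
Qed.

Lemma bnd_comp (a : nat -> R) C j : bnd a C -> a j ^+ 2 <= C.
Proof.
move=> /(_ j.+1); apply: le_trans; rewrite big_ord_recr/= lerDr.
by apply: sumr_ge0 => i _; exact: sqr_ge0.
Qed.

(** Lower semicontinuity of the $l^2$ norm: each partial sum involves finitely many coordinates. *)
Lemma bnd_lim (a : nat -> nat -> R) b C : (forall j, a m j @[m --> \oo] --> b j) ->
  (\forall m \near \oo, bnd (a m) C) -> bnd b C.
Proof.
move=> h hC n.
have cv : \sum_(j < n) a m j ^+ 2 @[m --> \oo] --> \sum_(j < n) b j ^+ 2.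
  elim: n => [|n ih].
    by rewrite big_ord0; under eq_fun do rewrite big_ord0; exact: cvg_cst.
  rewrite big_ord_recr/=; under eq_fun do rewrite big_ord_recr/=.
  by apply: cvgD => //; under eq_fun do rewrite expr2; rewrite expr2; exact: cvgM.
rewrite -(cvg_lim _ cv)//; apply: limr_le; first exact: cvgP cv.
by apply: filterS hC => m; exact.
Qed.

End epsilon_delta.

(** * Strong continuity in the energy norm *)

Section strong_continuity.
Context {R : realType}.
Variable om : nat -> R.
Local Notation en := (en om).
Implicit Types p q : nat -> R.

Lemma en_tail p q p' q' m n : (m <= n)%N ->
  en (p - p') (q - q') n - en (p - p') (q - q') m <=
  2 * (en p q n - en p q m) + 2 * (en p' q' n - en p' q' m).
Proof.
elim: n => [|n ih]; first by rewrite leqn0 => /eqP ->; rewrite !subrr !mulr0 addr0.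
rewrite leq_eqVlt => /orP[/eqP ->|]; first by rewrite !subrr !mulr0 addr0.
rewrite ltnS => /ih; rewrite !en_S.
have -> : (p - p') n = p n - p' n by [].
have -> : (q - q') n = q n - q' n by [].
have := sqr_ge0 (q n + q' n); have := sqr_ge0 (om n * p n + om n * p' n).
move: (en _ _ _) (en _ _ m) (en p q n) (en p q m) (en p' q' n) (en p' q' m).
by move=> *; nra.
Qed.

Lemma en_nd p q : nondecreasing_seq (en p q).
Proof. by apply/nondecreasing_seqP => n; rewrite en_S lerDl addr_ge0 ?sqr_ge0. Qed.

Lemma en_attained p q B e : 0 < e -> (forall n, en p q n <= B) ->
  exists m, forall n, en p q n - en p q m <= e.
Proof.
move=> e0 hB; have cv : cvgn (en p q).
  by apply: nondecreasing_is_cvgn; [exact: en_nd|exists B => _ [n _ <-]].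
move: (cv) => /cvgrPdist_le /(_ _ e0) [m _ hm]; exists m => n.
have h1 := nondecreasing_cvgn_le (en_nd p q) cv n.
have := hm m (leqnn m); move=> /(le_trans (ler_norm _)); lra.
Qed.

(* Weak continuity and continuity of the norm give strong continuity. *)
Lemma strong_cont (T B K : R) (v v' : R -> nat -> R) :
  (forall j, {within `[0, T], continuous (v ^~ j)}) ->
  (forall j, {within `[0, T], continuous (v' ^~ j)}) ->
  (forall n t, 0 <= t <= T -> en (v t) (v' t) n <= B) ->
  (forall n s t, 0 <= s -> s <= t -> t <= T ->
     `|en (v t) (v' t) n - en (v s) (v' s) n| <= K * (t - s)) ->
  forall t e : R, 0 <= t <= T -> 0 < e -> exists2 d : R, 0 < d &
    forall s, 0 <= s <= T -> `|s - t| < d -> forall n, en (v s - v t) (v' s - v' t) n <= e.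
Proof.
move=> cv cv' hB hK t e tT e0.
(* Budget: the tail beyond m is at most e/8 at time t. The partial energies being Lipschitz in time
   uniformly in n, it is at most e/4 at time s. Doubling both and adding e/8 for the first m modes
   stays below e. *)
have [m hm] := en_attained (v t) (v' t) B (e / 8) (divr_gt0 e0 (ltr0Sn _ _)) (fun n => hB n t tT).
have lip n s : 0 <= s <= T -> `|en (v s) (v' s) n - en (v t) (v' t) n| <= `|K| * `|s - t|.
  move=> /andP[s0 sT]; move/andP : (tT) => [t0 tT'].
  have [st|ts] := leP s t.
    rewrite distrC (distrC s); apply: le_trans (hK n s t s0 st tT') _.
    by rewrite (ger0_norm (x := t - s)) ?subr_ge0//; apply: ler_wpM2r; rewrite ?subr_ge0// ler_norm.
  apply: le_trans (hK n t s t0 (ltW ts) sT) _.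
  by rewrite (ger0_norm (x := s - t)) ?subr_ge0 ?(ltW ts)//; apply: ler_wpM2r; rewrite ?subr_ge0 ?(ltW ts)// ler_norm.
have cE : {within `[0, T], continuous (fun s => en (v s - v t) (v' s - v' t) m)}.
  apply: (within_sum _ _ (fun j s => (v' s j - v' t j) ^+ 2 + (om j * (v s j - v t j)) ^+ 2)) => j.
  have c1 : {within `[0, T], continuous (fun s => v' s j - v' t j)}.
    by apply: withinB; [exact: cv'|exact: within_cst].
  have c2 : {within `[0, T], continuous (fun s => om j * (v s j - v t j))}.
    by apply: withinM; [exact: within_cst|apply: withinB; [exact: cv|exact: within_cst]].
  by apply: withinD; [exact: (withinM _ _ _ c1 c1)|exact: (withinM _ _ _ c2 c2)].
have tA : (`[0, T]%classic : set R) t by rewrite /= in_itv.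
have [d1 d10 h1] := within_eps _ _ _ cE tA (e / 8) (divr_gt0 e0 (ltr0Sn _ _)).
have K1 : 0 < `|K| + 1 by rewrite ltr_wpDl.
exists (Num.min d1 (e / (16 * (`|K| + 1)))).
  by rewrite lt_min d10/= divr_gt0// mulr_gt0.
move=> s sT; rewrite lt_min => /andP[sd1 sd2] n.
have sA : (`[0, T]%classic : set R) s by rewrite /= in_itv.
have en0 : en (v t - v t) (v' t - v' t) m = 0.
  rewrite !subrr /en big1// => j _; have -> : (0 : nat -> R) j = 0 by [].
  by rewrite mulr0 expr0n addr0.
have := h1 s sA sd1; rewrite en0 subr0 => /(le_trans (ler_norm _)) h2.
have Ks : `|K| * `|s - t| <= e / 16.
  have : `|s - t| * (`|K| + 1) <= e / 16.
    by move/ltW : sd2; rewrite invfM mulrA ler_pdivlMr.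
  by have := normr_ge0 (s - t); have := normr_ge0 K; nra.
have [nm|mn] := leqP n m.
  by apply: le_trans (en_nd _ _ _ _ nm) _; lra.
have := en_tail (v s) (v' s) (v t) (v' t) m n (ltnW mn).
have := hm n.
have /ler_normlP[a1 a2] := lip n s sT; have /ler_normlP[b1 b2] := lip m s sT.
move: Ks h2 a1 a2 b1 b2; lra.
Qed.

End strong_continuity.

(** * Picard iteration for a globally Lipschitz force *)

Section picard.
Context {R : realType}.
Variable om : nat -> R.
Hypothesis om_gt0 : forall j, 0 < om j.
Local Notation en := (en om).
Implicit Types (p q : nat -> R) (u v : R -> nat -> R).

(** [bnd (wt p) C] bounds the squared energy norm of p by C. *)
Definition wt p : nat -> R := fun j => om j * p j.
Definition inV p := exists C, bnd (wt p) C.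

Lemma wtB p q : wt (p - q) = wt p - wt q.
Proof. by apply/funext => j; rewrite /wt !fctE mulrBr. Qed.

Lemma wtD p q : wt (p + q) = wt p + wt q.
Proof. by apply/funext => j; rewrite /wt !fctE mulrDr. Qed.

Lemma wtZ (a : R) p : wt (a *: p) = a *: wt p.
Proof. by apply/funext => j; rewrite /wt !fctE /GRing.scale/= mulrCA. Qed.

Lemma bnd_wt_en p q C : (forall n, en p q n <= C) -> bnd (wt p) C.
Proof.
by move=> h n; apply: le_trans (h n); apply: ler_sum => j _; rewrite lerDr sqr_ge0.
Qed.

Lemma bnd_vel_en p q C : (forall n, en p q n <= C) -> bnd q C.
Proof.
by move=> h n; apply: le_trans (h n); apply: ler_sum => j _; rewrite lerDl sqr_ge0.
Qed.

Lemma bnd_wt_lim (a : nat -> nat -> R) p C : (forall j, a m j @[m --> \oo] --> p j) ->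
  (\forall m \near \oo, bnd (wt (a m)) C) -> bnd (wt p) C.
Proof.
move=> h hC; apply: (bnd_lim (fun m => wt (a m))) => // j.
by apply: cvgM; [exact: cvg_cst|exact: h].
Qed.

Lemma bnd_wt_comp p C j : bnd (wt p) C -> `|p j| <= Num.sqrt C / om j.
Proof.
move=> h; have C0 := bnd_ge0 _ _ h; have := bnd_comp _ _ j h; rewrite /wt => hj.
rewrite ler_pdivlMr// -[X in _ * X](ger0_norm (ltW (om_gt0 j))) -normrM mulrC.
by rewrite -sqrtr_sqr ler_wsqrtr.
Qed.

Variables (F : (nat -> R) -> nat -> R) (kap2 CF : R).
Hypothesis kap2_ge0 : 0 <= kap2.
Hypothesis F_lip : forall p q d, inV p -> inV q -> bnd (wt (p - q)) d ->
  bnd (F p - F q) (kap2 * d).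
Hypothesis F_bnd : forall p, inV p -> bnd (F p) CF.
Variables (u0 u1 : nat -> R) (N0 : R).
Hypothesis u01 : forall n, en u0 u1 n <= N0.

(** For negative times the force is frozen at its value at time 0, which makes it continuous on the
    whole line as Duhamel's formula requires. *)
Definition pos (t : R) : R := Num.max 0 t.

Lemma pos_ge0 t : 0 <= pos t. Proof. by rewrite le_max lexx. Qed.
Lemma pos_id t : 0 <= t -> pos t = t. Proof. by move=> t0; apply/max_idPr. Qed.

Lemma pos_lip t s : `|pos t - pos s| <= `|t - s|.
Proof.
rewrite /pos; have [t0|t0] := leP t 0; have [s0|s0] := leP s 0.
- by rewrite subrr normr0.
- rewrite !ler0_norm; lra.
- rewrite !ger0_norm; lra.
- by [].
Qed.

Definition vcont (u : R -> nat -> R) := forall t e : R, 0 <= t -> 0 < e ->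
  exists2 d : R, 0 < d & forall s, 0 <= s -> `|s - t| < d -> bnd (u s - u t) e.

Definition good u := (forall t, 0 <= t -> inV (u t)) /\ vcont (fun t => wt (u t)).

Definition force u j s := F (u (pos s)) j.
Definition Phi u t j := duhamel (om j) (force u j) (u0 j) (u1 j) t.
Definition Phi' u t j := duhamel' (om j) (force u j) (u0 j) (u1 j) t.

Lemma CF_ge0 : 0 <= CF.
Proof.
have : inV (0 : nat -> R) by exists 0 => n; rewrite big1// => j _; rewrite /wt mulr0 expr0n.
by move/F_bnd/bnd_ge0.
Qed.

Lemma force_cont u j : good u -> continuous (force u j).
Proof.
move=> [Vu cu] x; apply/cvgrPdist_le => e e0.
have e'0 : 0 < e ^+ 2 / (kap2 + 1) by rewrite divr_gt0 ?exprn_gt0// ltr_wpDl.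
have [d d0 hd] := cu (pos x) _ (pos_ge0 x) e'0.
have := near_dist x d d0; apply: filterS => y yd.
have h : bnd (wt (u (pos y) - u (pos x))) (e ^+ 2 / (kap2 + 1)).
  by rewrite wtB; apply: hd; [exact: pos_ge0|apply: le_lt_trans yd; exact: pos_lip].
have := bnd_comp _ _ j (F_lip _ _ _ (Vu _ (pos_ge0 y)) (Vu _ (pos_ge0 x)) h).
rewrite [(_ - _) j]/GRing.add/= => h2; rewrite distrC.
rewrite -(@ler_pXn2r _ 2)// ?nnegrE ?(ltW e0)// real_normK ?num_real//.
apply: le_trans h2 _; rewrite mulrCA ger_pMr ?exprn_gt0// ler_pdivrMr ?ltr_wpDl//.
by rewrite mul1r lerDl.
Qed.

Section Phi_good.
Variable u : R -> nat -> R.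
Hypothesis gu : good u.

Lemma Phi_derive j (t : R) : -1 < t -> is_derive t (1 : R) (Phi u ^~ j) (Phi' u t j).
Proof. by move=> t1; apply: duhamel_derive => //; exact: force_cont. Qed.

Lemma Phi'_derive j (t : R) : -1 < t ->
  is_derive t (1 : R) (Phi' u ^~ j) (F (u (pos t)) j - om j ^+ 2 * Phi u t j).
Proof. by move=> t1; apply: duhamel'_derive => //; exact: force_cont. Qed.

Lemma Phi0 : Phi u 0 = u0.
Proof. by apply/funext => j; exact: duhamel0. Qed.

Lemma Phi'0 : Phi' u 0 = u1.
Proof. by apply/funext => j; exact: duhamel'0. Qed.

Lemma derive_within (T : R) (f f' : R -> R) : (forall t : R, -1 < t -> is_derive t (1 : R) f (f' t)) ->
  {within `[0, T], continuous f}.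
Proof.
move=> h; apply: continuous_in_subspaceT => x; rewrite inE/= in_itv/= => /andP[x0 _].
apply: differentiable_continuous; apply/derivable1_diffP.
by have [] := h x (lt_le_trans (ltrN10 _) x0).
Qed.

Lemma Phi_within T j : {within `[0, T], continuous (Phi u ^~ j)}.
Proof. exact: (derive_within T (Phi u ^~ j) (fun t => Phi' u t j) (Phi_derive j)). Qed.

Lemma Phi'_within T j : {within `[0, T], continuous (Phi' u ^~ j)}.
Proof.
exact: (derive_within T (Phi' u ^~ j) (fun t => F (u (pos t)) j - om j ^+ 2 * Phi u t j) (Phi'_derive j)).
Qed.

Lemma m1_lt (t T : R) : 0 < t < T -> -1 < t :> R.
Proof. by move=> /andP[t0 _]; lra. Qed.

Lemma Phi_energy (La : R) n (t : R) : 0 < La -> 0 <= t ->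
  en (Phi u t) (Phi' u t) n <= (N0 + CF / La ^+ 2) * expR (2 * La * t).
Proof.
move=> La0 t0; apply: (energy_le om t (Phi u) (Phi' u) (fun t => F (u (pos t)))
  (Phi_within t) (Phi'_within t) (fun j s st => Phi_derive j s (m1_lt _ _ st))
  (fun j s st => Phi'_derive j s (m1_lt _ _ st)) La N0 CF La0 CF_ge0).
- by move=> k; rewrite Phi0 Phi'0.
- move=> s /andP[s0 _]; apply: bnd_le (F_bnd _ (gu.1 _ (pos_ge0 s))).
  rewrite -[leLHS]mulr1; apply: ler_wpM2l; first exact: CF_ge0.
  by rewrite -expR0 ler_expR !mulr_ge0// ltW.
by rewrite t0 lexx.
Qed.

Lemma Phi_energyT (T : R) n (t : R) : 0 <= t <= T ->
  en (Phi u t) (Phi' u t) n <= (N0 + CF) * expR (2 * T).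
Proof.
move=> /andP[t0 tT]; apply: le_trans (Phi_energy 1 n t ltr01 t0) _.
rewrite expr1n divr1 mulr1; apply: ler_wpM2l; last by rewrite ler_expR ler_pM2l.
by rewrite addr_ge0 ?CF_ge0//; have := u01 0%N; rewrite /en big_ord0.
Qed.

Lemma Phi_strong_cont : forall t e : R, 0 <= t -> 0 < e ->
  exists2 d : R, 0 < d & forall s, 0 <= s -> `|s - t| < d ->
  forall n, en (Phi u s - Phi u t) (Phi' u s - Phi' u t) n <= e.
Proof.
move=> t e t0 e0; pose T := t + 1.
have hB n s := Phi_energyT T n s.
have tT : 0 <= t <= T by rewrite /T; apply/andP; split; lra.
have [d d0 hd] : exists2 d : R, 0 < d & forall s, 0 <= s <= T -> `|s - t| < d ->
    forall n, en (Phi u s - Phi u t) (Phi' u s - Phi' u t) n <= e.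
  apply: (strong_cont om T ((N0 + CF) * expR (2 * T)) ((N0 + CF) * expR (2 * T) + CF)) => //.
  - exact: Phi_within.
  - exact: Phi'_within.
  - move=> n s r s0 sr rT; apply: (en_lip om T (Phi u) (Phi' u) (fun t => F (u (pos t)))
      (Phi_within T) (Phi'_within T) (fun j x xt => Phi_derive j x (m1_lt _ _ xt))
      (fun j x xt => Phi'_derive j x (m1_lt _ _ xt)) _ _ (fun n s => Phi_energyT T n s)) => //.
    by move=> x _; apply: F_bnd; apply: gu.1; exact: pos_ge0.
exists (Num.min d 1); first by rewrite lt_min d0/=.
move=> s s0; rewrite lt_min => /andP[sd s1] n; apply: hd => //.
rewrite s0/= /T; move/ltr_normlP : s1 => [_ h]; lra.
Qed.

Lemma good_Phi : good (Phi u).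
Proof.
split.
  move=> t t0; exists ((N0 + CF) * expR (2 * t)).
  by apply: bnd_wt_en (Phi' u t) _ _ => n; apply: Phi_energyT; rewrite t0 lexx.
move=> t e t0 e0; have [d d0 hd] := Phi_strong_cont t e t0 e0.
exists d => // s s0 sd; rewrite -wtB; apply: bnd_wt_en => n; exact: hd.
Qed.

End Phi_good.

(** Energy estimate for a difference that starts from zero data: in the norm weighted by $e^{-La t}$
    the map [Phi] has squared Lipschitz constant [kap2 / La ^+ 2], with no restriction on the length
    of time. *)
Lemma Phi_diff u v (m La : R) : good u -> good v -> 0 <= m -> 0 < La ->
  (forall t, 0 <= t -> bnd (wt (u t - v t)) (m * expR (2 * La * t))) ->
  forall t, 0 <= t -> bnd (wt (Phi u t - Phi v t)) (kap2 * m / La ^+ 2 * expR (2 * La * t)).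
Proof.
move=> gu gv m0 La0 huv t t0.
apply: (bnd_wt_en _ (Phi' u t - Phi' v t)) => n.
have d1 j s : 0 < s < t -> is_derive s (1 : R) (fun s => (Phi u s - Phi v s) j) ((Phi' u s - Phi' v s) j).
  move=> /m1_lt s1; have h1 := Phi_derive u gu j s s1; have h2 := Phi_derive v gv j s s1.
  exact: (is_deriveB h1 h2).
have d2 j s : 0 < s < t -> is_derive s (1 : R) (fun s => (Phi' u s - Phi' v s) j)
    ((F (u (pos s)) - F (v (pos s))) j - om j ^+ 2 * (Phi u s - Phi v s) j).
  move=> /m1_lt s1; have h1 := Phi'_derive u gu j s s1; have h2 := Phi'_derive v gv j s s1.
  apply: (is_derive_eq (is_deriveB h1 h2)); rewrite !fctE; ring.
have := energy_le om t (fun s => Phi u s - Phi v s) (fun s => Phi' u s - Phi' v s)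
  (fun t => F (u (pos t)) - F (v (pos t)))
  (fun j => withinB _ _ _ (Phi_within u gu t j) (Phi_within v gv t j))
  (fun j => withinB _ _ _ (Phi'_within u gu t j) (Phi'_within v gv t j))
  d1 d2 La 0 (kap2 * m) La0 (mulr_ge0 kap2_ge0 m0).
rewrite add0r; apply.
- move=> k; rewrite !Phi0// !Phi'0// !subrr /en big1// => j _.
  by rewrite expr0n mulr0 expr0n addr0.
- move=> s /andP[s0 _]; rewrite pos_id ?(ltW s0)// -mulrA; apply: F_lip.
  + by apply: gu.1; exact: ltW.
  + by apply: gv.1; exact: ltW.
  by apply: huv; exact: ltW.
by rewrite t0 lexx.
Qed.

(** Chosen so that the squared contraction factor is at most 1/16, small enough to absorb the
    doubling in [bndD] as well. *)
Let La : R := 4 * (kap2 + 1).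
Let La_gt0 : 0 < La. Proof. by rewrite mulr_gt0// ltr_wpDl. Qed.
Let ratio : kap2 / La ^+ 2 <= 16^-1.
Proof.
rewrite ler_pdivrMr ?exprn_gt0// /La exprMn mulrA.
have -> : 16^-1 * (4 : R) ^+ 2 = 1 by field.
by rewrite mul1r; have := kap2_ge0; nra.
Qed.

Definition Pic (m : nat) : R -> nat -> R := iter m Phi (fun=> u0).

Lemma N0_ge0 : 0 <= N0. Proof. by have := u01 0%N; rewrite /en big_ord0. Qed.

Lemma good_Pic m : good (Pic m).
Proof.
elim: m => [|m ih]; last exact: good_Phi.
split => [t _|t e _ e0]; first by exists N0; exact: bnd_wt_en u01.
by exists 1 => // s _ _ n; rewrite subrr big1 ?(ltW e0)// => j _; rewrite expr0n.
Qed.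

(** Bound for the first Picard step in the form produced by [bndB]: twice the energy bound of
    [Pic 1] plus twice that of the initial data. *)
Definition K0 : R := 2 * (N0 + CF / La ^+ 2) + 2 * N0.

Lemma K0_ge0 : 0 <= K0.
Proof.
have a := N0_ge0; have b : 0 <= CF / La ^+ 2 by rewrite divr_ge0 ?CF_ge0 ?sqr_ge0.
by rewrite /K0; lra.
Qed.

Lemma exp_ge1 t : 0 <= t -> 1 <= expR (2 * La * t).
Proof.
move=> t0; rewrite -expR0 ler_expR; apply: mulr_ge0 => //.
by apply: mulr_ge0 => //; exact: ltW La_gt0.
Qed.

Lemma Pic_step m t : 0 <= t ->
  bnd (wt (Pic m.+1 t - Pic m t)) (K0 / 16 ^+ m * expR (2 * La * t)).
Proof.
elim: m t => [|m ih] t t0.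
  have E x : K0 / 16 ^+ 0 * x = 2 * ((N0 + CF / La ^+ 2) * x) + 2 * (N0 * x).
    by rewrite expr0 divr1 /K0 mulrDl -!(mulrA 2).
  rewrite E wtB.
  apply: bndB.
    apply: (bnd_wt_en _ (Phi' (Pic 0) t)) => n.
    by apply: (Phi_energy _ (good_Pic 0) La).
  apply: (bnd_le _ N0); last exact: bnd_wt_en u01.
  by rewrite ler_peMr ?N0_ge0// exp_ge1.
have m0 : 0 <= K0 / 16 ^+ m by rewrite divr_ge0 ?K0_ge0 ?exprn_ge0.
have h := Phi_diff _ _ _ La (good_Pic m.+1) (good_Pic m) m0 La_gt0 ih t t0.
apply: bnd_le h; apply: ler_wpM2r; first exact: expR_ge0.
have -> : K0 / 16 ^+ m.+1 = 16^-1 * (K0 / 16 ^+ m) by rewrite exprS invfM mulrCA.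
by rewrite mulrAC; apply: ler_wpM2r.
Qed.

(** The factor 4 is stable under the induction on k because $2 \cdot 4/16 + 2 \le 4$. *)
Lemma Pic_dist m k t : 0 <= t ->
  bnd (wt (Pic (m + k) t - Pic m t)) (4 * K0 / 16 ^+ m * expR (2 * La * t)).
Proof.
move=> t0; have e0 := expR_ge0 (2 * La * t); have k0 := K0_ge0.
elim: k m => [|k ih] m.
  rewrite addn0 subrr => n; rewrite big1; last by move=> j _; rewrite /wt mulr0 expr0n.
  by rewrite !mulr_ge0// invr_ge0 exprn_ge0.
have -> : Pic (m + k.+1) t - Pic m t = (Pic (m.+1 + k) t - Pic m.+1 t) + (Pic m.+1 t - Pic m t).
  by rewrite addrA subrK addSnnS.
rewrite wtD; apply: bnd_le (bndD _ _ _ _ (ih m.+1) (Pic_step m t t0)).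
rewrite exprS invfM; have : 0 <= (16 ^+ m)^-1 :> R by rewrite invr_ge0 exprn_ge0.
move: (16 ^+ m)^-1 => z z0.
have : 0 <= K0 * z * expR (2 * La * t) by rewrite !mulr_ge0.
move: (expR _) => x; lra.
Qed.

Definition ulim t j : R := limn (fun m => Pic m t j).

Lemma pow16_cvg0 (c : R) : c / 16 ^+ m @[m --> \oo] --> 0.
Proof.
rewrite -[X in _ --> X](mulr0 c); apply: cvgM; first exact: cvg_cst.
under eq_fun do rewrite -exprVn; apply: cvg_expr; rewrite ger0_norm//; lra.
Qed.

Lemma Pic_cvg t j : 0 <= t -> Pic m t j @[m --> \oo] --> ulim t j.
Proof.
move=> t0; apply: (cauchy_rate_cvg _ (fun m => Num.sqrt (4 * K0 / 16 ^+ m * expR (2 * La * t)) / om j)).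
  rewrite -[X in _ --> X](mul0r (om j)^-1); apply: cvgM; last exact: cvg_cst.
  rewrite -[X in _ --> X]sqrtr0; apply: (continuous_cvg _ (@sqrt_continuous _ _)).
  rewrite -[X in _ --> X](mul0r (expR (2 * La * t))); apply: cvgM; last exact: cvg_cst.
  exact: pow16_cvg0.
by move=> m k; have := bnd_wt_comp _ _ j (Pic_dist m k t t0).
Qed.

Lemma ulim_dist m t : 0 <= t ->
  bnd (wt (ulim t - Pic m t)) (4 * K0 / 16 ^+ m * expR (2 * La * t)).
Proof.
move=> t0; apply: (bnd_wt_lim (fun k => Pic k t - Pic m t)).
  by move=> j; apply: cvgB; [exact: Pic_cvg|exact: cvg_cst].
by exists m => // k /= mk; rewrite -(subnKC mk); exact: Pic_dist.
Qed.

Lemma good_ulim : good ulim.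
Proof.
split=> [t t0|t e t0 e0].
  have [C hC] := (good_Pic 0).1 t t0.
  exists (2 * (4 * K0 / 16 ^+ 0 * expR (2 * La * t)) + 2 * C).
  rewrite (_ : ulim t = (ulim t - Pic 0 t) + Pic 0 t); last by rewrite subrK.
  by rewrite wtD; apply: bndD => //; exact: ulim_dist.
pose X := expR (2 * La * (t + 1)).
have e12 : 0 < e / 12 by rewrite divr_gt0.
have [m hm] : exists m, 4 * K0 / 16 ^+ m * X <= e / 12.
  have : 4 * K0 / 16 ^+ m * X @[m --> \oo] --> 0.
    rewrite -[X in _ --> X](mul0r X); apply: cvgM; last exact: cvg_cst.
    exact: pow16_cvg0.
  move/cvgrPdist_le => /(_ _ e12) [m _ h]; exists m; have := h m (leqnn m).
  by rewrite sub0r normrN; apply: le_trans; exact: ler_norm.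
have [d d0 hd] := (good_Pic m).2 t (e / 12) t0 e12.
exists (Num.min d 1); first by rewrite lt_min d0/=.
move=> s s0; rewrite lt_min => /andP[sd s1].
have close r : 0 <= r -> r <= t + 1 -> bnd (wt (ulim r - Pic m r)) (e / 12).
  move=> r0 rt; apply: bnd_le (ulim_dist m r r0); apply: le_trans hm.
  apply: ler_wpM2l; first by rewrite divr_ge0 ?exprn_ge0// mulr_ge0// K0_ge0.
  by rewrite ler_expR ler_pM2l// mulr_gt0.
have st : s <= t + 1 by move/ltr_normlP : s1 => [_ h]; lra.
have tt : t <= t + 1 by lra.
rewrite -wtB (_ : ulim s - ulim t = (ulim s - Pic m s) - (ulim t - Pic m t) + (Pic m s - Pic m t)); last first.
  by apply/funext => j; rewrite !fctE; ring.
rewrite wtD wtB [wt (Pic m s - Pic m t)]wtB.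
apply: bnd_le (bndD _ _ _ _ (bndB _ _ _ _ (close s s0 st) (close t t0 tt)) (hd s s0 sd)).
lra.
Qed.

Lemma Phi_ulim t : 0 <= t -> Phi ulim t = ulim t.
Proof.
move=> t0; apply/funext => j; apply/esym; apply: cvg_lim => //.
rewrite -cvg_shiftS /=.
have h m : `|Phi ulim t j - Pic m.+1 t j| <= Num.sqrt (kap2 * (4 * K0 / 16 ^+ m) / La ^+ 2 * expR (2 * La * t)) / om j.
  have m0 : 0 <= 4 * K0 / 16 ^+ m by rewrite divr_ge0 ?exprn_ge0// mulr_ge0// K0_ge0.
  exact: (bnd_wt_comp _ _ j (Phi_diff _ _ _ La good_ulim (good_Pic m) m0 La_gt0 (ulim_dist m) t t0)).
apply/subr_cvg0/norm_cvg0P.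
apply: (@squeeze_cvgr _ _ _ _ (cst 0) (fun m => Num.sqrt (kap2 * (4 * K0 / 16 ^+ m) / La ^+ 2 * expR (2 * La * t)) / om j)).
- by near=> m; rewrite normr_ge0/= distrC h.
- exact: cvg_cst.
- rewrite -[X in _ --> X](mul0r (om j)^-1); apply: cvgM; last exact: cvg_cst.
  rewrite -[X in _ --> X]sqrtr0; apply: (continuous_cvg _ (@sqrt_continuous _ _)).
  rewrite -[X in _ --> X](mul0r (expR (2 * La * t))); apply: cvgM; last exact: cvg_cst.
  rewrite -[X in _ --> X](mul0r (La ^+ 2)^-1); apply: cvgM; last exact: cvg_cst.
  rewrite -[X in _ --> X](mulr0 kap2); apply: cvgM; first exact: cvg_cst.
  exact: pow16_cvg0.
Unshelve. all: by end_near. Qed.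

(** On t >= 0 this is [ulim] itself, but in Duhamel's form it is differentiable by construction,
    also on both sides of t = 0. *)
Definition sol := Phi ulim.
Definition sol' := Phi' ulim.

End picard.

(** * Mean value and triangle inequalities in l^2 *)

Section mean_value.
Context {R : realType}.

Lemma MVT_le_on (f f' : R -> R) (x y C : R) :
  (forall z, Num.min x y <= z <= Num.max x y -> is_derive z (1 : R) f (f' z)) ->
  (forall z, Num.min x y <= z <= Num.max x y -> `|f' z| <= C) ->
  `|f y - f x| <= C * `|y - x|.
Proof.
wlog xy : x y / x <= y => [h hf hC|].
  have [xy|/ltW yx] := leP x y; first exact: h.
  by rewrite distrC (distrC y); apply: h => //; rewrite minC maxC.
rewrite (min_idPl xy) (max_idPr xy) => hf hC.
have cf : {within `[x, y], continuous f}.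
  apply: continuous_in_subspaceT => z; rewrite inE/= in_itv/= => /hf [dz _].
  by apply: differentiable_continuous; apply/derivable1_diffP.
have hd z : z \in `]x, y[ -> is_derive z (1 : R) f (f' z).
  by rewrite in_itv/= => /andP[h1 h2]; apply: hf; rewrite !ltW.
have [c cxy ->] := MVT_segment xy hd cf.
by rewrite normrM; apply: ler_wpM2r => //; apply: hC; move: cxy; rewrite in_itv.
Qed.

Lemma CS_bnd (a b : nat -> R) A B n : bnd a A -> bnd b B ->
  `|\sum_(j < n) a j * b j| <= Num.sqrt A * Num.sqrt B.
Proof.
move=> ha hb; have A0 := bnd_ge0 _ _ ha; have B0 := bnd_ge0 _ _ hb.
rewrite -(@ler_pXn2r _ 2)// ?nnegrE ?mulr_ge0 ?sqrtr_ge0//.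
rewrite real_normK ?num_real// exprMn !sqr_sqrtr//.
apply: le_trans (CS_sum _ _ _ _ _) _.
by apply: ler_pM; [exact: (sq_ge0 a n)|exact: (sq_ge0 b n)|exact: ha|exact: hb].
Qed.

Lemma bnd_MVT (p p' : R -> nat -> R) (s t B : R) : 0 <= B ->
  (forall j z, Num.min t s <= z <= Num.max t s -> is_derive z (1 : R) (p ^~ j) (p' z j)) ->
  (forall z, Num.min t s <= z <= Num.max t s -> bnd (p' z) (B ^+ 2)) ->
  bnd (p s - p t) ((B * `|s - t|) ^+ 2).
Proof.
move=> B0 hp hB n.
pose c j := p s j - p t j; pose X := \sum_(j < n) c j ^+ 2.
have X0 : 0 <= X by apply: sumr_ge0 => j _; exact: sqr_ge0.
(* Cut off after n coordinates, so that a [bnd] is available without knowing the tail. *)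
pose cn j := if (j < n)%N then c j else 0.
have cX : bnd cn X.
  move=> m; have [mn|nm] := leqP m n.
    apply: le_trans (_ : \sum_(j < m) c j ^+ 2 <= _); last first.
      by have := sq_nd c _ _ mn.
    by apply: ler_sum => j _; rewrite /cn (leq_trans (ltn_ord j) mn).
  rewrite /X (big_ord_widen _ (fun j => c j ^+ 2) (ltnW nm)) [leRHS]big_mkcond/=.
  by apply: ler_sum => j _; rewrite /cn; case: ifP => //; rewrite expr0n.
have hd z : Num.min t s <= z <= Num.max t s ->
    is_derive z (1 : R) (fun z => \sum_(j < n) c j * p z j) (\sum_(j < n) c j * p' z j).
  move=> hz; apply: (is_derive_osum z n (fun j z => c j * p z j) (fun j => c j * p' z j)) => j.
  by have := is_deriveZ (c j) (hp j z hz).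
have hb z : Num.min t s <= z <= Num.max t s -> `|\sum_(j < n) c j * p' z j| <= Num.sqrt X * B.
  move=> hz; have := CS_bnd cn (p' z) X (B ^+ 2) n cX (hB z hz).
  rewrite sqrtr_sqr (ger0_norm B0); congr (`|_| <= _).
  by apply: eq_bigr => j _; rewrite /cn ltn_ord.
have := MVT_le_on _ _ t s _ hd hb.
have -> : \sum_(j < n) c j * p s j - \sum_(j < n) c j * p t j = X.
  by rewrite -sumrB; apply: eq_bigr => j _; rewrite /c; ring.
rewrite (ger0_norm X0) -mulrA => h.
have {h} : Num.sqrt X <= B * `|s - t|.
  have [X00|Xp] := eqVneq X 0; first by rewrite X00 sqrtr0 mulr_ge0.
  have sX : 0 < Num.sqrt X by rewrite sqrtr_gt0 lt_neqAle eq_sym Xp.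
  by rewrite -(ler_pM2l sX) -{1}expr2 sqr_sqrtr.
move=> h; rewrite -[leLHS](_ : X = _)//; rewrite -(sqr_sqrtr X0).
by rewrite ler_pXn2r ?nnegrE ?sqrtr_ge0// mulr_ge0.
Qed.

(** Increments that are $o(|s - t|)$ give a zero derivative. Everything is stated relative to
    [0, T], since the energy is controlled only there. *)
Lemma flat_const (E : R -> R) (T : R) : 0 <= T ->
  (forall t e, 0 <= t <= T -> 0 < e -> exists2 d : R, 0 < d &
     forall s, 0 <= s <= T -> `|s - t| < d -> `|E s - E t| <= e * `|s - t|) ->
  E T = E 0.
Proof.
rewrite le_eqVlt => /orP[/eqP <- //|T0] h.
have cE : {within `[0, T], continuous E}.
  apply/subspace_continuousP => t; rewrite /= in_itv/= => tT; apply/cvgrPdist_le => e e0.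
  have [d d0 hd] := h t e tT e0; rewrite near_withinE; apply/nbhs_ballP.
  exists (Num.min d 1); first by rewrite /= lt_min d0/=.
  move=> s; rewrite /ball/= lt_min => /andP[sd s1]; rewrite in_itv/= => sT.
  rewrite distrC; apply: le_trans (hd s sT _) _; first by rewrite distrC.
  by rewrite ger_pMr// distrC ltW.
have dE t : t \in `]0, T[ -> is_derive t (1 : R) E (cst 0 t).
  rewrite in_itv/= => /andP[t0 tT]; apply: is_derive_eps => e e0.
  have tT' : 0 <= t <= T by rewrite !ltW.
  have [d d0 hd] := h t e tT' e0; near=> s.
  rewrite mul0r subr0; apply: hd.
    by apply/andP; split; apply: ltW; near: s; [exact: lt_nbhsr|exact: lt_nbhsl].
  by near: s; exact: near_dist.
have [c _ /eqP] := MVT T0 dE cE.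
by rewrite mul0r subr_eq0 => /eqP.
Unshelve. all: by end_near. Qed.

Lemma mink (a b : nat -> R) n : Num.sqrt (sq (a + b) n) <= Num.sqrt (sq a n) + Num.sqrt (sq b n).
Proof.
have a0 := sq_ge0 a n; have b0 := sq_ge0 b n.
rewrite -(@ler_pXn2r _ 2)// ?nnegrE ?addr_ge0 ?sqrtr_ge0// sqr_sqrtr ?sq_ge0//.
rewrite sqrrD !sqr_sqrtr//.
have -> : sq (a + b) n = sq a n + (\sum_(j < n) a j * b j) *+ 2 + sq b n.
  rewrite /sq -sumrMnl -!big_split/=; apply: eq_bigr => j _.
  by rewrite [(a + b) j]/GRing.add/= sqrrD.
rewrite lerD2r lerD2l ler_pMn2r//.
apply: le_trans (ler_norm _) _.
rewrite -(@ler_pXn2r _ 2)// ?nnegrE ?mulr_ge0 ?sqrtr_ge0// real_normK ?num_real//.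
by rewrite exprMn !sqr_sqrtr//; exact: CS_sum.
Qed.

(** Minkowski's inequality with constant 1, from which the norm itself is Lipschitz ([trunc_lip])
    and continuous in time ([coef_bounded]). *)
Lemma sqn_mink (a b : nat -> R) C d : bnd a C -> bnd (a - b) d ->
  Num.sqrt (sqn b) <= Num.sqrt (sqn a) + Num.sqrt d.
Proof.
move=> ha hd; have hb : bnd b (2 * C + 2 * d).
  have -> : b = a - (a - b) by rewrite opprB addrC subrK.
  exact: bndB.
have d0 := bnd_ge0 _ _ hd; have sa := sqn_ge0 _ _ ha.
rewrite -(@ler_pXn2r _ 2)// ?nnegrE ?addr_ge0 ?sqrtr_ge0// sqr_sqrtr; last exact: sqn_ge0 hb.
apply: (sqn_le b (_ ^+ 2)) => n.
have -> : \sum_(k < n) b k ^+ 2 = Num.sqrt (sq b n) ^+ 2 by rewrite sqr_sqrtr ?sq_ge0.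
rewrite ler_pXn2r ?nnegrE ?addr_ge0 ?sqrtr_ge0//.
have {1}-> : b = a + (b - a) by rewrite addrC subrK.
apply: le_trans (mink _ _ _) _; apply: lerD; apply: ler_wsqrtr; first exact: sq_le_sqn ha.
have -> : b - a = - (a - b) by rewrite opprB.
exact: bndN.
Qed.

End mean_value.

(** * Truncation, energy conservation and global solutions *)

Section conservation.
Context {R : realType}.
Variable om : nat -> R.
Hypothesis om_gt0 : forall j, 0 < om j.
Local Notation en := (en om).
Local Notation wt := (wt om).
Implicit Types (p q u v : nat -> R).

Lemma picard_sol (F : (nat -> R) -> nat -> R) (kap2 CF : R) (u0 u1 : nat -> R) (N0 : R) :
  0 <= kap2 ->
  (forall p q d, inV om p -> inV om q -> bnd (wt (p - q)) d -> bnd (F p - F q) (kap2 * d)) ->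
  (forall p, inV om p -> bnd (F p) CF) ->
  (forall n, en u0 u1 n <= N0) ->
  exists U U' : R -> nat -> R,
  [/\ U 0 = u0 /\ U' 0 = u1,
   forall j (t : R), -1 < t -> is_derive t (1 : R) (U ^~ j) (U' t j),
   forall j (t : R), -1 < t -> is_derive t (1 : R) (U' ^~ j) (F (U (pos t)) j - om j ^+ 2 * U t j),
   forall (T : R) n (t : R), 0 <= t <= T -> en (U t) (U' t) n <= (N0 + CF) * expR (2 * T) &
   forall t e : R, 0 <= t -> 0 < e -> exists2 d : R, 0 < d & forall s : R, 0 <= s -> `|s - t| < d ->
     forall n, en (U s - U t) (U' s - U' t) n <= e].
Proof.
move=> k0 FL FB u01.
have gu := good_ulim om om_gt0 F kap2 CF k0 FL FB u0 u1 N0 u01.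
exists (sol om F u0 u1), (sol' om F u0 u1); split.
- by rewrite /sol /sol' Phi0 Phi'0.
- by move=> j t t1; apply: (Phi_derive om om_gt0 F kap2).
- move=> j t t1; have := Phi'_derive om om_gt0 F kap2 k0 FL u0 u1 _ gu j t t1.
  by rewrite -{1}(Phi_ulim om om_gt0 F kap2 CF k0 FL FB u0 u1 N0 u01 _ (pos_ge0 t)).
- by move=> T n t tT; exact: (Phi_energyT om om_gt0 F kap2 CF).
- by move=> t e t0 e0; exact: (Phi_strong_cont om om_gt0 F kap2 CF k0 FL FB u0 u1 N0).
Qed.

Definition Nv u : R := Num.sqrt (sqn (wt u)).
Definition trunc (r : R) u : nat -> R := (Num.max 1 (Nv u / r))^-1 *: u.

Lemma Nv_le u C : 0 <= C -> bnd (wt u) (C ^+ 2) -> Nv u <= C.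
Proof.
move=> C0 h; rewrite -[leRHS](ger0_norm C0) -sqrtr_sqr; apply: ler_wsqrtr; exact: sqn_le.
Qed.

Lemma bnd_Nv u : inV om u -> bnd (wt u) (Nv u ^+ 2).
Proof. by move=> [C h]; rewrite sqr_sqrtr; [exact: bnd_sqn h|exact: sqn_ge0 h]. Qed.

Lemma trunc_id (r : R) u : 0 < r -> bnd (wt u) (r ^+ 2) -> trunc r u = u.
Proof.
move=> r0 /(Nv_le _ _ (ltW r0)) h; rewrite /trunc.
have -> : Num.max 1 (Nv u / r) = 1 by apply/max_idPl; rewrite ler_pdivrMr// mul1r.
by rewrite invr1 scale1r.
Qed.

Lemma bnd_trunc (r : R) u : 0 < r -> inV om u -> bnd (wt (trunc r u)) (r ^+ 2).
Proof.
move=> r0 /bnd_Nv h; rewrite /trunc wtZ; apply: bnd_le (bndZ _ _ _ h).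
set m := Num.max _ _; have m0 : 0 < m by rewrite lt_max ltr01.
rewrite -exprMn ler_pXn2r ?nnegrE ?(ltW r0)//; last by rewrite mulr_ge0 ?sqrtr_ge0// invr_ge0 ltW.
by rewrite mulrC ler_pdivrMr// mulrC -ler_pdivrMr// /m le_max lexx orbT.
Qed.

(** The difference splits as [al *: (u - v) + (al - be) *: v]. Each summand has squared energy norm
    at most d: for the second, the norm is 1-Lipschitz and the factor |v| / r is compensated by be.
    Then [bndD] gives 4 d. *)
Lemma trunc_lip (r : R) u v d : 0 < r -> inV om u -> inV om v -> bnd (wt (u - v)) d ->
  bnd (wt (trunc r u - trunc r v)) (4 * d).
Proof.
move=> r0 uV vV h.
pose a := Nv u; pose b := Nv v.
have d0 := bnd_ge0 _ _ h.
have hv := bnd_Nv _ vV.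
have ab : `|b - a| <= Num.sqrt d.
  case: (uV) => C1 h1; case: (vV) => C2 h2; apply/ler_normlP; split; rewrite /a /b /Nv.
    rewrite opprB lerBlDl; apply: (sqn_mink _ _ _ _ h2); rewrite -wtB.
    have -> : v - u = - (u - v) by rewrite opprB.
    by rewrite -scaleN1r wtZ scaleN1r; apply: bndN.
  by rewrite lerBlDl; apply: (sqn_mink _ _ _ _ h1); rewrite -wtB.
pose al := (Num.max 1 (a / r))^-1; pose be := (Num.max 1 (b / r))^-1.
have -> : trunc r u - trunc r v = al *: (u - v) + (al - be) *: v.
  by apply/funext => j; rewrite /trunc -/a -/b -/al -/be !fctE /GRing.scale/=; ring.
have ma : 1 <= Num.max 1 (a / r) by rewrite le_max lexx.
have mb : 1 <= Num.max 1 (b / r) by rewrite le_max lexx.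
have ma0 := lt_le_trans ltr01 ma; have mb0 := lt_le_trans ltr01 mb.
have a0 : 0 <= a by exact: sqrtr_ge0.
have b0 : 0 <= b by exact: sqrtr_ge0.
have -> : 4 * d = 2 * d + 2 * d by ring.
rewrite wtD !wtZ; apply: bndD.
  apply: bnd_le (bndZ _ _ _ h); rewrite ler_piMl// expr_le1// ?invr_ge0 ?(ltW ma0)//.
  by rewrite invf_le1.
apply: bnd_le (bndZ _ _ _ hv); rewrite -exprMn -/b -(sqr_sqrtr d0) -real_normK ?num_real//.
rewrite ler_pXn2r ?nnegrE ?sqrtr_ge0//.
have dm : `|Num.max 1 (b / r) - Num.max 1 (a / r)| <= `|b - a| / r.
  have -> : `|b - a| / r = `|b / r - a / r| by rewrite -mulrBl normrM (ger0_norm (x := r^-1))// invr_ge0 ltW.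
  move: (b / r) (a / r) => x y; have [x1|x1] := leP 1 x; have [y1|y1] := leP 1 y.
  - by [].
  - by rewrite !ger0_norm; lra.
  - by rewrite distrC (distrC x) !ger0_norm; lra.
  - by rewrite subrr normr0.
rewrite normrM (ger0_norm b0).
have -> : al - be = (Num.max 1 (b / r) - Num.max 1 (a / r)) / (Num.max 1 (a / r) * Num.max 1 (b / r)).
  rewrite /al /be; field; by rewrite !gt_eqF.
rewrite normrM [`|(_ * _)^-1|]ger0_norm; last by rewrite invr_ge0 mulr_ge0// ltW.
rewrite -mulrA mulrC -mulrA ler_pdivrMl; last by rewrite mulr_gt0.
apply: le_trans (ler_wpM2l b0 (le_trans dm (ler_wpM2r _ ab))) _; first by rewrite invr_ge0 ltW.
rewrite mulrCA mulrC; apply: ler_wpM2r; first exact: sqrtr_ge0.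
apply: le_trans (_ : Num.max 1 (b / r) <= _); first by rewrite le_max lexx orbT.
by rewrite ler_peMl// ltW.
Qed.

Variables (F : (nat -> R) -> nat -> R) (P : (nat -> R) -> R) (CF0 c0 c1 : R).
Hypothesis F_loc : forall r : R, exists2 C : R, 0 <= C & forall u v d,
  bnd (wt u) r -> bnd (wt v) r -> bnd (wt (u - v)) d -> bnd (F u - F v) (C * d).
Hypothesis F_0 : bnd (F 0) CF0.
(** This expresses that F is minus the gradient of P, with a remainder measured by one energy
    distance times one $l^2$ distance. The pairing is a series, whose convergence is encoded by e
    and n0; it is summed to an even index because coordinates will come in pairs (w, theta). *)
Hypothesis P_taylor : forall r : R, exists2 C : R, 0 <= C & forall u v dV d0,
  bnd (wt u) r -> bnd (wt v) r -> 0 <= dV -> 0 <= d0 ->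
  bnd (wt (u - v)) (dV ^+ 2) -> bnd (u - v) (d0 ^+ 2) ->
  forall e : R, 0 < e -> exists n0, forall n, (n0 <= n)%N ->
    `|P v - P u + \sum_(j < n.*2) F u j * (v j - u j)| <= C * dV * d0 + e.
Hypothesis c0_ge0 : 0 <= c0.
Hypothesis c1_ge0 : 0 <= c1.
Hypothesis P_coer : forall u (r : R), 0 <= r -> bnd (wt u) (r ^+ 2) -> - c0 - c1 * r <= P u.

Section energy_conservation.
Variables (U U' : R -> nat -> R) (T r B K : R).
Hypothesis dU : forall j (t : R), 0 <= t <= T -> is_derive t (1 : R) (U ^~ j) (U' t j).
Hypothesis dU' : forall j (t : R), 0 <= t <= T ->
  is_derive t (1 : R) (U' ^~ j) (F (U t) j - om j ^+ 2 * U t j).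
Hypothesis UB : forall n (t : R), 0 <= t <= T -> en (U t) (U' t) n <= B.
Hypothesis Ucont : forall t e : R, 0 <= t <= T -> 0 < e -> exists2 d : R, 0 < d &
  forall s : R, 0 <= s <= T -> `|s - t| < d -> forall n, en (U s - U t) (U' s - U' t) n <= e.

Let EN t := limn (en (U t) (U' t)).

Lemma EN_cvg t : 0 <= t <= T -> en (U t) (U' t) n @[n --> \oo] --> EN t.
Proof.
move=> tT; apply: nondecreasing_is_cvgn; first exact: en_nd.
by exists B => _ [n _ <-]; exact: UB.
Qed.

(** Between t and s the kinetic and elastic part changes by the work of F along the path, and P by
    minus the work of F frozen at time t. Strong continuity makes the energy distance at most eta,
    hence F changes little, while the $l^2$ displacement is at most b |s - t|. The total error is a
    small multiple of |s - t|, and [flat_const] applies. *)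
Lemma energy_const : 0 <= T -> 2^-1 * EN T + P (U T) = 2^-1 * EN 0 + P (U 0).
Proof.
move=> T0; apply: (flat_const (fun t => 2^-1 * EN t + P (U t)) T T0) => t e tT e0.
have B0 : 0 <= B by have := UB 0 t tT; rewrite /en big_ord0.
have [C C0 FC] := F_loc B; have [C' C'0 PC] := P_taylor B.
pose b := Num.sqrt B; have b0 : 0 <= b by exact: sqrtr_ge0.
pose X := Num.sqrt C * b + C' * b; have X0 : 0 <= X by rewrite addr_ge0// mulr_ge0// sqrtr_ge0.
pose eta := e / (X + 1); have eta0 : 0 < eta by rewrite divr_gt0// ltr_wpDl.
have [d d0 hd] := Ucont t (eta ^+ 2) tT (exprn_gt0 _ eta0).
exists d => // s sT sd.
have seg z : Num.min t s <= z <= Num.max t s -> 0 <= z <= T /\ `|z - t| < d.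
  case/andP: (tT) => t1 t2; case/andP: (sT) => s1 s2; move/ltr_normlP : sd => [d1 d2].
  have [ts|st] := leP t s => /andP[z1 z2]; split; first (by apply/andP; split; lra);
    last (by apply/ltr_normlP; split; lra); first (by apply/ltr_normlP; split; lra).
  by apply/andP; split; lra.
have VB z : 0 <= z <= T -> bnd (wt (U z)) B by move=> zT; apply: (bnd_wt_en om _ (U' z)) => n; exact: UB.
have near_t z : Num.min t s <= z <= Num.max t s -> bnd (wt (U t - U z)) (eta ^+ 2).
  move=> /seg[zT zd]; have -> : U t - U z = - (U z - U t) by rewrite opprB.
  rewrite -scaleN1r wtZ scaleN1r; apply: bndN.
  by apply: (bnd_wt_en om _ (U' z - U' t)) => n; exact: hd.
have smax : Num.min t s <= s <= Num.max t s by rewrite ge_min le_max !lexx !orbT.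
have disp : bnd (U t - U s) ((b * `|s - t|) ^+ 2).
  have -> : U t - U s = - (U s - U t) by rewrite opprB.
  apply: bndN; apply: (bnd_MVT U U') => //.
    by move=> j z /seg[zT _]; exact: dU.
  move=> z /seg[zT _]; rewrite sqr_sqrtr//.
  by apply: (bnd_vel_en om (U z)) => n; exact: UB.
have work n : `|2^-1 * en (U s) (U' s) n - 2^-1 * en (U t) (U' t) n
     - \sum_(j < n) F (U t) j * (U s j - U t j)| <= Num.sqrt C * eta * b * `|s - t|.
  pose psi z := 2^-1 * en (U z) (U' z) n - \sum_(j < n) F (U t) j * U z j.
  have -> : 2^-1 * en (U s) (U' s) n - 2^-1 * en (U t) (U' t) n
     - \sum_(j < n) F (U t) j * (U s j - U t j) = psi s - psi t.
    rewrite /psi; under eq_bigr do rewrite mulrBr.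
    by rewrite sumrB; ring.
  apply: (MVT_le_on _ (fun z => \sum_(j < n) (F (U z) - F (U t)) j * U' z j)).
    move=> z /seg[zT _].
    have h1 := en_derive_at om U U' (F (U z)) n z (fun j => dU j z zT) (fun j => dU' j z zT).
    have h2 : is_derive z (1 : R) (fun z => \sum_(j < n) F (U t) j * U z j) (\sum_(j < n) F (U t) j * U' z j).
      apply: (is_derive_osum z n (fun j z => F (U t) j * U z j) (fun j => F (U t) j * U' z j)) => j.
      exact: (is_deriveZ (F (U t) j) (dU j z zT)).
    apply: (is_derive_eq (is_deriveB (is_deriveZ 2^-1 h1) h2)).
    rewrite /GRing.scale/= mulr_sumr -sumrB; apply: eq_bigr => j _.
    by rewrite !fctE; field.
  move=> z hz; have [zT zd] := seg z hz.
  have hF : bnd (F (U z) - F (U t)) (C * eta ^+ 2).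
    apply: FC; [exact: VB|exact: VB|].
    have -> : U z - U t = - (U t - U z) by rewrite opprB.
    by rewrite -scaleN1r wtZ scaleN1r; apply: bndN; exact: near_t.
  have hU : bnd (U' z) B by apply: (bnd_vel_en om (U z)) => m; exact: UB.
  have := CS_bnd _ _ _ _ n hF hU.
  by rewrite sqrtrM// sqrtr_sqr (ger0_norm (ltW eta0)).
have dbl : n.*2 @[n --> \oo] --> \oo.
  by apply/cvgnyPge => N; exists N => // n /= /leq_trans; apply; rewrite -addnn leq_addr.
have lim1 : 2^-1 * en (U s) (U' s) n.*2 - 2^-1 * en (U t) (U' t) n.*2 @[n --> \oo] --> 2^-1 * EN s - 2^-1 * EN t.
  apply: (cvg_comp _ _ dbl (_ : (fun n => 2^-1 * en (U s) (U' s) n - 2^-1 * en (U t) (U' t) n) @ \oo --> _)).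
  by apply: cvgB; apply: cvgM; [exact: cvg_cst|exact: EN_cvg|exact: cvg_cst|exact: EN_cvg].
have lim2 : 2^-1 * en (U s) (U' s) n.*2 - 2^-1 * en (U t) (U' t) n.*2 + (P (U s) - P (U t)) @[n --> \oo] -->
    2^-1 * EN s - 2^-1 * EN t + (P (U s) - P (U t)) by apply: cvgD => //; exact: cvg_cst.
have -> : 2^-1 * EN s + P (U s) - (2^-1 * EN t + P (U t)) = 2^-1 * EN s - 2^-1 * EN t + (P (U s) - P (U t)) by ring.
have lim3 : `|2^-1 * en (U s) (U' s) n.*2 - 2^-1 * en (U t) (U' t) n.*2 + (P (U s) - P (U t))| @[n --> \oo] -->
    `|2^-1 * EN s - 2^-1 * EN t + (P (U s) - P (U t))| by exact: cvg_norm.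
apply/ler_addgt0Pr => e' e'0.
have [n0 hn0] := PC (U t) (U s) eta (b * `|s - t|) (VB t tT) (VB s sT) (ltW eta0)
  (mulr_ge0 b0 (normr_ge0 _)) (near_t s smax) disp e' e'0.
rewrite -(cvg_lim _ lim3)//; apply: limr_le; first exact: cvgP lim3.
exists n0 => // n /= n0n.
have := hn0 n n0n; have := work n.*2.
move: (2^-1 * en (U s) _ n.*2) (2^-1 * en (U t) _ n.*2) (P (U s)) (P (U t)) (\sum_(j < n.*2) _) => x y p q z h1 h2.
have -> : x - y + (p - q) = (x - y - z) + (p - q + z) by ring.
apply: le_trans (ler_normD _ _) _; apply: le_trans (lerD h1 h2) _.
rewrite addrA lerD2r.
have -> : Num.sqrt C * eta * b * `|s - t| + C' * eta * (b * `|s - t|) = X * eta * `|s - t| by rewrite /X; ring.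
apply: ler_wpM2r => //; rewrite /eta mulrCA ger_pMr// ler_pdivrMr ?ltr_wpDl//; lra.
Qed.

End energy_conservation.

Lemma lim_en_le p q C : (forall n, en p q n <= C) -> forall n, en p q n <= limn (en p q).
Proof.
move=> h n; apply: nondecreasing_cvgn_le; first exact: en_nd.
by apply: nondecreasing_is_cvgn; [exact: en_nd|exists C => _ [m _ <-]; exact: h].
Qed.

(** With x the square root of the limit of [en], one has $x^2/2 - c_1 x - c_0 \le E_0$ and $c_1 x
    \le x^2/4 + c_1^2$. *)
Lemma energy_coercive p q C E0 : 0 <= E0 -> (forall n, en p q n <= C) ->
  2^-1 * limn (en p q) + P p <= E0 ->
  forall n, en p q n <= 4 * (E0 + c0) + 4 * c1 ^+ 2.
Proof.
move=> E00 h; have hl := lim_en_le _ _ _ h; move: (limn _) hl => N hN hE n.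
have N0 : 0 <= N by have := hN 0%N; rewrite /en big_ord0.
apply: le_trans (hN n) _.
have := P_coer p (Num.sqrt N) (sqrtr_ge0 _); rewrite sqr_sqrtr// => /(_ (bnd_wt_en om p q N hN)).
move: (sqrtr_ge0 N) (sqr_sqrtr N0); move: (Num.sqrt N) => x x0 xN.
move: hE c0_ge0 c1_ge0; rewrite -xN; have := sqr_ge0 (x - 2 * c1); nra.
Qed.

(** Bootstrap for the equation truncated at radius r: while [en] stays below $B + 1 = r^2$ the
    truncation is inactive, the total energy is conserved, and coercivity improves the bound to B.
    On [0, T] the partial energies are Lipschitz in time, so they gain at most 1 over a fixed step
    and the argument repeats. *)
Lemma global_sol u0 u1 N0 : (forall n, en u0 u1 n <= N0) ->
  exists (U U' : R -> nat -> R) (B : R),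
  [/\ U 0 = u0 /\ U' 0 = u1,
   forall j (t : R), -1 < t -> is_derive t (1 : R) (U ^~ j) (U' t j),
   forall j (t : R), -1 < t -> is_derive t (1 : R) (U' ^~ j) (F (U (pos t)) j - om j ^+ 2 * U t j),
   forall n (t : R), 0 <= t -> en (U t) (U' t) n <= B &
   forall t e : R, 0 <= t -> 0 < e -> exists2 d : R, 0 < d & forall s : R, 0 <= s -> `|s - t| < d ->
     forall n, en (U s - U t) (U' s - U' t) n <= e].
Proof.
move=> u01; pose E0 := `|2^-1 * limn (en u0 u1) + P u0|.
pose B := 4 * (E0 + c0) + 4 * c1 ^+ 2; pose r := Num.sqrt (B + 1).
have E0_ge0 : 0 <= E0 by exact: normr_ge0.
have B0 : 0 <= B by apply: addr_ge0; apply: mulr_ge0 => //; [exact: addr_ge0|exact: sqr_ge0].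
have r0 : 0 < r by rewrite sqrtr_gt0 ltr_wpDl.
have r2 : r ^+ 2 = B + 1 by rewrite sqr_sqrtr// addr_ge0.
have [C C0 FC] := F_loc (r ^+ 2).
have FL p q d : inV om p -> inV om q -> bnd (wt (p - q)) d ->
    bnd (F (trunc r p) - F (trunc r q)) (4 * C * d).
  move=> pV qV h; rewrite mulrAC mulrC; apply: FC; [exact: bnd_trunc|exact: bnd_trunc|].
  exact: trunc_lip.
have FB p : inV om p -> bnd (F (trunc r p)) (2 * (C * r ^+ 2) + 2 * CF0).
  move=> pV; rewrite -[F _](subrK (F 0)); apply: bndD => //.
  have b0 : bnd (wt 0) (r ^+ 2).
    by move=> n; rewrite big1 ?sqr_ge0// => j _; rewrite /wt mulr0 expr0n.
  by apply: FC => //; [exact: bnd_trunc|rewrite subr0; exact: bnd_trunc].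
have k0 : 0 <= 4 * C by rewrite mulr_ge0.
have [U [U' [[U0 U'0] dU dU' UT Uc]]] := picard_sol (F \o trunc r) (4 * C) _ u0 u1 N0 k0 FL FB u01.
pose CF := 2 * (C * r ^+ 2) + 2 * CF0.
have stay T : 0 <= T -> forall n (t : R), 0 <= t <= T -> en (U t) (U' t) n <= B.
  move=> T0; pose BT := (N0 + CF) * expR (2 * T).
  have cU j : {within `[0, T], continuous U ^~ j} by apply: derive_within => t t1; exact: dU.
  have cU' j : {within `[0, T], continuous U' ^~ j} by apply: derive_within => t t1; exact: dU'.
  have lip n (s t : R) : 0 <= s -> s <= t -> t <= T ->
      `|en (U t) (U' t) n - en (U s) (U' s) n| <= (BT + CF) * (t - s).
    apply: (en_lip om T U U' (fun t => F (trunc r (U (pos t)))) cU cU') => //.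
    - by move=> j x xT; apply: dU; exact: m1_lt xT.
    - by move=> j x xT; apply: dU'; exact: m1_lt xT.
    - by move=> m x xT; exact: UT.
    - move=> x /andP[x0 xT]; apply: FB; rewrite (pos_id _ (ltW x0)); exists BT.
      by apply: (bnd_wt_en om _ (U' x)) => m; apply: UT; rewrite !ltW.
  have conserved t : 0 <= t -> t <= T -> (forall n (s : R), 0 <= s <= t -> en (U s) (U' s) n <= B + 1) ->
      forall n, en (U t) (U' t) n <= B.
    move=> t0 tT inball.
    have ge0 (s : R) : 0 <= s -> -1 < s by move=> s0; lra.
    have := energy_const U U' t (B + 1) _ _ inball _ t0.
    have hid (s : R) : 0 <= s <= t -> trunc r (U s) = U s.
      move=> st; apply: trunc_id => //; rewrite r2.
      by apply: (bnd_wt_en om _ (U' s)) => n; exact: inball.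
    move=> /(_ (fun j s => fun h => dU j s (ge0 s (proj1 (andP h))))) h.
    apply: (energy_coercive (U t) (U' t) (B + 1) E0) => //.
      by move=> n; apply: inball; rewrite t0 lexx.
    rewrite (h _ _) ?U0 ?U'0; first exact: ler_norm.
      move=> j s st; have [s0 _] := andP st; have := dU' j s (ge0 s s0).
      by rewrite (pos_id s s0)/= hid.
    move=> s e st e0; have [s0 _] := andP st; have [d d0 hd] := Uc s e s0 e0.
    by exists d => // x /andP[x0 _]; exact: hd.
  (* Steps of length 1 / K, over which [en] grows by at most 1. *)
  pose K := `|BT + CF| + 1; have K0 : 0 < K by rewrite ltr_wpDl.
  have step k : forall (t : R), 0 <= t <= T -> t <= k%:R / K -> forall n, en (U t) (U' t) n <= B.
    elim: k => [|k ih] t /andP[t0 tT] tk.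
      have {}t0 : t = 0 by apply/eqP; rewrite eq_le t0 andbT; rewrite mul0r in tk.
      apply: conserved => //; rewrite ?t0// => n s /andP[s0 s0'].
      have {s0 s0'}-> : s = 0 by apply/eqP; rewrite eq_le s0 s0'.
      have E00 : 2^-1 * limn (en u0 u1) + P u0 <= E0 by exact: ler_norm.
      rewrite U0 U'0; apply: le_trans (energy_coercive _ _ _ _ (normr_ge0 _) u01 E00 n) _.
      by rewrite lerDl.
    apply: conserved => // n s /andP[s0 st].
    have [sk|ks] := leP s (k%:R / K).
      by apply: le_trans (ih s _ sk n) _; [rewrite s0 (le_trans st tT)|rewrite lerDl].
    have kK : 0 <= k%:R / K by rewrite divr_ge0// ltW.
    have kT : 0 <= k%:R / K <= T by rewrite kK/=; apply: le_trans (ltW ks) (le_trans st tT).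
    have := ih _ kT (lexx _) n.
    have := lip n (k%:R / K) s kK (ltW ks) (le_trans st tT).
    move=> /(le_trans (ler_norm _)) h1 h2.
    rewrite -[leLHS](subrK (en (U (k%:R / K)) (U' (k%:R / K)) n)) addrC; apply: lerD => //.
    apply: le_trans h1 _; apply: le_trans (_ : K * K^-1 <= _); last by rewrite divff ?gt_eqF.
    apply: le_trans (ler_wpM2r _ (ler_norm _)) _; first by rewrite subr_ge0 ltW.
    apply: ler_pM; rewrite ?subr_ge0 ?(ltW ks)//.
      by rewrite lerDl.
    rewrite lerBlDl; apply: le_trans st (le_trans tk _).
      by rewrite -natr1 mulrDl mul1r.
  move=> n t tT; have [k hk] : exists k : nat, t * K <= k%:R.
    exists (Num.truncn (t * K)).+1; apply: ltW; exact: truncnS_gt.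
  by apply: (step k) => //; rewrite ler_pdivlMr.
exists U, U', B; split => //.
- move=> j t t1; have := dU' j t t1; rewrite /= trunc_id// r2.
  apply: bnd_le (_ : B <= _) _; first by rewrite lerDl.
  by apply: (bnd_wt_en om _ (U' (pos t))) => n; apply: (stay (pos t) (pos_ge0 t)); rewrite pos_ge0 lexx.
- by move=> n t t0; apply: (stay t t0); rewrite t0 lexx.
Qed.

End conservation.

(** * The arc-length density *)

Section arc_length.
Context {R : realType}.
Implicit Types v : R.

(** Arc-length density; [ss] is its derivative, the function behind [chi], and [qq ^+ 3] its second
    derivative. *)
Definition gg v : R := Num.sqrt (1 + v ^+ 2).
Definition qq v : R := (gg v)^-1.
Definition ss v : R := v * qq v.

Lemma gg_sqr v : gg v ^+ 2 = 1 + v ^+ 2.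
Proof. by rewrite sqr_sqrtr// addr_ge0 ?sqr_ge0. Qed.

Lemma gg_ge1 v : 1 <= gg v.
Proof. by rewrite -[leLHS]sqrtr1 ler_wsqrtr// lerDl sqr_ge0. Qed.

Lemma gg_gt0 v : 0 < gg v. Proof. exact: lt_le_trans ltr01 (gg_ge1 v). Qed.

(** The remainder equals $(gg(v) gg(v') - 1 - v v') / gg(v)$. The numerator is nonnegative by
    Cauchy-Schwarz for (1, v) and (1, v'), and at most $(v' - v)^2$ by the arithmetic-geometric mean
    inequality. *)
Lemma gg_taylor v v' : `|gg v' - gg v - ss v * (v' - v)| <= (v' - v) ^+ 2.
Proof.
have g0 := gg_gt0 v; have g1 := gg_ge1 v; have g0' := gg_gt0 v'.
have s1 := gg_sqr v; have s2 := gg_sqr v'.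
have -> : gg v' - gg v - ss v * (v' - v) = (gg v * gg v' - 1 - v * v') / gg v.
  have gn : gg v != 0 by rewrite gt_eqF.
  apply: (mulIf gn); rewrite divfK//.
  rewrite /ss /qq !mulrBl; have -> : v * (gg v)^-1 * (v' - v) * gg v = v * (v' - v) by field; rewrite gt_eqF.
  by rewrite -expr2 s1; ring.
have up : gg v * gg v' - 1 - v * v' <= (v' - v) ^+ 2.
  by have := sqr_ge0 (gg v - gg v'); have := sqr_ge0 (v - v'); nra.
have lo : 0 <= gg v * gg v' - 1 - v * v'.
  rewrite -addrA -opprD subr_ge0; have [n0|p0] := leP (1 + v * v') 0.
    by apply: le_trans n0 _; rewrite mulr_ge0// ltW.
  rewrite -(@ler_pXn2r _ 2)// ?nnegrE ?mulr_ge0 ?(ltW p0) ?(ltW g0) ?(ltW g0')//.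
  by rewrite exprMn s1 s2; have := sqr_ge0 (v - v'); nra.
rewrite ger0_norm; last by rewrite divr_ge0// ltW.
by rewrite ler_pdivrMr//; apply: le_trans up _; rewrite ler_peMr ?sqr_ge0.
Qed.

Lemma der_gg : der gg ss.
Proof.
move=> v; apply: is_derive_eps => e e0; near=> w.
apply: le_trans (gg_taylor _ _) _; rewrite -real_normK ?num_real// expr2.
apply: ler_wpM2r => //; apply: ltW; near: w; exact: near_dist.
Unshelve. all: by end_near. Qed.

Lemma qq_bnd v : 0 < qq v <= 1.
Proof. by rewrite invr_gt0 gg_gt0/= invf_le1 ?gg_gt0// gg_ge1. Qed.

Lemma ss_le1 v : `|ss v| <= 1.
Proof.
rewrite normrM (ger0_norm (x := qq v)); last by have /andP[/ltW] := qq_bnd v.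
rewrite ler_pdivrMr ?gg_gt0// mul1r -sqrtr_sqr ler_wsqrtr//.
by rewrite -real_normK ?num_real// real_normK ?num_real// lerDr.
Qed.

Lemma der_qq : der qq (fun v => - (ss v * qq v ^+ 2)).
Proof.
move=> v; have hg := der_gg v; have g0 : gg v != 0 by rewrite gt_eqF ?gg_gt0.
have := is_deriveV g0; rewrite /GRing.scale/= => h.
by apply: (is_derive_eq (h _ _ hg)); rewrite /qq exprVn mulNr mulrC.
Qed.

Lemma der_ss : der ss (fun v => qq v ^+ 3).
Proof.
move=> v; have h := der_qq v; apply: (is_derive_eq (is_deriveM (is_derive_id v 1) h)).
have s1 := gg_sqr v; have g0 := gg_gt0 v.
rewrite /GRing.scale/= /ss /qq.
have -> : v * - (v * (gg v)^-1 * (gg v)^-1 ^+ 2) + (gg v)^-1 * 1 = (gg v ^+ 2 - v ^+ 2) * (gg v)^-1 ^+ 3.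
  by field; rewrite gt_eqF.
by rewrite s1 addrK mul1r.
Qed.

Definition lip1 (p : R -> R) := forall x y, `|p x - p y| <= `|x - y|.

Lemma der_lip1 p p' : der p p' -> (forall x, `|p' x| <= 1) -> lip1 p.
Proof.
by move=> hp h x y; rewrite -[leRHS]mul1r; apply: MVT_le hp _ => z _; exact: h.
Qed.

Lemma lip1_cont p : lip1 p -> continuous p.
Proof.
move=> h x; apply/cvgrPdist_le => e e0; near=> y.
by apply: le_trans (h _ _) _; rewrite distrC ltW//; near: y; exact: near_dist.
Unshelve. all: by end_near. Qed.

Lemma lip1_gg : lip1 gg. Proof. exact: der_lip1 der_gg ss_le1. Qed.

Lemma lip1_ss : lip1 ss.
Proof.
apply: der_lip1 der_ss _ => v; have /andP[/ltW q0 q1] := qq_bnd v.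
by rewrite ger0_norm ?exprn_ge0// exprn_ile1.
Qed.

Lemma lip1_qq : lip1 qq.
Proof.
apply: der_lip1 der_qq _ => v; have /andP[/ltW q0 q1] := qq_bnd v.
rewrite normrN normrM; have -> : 1 = 1 * 1 :> R by rewrite mulr1.
by apply: ler_pM => //; [exact: ss_le1|rewrite ger0_norm ?exprn_ge0// exprn_ile1].
Qed.

Lemma lip1_sin : lip1 (@sin R).
Proof. by apply: der_lip1 (fun x => is_derive_sin x) _ => x; rewrite ler_norml cos_geN1 cos_le1. Qed.

Lemma lip1_cos : lip1 (@cos R).
Proof.
apply: der_lip1 (fun x => is_derive_cos x) _ => x.
by rewrite normrN ler_norml sin_geN1 sin_le1.
Qed.

End arc_length.

(** * Locally Lipschitz maps from states to functions *)

Section lipschitz_classes.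
Context {R : realType} {L : R}.
Hypothesis L_gt0 : 0 < L.
Local Notation mu := (@lebesgue_measure R).
Local Notation D := (`]0, L[%classic : set R).
Local Notation nrm := (norm2 L).
Implicit Types (p q u v : R -> R).

(* Deflection w and rotation th with their first and second derivatives. *)
Record state := State {w_ : R -> R; w1 : R -> R; w2 : R -> R; th : R -> R; th1 : R -> R; th2 : R -> R}.
Implicit Types z : state.

Definition sball (r : R) z :=
  [/\ [/\ continuous (w_ z), continuous (w1 z) & continuous (w2 z)],
      [/\ continuous (th z), continuous (th1 z) & continuous (th2 z)],
      forall x, D x -> [/\ `|w_ z x| <= r, `|w1 z x| <= r, `|th z x| <= r & `|th1 z x| <= r] &
      nrm (w2 z) <= r /\ nrm (th2 z) <= r].

Definition near0 (d : R) z z' :=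
  forall x, D x -> [/\ `|w_ z x - w_ z' x| <= d, `|w1 z x - w1 z' x| <= d,
    `|th z x - th z' x| <= d & `|th1 z x - th1 z' x| <= d].

Definition near2 (d : R) z z' :=
  near0 d z z' /\ (nrm (w2 z - w2 z') <= d /\ nrm (th2 z - th2 z') <= d).

(* Bounded and Lipschitz on balls, for the sup norm and for the L^2 norm of the values. *)
Definition LB (f : state -> R -> R) := forall r : R, exists2 C : R, 0 <= C &
  (forall z, sball r z -> continuous (f z) /\ forall x, D x -> `|f z x| <= C) /\
  (forall z z' d, sball r z -> sball r z' -> 0 <= d -> near0 d z z' ->
     forall x, D x -> `|f z x - f z' x| <= C * d).

Definition LQ (f : state -> R -> R) := forall r : R, exists2 C : R, 0 <= C &
  (forall z, sball r z -> continuous (f z) /\ nrm (f z) <= C) /\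
  (forall z z' d, sball r z -> sball r z' -> 0 <= d -> near2 d z z' -> nrm (f z - f z') <= C * d).

Lemma cont_cst (c : R) : continuous (cst c : R -> R).
Proof. by move=> x; exact: cst_continuous. Qed.

Lemma LB_fun p : continuous p -> LB (fun=> p).
Proof.
move=> cp r; have [C C0 h] := cont_bounded L_gt0 p cp; exists C => //; split.
  move=> z _; split => // x; rewrite /= in_itv/= => /andP[x0 xL]; apply: h.
  by rewrite !ltW.
by move=> z z' d _ _ d0 _ x _; rewrite subrr normr0 mulr_ge0.
Qed.

Lemma LB_D f g : LB f -> LB g -> LB (fun z => f z + g z).
Proof.
move=> hf hg r; have [C C0 [f1 f2]] := hf r; have [C' C'0 [g1 g2]] := hg r.
exists (C + C'); first exact: addr_ge0.
split=> [z zr|z z' d zr zr' d0 zz x Dx].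
  have [cf bf] := f1 z zr; have [cg bg] := g1 z zr; split; first exact: contD.
  by move=> x Dx; apply: le_trans (ler_normD _ _) _; exact: lerD (bf x Dx) (bg x Dx).
rewrite !fctE mulrDl; have -> : f z x + g z x - (f z' x + g z' x) = (f z x - f z' x) + (g z x - g z' x) by ring.
by apply: le_trans (ler_normD _ _) _; exact: lerD (f2 _ _ _ zr zr' d0 zz x Dx) (g2 _ _ _ zr zr' d0 zz x Dx).
Qed.

Lemma LB_M f g : LB f -> LB g -> LB (fun z => f z * g z).
Proof.
move=> hf hg r; have [C C0 [f1 f2]] := hf r; have [C' C'0 [g1 g2]] := hg r.
exists (2 * C * C'); first by rewrite !mulr_ge0.
have CC : 0 <= C * C' by exact: mulr_ge0.
split=> [z zr|z z' d zr zr' d0 zz x Dx].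
  have [cf bf] := f1 z zr; have [cg bg] := g1 z zr; split; first exact: contM.
  move=> x Dx; rewrite normrM; apply: le_trans (ler_pM _ _ (bf x Dx) (bg x Dx)) _ => //.
  by rewrite -mulrA; lra.
rewrite !fctE; have -> : f z x * g z x - f z' x * g z' x = (f z x - f z' x) * g z x + f z' x * (g z x - g z' x) by ring.
have -> : 2 * C * C' * d = C * d * C' + C * (C' * d) by ring.
apply: le_trans (ler_normD _ _) _; rewrite !normrM; apply: lerD; apply: ler_pM => //.
- exact: f2 zr zr' d0 zz x Dx.
- by have [_ ->] := g1 z zr.
- by have [_ ->] := f1 z' zr'.
- exact: g2 zr zr' d0 zz x Dx.
Qed.

Lemma LB_Z (c : R) f : LB f -> LB (fun z => c *: f z).
Proof. move=> h; have := LB_M _ _ (LB_fun _ (cont_cst c)) h; congr LB. Qed.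

Lemma LB_N f : LB f -> LB (fun z => - f z).
Proof.
move/(LB_Z (-1)); congr LB; apply/funext => z; exact: scaleN1r.
Qed.

Lemma LB_B f g : LB f -> LB g -> LB (fun z => f z - g z).
Proof. by move=> hf hg; apply: LB_D => //; exact: LB_N. Qed.

Lemma LB_comp p f : lip1 p -> LB f -> LB (fun z => p \o f z).
Proof.
move=> hp hf r; have [C C0 [f1 f2]] := hf r.
exists (`|p 0| + C); first exact: addr_ge0.
split=> [z zr|z z' d zr zr' d0 zz x Dx].
  have [cf bf] := f1 z zr; split.
    by move=> x; apply: continuous_comp; [exact: cf|exact: lip1_cont].
  move=> x Dx; rewrite /= -[p _](subrK (p 0)) addrC; apply: le_trans (ler_normD _ _) _.
  by apply: lerD => //; apply: le_trans (hp _ _) _; rewrite subr0 bf.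
apply: le_trans (hp _ _) _; apply: le_trans (f2 _ _ _ zr zr' d0 zz x Dx) _.
by apply: ler_wpM2r => //; rewrite lerDr.
Qed.

(** Viewing a scalar as a constant function of x lets nonlocal terms such as the elongation enter
    the same calculus. *)
Lemma LB_int f : LB f -> LB (fun z => cst (\int[mu]_(x in D) f z x)).
Proof.
move=> hf r; have [C C0 [f1 f2]] := hf r.
exists (C * L); first by rewrite mulr_ge0// ltW.
split=> [z zr|z z' d zr zr' d0 zz x Dx].
  have [cf bf] := f1 z zr; split; first exact: cont_cst.
  by move=> x Dx; apply: Rint_cont_norm_le => //; exact: cont_intD.
have [cf _] := f1 z zr; have [cf' _] := f1 z' zr'.
rewrite /= -RintegralB//; first last.
- exact: (cont_intD L_gt0).
- exact: (cont_intD L_gt0).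
rewrite mulrAC; apply: Rint_cont_norm_le => //; last exact: f2 zr zr' d0 zz.
  by apply: cont_intD => //; exact: contB.
exact: mulr_ge0.
Qed.

Lemma LB_LQ f : LB f -> LQ f.
Proof.
move=> hf r; have [C C0 [f1 f2]] := hf r.
exists (C * Num.sqrt L); first by rewrite mulr_ge0// sqrtr_ge0.
split=> [z zr|z z' d zr zr' d0 [zz _]].
  by have [cf bf] := f1 z zr; split => //; apply: norm2_le_sup => //; exact: cont_L2.
have [cf _] := f1 z zr; have [cf' _] := f1 z' zr'.
rewrite mulrAC; apply: norm2_le_sup => //; first exact: mulr_ge0.
  by apply: cont_L2 => //; exact: contB.
exact: f2 zr zr' d0 zz.
Qed.

Lemma LQ_D f g : LQ f -> LQ g -> LQ (fun z => f z + g z).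
Proof.
move=> hf hg r; have [C C0 [f1 f2]] := hf r; have [C' C'0 [g1 g2]] := hg r.
exists (C + C'); first exact: addr_ge0.
split=> [z zr|z z' d zr zr' d0 zz].
  have [cf bf] := f1 z zr; have [cg bg] := g1 z zr; split; first exact: contD.
  apply: le_trans (norm2_tri _ _ _ _) _; [exact: cont_L2|exact: cont_L2|exact: lerD].
have [/(cont_L2 L_gt0) cf _] := f1 z zr; have [/(cont_L2 L_gt0) cf' _] := f1 z' zr'.
have [/(cont_L2 L_gt0) cg _] := g1 z zr; have [/(cont_L2 L_gt0) cg' _] := g1 z' zr'.
rewrite mulrDl; have -> : f z + g z - (f z' + g z') = (f z - f z') + (g z - g z') by rewrite opprD addrACA.
by apply: le_trans (norm2_tri _ _ _ _) _ => //; exact: lerD (f2 _ _ _ zr zr' d0 zz) (g2 _ _ _ zr zr' d0 zz).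
Qed.

Lemma norm2_mul_sup p u (C : R) : 0 <= C -> continuous p -> continuous u ->
  (forall x, D x -> `|p x| <= C) -> nrm (p * u) <= C * nrm u.
Proof.
move=> C0 cp cu pC; rewrite -(@ler_pXn2r _ 2)// ?nnegrE ?mulr_ge0 ?norm2_ge0//.
have cpu : continuous (p * u) by exact: contM.
rewrite exprMn !norm2_sqr -ip2Zl; [|exact: cont_L2|exact: cont_L2].
apply: le_Rintegral => //; first by apply: (L2_mul (p * u) (p * u)); exact: cont_L2.
  by apply: (L2_mul (C ^+ 2 *: u) u); [apply: L2Z|]; exact: cont_L2.
move=> x Dx; rewrite [leLHS](_ : _ = p x ^+ 2 * (u x * u x)); last by rewrite fctE; ring.
rewrite [leRHS](_ : _ = C ^+ 2 * (u x * u x)); last by rewrite /GRing.scale/= mulrA.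
apply: ler_wpM2r; first by rewrite -expr2 sqr_ge0.
by rewrite -real_normK ?num_real// ler_pXn2r ?nnegrE// pC.
Qed.

(** Second derivatives are controlled in L^2 only, so they may be multiplied by sup-bounded factors
    but not by one another; the force densities are affine in them. *)
Lemma LB_LQ_M f g : LB f -> LQ g -> LQ (fun z => f z * g z).
Proof.
move=> hf hg r; have [C C0 [f1 f2]] := hf r; have [C' C'0 [g1 g2]] := hg r.
exists (2 * C * C'); first by rewrite !mulr_ge0.
have CC : 0 <= C * C' by exact: mulr_ge0.
split=> [z zr|z z' d zr zr' d0 zz].
  have [cf bf] := f1 z zr; have [cg bg] := g1 z zr; split; first exact: contM.
  apply: le_trans (norm2_mul_sup _ _ _ C0 cf cg bf) _.
  by apply: le_trans (ler_wpM2l C0 bg) _; rewrite -mulrA; lra.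
have [cf bf] := f1 z zr; have [cf' bf'] := f1 z' zr'.
have [cg bg] := g1 z zr; have [cg' bg'] := g1 z' zr'.
have -> : f z * g z - f z' * g z' = (f z - f z') * g z + f z' * (g z - g z').
  by apply/funext => x; rewrite !fctE; ring.
have -> : 2 * C * C' * d = C * d * C' + C * (C' * d) by ring.
have c1 := contB _ _ cf cf'; have c2 := contB _ _ cg cg'.
apply: le_trans (norm2_tri _ _ _ _) _; [by apply: cont_L2 => //; exact: contM|by apply: cont_L2 => //; exact: contM|].
apply: lerD.
  apply: le_trans (norm2_mul_sup _ _ (C * d) _ c1 cg _) _; first exact: mulr_ge0.
    by move=> x Dx; exact: f2 zr zr' d0 zz.1 x Dx.
  by apply: ler_wpM2l => //; exact: mulr_ge0.
apply: le_trans (norm2_mul_sup _ _ C C0 cf' c2 bf') _.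
by apply: ler_wpM2l => //; exact: g2 zr zr' d0 zz.
Qed.

Lemma LB_w1 : LB w1.
Proof.
move=> r; exists (`|r| + 1) => //; split.
  move=> z [[_ c _] _ h _]; split => // x /h[_ h1 _ _].
  by apply: le_trans h1 (le_trans (ler_norm _) _); rewrite lerDl.
move=> z z' d _ _ d0 h x /h[_ h1 _ _]; apply: le_trans h1 _.
by rewrite ler_peMl// lerDr.
Qed.

Lemma LB_th : LB th.
Proof.
move=> r; exists (`|r| + 1) => //; split.
  move=> z [_ [c _ _] h _]; split => // x /h[_ _ h1 _].
  by apply: le_trans h1 (le_trans (ler_norm _) _); rewrite lerDl.
move=> z z' d _ _ d0 h x /h[_ _ h1 _]; apply: le_trans h1 _.
by rewrite ler_peMl// lerDr.
Qed.

Lemma LB_th1 : LB th1.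
Proof.
move=> r; exists (`|r| + 1) => //; split.
  move=> z [_ [_ c _] h _]; split => // x /h[_ _ _ h1].
  by apply: le_trans h1 (le_trans (ler_norm _) _); rewrite lerDl.
move=> z z' d _ _ d0 h x /h[_ _ _ h1]; apply: le_trans h1 _.
by rewrite ler_peMl// lerDr.
Qed.

Lemma LQ_w2 : LQ w2.
Proof.
move=> r; exists (`|r| + 1) => //; split.
  move=> z [[_ _ c] _ _ [h _]]; split => //.
  by apply: le_trans h (le_trans (ler_norm _) _); rewrite lerDl.
by move=> z z' d _ _ d0 [_ [h _]]; apply: le_trans h _; rewrite ler_peMl// lerDr.
Qed.

Lemma LQ_th2 : LQ th2.
Proof.
move=> r; exists (`|r| + 1) => //; split.
  move=> z [_ [_ _ c] _ [_ h]]; split => //.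
  by apply: le_trans h (le_trans (ler_norm _) _); rewrite lerDl.
by move=> z z' d _ _ d0 [_ [_ h]]; apply: le_trans h _; rewrite ler_peMl// lerDr.
Qed.

End lipschitz_classes.

(** * Cable forces in weak and strong form *)

Section forces.
Context {R : realType} {L : R}.
Hypothesis L_gt0 : 0 < L.
Local Notation mu := (@lebesgue_measure R).
Local Notation D := (`]0, L[%classic : set R).
Local Notation ip := (ip2 L).
Local Notation nrm := (norm2 L).
Local Notation es := (es (L := L)).
Local Notation cs := (cs (L := L)).
Local Notation kap := (kap (L := L)).
Local Notation sc := (sc (L := L)).
Implicit Types (z : @state R) (p q u v : R -> R) (a : R).
Variables (l c m : R) (Hx Hx' y1 y2 : R -> R).
Hypothesis dHx : der Hx Hx'.
Hypothesis cHx' : continuous Hx'.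
Hypothesis dy1 : der y1 y2.
Hypothesis cy2 : continuous y2.

(* [a = l] is the alpha cable and [a = - l] the beta cable; [slope] is (w + a sin th + y)_x. *)
Definition slope a z : R -> R := w1 z + a *: ((cos \o th z) * th1 z) + y1.
Definition slope' a z : R -> R :=
  w2 z + a *: ((cos \o th z) * th2 z - (sin \o th z) * (th1 z * th1 z)) + y2.
Definition elong a z : R := \int[mu]_(x in D) (gg (slope a z x) - gg (y1 x)).
Definition tension a z : R -> R := Hx + c *: cst (elong a z).
Definition hh a z : R -> R := - (tension a z * (ss \o slope a z)).
Definition hh' a z : R -> R :=
  - (tension a z * (((qq \o slope a z) * ((qq \o slope a z) * (qq \o slope a z))) * slope' a z)
     + (ss \o slope a z) * Hx').
Definition dens_w z : R -> R := cst m - (hh' l z + hh' (- l) z).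
Definition dens_th z : R -> R := - l *: ((cos \o th z) * (hh' l z - hh' (- l) z)).
(** The weak forms [Fw] and [Fth] use only first derivatives of the state, hence make sense for full
    sine series. The strong densities [dens_w] and [dens_th] involve second derivatives and serve
    for smooth states. *)
Definition Fw z k : R := ip (hh l z + hh (- l) z) (kap k *: cs k) + ip (cst m) (es k).
Definition Fth z k : R :=
  l * ip (hh l z - hh (- l) z) ((cos \o th z) * (kap k *: cs k) - (sin \o th z) * (th1 z * es k)).

Definition smooth z := [/\ der (w1 z) (w2 z), der (th z) (th1 z) & der (th1 z) (th2 z)].

Let cHx := der_cont _ _ dHx.
Let cy1 := der_cont _ _ dy1.

Lemma LB_slope a : LB (L := L) (slope a).
Proof.
apply: LB_D; last exact: LB_fun.
apply: LB_D; first exact: LB_w1.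
apply: LB_Z => //; apply: LB_M; last exact: LB_th1.
by apply: LB_comp; [exact: lip1_cos|exact: LB_th].
Qed.

Lemma LQ_slope' a : LQ (L := L) (slope' a).
Proof.
apply: LQ_D => //; last by apply: LB_LQ => //; exact: LB_fun.
apply: LQ_D => //; first exact: LQ_w2.
have hcos : LB (L := L) (fun z => cos \o th z) by apply: LB_comp; [exact: lip1_cos|exact: LB_th].
have hsin : LB (L := L) (fun z => sin \o th z) by apply: LB_comp; [exact: lip1_sin|exact: LB_th].
have h : LQ (L := L) (fun z => (cos \o th z) * th2 z - (sin \o th z) * (th1 z * th1 z)).
  apply: LQ_D => //; first by apply: LB_LQ_M => //; exact: LQ_th2.
  apply: LB_LQ => //; apply: LB_N => //; apply: LB_M => //; apply: LB_M; exact: LB_th1.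
exact: (LB_LQ_M L_gt0 _ _ (LB_fun L_gt0 _ (cont_cst a)) h).
Qed.

Lemma LB_elong a : LB (L := L) (fun z => cst (elong a z)).
Proof.
apply: (LB_int L_gt0 (fun z => (gg \o slope a z) - (gg \o y1))).
apply: LB_B => //; first by apply: LB_comp; [exact: lip1_gg|exact: LB_slope].
by apply: LB_comp; [exact: lip1_gg|exact: LB_fun].
Qed.

Lemma LB_tension a : LB (L := L) (tension a).
Proof. by apply: LB_D; [exact: LB_fun|apply: LB_Z => //; exact: LB_elong]. Qed.

Lemma LB_ss a : LB (L := L) (fun z => ss \o slope a z).
Proof. by apply: LB_comp; [exact: lip1_ss|exact: LB_slope]. Qed.

Lemma LB_qq a : LB (L := L) (fun z => qq \o slope a z).
Proof. by apply: LB_comp; [exact: lip1_qq|exact: LB_slope]. Qed.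

Lemma LB_hh a : LB (L := L) (hh a).
Proof. by apply: LB_N => //; apply: LB_M; [exact: LB_tension|exact: LB_ss]. Qed.

Lemma LQ_N f : LQ (L := L) f -> LQ (L := L) (fun z : @state R => - f z).
Proof.
move=> h; have := LB_LQ_M L_gt0 _ _ (LB_fun L_gt0 _ (cont_cst (-1))) h.
congr LQ; apply/funext => z; apply/funext => x; by rewrite !fctE mulN1r.
Qed.

Lemma LQ_hh' a : LQ (L := L) (hh' a).
Proof.
apply: LQ_N; apply: LQ_D => //.
  apply: LB_LQ_M => //; first exact: LB_tension.
  apply: LB_LQ_M => //; last exact: LQ_slope'.
  by apply: LB_M; [|apply: LB_M]; exact: LB_qq.
by apply: LB_LQ => //; apply: LB_M; [exact: LB_ss|exact: LB_fun].
Qed.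

Lemma LQ_dens_w : LQ (L := L) dens_w.
Proof.
apply: LQ_D => //; first by apply: LB_LQ => //; apply: LB_fun => //; exact: cont_cst.
by apply: LQ_N; apply: LQ_D => //; exact: LQ_hh'.
Qed.

Lemma LQ_dens_th : LQ (L := L) dens_th.
Proof.
have h : LQ (L := L) (fun z => (cos \o th z) * (hh' l z - hh' (- l) z)).
  apply: LB_LQ_M => //; first by apply: LB_comp; [exact: lip1_cos|exact: LB_th].
  by apply: LQ_D => //; [exact: LQ_hh'|apply: LQ_N; exact: LQ_hh'].
exact: (LB_LQ_M L_gt0 _ _ (LB_fun L_gt0 _ (cont_cst (- l))) h).
Qed.

Lemma LB_Fw k : LB (L := L) (fun z => cst (Fw z k)).
Proof.
apply: (LB_D (L := L) (fun z => cst (ip (hh l z + hh (- l) z) (kap k *: cs k))) (fun z => cst (ip (cst m) (es k)))); last first.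
  by apply: LB_fun => //; exact: cont_cst.
apply: (LB_int L_gt0 (fun z => (hh l z + hh (- l) z) * (kap k *: cs k))).
apply: LB_M; first by apply: LB_D; exact: LB_hh.
by apply: LB_fun => //; apply: contZ; exact: cont_cs.
Qed.

Lemma LB_Fth k : LB (L := L) (fun z => cst (Fth z k)).
Proof.
pose f z := (hh l z - hh (- l) z) * ((cos \o th z) * (kap k *: cs k) - (sin \o th z) * (th1 z * es k)).
apply: (LB_Z L_gt0 l (fun z => cst (\int[mu]_(x in D) f z x))).
apply: LB_int => //; apply: LB_M.
  by apply: LB_B => //; exact: LB_hh.
apply: LB_B => //; apply: LB_M.
- by apply: LB_comp; [exact: lip1_cos|exact: LB_th].
- by apply: LB_fun => //; apply: contZ; exact: cont_cs.
- by apply: LB_comp; [exact: lip1_sin|exact: LB_th].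
- by apply: LB_M; [exact: LB_th1|apply: LB_fun => //; exact: cont_es].
Qed.

Section smooth_state.
Variables (r : R) (z : @state R).
Hypothesis zr : sball (L := L) r z.
Hypothesis sz : smooth z.

Let ccos : continuous (cos \o th z).
Proof. by have [C _ [h _]] := LB_comp _ _ lip1_cos (LB_th (L := L)) r; have [] := h z zr. Qed.

Let csin : continuous (sin \o th z).
Proof. by have [C _ [h _]] := LB_comp _ _ lip1_sin (LB_th (L := L)) r; have [] := h z zr. Qed.

Lemma cont_LB (f : @state R -> R -> R) : LB (L := L) f -> continuous (f z).
Proof. by move=> h; have [C _ [h' _]] := h r; have [] := h' z zr. Qed.

Lemma cont_LQ (f : @state R -> R -> R) : LQ (L := L) f -> continuous (f z).
Proof. by move=> h; have [C _ [h' _]] := h r; have [] := h' z zr. Qed.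

Lemma der_cos_th : der (cos \o th z) (- ((sin \o th z) * th1 z)).
Proof.
case: sz => _ dth _; have := der_comp _ _ _ _ (fun x => is_derive_cos x) dth.
move=> h x; have := h x; congr (is_derive _ _ _ _).
by rewrite !fctE mulNr.
Qed.

Lemma der_slope a : der (slope a z) (slope' a z).
Proof.
case: sz => d1 dt dt1; apply: derD; last exact: dy1.
apply: derD => //; apply: derZ.
move=> x; have := derM _ _ _ _ der_cos_th dt1 x; congr (is_derive _ _ _ _).
by rewrite !fctE; ring.
Qed.

Lemma der_hh a : der (hh a z) (hh' a z).
Proof.
have h1 := der_comp _ _ _ _ der_ss (der_slope a).
have h2 : der (tension a z) Hx'.
  move=> x; have := derD _ _ _ _ dHx (derZ c _ _ (fun x => is_derive_cst (elong a z) x (1 : R))) x.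
  by congr (is_derive _ _ _ _); rewrite !fctE /GRing.scale/= mulr0 addr0.
have h3 := derZ (-1) _ _ (derM _ _ _ _ h2 h1).
by move=> x; have := h3 x; rewrite !scaleN1r.
Qed.

Lemma Fw_dens k : Fw z k = ip (dens_w z) (es k).
Proof.
have cw := cont_LQ _ (LQ_hh' l); have cw' := cont_LQ _ (LQ_hh' (- l)).
have ch := cont_LB _ (LB_hh l); have ch' := cont_LB _ (LB_hh (- l)).
have l2a := cont_L2 L_gt0 _ (contD _ _ cw cw').
have hes := L2_es L_gt0 k; have hm := cont_L2 L_gt0 _ (cont_cst m).
have := ibp_D L_gt0 _ _ _ _ (derD _ _ _ _ (der_hh l) (der_hh (- l))) (der_es (L := L) k)
  (contD _ _ cw cw') (contZ _ _ (cont_cs k)).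
rewrite es0 esL// !mulr0 subrr sub0r /Fw => ->.
by rewrite addrC /dens_w ip2Bl.
Qed.

(** The test function is $\cos\theta$ times a sine, which vanishes at both ends; its derivative is
    the two-term factor in [Fth]. *)
Lemma Fth_dens k : Fth z k = ip (dens_th z) (es k).
Proof.
have cw := cont_LQ _ (LQ_hh' l); have cw' := cont_LQ _ (LQ_hh' (- l)).
have cth1 := cont_LB _ (LB_th1 (L := L)).
have hes := L2_es L_gt0 k.
have dB : der (hh l z - hh (- l) z) (hh' l z - hh' (- l) z).
  by have := derD _ _ _ _ (der_hh l) (derZ (-1) _ _ (der_hh (- l))); rewrite !scaleN1r.
have dM := derM _ _ _ _ der_cos_th (der_es (L := L) k).
have cM : continuous ((cos \o th z) * (kap k *: cs k) + es k * - ((sin \o th z) * th1 z)).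
  apply: contD; first by apply: contM => //; apply: contZ; exact: cont_cs.
  apply: contM; first exact: cont_es.
  by move=> x; apply: continuousN; apply: contM.
have := ibp_D L_gt0 _ _ _ _ dB dM (contB _ _ cw cw') cM.
rewrite !fctE es0 esL// !mulr0 subrr sub0r => h.
rewrite /Fth; have -> : (cos \o th z) * (kap k *: cs k) - (sin \o th z) * (th1 z * es k) =
  (cos \o th z) * (kap k *: cs k) + es k * - ((sin \o th z) * th1 z).
  by apply/funext => x; rewrite !fctE; ring.
rewrite h mulrN -mulNr -ip2Zl//; last first.
- by apply: cont_L2 => //; apply: contM => //; exact: cont_es.
- by apply: cont_L2 => //; exact: contB.
rewrite /ip2; apply: eq_Rintegral => x _.
rewrite -[LHS]/((- l * (hh' l z x - hh' (- l) z x)) * (cos (th z x) * es k x)).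
rewrite -[RHS]/((- l * (cos (th z x) * (hh' l z x - hh' (- l) z x))) * es k x).
by move: (hh' l z x) (hh' _ z x) => *; ring.
Qed.

End smooth_state.

Lemma bessel_ip u : L2 L u -> bnd (fun k => ip u (es k)) (L / 2 * nrm u ^+ 2).
Proof.
move=> hu n; have := bessel L_gt0 u n hu; rewrite -norm2_sqr => h.
under eq_bigr do rewrite scE// exprMn.
rewrite -big_distrr/=; apply: le_trans (ler_wpM2l (sqr_ge0 _) h) _.
have -> : (L / 2) ^+ 2 * (2 / L * nrm u ^+ 2) = L / 2 * nrm u ^+ 2 by field; rewrite gt_eqF.
by [].
Qed.

(** Bessel's inequality for the difference of the strong densities, which are Lipschitz in L^2. *)
Lemma force_lip (r : R) : exists2 C : R, 0 <= C & forall z z' d, sball (L := L) r z -> sball (L := L) r z' ->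
  smooth z -> smooth z' -> 0 <= d -> near2 (L := L) d z z' ->
  bnd (Fw z - Fw z') (C * d ^+ 2) /\ bnd (Fth z - Fth z') (C * d ^+ 2).
Proof.
have [C C0 [f1 f2]] := LQ_dens_w r; have [C' C'0 [g1 g2]] := LQ_dens_th r.
exists (L / 2 * C ^+ 2 + L / 2 * C' ^+ 2).
  by rewrite addr_ge0// mulr_ge0 ?sqr_ge0// divr_ge0// ltW.
move=> z z' d zr zr' sz sz' d0 zz; split.
  have [/(cont_L2 L_gt0) cf _] := f1 z zr; have [/(cont_L2 L_gt0) cf' _] := f1 z' zr'.
  have -> : Fw z - Fw z' = (fun k => ip (dens_w z - dens_w z') (es k)).
    apply/funext => k; rewrite [LHS](_ : _ = Fw z k - Fw z' k)// (Fw_dens _ _ zr sz) (Fw_dens _ _ zr' sz') ip2Bl//.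
  apply: bnd_le (bessel_ip _ _) => //.
  rewrite mulrDl; apply: le_trans (_ : L / 2 * C ^+ 2 * d ^+ 2 <= _); last first.
    by rewrite lerDl !mulr_ge0 ?sqr_ge0 ?invr_ge0 ?(ltW L_gt0).
  rewrite -[leRHS]mulrA -exprMn; apply: ler_wpM2l; first by rewrite divr_ge0// ltW.
  by rewrite ler_pXn2r ?nnegrE ?mulr_ge0 ?norm2_ge0//; exact: f2.
have [/(cont_L2 L_gt0) cf _] := g1 z zr; have [/(cont_L2 L_gt0) cf' _] := g1 z' zr'.
have -> : Fth z - Fth z' = (fun k => ip (dens_th z - dens_th z') (es k)).
  apply/funext => k; rewrite [LHS](_ : _ = Fth z k - Fth z' k)// (Fth_dens _ _ zr sz) (Fth_dens _ _ zr' sz') ip2Bl//.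
apply: bnd_le (bessel_ip _ _) => //.
rewrite mulrDl; apply: le_trans (_ : L / 2 * C' ^+ 2 * d ^+ 2 <= _); last first.
  by rewrite lerDr !mulr_ge0 ?sqr_ge0 ?invr_ge0 ?(ltW L_gt0).
rewrite -[leRHS]mulrA -exprMn; apply: ler_wpM2l; first by rewrite divr_ge0// ltW.
by rewrite ler_pXn2r ?nnegrE ?mulr_ge0 ?norm2_ge0//; exact: g2.
Qed.

Lemma force_bnd (r : R) : exists C : R, forall z, sball (L := L) r z -> smooth z -> bnd (Fw z) C /\ bnd (Fth z) C.
Proof.
have [C C0 [f1 _]] := LQ_dens_w r; have [C' C'0 [g1 _]] := LQ_dens_th r.
exists (L / 2 * C ^+ 2 + L / 2 * C' ^+ 2) => z zr sz.
have A x : 0 <= L / 2 * x ^+ 2 by rewrite mulr_ge0 ?sqr_ge0// divr_ge0// ltW.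
have B x y : 0 <= x -> x <= y -> L / 2 * x ^+ 2 <= L / 2 * y ^+ 2.
  move=> x0 xy; apply: ler_wpM2l; first by rewrite divr_ge0// ltW.
  by rewrite ler_pXn2r ?nnegrE ?(le_trans x0 xy).
split.
  have [/(cont_L2 L_gt0) cf bf] := f1 z zr.
  rewrite (_ : Fw z = (fun k => ip (dens_w z) (es k))); last by apply/funext => k; exact: Fw_dens zr sz k.
  apply: bnd_le (bessel_ip _ cf); apply: le_trans (B _ _ (norm2_ge0 _) bf) _.
  by rewrite lerDl.
have [/(cont_L2 L_gt0) cf bf] := g1 z zr.
rewrite (_ : Fth z = (fun k => ip (dens_th z) (es k))); last by apply/funext => k; exact: Fth_dens zr sz k.
apply: bnd_le (bessel_ip _ cf); apply: le_trans (B _ _ (norm2_ge0 _) bf) _.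
by rewrite lerDr.
Qed.

End forces.

(** * Interpolation between the energy norm and L^2 *)

Section interpolation.
Context {R : realType} {L : R}.
Hypothesis L_gt0 : 0 < L.
Local Notation mu := (@lebesgue_measure R).
Local Notation D := (`]0, L[%classic : set R).
Local Notation ip := (ip2 L).
Local Notation nrm := (norm2 L).
Local Notation es := (es (L := L)).
Local Notation cs := (cs (L := L)).
Local Notation kap := (kap (L := L)).
Local Notation sc := (sc (L := L)).
Local Notation fser := (fser (L := L)).
Local Notation fser' := (fser' (L := L)).
Local Notation sin_k := (sin_k (L := L)).
Local Notation cos_k := (cos_k (L := L)).
Implicit Types (a : nat -> R) (u v : R -> R).

Lemma nrm_sc_bnd v C : L2 L v -> bnd (sc v) C -> nrm v ^+ 2 <= L / 2 * C.
Proof.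
move=> hv h; rewrite norm2_sqr.
have L20 : 0 <= L / 2 by rewrite divr_ge0// ltW.
rewrite -(cvg_lim _ (parseval L_gt0 v hv))//; apply: limr_le; first exact: cvgP (parseval L_gt0 v hv).
by near=> n; apply: ler_wpM2l => //; exact: h.
Unshelve. all: by end_near. Qed.

Lemma nrm_fser_le a C C' : bnd a C -> bnd (fun k => a k / kap k ^+ 2) C' -> nrm (fser a) ^+ 2 <= L / 2 * C'.
Proof.
move=> h h'; apply: nrm_sc_bnd; first exact: fser_L2 h.
by rewrite (_ : sc _ = (fun k => a k / kap k ^+ 2))//; apply/funext => k; exact: sc_fser h.
Qed.

Lemma bnd_div_kap a C : bnd a C -> bnd (fun k => a k / kap k ^+ 2) ((kap 0)^-1 ^+ 4 * C).
Proof.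
have k0 := kap_gt0 L_gt0 0.
rewrite (_ : (kap 0)^-1 ^+ 4 = ((kap 0)^-1 ^+ 2) ^+ 2); last by rewrite -exprM.
apply: bnd_dom => [|k]; first exact: sqr_ge0.
have kk := kap_gt0 L_gt0 k; have kle := kap_le L_gt0 0 k (leq0n k).
rewrite normrM mulrC; apply: ler_wpM2r => //.
rewrite ger0_norm ?invr_ge0 ?sqr_ge0// exprVn lef_pV2 ?posrE ?exprn_gt0//.
by rewrite ler_pXn2r// nnegrE ltW.
Qed.

(* Interpolation |u_x|^2 <= |u| |u_xx| on the sine series u = fser a. *)
Lemma fser'_interp a dV d0 : 0 <= dV -> 0 <= d0 -> bnd a (dV ^+ 2) ->
  bnd (fun k => a k / kap k ^+ 2) (d0 ^+ 2) -> nrm (fser' a) ^+ 2 <= L / 2 * (dV * d0).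
Proof.
move=> dV0 d00 ha ha'; have L20 : 0 <= L / 2 by rewrite divr_ge0// ltW.
have [v wv cv] := fser'_weak L_gt0 _ _ ha; have [hv _] := wv.
have h0 := fser_L2 L_gt0 _ _ ha.
rewrite norm2_sqr (weak_deriv_test0 L_gt0 _ _ _ _ (fser'_L2 L_gt0 _ _ ha) wv (der_fser L_gt0 _ _ ha)
  (fser'_cont L_gt0 _ _ ha) (fser0 _ _ ha) (fserL L_gt0 _ _ ha)).
apply: le_trans (ler_norm _) _; rewrite normrN; apply: le_trans (ip2_CS _ _ hv h0) _.
have n1 : nrm v ^+ 2 <= L / 2 * dV ^+ 2.
  apply: nrm_sc_bnd => //; rewrite (_ : sc v = - a); first exact: bndN.
  by apply/funext => k; exact: cv.
have n2 := nrm_fser_le _ _ _ ha ha'.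
rewrite -(@ler_pXn2r _ 2)// ?nnegrE ?mulr_ge0 ?norm2_ge0 ?(ltW L_gt0)//.
rewrite exprMn; have -> : (L / 2 * (dV * d0)) ^+ 2 = (L / 2 * dV ^+ 2) * (L / 2 * d0 ^+ 2) by ring.
by apply: ler_pM => //; exact: sqr_ge0.
Qed.

(** The norm of u is bounded both through u_xx, at the cost of [(kap 0)^-1 ^+ 2], and through d0;
    the geometric mean of the two bounds has the form of [fser'_interp]. *)
Lemma fser_interp a dV d0 : 0 <= dV -> 0 <= d0 -> bnd a (dV ^+ 2) ->
  bnd (fun k => a k / kap k ^+ 2) (d0 ^+ 2) -> nrm (fser a) ^+ 2 <= L / 2 * (kap 0)^-1 ^+ 2 * (dV * d0).
Proof.
move=> dV0 d00 ha ha'; have L20 : 0 <= L / 2 by rewrite divr_ge0// ltW.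
have n1 := nrm_fser_le _ _ _ ha (bnd_div_kap _ _ ha).
have n2 := nrm_fser_le _ _ _ ha ha'.
have k0 : 0 <= (kap 0)^-1 ^+ 2 by exact: sqr_ge0.
have B0 : 0 <= L / 2 * (kap 0)^-1 ^+ 2 * (dV * d0) by apply: mulr_ge0; apply: mulr_ge0.
rewrite -(@ler_pXn2r _ 2)// ?nnegrE ?sqr_ge0//.
rewrite [X in X <= _]expr2.
have -> : (L / 2 * (kap 0)^-1 ^+ 2 * (dV * d0)) ^+ 2 = (L / 2 * ((kap 0)^-1 ^+ 4 * dV ^+ 2)) * (L / 2 * d0 ^+ 2) by ring.
by apply: ler_pM => //; exact: sqr_ge0.
Qed.

Lemma ip_ssum_sin u a n : L2 L u -> ip u (ssum sin_k a n) = \sum_(k < n) a k / kap k ^+ 2 * ip u (es k).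
Proof.
move=> hu; rewrite ssum_sin_k ip2C /psum ip2_suml//.
by apply: eq_bigr => k _; rewrite ip2Zl// ip2C.
Qed.

Lemma ip_ssum_cos u a n : L2 L u ->
  ip u (ssum cos_k a n) = \sum_(k < n) a k / kap k ^+ 2 * ip u (kap k *: cs k).
Proof.
move=> hu; have -> : ssum cos_k a n = \sum_(k < n) (a k / kap k ^+ 2) *: (kap k *: cs k).
  apply/funext => x; rewrite fct_sumE /ssum big_mkord; apply: eq_bigr => k _.
  by rewrite !fctE /cos_k /GRing.scale/=; field; rewrite gt_eqF// kap_gt0.
rewrite ip2C ip2_suml//.
by apply: eq_bigr => k _; rewrite ip2Zl// ip2C.
Qed.

Lemma ip_fser_cvg u a C : L2 L u -> bnd a C ->
  \sum_(k < n) a k / kap k ^+ 2 * ip u (es k) @[n --> \oo] --> ip u (fser a).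
Proof.
move=> hu ha; have h0 := fser_L2 L_gt0 _ _ ha.
have hs n : L2 L (ssum sin_k a n) by apply: cont_L2 => //; apply: ssum_cont; exact: sin_k_cont.
under eq_fun do rewrite -ip_ssum_sin// ip2C; rewrite ip2C.
by apply: L2_cvg_ip => //; apply: nrm_unif => //; exact: ssum_unif (kap0V_ge0 L_gt0) (sin_k_le L_gt0) _ _ ha.
Qed.

Lemma ip_fser'_cvg u a C : L2 L u -> bnd a C ->
  \sum_(k < n) a k / kap k ^+ 2 * ip u (kap k *: cs k) @[n --> \oo] --> ip u (fser' a).
Proof.
move=> hu ha; have h0 := fser'_L2 L_gt0 _ _ ha.
have hs n : L2 L (ssum cos_k a n) by apply: cont_L2 => //; apply: ssum_cont; exact: cos_k_cont.
under eq_fun do rewrite -ip_ssum_cos// ip2C; rewrite ip2C.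
by apply: L2_cvg_ip => //; apply: nrm_unif => //; exact: ssum_unif ler01 (cos_k_le L_gt0) _ _ ha.
Qed.

End interpolation.

(** * Taylor expansion of the cable energy *)

Section potential.
Context {R : realType} {L : R}.
Hypothesis L_gt0 : 0 < L.
Local Notation mu := (@lebesgue_measure R).
Local Notation D := (`]0, L[%classic : set R).
Local Notation ip := (ip2 L).
Local Notation nrm := (norm2 L).
Implicit Types (z : @state R) (p q u v : R -> R) (a : R).
Variables (l c m : R) (Hx Hx' y1 y2 : R -> R).
Hypothesis c_ge0 : 0 <= c.
Hypothesis dHx : der Hx Hx'.
Hypothesis Hx_ge0 : forall x, D x -> 0 <= Hx x.
Hypothesis dy1 : der y1 y2.
Let cHx := der_cont _ _ dHx.
Let cy1 := der_cont _ _ dy1.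
Local Notation slope := (slope y1).
Local Notation elong := (elong (L := L) y1).
Local Notation tension := (tension (L := L) c Hx y1).
Local Notation hh := (hh (L := L) c Hx y1).

Lemma cos_taylor (x y : R) : `|cos y - cos x + sin x * (y - x)| <= (y - x) ^+ 2.
Proof.
have d : der (fun t : R => cos t + sin x * t) (fun t => - sin t + sin x).
  by move=> t; have := derD _ _ _ _ (fun x => is_derive_cos x) (der_lin (sin x)) t.
have := MVT_le _ _ x y `|y - x| d _.
rewrite -expr2 real_normK ?num_real//.
have -> : cos y + sin x * y - (cos x + sin x * x) = cos y - cos x + sin x * (y - x) by ring.
apply => t tx; apply: le_trans tx; rewrite addrC distrC; exact: lip1_sin.
Qed.

(** First-order part of the change of [slope a] from z to z'; paired with [hh a z] it gives the
    virtual work of one cable. *)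
Definition dslope a z z' : R -> R := (w1 z' - w1 z) +
  a *: ((cos \o th z) * (th1 z' - th1 z) - (sin \o th z) * ((th z' - th z) * th1 z)).
Definition sqdist z z' : R -> R := (w1 z' - w1 z) * (w1 z' - w1 z) +
  (th1 z' - th1 z) * (th1 z' - th1 z) + (th z' - th z) * (th z' - th z).

(** Pre-tension weighted by arc length, plus the elastic energy of the elongation. Its first
    variation along a change of slope is the integral of that change against [tension] times [ss],
    that is, against minus [hh]. *)
Definition cable_energy a z : R :=
  \int[mu]_(x in D) (Hx x * gg (slope a z x)) + c / 2 * elong a z ^+ 2.

Lemma slope_sqdist a r : 0 <= r -> exists2 K : R, 0 <= K & forall z z' x, `|th1 z x| <= r ->
  (slope a z' x - slope a z x) ^+ 2 <= K * sqdist z z' x /\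
  `|slope a z' x - slope a z x - dslope a z z' x| <= K * sqdist z z' x.
Proof.
move=> r0; exists (4 * (1 + a ^+ 2 + a ^+ 2 * r ^+ 2) + `|a| * (1 + r)).
  have h1 : 0 <= a ^+ 2 * r ^+ 2 by rewrite mulr_ge0// sqr_ge0.
  have h2 : 0 <= `|a| * (1 + r) by rewrite mulr_ge0// addr_ge0.
  by have := sqr_ge0 a; lra.
move=> z z' x zr.
have -> : slope a z' x - slope a z x = (w1 z' x - w1 z x) +
    a * (cos (th z' x) * th1 z' x - cos (th z x) * th1 z x).
  by rewrite /slope !fctE /GRing.scale/=; ring.
have -> : dslope a z z' x = (w1 z' x - w1 z x) +
    a * (cos (th z x) * (th1 z' x - th1 z x) - sin (th z x) * ((th z' x - th z x) * th1 z x)).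
  by [].
have -> : sqdist z z' x = (w1 z' x - w1 z x) ^+ 2 + (th1 z' x - th1 z x) ^+ 2 + (th z' x - th z x) ^+ 2.
  by [].
have := lip1_cos (th z' x) (th z x); have := cos_taylor (th z x) (th z' x).
have cle : `|cos (th z' x)| <= 1 by rewrite ler_norml cos_geN1 cos_le1.
move: (th1 z x) (th1 z' x) zr => t t' zr.
have -> : cos (th z' x) * t' - cos (th z x) * t = cos (th z' x) * (t' - t) + (cos (th z' x) - cos (th z x)) * t by ring.
move: cle; set C' := cos (th z' x); set C := cos (th z x); set S := sin (th z x).
move: (th z' x - th z x) (w1 z' x - w1 z x) => e w cle ct cl.
have Br : (C' * (t' - t) + (C' - C) * t) ^+ 2 <= 2 * (t' - t) ^+ 2 + 2 * (r ^+ 2 * e ^+ 2).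
  have h1 : (C' * (t' - t)) ^+ 2 <= (t' - t) ^+ 2.
    rewrite exprMn -[leRHS]mul1r; apply: ler_wpM2r; first exact: sqr_ge0.
    by rewrite -real_normK ?num_real// exprn_ile1.
  have h2 : ((C' - C) * t) ^+ 2 <= r ^+ 2 * e ^+ 2.
    rewrite exprMn mulrC; apply: ler_pM; rewrite ?sqr_ge0//; rewrite -real_normK ?num_real// -[leRHS]real_normK ?num_real//.
      by rewrite ler_pXn2r ?nnegrE// (ger0_norm r0).
    by rewrite ler_pXn2r ?nnegrE.
  by have := sqr_ge0 (C' * (t' - t) - (C' - C) * t); nra.
have a20 := sqr_ge0 a; have w20 := sqr_ge0 w; have e20 := sqr_ge0 e; have t20 := sqr_ge0 (t' - t).
have r20 : 0 <= r ^+ 2 by exact: sqr_ge0.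
have a2r : 0 <= a ^+ 2 * r ^+ 2 by rewrite mulr_ge0.
have ar : 0 <= `|a| * (1 + r) by rewrite mulr_ge0// addr_ge0.
split.
  move: (C' * (t' - t) + (C' - C) * t) Br => X Br.
  have h1 : (w + a * X) ^+ 2 <= 2 * w ^+ 2 + 2 * (a ^+ 2 * X ^+ 2).
    by have := sqr_ge0 (w - a * X); rewrite -exprMn; nra.
  have h2 := ler_wpM2l a20 Br.
  apply: le_trans h1 _; move: (X ^+ 2) h2 => X2 h2.
  move: (w ^+ 2) (e ^+ 2) ((t' - t) ^+ 2) (a ^+ 2) (r ^+ 2) (`|a| * (1 + r)) w20 e20 t20 a20 r20 ar a2r h2.
  move=> W E T A Q B W0 E0 T0 A0 Q0 B0 AQ0 h2.
  have p1 := mulr_ge0 B0 W0; have p2 := mulr_ge0 B0 E0; have p3 := mulr_ge0 B0 T0.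
  have p4 := mulr_ge0 AQ0 W0; have p5 := mulr_ge0 AQ0 E0; have p6 := mulr_ge0 AQ0 T0.
  have p7 := mulr_ge0 A0 W0; have p8 := mulr_ge0 A0 E0; have p9 := mulr_ge0 A0 T0.
  lra.
have -> : w + a * (C' * (t' - t) + (C' - C) * t) - (w + a * (C * (t' - t) - S * (e * t))) =
  a * ((C' - C) * (t' - t) + (C' - C + S * e) * t) by ring.
rewrite normrM; apply: le_trans (_ : `|a| * (1 + r) * ((t' - t) ^+ 2 + e ^+ 2) <= _); last first.
  apply: ler_pM; rewrite ?addr_ge0//; first by rewrite lerDr mulr_ge0 ?addr_ge0.
  by rewrite lerD2r lerDr.
rewrite -mulrA; apply: ler_wpM2l => //.
apply: le_trans (ler_normD _ _) _; rewrite !normrM.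
have b1 : `|C' - C| * `|t' - t| <= `|e| * `|t' - t| by apply: ler_wpM2r.
have b2 : `|C' - C + S * e| * `|t| <= e ^+ 2 * r by apply: ler_pM.
have b3 : `|e| * `|t' - t| <= (t' - t) ^+ 2 + e ^+ 2.
  rewrite -[(t' - t) ^+ 2]real_normK ?num_real// -[e ^+ 2]real_normK ?num_real//.
  by have := sqr_ge0 (`|e| - `|t' - t|); have := sqr_ge0 `|e|; have := sqr_ge0 `|t' - t|; nra.
have : 0 <= r * (t' - t) ^+ 2 by rewrite mulr_ge0.
move: b1 b2 b3; nra.
Qed.

Lemma Rint_le_mul u v (K : R) : continuous u -> continuous v -> (forall x, D x -> `|u x| <= K * v x) ->
  `|\int[mu]_(x in D) u x| <= K * \int[mu]_(x in D) v x.
Proof.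
move=> cu cv h; have iu := cont_intD L_gt0 _ cu; have iv := cont_intD L_gt0 _ cv.
apply: le_trans (le_normr_Rintegral mD iu) _; rewrite -RintegralZl//.
apply: le_Rintegral => //; first exact: integrable_norm.
exact: (intDZ K _ iv).
Qed.

Lemma cable_taylor a r : 0 <= r -> exists2 K : R, 0 <= K & forall z z',
  sball (L := L) r z -> sball (L := L) r z' ->
  `|cable_energy a z' - cable_energy a z + ip (hh a z) (dslope a z z')| <=
  K * (nrm (w1 z' - w1 z) ^+ 2 + nrm (th1 z' - th1 z) ^+ 2 + nrm (th z' - th z) ^+ 2).
Proof.
move=> r0; have [K K0 hK] := slope_sqdist a r r0.
have [T T0 [hT _]] := LB_tension L_gt0 c _ _ _ _ dHx dy1 a r.
exists (T * (2 * K) + c / 2 * (L * K)).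
  by rewrite addr_ge0 ?mulr_ge0// ?invr_ge0// ltW.
move=> z z' zr zr'.
have cz f : LB (L := L) f -> continuous (f z) := cont_LB r z zr f.
have cz' f : LB (L := L) f -> continuous (f z') := cont_LB r z' zr' f.
have [cw ct ct1] := And3 (cz _ LB_w1) (cz _ LB_th) (cz _ LB_th1).
have [cw' ct' ct1'] := And3 (cz' _ LB_w1) (cz' _ LB_th) (cz' _ LB_th1).
have cs1 := cz _ (LB_slope L_gt0 _ _ dy1 a); have cs1' := cz' _ (LB_slope L_gt0 _ _ dy1 a).
have cS := cz _ (LB_ss L_gt0 _ _ dy1 a).
have cT : continuous (tension a z) by case: (hT z zr).
have cH : continuous (hh a z) := cz _ (LB_hh L_gt0 c _ _ _ _ dHx dy1 a).
have cg : continuous (gg \o slope a z) by move=> x; apply: continuous_comp; [exact: cs1|exact: lip1_cont lip1_gg _].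
have cg' : continuous (gg \o slope a z') by move=> x; apply: continuous_comp; [exact: cs1'|exact: lip1_cont lip1_gg _].
have cgy : continuous (gg \o y1) by move=> x; apply: continuous_comp; [exact: cy1|exact: lip1_cont lip1_gg _].
have dw : continuous (w1 z' - w1 z) by exact: contB.
have dt : continuous (th z' - th z) by exact: contB.
have dt1 : continuous (th1 z' - th1 z) by exact: contB.
have ccos : continuous (cos \o th z) by move=> x; apply: continuous_comp; [exact: ct|exact: continuous_cos].
have csin : continuous (sin \o th z) by move=> x; apply: continuous_comp; [exact: ct|exact: continuous_sin].
have cl : continuous (dslope a z z').
  apply: contD => //; apply: contZ; apply: contB; first exact: contM.
  by apply: contM => //; exact: contM.
have cQ : continuous (sqdist z z') by apply: contD; [apply: contD|]; exact: contM.
have intE u v : continuous u -> continuous v ->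
    \int[mu]_(x in D) (u x - v x) = \int[mu]_(x in D) u x - \int[mu]_(x in D) v x.
  by move=> cu cv; rewrite RintegralB//; exact: (cont_intD L_gt0).
have QE : \int[mu]_(x in D) sqdist z z' x =
    nrm (w1 z' - w1 z) ^+ 2 + nrm (th1 z' - th1 z) ^+ 2 + nrm (th z' - th z) ^+ 2.
  have i1 := cont_intD L_gt0 _ (contM _ _ dw dw); have i2 := cont_intD L_gt0 _ (contM _ _ dt dt).
  have i3 := cont_intD L_gt0 _ (contM _ _ dt1 dt1).
  rewrite !norm2_sqr -RintegralD// -RintegralD//.
  exact: (intDD _ _ i1 i3).
have Q0 x : 0 <= sqdist z z' x.
  by rewrite /sqdist !fctE -!expr2 !addr_ge0 ?sqr_ge0.
have I0 : 0 <= \int[mu]_(x in D) sqdist z z' x by apply: Rintegral_ge0.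
pose G := gg \o slope a z; pose G' := gg \o slope a z'.
have E : elong a z' - elong a z = \int[mu]_(x in D) (G' - G) x.
  rewrite /elong (intE G' (gg \o y1))// (intE G (gg \o y1))// (intE G' G)//.
  ring.
have cGG : continuous (G' - G) by exact: contB.
have near x : D x -> `|th1 z x| <= r by move=> Dx; case: zr => _ _ h _; case: (h x Dx).
have E2 : (elong a z' - elong a z) ^+ 2 <= L * (K * \int[mu]_(x in D) sqdist z z' x).
  have c1 := cont_cst (1 : R).
  have -> : elong a z' - elong a z = ip (G' - G) (cst 1).
    by rewrite E /ip2; apply: eq_Rintegral => x _; rewrite /= mulr1.
  apply: le_trans (ip2_CS2 _ _ (cont_L2 L_gt0 _ cGG) (cont_L2 L_gt0 _ c1)) _.
  have -> : ip (cst 1) (cst 1) = L.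
    rewrite /ip2 (_ : (fun x => _) = cst 1); last by apply/funext => x; rewrite /= mulr1.
    by rewrite Rintegral_cst// mul1r [X in fine X]muD.
  rewrite mulrC; apply: ler_wpM2l; first exact: ltW.
  apply: le_trans (ler_norm _) _; apply: Rint_le_mul => //; first exact: contM.
  move=> x Dx; rewrite -expr2 normrX; have [h _] := hK z z' x (near x Dx).
  apply: le_trans h; rewrite -[leRHS]real_normK ?num_real// ler_pXn2r ?nnegrE//.
  exact: lip1_gg.
pose Rm := tension a z * (G' - G - (ss \o slope a z) * dslope a z z').
have cR : continuous Rm by apply: contM => //; apply: contB => //; exact: contM.
(* Exact identity: the elastic energy is quadratic in the elongation and leaves, beyond its linear
   part, the square of the change; everything else is the pointwise remainder [Rm]. *)
have key : cable_energy a z' - cable_energy a z + ip (hh a z) (dslope a z z') =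
    \int[mu]_(x in D) Rm x + c / 2 * (elong a z' - elong a z) ^+ 2.
  have -> : \int[mu]_(x in D) Rm x = \int[mu]_(x in D) ((Hx * G') x) - \int[mu]_(x in D) ((Hx * G) x)
      + c * elong a z * (elong a z' - elong a z) + ip (hh a z) (dslope a z z').
    have c1 := contM _ _ cHx cg'; have c2 := contM _ _ cHx cg.
    have c3 := contZ (c * elong a z) _ cGG; have c4 := contM _ _ cH cl.
    have c12 := contB _ _ c1 c2; have c123 := contD _ _ c12 c3.
    rewrite E -(intE _ _ c1 c2) -RintegralZl//; last exact: (cont_intD L_gt0).
    rewrite -RintegralD//; [|exact: (cont_intD L_gt0)|exact: (cont_intD L_gt0)].
    rewrite /ip2 -RintegralD//; [|exact: (cont_intD L_gt0)|exact: (cont_intD L_gt0)].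
    apply: eq_Rintegral => x _; rewrite /Rm /hh /tension -/(elong a z).
    rewrite -[LHS]/((Hx x + c * elong a z) * (G' x - G x - ss (slope a z x) * dslope a z z' x)).
    rewrite -[RHS]/(Hx x * G' x - Hx x * G x + c * elong a z * (G' x - G x)
      + - ((Hx x + c * elong a z) * ss (slope a z x)) * dslope a z z' x).
    by move: (dslope a z z' x) (elong a z) (ss _) (G x) (G' x) => *; ring.
  rewrite -[cable_energy a z']/(\int[mu]_(x in D) ((Hx * G') x) + c / 2 * elong a z' ^+ 2).
  rewrite -[cable_energy a z]/(\int[mu]_(x in D) ((Hx * G) x) + c / 2 * elong a z ^+ 2).
  move: (elong a z) (elong a z') (\int[mu]_(x in D) ((Hx * G) x)) (\int[mu]_(x in D) ((Hx * G') x)) (ip _ _) => e e' p q s.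
  by field.
rewrite key; apply: le_trans (ler_normD _ _) _; rewrite mulrDl; apply: lerD.
  rewrite -QE; apply: Rint_le_mul => // x Dx; rewrite normrM -mulrA.
  apply: ler_pM => //; first by have [_ ->] := hT z zr.
  have [h1 h2] := hK z z' x (near x Dx).
  have -> : (G' - G - (ss \o slope a z) * dslope a z z') x =
    (G' x - G x - ss (slope a z x) * (slope a z' x - slope a z x))
     + ss (slope a z x) * (slope a z' x - slope a z x - dslope a z z' x).
    by rewrite !fctE; ring.
  apply: le_trans (ler_normD _ _) _; rewrite -mulrA mulr_natl mulr2n; apply: lerD.
    exact: le_trans (gg_taylor _ _) h1.
  by rewrite normrM; apply: le_trans h2; rewrite ler_piMl// ss_le1.
have c2 : 0 <= c / 2 by rewrite divr_ge0.
rewrite normrM (ger0_norm c2) -[leRHS]mulrA; apply: ler_wpM2l => //.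
rewrite ger0_norm ?sqr_ge0// -QE; apply: le_trans E2 _.
by rewrite mulrA.
Qed.

End potential.

(** * Two sequences carried by one *)

Section interleaving.
Context {R : realType}.
Implicit Types (a b : nat -> R).

Definition evens a k := a k.*2.
Definition odds a k := a k.*2.+1.

Lemma sum_double (f : nat -> R) n :
  \sum_(j < n.*2) f j = \sum_(k < n) (f k.*2 + f k.*2.+1).
Proof.
elim: n => [|n ih]; first by rewrite !big_ord0.
by rewrite doubleS !big_ord_recr/= ih addrA.
Qed.

Lemma bnd_interleave a C C' : bnd (evens a) C -> bnd (odds a) C' -> bnd a (C + C').
Proof.
move=> he ho n; apply: le_trans (_ : \sum_(j < n.*2) a j ^+ 2 <= _).
  by apply: (sq_nd a); rewrite -addnn leq_addr.
rewrite (sum_double (fun j => a j ^+ 2)) big_split/=; apply: lerD; [exact: he|exact: ho].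
Qed.

Lemma bnd_evens a C : bnd a C -> bnd (evens a) C.
Proof.
move=> h n; apply: le_trans (h n.*2); rewrite (sum_double (fun j => a j ^+ 2)).
by apply: ler_sum => k _; rewrite lerDl sqr_ge0.
Qed.

Lemma bnd_odds a C : bnd a C -> bnd (odds a) C.
Proof.
move=> h n; apply: le_trans (h n.*2); rewrite (sum_double (fun j => a j ^+ 2)).
by apply: ler_sum => k _; rewrite lerDr sqr_ge0.
Qed.

End interleaving.

(** * The system in scaled sine coordinates *)

Section coordinates.
Context {R : realType} {L : R}.
Hypothesis L_gt0 : 0 < L.
Local Notation D := (`]0, L[%classic : set R).
Local Notation ip := (ip2 L).
Local Notation nrm := (norm2 L).
Local Notation es := (es (L := L)).
Local Notation cs := (cs (L := L)).
Local Notation kap := (kap (L := L)).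
Local Notation fser := (fser (L := L)).
Local Notation fser' := (fser' (L := L)).
Local Notation sin_k := (sin_k (L := L)).
Local Notation cos_k := (cos_k (L := L)).
Local Notation psum := (psum (L := L)).
Variables (M l EI EJ GK : R).
Hypothesis M_gt0 : 0 < M.
Hypothesis l_gt0 : 0 < l.
Hypothesis EI_gt0 : 0 < EI.
Hypothesis EJ_gt0 : 0 < EJ.
Hypothesis GK_gt0 : 0 < GK.
Implicit Types (u v : nat -> R).

(* The scaling turns M |w_t|^2 + M l^2 / 3 |theta_t|^2 into the plain sum of squares of the coordinates' velocities. *)
Definition cw : R := Num.sqrt (2 / (L * M)).
Definition cth : R := Num.sqrt (6 / (L * M * l ^+ 2)).
Definition omw k : R := Num.sqrt (EI / M) * kap k ^+ 2.
Definition omth k : R := Num.sqrt (3 / (M * l ^+ 2) * (EJ * kap k ^+ 4 + GK * kap k ^+ 2)).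
Definition om j : R := if odd j then omth j./2 else omw j./2.
(** Coefficients of $-w_{xx}$, the form that [fser] expects; w sits on the even coordinates and
    theta on the odd ones. *)
Definition aw u k : R := cw * kap k ^+ 2 * u k.*2.
Definition ath u k : R := cth * kap k ^+ 2 * u k.*2.+1.
Local Notation wt := (wt om).

Lemma cw_gt0 : 0 < cw.
Proof. by rewrite sqrtr_gt0 divr_gt0// mulr_gt0. Qed.

Lemma cth_gt0 : 0 < cth.
Proof. by rewrite sqrtr_gt0 divr_gt0// !mulr_gt0// exprn_gt0. Qed.

Lemma omw_gt0 k : 0 < omw k.
Proof. by rewrite mulr_gt0 ?sqrtr_gt0 ?divr_gt0// exprn_gt0// kap_gt0. Qed.

Lemma omth_gt0 k : 0 < omth k.
Proof.
have k0 := kap_gt0 L_gt0 k.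
by rewrite sqrtr_gt0; apply: mulr_gt0; [apply: divr_gt0|apply: addr_gt0] => //; apply: mulr_gt0 => //; exact: exprn_gt0.
Qed.

Lemma om_gt0 j : 0 < om j.
Proof. by rewrite /om; case: ifP => _; [exact: omth_gt0|exact: omw_gt0]. Qed.

Definition Aw : R := (cw / Num.sqrt (EI / M)) ^+ 2.
Definition Ath : R := (cth / Num.sqrt (3 * EJ / (M * l ^+ 2))) ^+ 2.

Lemma bnd_aw u C : bnd (wt u) C -> bnd (aw u) (Aw * C).
Proof.
have s0 : 0 < Num.sqrt (EI / M) by rewrite sqrtr_gt0 divr_gt0.
move/bnd_evens; apply: bnd_dom; first by rewrite divr_ge0// ltW// cw_gt0.
move=> k; rewrite /evens /wt /om odd_double doubleK /aw /omw.
move: (kap k ^+ 2) (u k.*2) => x y; rewrite !normrM (ger0_norm (ltW cw_gt0)) (ger0_norm (ltW s0)).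
rewrite le_eqVlt; apply/orP; left; apply/eqP; field.
by rewrite gt_eqF.
Qed.

Lemma omth_ge k : Num.sqrt (3 * EJ / (M * l ^+ 2)) * kap k ^+ 2 <= omth k.
Proof.
rewrite -[X in _ * X <= _](ger0_norm (sqr_ge0 (kap k))) -sqrtr_sqr mulrC -sqrtrM ?sqr_ge0//.
apply: ler_wsqrtr.
have -> : kap k ^+ 2 ^+ 2 * (3 * EJ / (M * l ^+ 2)) = 3 / (M * l ^+ 2) * (EJ * kap k ^+ 4).
  by field; rewrite !gt_eqF.
apply: ler_wpM2l; first by rewrite divr_ge0// mulr_ge0 ?sqr_ge0// ltW.
by rewrite lerDl mulr_ge0 ?sqr_ge0// ltW.
Qed.

Definition Omth : R := Num.sqrt (3 / (M * l ^+ 2) * (EJ + GK * (kap 0)^-1 ^+ 2)).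

(** The torsional term is absorbed by $kap_k^2 \le kap_k^4 / kap_0^2$. *)
Lemma omth_le k : omth k <= Omth * kap k ^+ 2.
Proof.
have k0 := kap_gt0 L_gt0 0; have kk := kap_gt0 L_gt0 k.
have c0 : 0 <= 3 / (M * l ^+ 2) by rewrite divr_ge0// mulr_ge0 ?sqr_ge0// ltW.
rewrite -[X in _ <= _ * X](ger0_norm (sqr_ge0 (kap k))) -sqrtr_sqr mulrC -sqrtrM ?sqr_ge0//.
rewrite /omth; apply: ler_wsqrtr; rewrite [leRHS]mulrCA; apply: ler_wpM2l => //.
have xy : kap 0 ^+ 2 <= kap k ^+ 2 by rewrite ler_pXn2r ?nnegrE ?(ltW k0) ?(ltW kk)//; exact: kap_le.
have -> : kap k ^+ 4 = kap k ^+ 2 ^+ 2 by rewrite -exprM.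
have y0 : 0 < kap 0 ^+ 2 by rewrite exprn_gt0.
have x0 : 0 <= kap k ^+ 2 by exact: sqr_ge0.
rewrite exprVn; move: (kap 0 ^+ 2) (kap k ^+ 2) xy y0 x0 => y x xy y0 x0.
have h : x <= x ^+ 2 / y by rewrite ler_pdivlMr// expr2; exact: ler_wpM2l.
by have := ler_wpM2l (ltW GK_gt0) h; lra.
Qed.

Lemma bnd_ath u C : bnd (wt u) C -> bnd (ath u) (Ath * C).
Proof.
have s0 : 0 < Num.sqrt (3 * EJ / (M * l ^+ 2)).
  by rewrite sqrtr_gt0 divr_gt0 ?mulr_gt0 ?exprn_gt0.
move/bnd_odds; apply: bnd_dom; first by rewrite divr_ge0// ltW// cth_gt0.
move=> k; rewrite /odds /wt /om /= odd_double /= uphalf_double /ath.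
have k0 := kap_gt0 L_gt0 k.
rewrite normrM [X in _ <= _ * X]normrM (ger0_norm (ltW (omth_gt0 k))).
rewrite [X in X * _ <= _]ger0_norm; last by rewrite mulr_ge0 ?sqr_ge0// ltW// cth_gt0.
rewrite [leRHS]mulrA; apply: ler_wpM2r => //; rewrite -[leRHS]mulrA; apply: ler_wpM2l; first exact: ltW cth_gt0.
by rewrite ler_pdivlMl// omth_ge.
Qed.

Lemma awB u v : aw (u - v) = aw u - aw v.
Proof. by apply/funext => k; rewrite /aw !fctE mulrBr. Qed.

Lemma athB u v : ath (u - v) = ath u - ath v.
Proof. by apply/funext => k; rewrite /ath !fctE mulrBr. Qed.

Lemma aw_low u C : bnd u C -> bnd (fun k => aw u k / kap k ^+ 2) (cw ^+ 2 * C).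
Proof.
move/bnd_evens/(bndZ cw); rewrite (_ : cw *: evens u = (fun k => aw u k / kap k ^+ 2))//.
apply/funext => k; rewrite fctE /GRing.scale/= /aw /evens; field.
by rewrite gt_eqF// kap_gt0.
Qed.

Lemma ath_low u C : bnd u C -> bnd (fun k => ath u k / kap k ^+ 2) (cth ^+ 2 * C).
Proof.
move/bnd_odds/(bndZ cth); rewrite (_ : cth *: odds u = (fun k => ath u k / kap k ^+ 2))//.
apply/funext => k; rewrite fctE /GRing.scale/= /ath /odds; field.
by rewrite gt_eqF// kap_gt0.
Qed.

(** The full series need not have a continuous second derivative, so these fields hold the
    placeholder 0. Estimates that involve second derivatives go through the smooth truncations
    [stn]. *)
Definition st u : state := State (fser (aw u)) (fser' (aw u)) 0 (fser (ath u)) (fser' (ath u)) 0.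
Definition stn n u : state := State (ssum sin_k (aw u) n) (ssum cos_k (aw u) n) (- psum (aw u) n)
  (ssum sin_k (ath u) n) (ssum cos_k (ath u) n) (- psum (ath u) n).

(** Operator bound from the energy norm into [sball]: sup bounds for values and slopes, with factors
    [(kap 0)^-1] and 1, plus the L^2 bound for the second derivatives of truncations. *)
Definition Kst : R :=
  ((kap 0)^-1 + 1) * Num.sqrt ((Aw + Ath) * Kap (L := L)) + Num.sqrt (L / 2 * (Aw + Ath)).

Lemma Aw_ge0 : 0 <= Aw. Proof. exact: sqr_ge0. Qed.
Lemma Ath_ge0 : 0 <= Ath. Proof. exact: sqr_ge0. Qed.

Lemma Kst_ge0 : 0 <= Kst.
Proof. by rewrite addr_ge0 ?sqrtr_ge0// mulr_ge0 ?sqrtr_ge0// addr_ge0// kap0V_ge0. Qed.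

Lemma ssum_le (t : nat -> R -> R) B b C n x : 0 <= B -> (forall k x, `|t k x| <= B / kap k) -> bnd b C ->
  `|ssum t b n x| <= B * Num.sqrt (C * Kap (L := L)).
Proof.
move=> B0 ht hb; have := ssum_dist L_gt0 t B B0 ht b C x 0 n hb (leq0n n).
by rewrite [X in _ - X]/ssum big_nil subr0 divr1.
Qed.

Lemma Kst_bounds (s C : R) : 0 <= s -> C <= Aw + Ath ->
  [/\ (kap 0)^-1 * Num.sqrt (C * s ^+ 2 * Kap (L := L)) <= Kst * s,
      1 * Num.sqrt (C * s ^+ 2 * Kap (L := L)) <= Kst * s &
      Num.sqrt (L / 2 * (C * s ^+ 2)) <= Kst * s].
Proof.
move=> s0 hC; have K0 := Kap_ge0 (L := L); have k0 := kap0V_ge0 L_gt0.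
have s1 : Num.sqrt (C * s ^+ 2 * Kap (L := L)) <= Num.sqrt ((Aw + Ath) * Kap (L := L)) * s.
  rewrite -{2}(ger0_norm s0) -sqrtr_sqr -sqrtrM; last by rewrite mulr_ge0// addr_ge0 ?sqr_ge0.
  by apply: ler_wsqrtr; rewrite mulrAC; apply: ler_wpM2r; rewrite ?sqr_ge0//; apply: ler_wpM2r.
have s2 : Num.sqrt (L / 2 * (C * s ^+ 2)) <= Num.sqrt (L / 2 * (Aw + Ath)) * s.
  have L0 : 0 <= L / 2 by rewrite divr_ge0// ltW.
  rewrite -{2}(ger0_norm s0) -sqrtr_sqr -sqrtrM; last by rewrite mulr_ge0// addr_ge0 ?sqr_ge0.
  by apply: ler_wsqrtr; rewrite mulrA; apply: ler_wpM2r; rewrite ?sqr_ge0//; apply: ler_wpM2l.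
rewrite /Kst mulrDl; move: s1 s2; have := sqrtr_ge0 ((Aw + Ath) * Kap (L := L)); have := sqrtr_ge0 (L / 2 * (Aw + Ath)).
move: (Num.sqrt _) (Num.sqrt _) (Num.sqrt _) (Num.sqrt _) (kap 0)^-1 k0 => x y z w k k0 x0 y0.
have zs := mulr_ge0 x0 s0; have ys := mulr_ge0 y0 s0; have kys := mulr_ge0 k0 ys; have kxs := mulr_ge0 k0 zs.
move=> h1 h2; have := ler_wpM2l k0 h1; split; lra.
Qed.

Lemma bnd_wt_sqr u s : bnd (wt u) (s ^+ 2) ->
  bnd (aw u) (Aw * s ^+ 2) /\ bnd (ath u) (Ath * s ^+ 2).
Proof. by move=> h; split; [exact: bnd_aw|exact: bnd_ath]. Qed.

Lemma AwE : Aw <= Aw + Ath. Proof. by rewrite lerDl Ath_ge0. Qed.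
Lemma AthE : Ath <= Aw + Ath. Proof. by rewrite lerDr Aw_ge0. Qed.

Lemma nrm_psum_le a n C : bnd a C -> nrm (psum a n) <= Num.sqrt (L / 2 * C).
Proof.
move=> h; rewrite -[leLHS]ger0_norm ?norm2_ge0// -sqrtr_sqr; apply: ler_wsqrtr.
rewrite nrm_psum//; apply: ler_wpM2l; last exact: h.
by rewrite divr_ge0// ltW.
Qed.

Lemma sball_st u (s : R) : 0 <= s -> bnd (wt u) (s ^+ 2) -> sball (L := L) (Kst * s) (st u).
Proof.
move=> s0 /bnd_wt_sqr [ha hb].
have [a1 a2 _] := Kst_bounds s Aw s0 AwE; have [b1 b2 _] := Kst_bounds s Ath s0 AthE.
have K0 : 0 <= Kst * s by rewrite mulr_ge0// Kst_ge0.
split => /=.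
- by split; [exact: fser_cont ha|exact: fser'_cont ha|exact: cont_cst 0].
- by split; [exact: fser_cont hb|exact: fser'_cont hb|exact: cont_cst 0].
- move=> x _; rewrite mul1r in a2; rewrite mul1r in b2; split.
  + exact: le_trans (fser_le L_gt0 _ _ x ha) a1.
  + exact: le_trans (fser'_le L_gt0 _ _ x ha) a2.
  + exact: le_trans (fser_le L_gt0 _ _ x hb) b1.
  + exact: le_trans (fser'_le L_gt0 _ _ x hb) b2.
- by rewrite norm2_0.
Qed.

Lemma sball_stn n u (s : R) : 0 <= s -> bnd (wt u) (s ^+ 2) -> sball (L := L) (Kst * s) (stn n u).
Proof.
move=> s0 /bnd_wt_sqr [ha hb].
have [a1 a2 a3] := Kst_bounds s Aw s0 AwE; have [b1 b2 b3] := Kst_bounds s Ath s0 AthE.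
have cp a : continuous (- psum a n).
  move=> x; apply: continuousN.
  exact: (der_cont _ _ (der_sum n (fun k => a k *: es k) _ (fun k => derZ (a k) _ _ (der_es k)))).
split => /=.
- by split; [exact: ssum_cont sin_k_cont _ _|exact: ssum_cont cos_k_cont _ _|exact: cp].
- by split; [exact: ssum_cont sin_k_cont _ _|exact: ssum_cont cos_k_cont _ _|exact: cp].
- move=> x _; split.
  + exact: le_trans (ssum_le _ _ _ _ n x (kap0V_ge0 L_gt0) (sin_k_le L_gt0) ha) a1.
  + exact: le_trans (ssum_le _ _ _ _ n x ler01 (cos_k_le L_gt0) ha) a2.
  + exact: le_trans (ssum_le _ _ _ _ n x (kap0V_ge0 L_gt0) (sin_k_le L_gt0) hb) b1.
  + exact: le_trans (ssum_le _ _ _ _ n x ler01 (cos_k_le L_gt0) hb) b2.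
- by rewrite !norm2N; split; [exact: le_trans (nrm_psum_le _ _ _ ha) a3|exact: le_trans (nrm_psum_le _ _ _ hb) b3].
Qed.

Lemma ssumB (t : nat -> R -> R) a b n : ssum t (a - b) n = ssum t a n - ssum t b n.
Proof.
apply/funext => x; rewrite [RHS]/GRing.add/= [X in _ + X]/GRing.opp/= /ssum -sumrB.
by apply: eq_bigr => k _; rewrite !fctE mulrBl.
Qed.

Lemma psumB a b n : psum (a - b) n = psum a n - psum b n.
Proof.
rewrite /psum -sumrB; apply: eq_bigr => k _.
by rewrite -scalerBl.
Qed.

Lemma near2_stn n u v (d : R) : 0 <= d -> bnd (wt (u - v)) (d ^+ 2) ->
  near2 (L := L) (Kst * d) (stn n u) (stn n v).
Proof.
move=> d0 /(sball_stn n _ _ d0) [_ _ h1 [h2 h3]]; split.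
  move=> x Dx; have [] := h1 x Dx; rewrite /= awB athB !ssumB.
  by move=> *; split.
move: h2 h3; rewrite /= awB athB !psumB => h2 h3; split.
  by move: h2; congr (nrm _ <= _); rewrite opprB opprK addrC.
by move: h3; congr (nrm _ <= _); rewrite opprB opprK addrC.
Qed.

Lemma smooth_stn n u : smooth (stn n u).
Proof. by split; [exact: der_ssum'|exact: der_ssum|exact: der_ssum']. Qed.

Lemma near0_stn u C (e : R) : bnd (wt u) C -> 0 < e -> \forall n \near \oo, near0 (L := L) e (stn n u) (st u).
Proof.
move=> h e0; have ha := bnd_aw _ _ h; have hb := bnd_ath _ _ h.
have h1 := ssum_unif L_gt0 _ _ (kap0V_ge0 L_gt0) (sin_k_le L_gt0) _ _ ha _ e0.
have h2 := ssum_unif L_gt0 _ _ ler01 (cos_k_le L_gt0) _ _ ha _ e0.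
have h3 := ssum_unif L_gt0 _ _ (kap0V_ge0 L_gt0) (sin_k_le L_gt0) _ _ hb _ e0.
have h4 := ssum_unif L_gt0 _ _ ler01 (cos_k_le L_gt0) _ _ hb _ e0.
by near=> n => x _; split; move: x; near: n.
Unshelve. all: by end_near. Qed.

Variables (c m : R) (Hx Hx' y1 y2 : R -> R).
Hypothesis c_ge0 : 0 <= c.
Hypothesis dHx : der Hx Hx'.
Hypothesis cHx' : continuous Hx'.
Hypothesis Hx_ge0 : forall x, D x -> 0 <= Hx x.
Hypothesis dy1 : der y1 y2.
Hypothesis cy2 : continuous y2.
Local Notation Fw := (Fw (L := L) l c m Hx y1).
Local Notation Fth := (Fth (L := L) l c Hx y1).
Local Notation hh := (hh (L := L) c Hx y1).

Definition FF u j : R := if odd j then cth * Fth (st u) j./2 else cw * Fw (st u) j./2.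

Lemma bnd_FF u v C : bnd (Fw (st u) - Fw (st v)) C -> bnd (Fth (st u) - Fth (st v)) C ->
  bnd (FF u - FF v) ((cw ^+ 2 + cth ^+ 2) * C).
Proof.
move=> h1 h2; rewrite mulrDl; apply: bnd_interleave.
  move: (bndZ cw _ _ h1); congr (bnd _ _); apply/funext => k.
  by rewrite /evens /FF !fctE odd_double doubleK /GRing.scale/= mulrBr.
move: (bndZ cth _ _ h2); congr (bnd _ _); apply/funext => k.
by rewrite /odds /FF !fctE /= odd_double/= uphalf_double /GRing.scale/= mulrBr.
Qed.

(** The [LB] hypothesis is a Lipschitz bound for the scalar f in the sup norm of values and first
    derivatives, a norm in which the truncations converge. *)
Lemma LB_stn_cvg (f : @state R -> R) u C : LB (L := L) (fun z => cst (f z)) -> bnd (wt u) C ->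
  f (stn n u) @[n --> \oo] --> f (st u).
Proof.
move=> hf h; have C0 := bnd_ge0 _ _ h; have s0 := sqrtr_ge0 C.
have h' : bnd (wt u) (Num.sqrt C ^+ 2) by rewrite sqr_sqrtr.
have [K K0 [_ hK]] := hf (Kst * Num.sqrt C).
apply/cvgrPdist_le => e e0; have e1 : 0 < e / (K + 1) by rewrite divr_gt0// ltr_wpDl.
have := near0_stn _ _ _ h e1; apply: filterS => n hn; rewrite distrC.
(* Any point of (0, L) reads off the value of a constant function. *)
have D2 : D (L / 2) by rewrite /= in_itv/= divr_gt0//= ltr_pdivrMr// mulr_natr mulr2n ltrDl.
apply: le_trans (hK _ _ _ (sball_stn n _ _ s0 h') (sball_st _ _ s0 h') (ltW e1) hn _ D2) _.
rewrite mulrCA ger_pMr// ler_pdivrMr ?ltr_wpDl//; lra.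
Qed.

(** The strong densities represent the force for truncated states; the resulting Lipschitz bound
    does not depend on the truncation and passes to the limit coordinatewise. *)
Lemma FF_loc (r : R) : exists2 C : R, 0 <= C & forall u v d,
  bnd (wt u) r -> bnd (wt v) r -> bnd (wt (u - v)) d -> bnd (FF u - FF v) (C * d).
Proof.
have [C C0 hC] := force_lip L_gt0 l c m _ _ _ _ dHx cHx' dy1 cy2 (Kst * Num.sqrt r).
have K0 := Kst_ge0.
exists ((cw ^+ 2 + cth ^+ 2) * (C * Kst ^+ 2)); first by apply: mulr_ge0; [apply: addr_ge0; exact: sqr_ge0|apply: mulr_ge0 => //; exact: sqr_ge0].
move=> u v d hu hv huv; have d0 := bnd_ge0 _ _ huv; have r0 := bnd_ge0 _ _ hu.
have hu' : bnd (wt u) (Num.sqrt r ^+ 2) by rewrite sqr_sqrtr.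
have hv' : bnd (wt v) (Num.sqrt r ^+ 2) by rewrite sqr_sqrtr.
have huv' : bnd (wt (u - v)) (Num.sqrt d ^+ 2) by rewrite sqr_sqrtr.
have s0 := sqrtr_ge0 r; have sd := sqrtr_ge0 d.
have step n : bnd (Fw (stn n u) - Fw (stn n v)) (C * Kst ^+ 2 * d) /\
    bnd (Fth (stn n u) - Fth (stn n v)) (C * Kst ^+ 2 * d).
  have := hC _ _ (Kst * Num.sqrt d) (sball_stn n _ _ s0 hu') (sball_stn n _ _ s0 hv') (smooth_stn n u) (smooth_stn n v).
  rewrite exprMn sqr_sqrtr// mulrA; apply; first exact: mulr_ge0.
  exact: near2_stn.
rewrite -mulrA; apply: bnd_FF.
  apply: (bnd_lim (fun n => Fw (stn n u) - Fw (stn n v))) => [j|]; last by near=> n; have [] := step n.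
  by apply: cvgB; apply: (LB_stn_cvg (fun z => Fw z j)) => //; exact: (LB_Fw L_gt0 l c m _ _ _ _ dHx dy1).
apply: (bnd_lim (fun n => Fth (stn n u) - Fth (stn n v))) => [j|]; last by near=> n; have [] := step n.
by apply: cvgB; apply: (LB_stn_cvg (fun z => Fth z j)) => //; exact: (LB_Fth L_gt0 l c _ _ _ _ dHx dy1).
Unshelve. all: by end_near. Qed.

Lemma FF_0 : exists C, bnd (FF 0) C.
Proof.
have [C hC] := force_bnd L_gt0 l c m _ _ _ _ dHx cHx' dy1 cy2 (Kst * 0).
have w0 : bnd (wt 0) (0 ^+ 2) by move=> n; rewrite big1 ?expr0n// => j _; rewrite /wt mulr0 expr0n.
have step n : bnd (Fw (stn n 0)) C /\ bnd (Fth (stn n 0)) C.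
  by apply: hC; [exact: sball_stn|exact: smooth_stn].
have h1 : bnd (Fw (st 0)) C.
  apply: (bnd_lim (fun n => Fw (stn n 0))) => [j|]; last by near=> n; have [] := step n.
  by apply: (LB_stn_cvg (fun z => Fw z j)) w0; exact: (LB_Fw L_gt0 l c m _ _ _ _ dHx dy1).
have h2 : bnd (Fth (st 0)) C.
  apply: (bnd_lim (fun n => Fth (stn n 0))) => [j|]; last by near=> n; have [] := step n.
  by apply: (LB_stn_cvg (fun z => Fth z j)) w0; exact: (LB_Fth L_gt0 l c _ _ _ _ dHx dy1).
exists (cw ^+ 2 * C + cth ^+ 2 * C); apply: bnd_interleave.
  move: (bndZ cw _ _ h1); congr (bnd _ _); apply/funext => k.
  by rewrite /evens /FF !fctE odd_double doubleK.
move: (bndZ cth _ _ h2); congr (bnd _ _); apply/funext => k.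
by rewrite /odds /FF !fctE /= odd_double/= uphalf_double.
Unshelve. all: by end_near. Qed.

Local Notation cable_energy := (cable_energy (L := L) c Hx y1).

Definition potential u : R :=
  cable_energy l (st u) + cable_energy (- l) (st u) - ip (cst m) (fser (aw u)).

Lemma ip2MA p q w : ip (p * q) w = ip p (q * w).
Proof. by rewrite /ip2; apply: eq_Rintegral => x _; rewrite !fctE mulrA. Qed.

Lemma sum_FF u (d : nat -> R) n : \sum_(j < n.*2) FF u j * d j =
  \sum_(k < n) (aw d k / kap k ^+ 2 * Fw (st u) k) + \sum_(k < n) (ath d k / kap k ^+ 2 * Fth (st u) k).
Proof.
rewrite (sum_double (fun j => FF u j * d j)) -big_split/=; apply: eq_bigr => k _.
rewrite /FF /= odd_double/= uphalf_double doubleK /aw /ath.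
by field; rewrite gt_eqF// kap_gt0.
Qed.

Section pairing.
Variables (r : R) (z : @state R).
Hypothesis zr : sball (L := L) r z.
Let Hs := hh l z + hh (- l) z.
Let Hd := hh l z - hh (- l) z.

Let ch x : continuous (hh x z). Proof. exact: cont_LB _ _ zr _ (LB_hh L_gt0 c _ _ _ _ dHx dy1 x). Qed.
Let ct1 : continuous (th1 z). Proof. by have [_ []] := zr. Qed.

Lemma cont_cos_th : continuous (cos \o th z).
Proof. by move=> x; apply: continuous_comp; [have [_ [h _ _] _ _] := zr; exact: h|exact: continuous_cos]. Qed.

Lemma cont_sin_th : continuous (sin \o th z).
Proof. by move=> x; apply: continuous_comp; [have [_ [h _ _] _ _] := zr; exact: h|exact: continuous_sin]. Qed.

Lemma pairing_w a C : bnd a C -> \sum_(k < n) a k / kap k ^+ 2 * Fw z k @[n --> \oo] -->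
  ip Hs (fser' a) + ip (cst m) (fser a).
Proof.
move=> ha; under eq_fun => n.
  under eq_bigr => k _ do rewrite /Fw mulrDr.
  rewrite big_split/=; over.
apply: cvgD; [apply: ip_fser'_cvg ha => //|apply: ip_fser_cvg ha => //]; apply: cont_L2 => //.
  exact: contD.
exact: cont_cst.
Qed.

(** Moving $\cos\theta$ and $\sin\theta \, \theta_x$ into the left factor reduces the claim to the
    convergence of one cosine and one sine series. *)
Lemma pairing_th b C : bnd b C -> \sum_(k < n) b k / kap k ^+ 2 * Fth z k @[n --> \oo] -->
  l * ip Hd ((cos \o th z) * fser' b - (sin \o th z) * (fser b * th1 z)).
Proof.
move=> hb; have ccos := cont_cos_th; have csin := cont_sin_th.
have cHd : continuous Hd by exact: contB.
have cL f : continuous f -> L2 L f by exact: cont_L2.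
have cHc : continuous (Hd * (cos \o th z)) by exact: contM.
have cHst : continuous (Hd * ((sin \o th z) * th1 z)) by do 2!apply: contM => //.
have X1 : L2 L ((cos \o th z) * fser' b).
  by apply: cL; apply: contM => //; exact: fser'_cont hb.
have X2 : L2 L ((sin \o th z) * (fser b * th1 z)).
  by apply: cL; apply: contM => //; apply: contM => //; exact: fser_cont hb.
have hHd := cL _ cHd.
have -> : ip Hd ((cos \o th z) * fser' b - (sin \o th z) * (fser b * th1 z)) =
    ip (Hd * (cos \o th z)) (fser' b) - ip (Hd * ((sin \o th z) * th1 z)) (fser b).
  rewrite ip2Br// !ip2MA; congr (_ - ip _ _); apply/funext => x; rewrite !fctE; ring.
have E n : \sum_(k < n) (b k / kap k ^+ 2 * Fth z k) =
  l * (\sum_(k < n) b k / kap k ^+ 2 * ip (Hd * (cos \o th z)) (kap k *: cs k)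
    - \sum_(k < n) b k / kap k ^+ 2 * ip (Hd * ((sin \o th z) * th1 z)) (es k)).
  rewrite -sumrB big_distrr/=; apply: eq_bigr => k _.
  rewrite /Fth -/Hd ip2Br; first last.
  - exact: cL.
  - by apply: cL; apply: contM => //; apply: contM => //; exact: cont_es.
  - by apply: cL; apply: contM => //; apply: contZ; exact: cont_cs.
  rewrite !ip2MA (_ : (sin \o th z) * th1 z * es k = (sin \o th z) * (th1 z * es k)); last by rewrite mulrA.
  ring.
under eq_fun do rewrite E.
apply: cvgM; first exact: cvg_cst.
by apply: cvgB; [exact: ip_fser'_cvg (cL _ cHc) hb|exact: ip_fser_cvg (cL _ cHst) hb].
Qed.

End pairing.

(** The scalings in [FF] and in the coordinates combine so that the pairing of sequences is the
    virtual work of both cables and of gravity along v - u. *)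
Lemma force_pairing_cvg u v C C' : bnd (wt u) C -> bnd (wt v) C' ->
  \sum_(j < n.*2) FF u j * (v j - u j) @[n --> \oo] -->
  ip (hh l (st u)) (dslope l (st u) (st v)) + ip (hh (- l) (st u)) (dslope (- l) (st u) (st v))
   + ip (cst m) (fser (aw (v - u))).
Proof.
move=> hu hv; set zu := st u; set zv := st v; pose a := aw (v - u); pose b := ath (v - u).
have hw : bnd (wt (v - u)) (2 * C' + 2 * C) by rewrite wtB; exact: bndB.
have ha := bnd_aw _ _ hw; have hb := bnd_ath _ _ hw.
have [hau hbu] : bnd (aw u) (Aw * C) /\ bnd (ath u) (Ath * C) by split; [exact: bnd_aw|exact: bnd_ath].
have [hav hbv] : bnd (aw v) (Aw * C') /\ bnd (ath v) (Ath * C') by split; [exact: bnd_aw|exact: bnd_ath].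
have E1 : w1 zv - w1 zu = fser' a by rewrite /= /a awB (fser'B L_gt0 _ _ _ _ hav hau).
have E2 : th zv - th zu = fser b by rewrite /= /b athB (fserB L_gt0 _ _ _ _ hbv hbu).
have E3 : th1 zv - th1 zu = fser' b by rewrite /= /b athB (fser'B L_gt0 _ _ _ _ hbv hbu).
have zr : sball (L := L) (Kst * Num.sqrt C) zu.
  by apply: sball_st; rewrite ?sqrtr_ge0// sqr_sqrtr//; exact: bnd_ge0 hu.
have ch x : L2 L (hh x zu) := cont_L2 L_gt0 _ (cont_LB _ _ zr _ (LB_hh L_gt0 c _ _ _ _ dHx dy1 x)).
have ct1 : continuous (th1 zu) := fser'_cont L_gt0 _ _ hbu.
have ccos := cont_cos_th _ _ zr; have csin := cont_sin_th _ _ zr.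
have la' := fser'_L2 L_gt0 _ _ ha.
have -> : ip (hh l zu) (dslope l zu zv) + ip (hh (- l) zu) (dslope (- l) zu zv) + ip (cst m) (fser a) =
    (ip (hh l zu + hh (- l) zu) (fser' a) + ip (cst m) (fser a)) +
    l * ip (hh l zu - hh (- l) zu) ((cos \o th zu) * fser' b - (sin \o th zu) * (fser b * th1 zu)).
  rewrite /dslope E1 E2 E3; set X := _ * _ - _.
  have hX : L2 L X.
    apply: cont_L2 => //; apply: contB; apply: contM => //; first exact: fser'_cont hb.
    by apply: contM => //; exact: fser_cont hb.
  have h1 := ch l; have h2 := ch (- l).
  move: (X) hX => Y hY; rewrite !ip2Dr// !ip2Zr// ip2Dl// ip2Bl//.
  move: (ip (hh l zu) (fser' a)) (ip (hh (- l) zu) (fser' a)) (ip (cst m) _) (ip (hh l zu) Y) (ip _ Y) => *.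
  ring.
under eq_fun do rewrite (sum_FF u (v - u)).
by apply: cvgD; [exact: (pairing_w _ _ zr) ha|exact: (pairing_th _ _ zr) hb].
Qed.

(** The cable remainders are quadratic in the L^2 norms of the changes of w_x, theta and theta_x,
    and interpolation turns each square into dV times d0. [S] collects the interpolation constants,
    the scalings and the comparison constants [Aw], [Ath]. *)
Lemma potential_taylor (r : R) : exists2 C : R, 0 <= C & forall u v dV d0,
  bnd (wt u) r -> bnd (wt v) r -> 0 <= dV -> 0 <= d0 ->
  bnd (wt (u - v)) (dV ^+ 2) -> bnd (u - v) (d0 ^+ 2) ->
  forall e : R, 0 < e -> exists n0, forall n, (n0 <= n)%N ->
    `|potential v - potential u + \sum_(j < n.*2) FF u j * (v j - u j)| <= C * dV * d0 + e.
Proof.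
have s0 := sqrtr_ge0 r; have K0 := Kst_ge0; have Ks := mulr_ge0 K0 s0.
have [K1 K10 hK1] := cable_taylor L_gt0 c _ _ _ _ c_ge0 dHx dy1 l _ Ks.
have [K2 K20 hK2] := cable_taylor L_gt0 c _ _ _ _ c_ge0 dHx dy1 (- l) _ Ks.
pose qa := Num.sqrt Aw * cw; pose qb := Num.sqrt Ath * cth; pose k2 := (kap 0)^-1 ^+ 2.
have qa0 : 0 <= qa by rewrite mulr_ge0 ?sqrtr_ge0.
have qb0 : 0 <= qb by rewrite mulr_ge0 ?sqrtr_ge0.
have k20 : 0 <= k2 by exact: sqr_ge0.
have L20 : 0 <= L / 2 by rewrite divr_ge0// ltW.
pose S := L / 2 * (qa + qb + k2 * qb).
have S0 : 0 <= S by rewrite mulr_ge0// !addr_ge0// mulr_ge0.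
exists ((K1 + K2) * S); first by rewrite mulr_ge0// addr_ge0.
move=> u v dV d0 hu hv dV0 d00 hV h0 e e0.
have r0 := bnd_ge0 _ _ hu.
have hu' : bnd (wt u) (Num.sqrt r ^+ 2) by rewrite sqr_sqrtr.
have hv' : bnd (wt v) (Num.sqrt r ^+ 2) by rewrite sqr_sqrtr.
have zu := sball_st _ _ s0 hu'; have zv := sball_st _ _ s0 hv'.
have [hau hbu] := bnd_wt_sqr _ _ hu'; have [hav hbv] := bnd_wt_sqr _ _ hv'.
pose a := aw (v - u); pose b := ath (v - u).
have vuE : v - u = - (u - v) by rewrite opprB.
have hV' : bnd (wt (v - u)) (dV ^+ 2).
  by rewrite vuE -scaleN1r wtZ scaleN1r; exact: bndN.
have h0' : bnd (v - u) (d0 ^+ 2) by rewrite vuE; exact: bndN.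
have ha : bnd a ((Num.sqrt Aw * dV) ^+ 2) by rewrite exprMn sqr_sqrtr ?Aw_ge0//; exact: bnd_aw.
have hb : bnd b ((Num.sqrt Ath * dV) ^+ 2) by rewrite exprMn sqr_sqrtr ?Ath_ge0//; exact: bnd_ath.
have ha' : bnd (fun k => a k / kap k ^+ 2) ((cw * d0) ^+ 2) by rewrite exprMn; exact: aw_low.
have hb' : bnd (fun k => b k / kap k ^+ 2) ((cth * d0) ^+ 2) by rewrite exprMn; exact: ath_low.
have pa : 0 <= Num.sqrt Aw * dV by rewrite mulr_ge0 ?sqrtr_ge0.
have pb : 0 <= Num.sqrt Ath * dV by rewrite mulr_ge0 ?sqrtr_ge0.
have pa' : 0 <= cw * d0 by rewrite mulr_ge0 ?sqrtr_ge0.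
have pb' : 0 <= cth * d0 by rewrite mulr_ge0 ?sqrtr_ge0.
have n1 := fser'_interp L_gt0 _ _ _ pa pa' ha ha'.
have n2 := fser'_interp L_gt0 _ _ _ pb pb' hb hb'.
have n3 := fser_interp L_gt0 _ _ _ pb pb' hb hb'.
have E1 : w1 (st v) - w1 (st u) = fser' a by rewrite /= /a awB (fser'B L_gt0 _ _ _ _ hav hau).
have E2 : th (st v) - th (st u) = fser b by rewrite /= /b athB (fserB L_gt0 _ _ _ _ hbv hbu).
have E3 : th1 (st v) - th1 (st u) = fser' b by rewrite /= /b athB (fser'B L_gt0 _ _ _ _ hbv hbu).
have t1 := hK1 _ _ zu zv; have t2 := hK2 _ _ zu zv.
rewrite E1 E2 E3 in t1 t2.
have sumS : nrm (fser' a) ^+ 2 + nrm (fser' b) ^+ 2 + nrm (fser b) ^+ 2 <= S * dV * d0.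
  apply: le_trans (lerD (lerD n1 n2) n3) _.
  by rewrite le_eqVlt; apply/orP; left; apply/eqP; rewrite /S /qa /qb /k2; ring.
have := force_pairing_cvg _ _ _ _ hu hv; move/cvgrPdist_le => /(_ _ e0) [n0 _ hn].
exists n0 => n nn; have := hn n nn.
have mE : potential v - potential u = (cable_energy l (st v) - cable_energy l (st u)) +
    (cable_energy (- l) (st v) - cable_energy (- l) (st u)) - ip (cst m) (fser a).
  have cL f C : bnd f C -> L2 L (fser f) := fser_L2 L_gt0 _ _.
  have hm : L2 L (cst m : R -> R) by apply: cont_L2 => //; exact: cont_cst.
  have l1 := cL _ _ hav; have l2 := cL _ _ hau.
  have -> : fser a = fser (aw v) - fser (aw u) by rewrite /a awB (fserB L_gt0 _ _ _ _ hav hau).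
  rewrite ip2Br// /potential.
  move: (cable_energy l (st v)) (cable_energy l (st u)) (cable_energy (- l) (st v)) (cable_energy (- l) (st u)).
  move: (ip _ (fser (aw v))) (ip _ (fser (aw u))) => *.
  ring.
rewrite mE; move: t1 t2; rewrite -/a.
move: (ip (hh l _) _) (ip (hh (- l) _) _) (ip (cst m) _) (\sum_(j < _) _) => p q s z.
move: (cable_energy l (st v) - _) (cable_energy (- l) (st v) - _) => x y t1 t2 t3.
have -> : x + y - s + z = (x + p) + (y + q) + (- (p + q + s - z)) by ring.
apply: le_trans (ler_normD _ _) _; rewrite normrN; apply: lerD => //.
apply: le_trans (ler_normD _ _) _; apply: le_trans (lerD t1 t2) _.
rewrite -mulrDl; move: (S) sumS => S' sumS'.
have -> : (K1 + K2) * S' * dV * d0 = (K1 + K2) * (S' * dV * d0) by rewrite !mulrA.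
by apply: ler_wpM2l => //; exact: addr_ge0.
Qed.

(** Cable energies are nonnegative because the pre-tension is, and gravity is linear in w. *)
Lemma potential_coer : exists2 c1 : R, 0 <= c1 & forall u (r : R), 0 <= r ->
  bnd (wt u) (r ^+ 2) -> - 0 - c1 * r <= potential u.
Proof.
have K0 := Kst_ge0; exists (`|m| * Kst * L); first by rewrite !mulr_ge0// ltW.
move=> u r r0 hu; have [ha _] := bnd_wt_sqr _ _ hu.
have [_ _ hb _] := sball_st _ _ r0 hu.
have ce a : 0 <= cable_energy a (st u).
  rewrite addr_ge0//; last by rewrite mulr_ge0 ?sqr_ge0// divr_ge0.
  by apply: Rintegral_ge0 => x Dx; apply: mulr_ge0; [exact: Hx_ge0|exact: ltW (gg_gt0 _)].
have := ce l; have := ce (- l).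
have : `|ip (cst m) (fser (aw u))| <= `|m| * Kst * r * L.
  apply: Rint_cont_norm_le => //; [|by rewrite !mulr_ge0|].
    apply: cont_intD => // ; apply: contM; [exact: cont_cst|exact: fser_cont ha].
  move=> x Dx; rewrite normrM -mulrA; apply: ler_wpM2l => //.
  by have [] := hb x Dx.
move=> /ler_normlP[_ h]; rewrite /potential; lra.
Qed.

End coordinates.

(** * Limits within an interval and difference quotients *)

Section limits_within.
Context {R : realType}.

Lemma cvg0_within (I : set R) (f : R -> R) (t : R) :
  (forall e : R, 0 < e -> exists2 d : R, 0 < d & forall s, I s -> `|s - t| < d -> `|f s| <= e) ->
  f s @[s --> within I (nbhs t)] --> 0.
Proof.
move=> h; apply/cvgrPdist_le => e e0; have [d d0 hd] := h e e0.
rewrite near_withinE; apply/nbhs_ballP; exists d => // s sd Is.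
by rewrite sub0r normrN; apply: hd => //; rewrite distrC.
Qed.

Lemma cvg0_within' (I : set R) (f : R -> R) (t : R) :
  (forall e : R, 0 < e -> exists2 d : R, 0 < d & forall s, I s -> s != t -> `|s - t| < d -> `|f s| <= e) ->
  f s @[s --> within I (dnbhs t)] --> 0.
Proof.
move=> h; apply/cvgrPdist_le => e e0; have [d d0 hd] := h e e0.
rewrite near_withinE /dnbhs near_withinE; apply/nbhs_ballP; exists d => // s sd st Is.
by rewrite sub0r normrN; apply: hd => //; rewrite distrC.
Qed.

Lemma within_cvg0 (I : set R) (f : R -> R) (t : R) : f s @[s --> within I (nbhs t)] --> 0 ->
  forall e : R, 0 < e -> exists2 d : R, 0 < d & forall s, I s -> `|s - t| < d -> `|f s| <= e.
Proof.
move=> /cvgrPdist_le h e e0; have := h e e0; rewrite near_withinE => /nbhs_ballP [d d0 hd].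
exists d => // s Is sd; have := hd s; rewrite sub0r normrN; apply => //.
by rewrite /ball/= distrC.
Qed.

Lemma within'_cvg0 (I : set R) (f : R -> R) (t : R) : f s @[s --> within I (dnbhs t)] --> 0 ->
  forall e : R, 0 < e -> exists2 d : R, 0 < d & forall s, I s -> s != t -> `|s - t| < d -> `|f s| <= e.
Proof.
move=> /cvgrPdist_le h e e0; have := h e e0.
rewrite near_withinE /dnbhs near_withinE => /nbhs_ballP [d d0 hd].
exists d => // s Is st sd; have := hd s; rewrite sub0r normrN; apply => //.
by rewrite /ball/= distrC.
Qed.

Definition bcont (q : R -> nat -> R) := forall t e : R, 0 <= t -> 0 < e ->
  exists2 d : R, 0 < d & forall s : R, 0 <= s -> `|s - t| < d -> bnd (q s - q t) e.

(** [bnd_MVT] is applied to q(z) - z q'(t), whose derivative is small near t. *)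
Lemma diff_quot (q q' : R -> nat -> R) :
  (forall j (t : R), 0 <= t -> is_derive t (1 : R) (q ^~ j) (q' t j)) -> bcont q' ->
  forall t e : R, 0 <= t -> 0 < e -> exists2 d : R, 0 < d & forall s : R, 0 <= s -> s != t -> `|s - t| < d ->
    bnd ((s - t)^-1 *: (q s - q t) - q' t) e.
Proof.
move=> dq cq t e t0 e0; have [d d0 hd] := cq t e t0 e0.
exists d => // s s0 st sd.
have seg z : Num.min t s <= z <= Num.max t s -> 0 <= z /\ `|z - t| < d.
  move/ltr_normlP : sd => [d1 d2]; have [ts|ts] := leP t s => /andP[z1 z2];
    (split; [lra|apply/ltr_normlP; split; lra]).
have se := sqrtr_ge0 e.
have st0 : s - t != 0 by rewrite subr_eq0.
have := bnd_MVT (fun z => q z - z *: q' t) (fun z => q' z - q' t) s t (Num.sqrt e) se _ _.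
move=> h; have {}h : bnd ((q s - s *: q' t) - (q t - t *: q' t)) ((Num.sqrt e * `|s - t|) ^+ 2).
  apply: h => [j z /seg[z0 _]|z /seg[z0 zd]]; last by rewrite sqr_sqrtr ?(ltW e0)//; exact: hd.
  have h1 := dq j z z0.
  have h2 : is_derive z (1 : R) (fun z => (z *: q' t) j) (q' t j).
    by apply: (is_derive_eq (is_deriveM (is_derive_id z (1 : R)) (is_derive_cst (q' t j) z (1 : R)))); rewrite /GRing.scale/= mulr0 mulr1 add0r.
  exact: (is_deriveB h1 h2).
have := bndZ (s - t)^-1 _ _ h.
have -> : (s - t)^-1 ^+ 2 * (Num.sqrt e * `|s - t|) ^+ 2 = e.
  by rewrite exprMn sqr_sqrtr ?(ltW e0)// real_normK ?num_real//; field.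
congr (bnd _ _); apply/funext => j; rewrite !fctE /GRing.scale/=; field.
exact: st0.
Qed.

End limits_within.

(** * The dual space and the regularity class of solutions *)

Section dual_norm.
Context {R : realType} {L : R}.
Hypothesis L_gt0 : 0 < L.
Local Notation ip := (ip2 L).
Local Notation nrm := (norm2 L).
Local Notation es := (es (L := L)).
Local Notation kap := (kap (L := L)).
Local Notation sc := (sc (L := L)).
Local Notation psum := (psum (L := L)).
Local Notation fser := (fser (L := L)).
Local Notation fser' := (fser' (L := L)).
Local Notation coef := (coef (L := L)).
Implicit Types (u v phi : R -> R) (a b : nat -> R).

Definition rf a : R -> R := xget (cst 0) [set v | L2 L v /\ forall k, sc v k = a k].

Lemma rfP a C : bnd a C -> L2 L (rf a) /\ forall k, sc (rf a) k = a k.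
Proof.
move=> h; have [v hv cv] := riesz_fischer L_gt0 a C h.
apply: (xgetPex (cst 0) (P := [set v | L2 L v /\ forall k, sc v k = a k])).
exists v; split=> // k; have h1 : sc (psum a n) k @[n --> \oo] --> sc v k.
  apply: cvgM; first exact: cvg_cst.
  by apply: L2_cvg_ip => //; under eq_fun do rewrite norm2BC.
apply/esym; rewrite -(cvg_lim _ h1)//; apply/esym; apply: cvg_lim => //.
apply: (cvg_near_cst (a k)); exists k.+1 => // n /= kn.
by rewrite sc_psum// kn.
Qed.

Lemma sc_lin (c : R) u v k : L2 L u -> L2 L v -> sc (c *: u + v) k = c * sc u k + sc v k.
Proof. by move=> hu hv; rewrite /sc ip2Dl// ip2Zl//; ring. Qed.

Lemma scB u v k : L2 L u -> L2 L v -> sc (u - v) k = sc u k - sc v k.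
Proof. by move=> hu hv; rewrite /sc ip2Bl// mulrBr. Qed.

Lemma nrm_sc_eps u (e : R) : 0 <= e -> L2 L u -> bnd (sc u) (2 / L * e ^+ 2) -> nrm u <= e.
Proof.
move=> e0 hu h; have := nrm_sc_bnd L_gt0 _ _ hu h.
have -> : L / 2 * (2 / L * e ^+ 2) = e ^+ 2 by field; rewrite gt_eqF.
by rewrite ler_pXn2r ?nnegrE ?norm2_ge0.
Qed.

Lemma H2H10_lin (c : R) u v : H2H10 L u -> H2H10 L v ->
  weak_deriv L (wD L (c *: u + v)) (c *: wD L (wD L u) + wD L (wD L v)).
Proof.
move=> hu hv.
have h1 := weak_deriv_lin L_gt0 c _ _ _ _ (H2H10_L2 _ hu) (H2H10_L2 _ hv) (H2H10_wD _ hu) (H2H10_wD _ hv).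
have h2 := weak_deriv_lin L_gt0 c _ _ _ _ (H2H10_L2_1 _ hu) (H2H10_L2_1 _ hv) (H2H10_wD2 _ hu) (H2H10_wD2 _ hv).
apply: (weak_deriv_ae L_gt0 _ _ _ h1.1 (wD_L2 _ _ h1) _ h2).
by have := wD_ae L_gt0 _ _ h1; apply: filterS => x h Dx; rewrite h.
Qed.

(** Since $\phi \mapsto \phi_{xx}$ preserves norms from $H^2 \cap H^1_0$ to L^2, a function v in L^2
    represents in this way an element of the dual, of norm at most that of v. *)
Definition dd v phi : R := ip v (wD L (wD L phi)).

Lemma dd_Hstar v : L2 L v -> Hstar L (dd v).
Proof.
move=> hv; split=> [c u w hu hw|]; last first.
  by exists (nrm v) => u hu; apply: (ip2_CS _ _ hv); exact: H2H10_L2_2.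
have l1 := H2H10_L2_2 _ hu; have l2 := H2H10_L2_2 _ hw.
have h := H2H10_lin c _ _ hu hw.
rewrite /dd -(ip2Zr _ _ _ l1 hv) -(ip2Dr _ _ _ (L2Z _ _ l1) l2 hv).
exact: (ip2_ae _ _ _ _ hv hv (wD_L2 _ _ h) h.1 (ae_eq_refl _ _ _) (wD_ae L_gt0 _ _ h)).
Qed.

Lemma normH2_ge0 u : 0 <= normH2 L u. Proof. exact: sqrtr_ge0. Qed.

Lemma H2H10_0 : H2H10 L (0 : R -> R).
Proof.
have h0 : bnd (0 : nat -> R) 0 by move=> n; rewrite big1// => k _; rewrite expr0n.
have := fser_H2H10 L_gt0 _ _ h0.
by have := fserB L_gt0 _ _ _ _ h0 h0; rewrite !subrr => ->.
Qed.

Lemma Hstar_0 F : Hstar L F -> F 0 = 0.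
Proof.
move=> [h _]; have := h 1 0 0 H2H10_0 H2H10_0.
by rewrite scale1r addr0 mul1r => /eqP; rewrite -subr_eq0 opprD addrA subrr sub0r oppr_eq0 => /eqP.
Qed.

Lemma normstar_le (F : (R -> R) -> R) (C : R) : 0 <= C -> (forall u, H2H10 L u -> `|F u| <= C * normH2 L u) ->
  `|normstar L F| <= C.
Proof.
move=> C0 h; rewrite /normstar; set S := [set r | _].
(* A real [sup] is meaningful for a nonempty bounded set only; the zero function provides an
   element. *)
have S0 : S `|F 0|.
  exists 0; split => //; first exact: H2H10_0.
  have := normH2_sqr L_gt0 _ H2H10_0; have -> : coef 0 = 0.
    by apply/funext => k; rewrite /coef /sc ip20l !mulr0.
  have -> : sqn (0 : nat -> R) = 0.
    by apply: cvg_lim => //; rewrite (_ : sq 0 = cst 0); [exact: cvg_cst|apply/funext => n; rewrite /sq big1// => k _; rewrite expr0n].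
  by rewrite mulr0 => /eqP; rewrite sqrf_eq0 => /eqP ->.
have ubS : ubound S C.
  move=> _ [u [hu n1 ->]]; apply: le_trans (h u hu) _.
  by rewrite -[leRHS]mulr1; apply: ler_wpM2l.
rewrite ger0_norm; first by apply: ge_sup => //; exists `|F 0|.
by apply: le_trans (ub_le_sup _ S0) => //; exists C.
Qed.

(* Parseval: <u, phi> = <- (inverse Laplacian of u), phi_xx>. *)
Lemma ip_dd u phi : L2 L u -> H2H10 L phi -> ip u phi = dd (- fser (sc u)) phi.
Proof.
move=> hu hp; have hb : bnd (sc u) (2 / L * ip u u) by move=> n; exact: bessel.
have l2 := H2H10_L2_2 _ hp; have l0 := H2H10_L2 _ hp.
rewrite /dd ip2Nl//; last exact: fser_L2 hb.
have h1 : ip (psum (sc u) n) phi @[n --> \oo] --> ip u phi.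
  apply: L2_cvg_ip => // ; under eq_fun do rewrite norm2BC; exact: psum_cvg.
have h2 := ip_fser_cvg L_gt0 _ _ _ l2 hb; rewrite [ip _ (fser _)]ip2C in h2.
rewrite -(cvg_lim _ h1)// -(cvg_lim _ (cvgN h2))//; congr (limn _).
apply/funext => n; rewrite [RHS]/GRing.opp/= ip2C ip_psumr// -sumrN big_distrr/=; apply: eq_bigr => k _.
rewrite !scE// sc_wD2//; have k0 := kap_gt0 L_gt0 k.
by field; rewrite gt_eqF.
Qed.

Lemma dual_le v phi (e : R) : 0 <= e -> L2 L v -> bnd (sc v) (2 / L * e ^+ 2) -> H2H10 L phi ->
  `|dd v phi| <= e * normH2 L phi.
Proof.
move=> e0 hv h hp; apply: le_trans (ip2_CS _ _ hv (H2H10_L2_2 _ hp)) _.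
by apply: ler_wpM2r; [exact: normH2_ge0|exact: nrm_sc_eps].
Qed.

(** Poincare's inequality, from [kap 0 <= kap k]. *)
Lemma nrm_normH2 phi : H2H10 L phi -> nrm phi <= (kap 0)^-1 ^+ 2 * normH2 L phi.
Proof.
move=> hp; have hb := coef_bnd L_gt0 _ hp; have h0 := H2H10_L2 _ hp.
have k0 := kap_gt0 L_gt0 0.
apply: nrm_sc_eps => //; first by rewrite mulr_ge0 ?sqr_ge0 ?normH2_ge0.
have := bnd_div_kap L_gt0 _ _ hb.
have -> : (fun k => coef phi k / kap k ^+ 2) = sc phi.
  by apply/funext => k; rewrite /coef; field; rewrite gt_eqF// kap_gt0.
by apply: bnd_le; rewrite le_eqVlt; apply/orP; left; apply/eqP; ring.
Qed.

Lemma L2_Hstar u : L2 L u -> Hstar L (L2_to_Hstar L u).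
Proof.
move=> hu; split=> [c v w hv hw|].
  by have := H2H10_L2 _ hv; have := H2H10_L2 _ hw => *; rewrite /L2_to_Hstar ip2Dr// ip2Zr.
exists (nrm u * (kap 0)^-1 ^+ 2) => v hv; apply: le_trans (ip2_CS _ _ hu (H2H10_L2 _ hv)) _.
by rewrite -mulrA; apply: ler_wpM2l; [exact: norm2_ge0|exact: nrm_normH2].
Qed.

Lemma normstar_L2 (F : (R -> R) -> R) u (e : R) : 0 <= e -> L2 L u -> nrm u <= e ->
  (forall phi, H2H10 L phi -> F phi = ip u phi) -> `|normstar L F| <= e * (kap 0)^-1 ^+ 2.
Proof.
move=> e0 hu he hF; apply: normstar_le => [|phi hp]; first by rewrite mulr_ge0 ?sqr_ge0.
rewrite hF//; apply: le_trans (ip2_CS _ _ hu (H2H10_L2 _ hp)) _.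
by rewrite -mulrA; apply: ler_pM; rewrite ?norm2_ge0//; exact: nrm_normH2.
Qed.

Section curves.
Variables (T : \bar R) (p p' p'' : R -> nat -> R).
Let p2 t k := kap k ^+ 2 * p t k.
Let pm t k := p'' t k / kap k ^+ 2.
Hypothesis p2_bnd : forall t : R, 0 <= t -> exists C, bnd (p2 t) C.
Hypothesis p'_bnd : forall t : R, 0 <= t -> exists C, bnd (p' t) C.
Hypothesis pm_bnd : forall t : R, 0 <= t -> exists C, bnd (pm t) C.
Hypothesis p2_cont : bcont p2.
Hypothesis p'_cont : bcont p'.
Hypothesis pm_cont : bcont pm.
Hypothesis dp : forall j (t : R), 0 <= t -> is_derive t (1 : R) (p ^~ j) (p' t j).
Hypothesis dp' : forall j (t : R), 0 <= t -> is_derive t (1 : R) (p' ^~ j) (p'' t j).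

(** Up to constants, the $l^2$ norms of [p2], [p'] and [pm] are the norms of displacement, velocity
    and acceleration in H^2, L^2 and the dual. The sign in [accel] offsets the one in the
    coefficients of $\phi_{xx}$. *)
Definition displ t : R -> R := fser (p2 t).
Definition veloc t : R -> R := rf (p' t).
Definition accel t : (R -> R) -> R := dd (rf (- pm t)).
Local Notation I := (time_interval T).

Lemma displ_H2H10 t : 0 <= t -> H2H10 L (displ t).
Proof. by move=> t0; have [C h] := p2_bnd t t0; exact: fser_H2H10 h. Qed.

Lemma displ_L2 t : 0 <= t -> L2 L (displ t).
Proof. by move=> /displ_H2H10; exact: H2H10_L2. Qed.

Lemma sc_displ t k : 0 <= t -> sc (displ t) k = p t k.
Proof.
move=> t0; have [C h] := p2_bnd t t0; rewrite (sc_fser L_gt0 _ _ _ h) /p2.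
by field; rewrite gt_eqF// kap_gt0.
Qed.

Lemma velocP t : 0 <= t -> L2 L (veloc t) /\ forall k, sc (veloc t) k = p' t k.
Proof. by move=> t0; have [C h] := p'_bnd t t0; exact: rfP h. Qed.

Lemma accelP t : 0 <= t -> L2 L (rf (- pm t)) /\ forall k, sc (rf (- pm t)) k = - pm t k.
Proof. by move=> t0; have [C h] := pm_bnd t t0; exact: rfP (bndN _ _ h). Qed.

Lemma I_ge0 t : I t -> 0 <= t. Proof. by case. Qed.

Lemma eps_pos (e : R) : 0 < e -> 0 < 2 / L * e ^+ 2.
Proof. by move=> e0; rewrite mulr_gt0 ?divr_gt0 ?exprn_gt0. Qed.

Lemma displ_time_H2 : time_C (H2H10 L) (normH2 L) I 0 displ.
Proof.
split => //; split => [t /I_ge0|t /I_ge0 t0]; first exact: displ_H2H10.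
apply: cvg0_within => e e0; have [d d0 hd] := p2_cont t _ t0 (eps_pos e e0).
exists d => // s /I_ge0 s0 sd; have [C1 h1] := p2_bnd s s0; have [C2 h2] := p2_bnd t t0.
have h := hd s s0 sd; have hD := fser_H2H10 L_gt0 _ _ h.
rewrite /displ -(fserB L_gt0 _ _ _ _ h1 h2) ger0_norm ?normH2_ge0//.
rewrite -(@ler_pXn2r _ 2)// ?nnegrE ?normH2_ge0 ?(ltW e0)// normH2_sqr//.
have -> : coef (fser (p2 s - p2 t)) = p2 s - p2 t by apply/funext => k; exact: coef_fser h.
apply: le_trans (ler_wpM2l _ (sqn_le _ _ h)) _; first by rewrite divr_ge0// ltW.
by rewrite le_eqVlt; apply/orP; left; apply/eqP; field; rewrite gt_eqF.
Qed.

Lemma displ_quot t e : 0 <= t -> 0 < e -> exists2 d : R, 0 < d & forall s, 0 <= s -> s != t -> `|s - t| < d ->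
  nrm ((s - t)^-1 *: (displ s - displ t) - veloc t) <= e.
Proof.
move=> t0 e0; have [d d0 hd] := diff_quot p p' dp p'_cont t _ t0 (eps_pos e e0).
exists d => // s s0 st sd; have [v1 v2] := velocP t t0.
have l1 := displ_L2 s s0; have l2 := displ_L2 t t0; have l3 := L2B _ _ l1 l2.
apply: nrm_sc_eps; [exact: ltW|exact: L2B _ _ (L2Z _ _ l3) v1|].
move: (hd s s0 st sd); congr (bnd _ _); apply/funext => k.
rewrite scB//.
rewrite -[_ *: (displ s - displ t)]addr0 sc_lin//.
rewrite scB// v2 !sc_displ// /sc ip20l mulr0 addr0.
by rewrite !fctE.
Qed.

Lemma displ_cont t e : 0 <= t -> 0 < e -> exists2 d : R, 0 < d & forall s, 0 <= s -> `|s - t| < d ->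
  nrm (displ s - displ t) <= e.
Proof.
move=> t0 e0; have K0 : 0 < (kap 0)^-1 ^+ 4 by rewrite exprn_gt0// invr_gt0 kap_gt0.
have [d d0 hd] := p2_cont t _ t0 (divr_gt0 (eps_pos e e0) K0).
exists d => // s s0 sd; have l1 := displ_L2 s s0; have l2 := displ_L2 t t0.
apply: nrm_sc_eps; [exact: ltW|exact: L2B|].
have := bnd_div_kap L_gt0 _ _ (hd s s0 sd); rewrite mulrCA mulfV ?gt_eqF// mulr1.
congr (bnd _ _); apply/funext => k; rewrite scB// !sc_displ// /p2 !fctE.
by field; rewrite gt_eqF// kap_gt0.
Qed.

Lemma veloc_cont t e : 0 <= t -> 0 < e -> exists2 d : R, 0 < d & forall s, 0 <= s -> `|s - t| < d ->
  nrm (veloc s - veloc t) <= e.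
Proof.
move=> t0 e0; have [d d0 hd] := p'_cont t _ t0 (eps_pos e e0).
exists d => // s s0 sd; have [l1 c1] := velocP s s0; have [l2 c2] := velocP t t0.
apply: nrm_sc_eps; [exact: ltW|exact: L2B|].
by move: (hd s s0 sd); congr (bnd _ _); apply/funext => k; rewrite scB// c1 c2 !fctE.
Qed.

Lemma displ_deriv : time_deriv (L2 L) nrm I displ veloc.
Proof.
split=> [t /I_ge0|t /I_ge0 t0|t /I_ge0 t0]; [exact: displ_L2|by have [] := velocP t t0|].
apply: cvg0_within' => e e0; have [d d0 hd] := displ_quot t e t0 e0.
by exists d => // s /I_ge0 s0 st sd; rewrite ger0_norm ?norm2_ge0// hd.
Qed.

Lemma displ_time_L2 : time_C (L2 L) nrm I 1 displ.
Proof.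
split.
  split=> [t /I_ge0|t /I_ge0 t0]; first exact: displ_L2.
  apply: cvg0_within => e e0; have [d d0 hd] := displ_cont t e t0 e0.
  by exists d => // s /I_ge0 s0 sd; rewrite ger0_norm ?norm2_ge0// hd.
exists veloc; first exact: displ_deriv.
split => //; split=> [t /I_ge0 t0|t /I_ge0 t0]; first by have [] := velocP t t0.
apply: cvg0_within => e e0; have [d d0 hd] := veloc_cont t e t0 e0.
by exists d => // s /I_ge0 s0 sd; rewrite ger0_norm ?norm2_ge0// hd.
Qed.

Let k2 : R := (kap 0)^-1 ^+ 2.
Let k2_gt0 : 0 < k2. Proof. by rewrite exprn_gt0// invr_gt0 kap_gt0. Qed.

Lemma star_cont (c : R -> R -> R) : (forall t, 0 <= t -> L2 L (c t)) ->
  (forall t e : R, 0 <= t -> 0 < e -> exists2 d : R, 0 < d & forall s, 0 <= s -> `|s - t| < d ->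
     nrm (c s - c t) <= e) ->
  time_continuous (Hstar L) (normstar L) I (fun t => L2_to_Hstar L (c t)).
Proof.
move=> hc h; split=> [t /I_ge0 t0|t /I_ge0 t0]; first exact: L2_Hstar (hc t t0).
apply: cvg0_within => e e0; have [d d0 hd] := h t (e / k2) t0 (divr_gt0 e0 k2_gt0).
exists d => // s /I_ge0 s0 sd; have l1 := hc s s0; have l2 := hc t t0.
have := normstar_L2 _ _ _ (ltW (divr_gt0 e0 k2_gt0)) (L2B _ _ l1 l2) (hd s s0 sd).
rewrite divfK ?gt_eqF//; apply => phi hp; have l3 := H2H10_L2 _ hp.
by rewrite ip2Bl.
Qed.

Lemma displ_star_deriv : time_deriv (Hstar L) (normstar L) I
  (fun t => L2_to_Hstar L (displ t)) (fun t => L2_to_Hstar L (veloc t)).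
Proof.
split=> [t /I_ge0 t0|t /I_ge0 t0|t /I_ge0 t0]; [exact: L2_Hstar (displ_L2 t t0)|by apply: L2_Hstar; have [] := velocP t t0|].
apply: cvg0_within' => e e0; have [d d0 hd] := displ_quot t (e / k2) t0 (divr_gt0 e0 k2_gt0).
exists d => // s /I_ge0 s0 st sd; have l1 := displ_L2 s s0; have l2 := displ_L2 t t0.
have [v1 _] := velocP t t0; have l3 := L2B _ _ l1 l2; have l4 := L2Z (s - t)^-1 _ l3.
have := normstar_L2 _ _ _ (ltW (divr_gt0 e0 k2_gt0)) (L2B _ _ l4 v1) (hd s s0 st sd).
rewrite divfK ?gt_eqF//; apply => phi hp; have l5 := H2H10_L2 _ hp.
by rewrite ip2Bl// ip2Zl// ip2Bl.
Qed.

(** In the dual norm the velocity is measured through p' divided by [kap k ^+ 2], a curve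
    differentiable in $l^2$ with derivative [pm]. *)
Lemma veloc_star_deriv : time_deriv (Hstar L) (normstar L) I (fun t => L2_to_Hstar L (veloc t)) accel.
Proof.
split=> [t /I_ge0 t0|t /I_ge0 t0|t /I_ge0 t0].
- by apply: L2_Hstar; have [] := velocP t t0.
- by apply: dd_Hstar; have [] := accelP t t0.
apply: cvg0_within' => e e0.
pose q t k := p' t k / kap k ^+ 2.
have dq j (z : R) : 0 <= z -> is_derive z (1 : R) (q ^~ j) (pm z j).
  by move=> z0; have h := dp' j z z0; apply: (is_derive_eq (is_deriveM h (is_derive_cst (kap j ^+ 2)^-1 z (1 : R)))); rewrite /GRing.scale/= mulr0 add0r mulrC.
have [d d0 hd] := diff_quot q pm dq pm_cont t _ t0 (eps_pos e e0).
exists d => // s /I_ge0 s0 st sd; have [l1 c1] := velocP s s0; have [l2 c2] := velocP t t0.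
have [l3 c3] := accelP t t0; have l4 := L2Z (s - t)^-1 _ (L2B _ _ l1 l2).
pose X := (s - t)^-1 *: (veloc s - veloc t).
have scX k : sc X k = (s - t)^-1 * (p' s k - p' t k).
  rewrite /X -[_ *: _]addr0 sc_lin//.
  by rewrite scB// c1 c2 /sc ip20l mulr0 addr0.
have hX : bnd (sc X) (2 / L * ip X X) by move=> n; exact: bessel.
have lf := fser_L2 L_gt0 _ _ hX; have lf' := L2N _ lf.
apply: normstar_le => [|phi hp]; first exact: ltW.
have lp := H2H10_L2 _ hp; have lp2 := H2H10_L2_2 _ hp.
have -> : ((s - t)^-1 *: (L2_to_Hstar L (veloc s) - L2_to_Hstar L (veloc t)) - accel t) phi =
    dd (- fser (sc X) - rf (- pm t)) phi.
  rewrite /dd ip2Bl// -/(dd _ phi) -(ip_dd _ _ l4 hp) ip2Zl//.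
  by rewrite ip2Bl.
apply: dual_le => //; first exact: ltW.
move: (bndN _ _ (hd s s0 st sd)); congr (bnd _ _); apply/funext => k.
have -> : sc (- fser (sc X) - rf (- pm t)) k = - (sc X k / kap k ^+ 2) + pm t k.
  rewrite scB// c3 opprK -(sc_fser L_gt0 _ _ k hX) /sc ip2Nl// mulrN.
  by [].
rewrite scX /q !fctE /GRing.scale/= /pm; field.
by rewrite subr_eq0 st gt_eqF// kap_gt0.
Qed.

Lemma accel_cont : time_continuous (Hstar L) (normstar L) I accel.
Proof.
split=> [t /I_ge0 t0|t /I_ge0 t0]; first by apply: dd_Hstar; have [] := accelP t t0.
apply: cvg0_within => e e0; have [d d0 hd] := pm_cont t _ t0 (eps_pos e e0).
exists d => // s /I_ge0 s0 sd; have [l1 c1] := accelP s s0; have [l2 c2] := accelP t t0.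
apply: normstar_le => [|phi hp]; first exact: ltW.
have lp2 := H2H10_L2_2 _ hp.
have -> : (accel s - accel t) phi = dd (rf (- pm s) - rf (- pm t)) phi by rewrite /dd ip2Bl.
apply: dual_le => //; first exact: ltW.
move: (bndN _ _ (hd s s0 sd)); congr (bnd _ _); apply/funext => k.
by rewrite scB// c1 c2 !fctE opprB opprK addrC.
Qed.

Lemma XT_displ : XT L T displ.
Proof.
split; [exact: displ_time_H2|exact: displ_time_L2|].
split; first by apply: star_cont => [t|]; [exact: displ_L2|exact: displ_cont].
exists (fun t => L2_to_Hstar L (veloc t)); first exact: displ_star_deriv.
split.
  by apply: star_cont => [t t0|]; [have [] := velocP t t0|exact: veloc_cont].
exists accel; first exact: veloc_star_deriv.
by split => //; exact: accel_cont.
Qed.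

Lemma displ_tt : Hstar_tt_deriv L T displ accel.
Proof.
by exists (fun t => L2_to_Hstar L (veloc t)); [exact: displ_star_deriv|exact: veloc_star_deriv].
Qed.

End curves.

End dual_norm.

(** * The mechanical model in terms of sine coefficients *)

Section physical_model.
Context {R : realType}.
Variables (L l M g E I J G K A Ec y0 f : R).
Hypothesis L_gt0 : 0 < L.
Hypothesis l_gt0 : 0 < l.
Hypothesis M_gt0 : 0 < M.
Hypothesis g_gt0 : 0 < g.
Hypothesis A_gt0 : 0 < A.
Hypothesis Ec_gt0 : 0 < Ec.
Hypothesis f_gt0 : 0 < f.
Local Notation mu := (@lebesgue_measure R).
Local Notation D := (`]0, L[%classic : set R).
Local Notation ip := (ip2 L).
Local Notation es := (es (L := L)).
Local Notation kap := (kap (L := L)).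
Local Notation sc := (sc (L := L)).
Local Notation fser := (fser (L := L)).
Local Notation fser' := (fser' (L := L)).
Local Notation coef := (coef (L := L)).
Local Notation Hc := (Hc L M g f).
Local Notation yc := (ycable L M g y0 f).
Local Notation Gam := (Gam L M g y0 f).
Local Notation chi := (chi L M g y0 f).
Implicit Types (u v w th phi psi : R -> R) (a : R).

Definition yslope : R -> R := derive1 yc.
Definition ycurv : R -> R := cst (- (M * g / (2 * Hc))).
Definition weight : R -> R := Hc *: (gg \o yslope).
Definition weight' : R -> R := Hc *: ((ss \o yslope) * ycurv).
Definition stiff : R := A * Ec / Lc L M g y0 f.

Lemma Hc_gt0 : 0 < Hc.
Proof. by rewrite divr_gt0 ?mulr_gt0 ?exprn_gt0. Qed.

Lemma der_yc : der yc (fun x => - (M * g / (2 * Hc)) * x + M * g * L / (4 * Hc)).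
Proof.
move=> x; rewrite /ycable.
have H0 := Hc_gt0; move: Hc H0 => H H0.
apply: is_derive_eq; rewrite /GRing.scale/=; field.
by rewrite gt_eqF.
Qed.

Lemma yslopeE : yslope = fun x => - (M * g / (2 * Hc)) * x + M * g * L / (4 * Hc).
Proof. by apply/funext => x; rewrite /yslope derive1E; have := der_yc x; case=> _ ->. Qed.

Lemma der_yslope : der yslope ycurv.
Proof.
rewrite yslopeE => x; have := derD _ _ _ _ (der_lin (- (M * g / (2 * Hc)))) (fun x => is_derive_cst (M * g * L / (4 * Hc)) x (1 : R)) x.
by congr (is_derive _ _ _ _); rewrite !fctE addr0.
Qed.

Lemma der_yc' : der yc yslope.
Proof. by rewrite yslopeE; exact: der_yc. Qed.

Let cyc : continuous yc := der_cont _ _ der_yc'.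
Let cy1 : continuous yslope := der_cont _ _ der_yslope.

Lemma cont_ycurv : continuous ycurv. Proof. exact: cont_cst. Qed.

Lemma der_weight : der weight weight'.
Proof. by apply: derZ; exact: der_comp der_gg der_yslope. Qed.

Lemma cont_weight' : continuous weight'.
Proof.
apply: contZ; apply: contM; last exact: cont_ycurv.
by move=> x; apply: continuous_comp; [exact: cy1|exact: lip1_cont lip1_ss _].
Qed.

Lemma weight_ge0 x : D x -> 0 <= weight x.
Proof. by move=> _; rewrite /weight /GRing.scale/= mulr_ge0// ltW ?Hc_gt0// gg_gt0. Qed.

Lemma stiff_ge0 : 0 <= stiff.
Proof.
rewrite divr_ge0 ?mulr_ge0 ?(ltW A_gt0) ?(ltW Ec_gt0)//.
by apply: Rintegral_ge0 => x _; exact: sqrtr_ge0.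
Qed.

(** Built from continuous representatives of w, theta and their first derivatives, with 0 in place
    of second derivatives as in [st]. *)
Definition zst w th : state := State (fser (coef w)) (fser' (coef w)) 0 (fser (coef th)) (fser' (coef th)) 0.

Lemma cont_comp_meas (p : R -> R) u : continuous p -> measurable_fun D u -> measurable_fun D (p \o u).
Proof. by move=> cp mu_; apply: measurableT_comp => //; exact: continuous_measurable_fun. Qed.

Lemma L2_ae u v : measurable_fun D v -> ae_eq mu D u v -> L2 L u -> L2 L v.
Proof.
move=> mv uv hu; apply: L2P => //; apply: (intD_ae (u * u)).
- exact: measurable_funM.
- exact: ae_eqM.
- exact: L2_mul.
Qed.

Lemma ae_comp (p : R -> R) u v : ae_eq mu D u v -> ae_eq mu D (p \o u) (p \o v).
Proof. by apply: filterS => x h Dx; rewrite /= h. Qed.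

Section cable_force.
Variables (w th : R -> R).
Hypothesis hw : H2H10 L w.
Hypothesis ht : H2H10 L th.
Let z := zst w th.
Let bw := coef_bnd L_gt0 _ hw.
Let bt := coef_bnd L_gt0 _ ht.

Lemma sball_zst : exists r, sball (L := L) r z.
Proof.
have [C1 b1] : exists C, bnd (coef w) C by eexists; exact: bw.
have [C2 b2] : exists C, bnd (coef th) C by eexists; exact: bt.
exists (((kap 0)^-1 + 1) * Num.sqrt (C1 * Kap (L := L)) + ((kap 0)^-1 + 1) * Num.sqrt (C2 * Kap (L := L))).
have k0 := kap0V_ge0 L_gt0.
have s1 := sqrtr_ge0 (C1 * Kap (L := L)); have s2 := sqrtr_ge0 (C2 * Kap (L := L)).
have p1 := mulr_ge0 k0 s1; have p2 := mulr_ge0 k0 s2.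
split => /=.
- by split; [exact: fser_cont b1|exact: fser'_cont b1|exact: cont_cst 0].
- by split; [exact: fser_cont b2|exact: fser'_cont b2|exact: cont_cst 0].
- move=> x _; have a1 := fser_le L_gt0 _ _ x b1; have a2 := fser'_le L_gt0 _ _ x b1.
  have a3 := fser_le L_gt0 _ _ x b2; have a4 := fser'_le L_gt0 _ _ x b2.
  move: s1 s2 p1 p2 a1 a2 a3 a4; move: (Num.sqrt _) (Num.sqrt _) (kap 0)^-1 => x1 x2 x3.
  by move: `|_| `|_| `|_| `|_| => *; split; lra.
- move: s1 s2 p1 p2; rewrite norm2_0; move: (Num.sqrt _) (Num.sqrt _) (kap 0)^-1 => x1 x2 x3 *.
  by split; lra.
Qed.

Let cable_displ a := w + a *: (sin \o th).

(** w and theta are replaced by their C^1 representatives, for which the chain rule is classical;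
    weak derivatives do not see the null set on which they differ. *)
Lemma weak_deriv_cable a : weak_deriv L (cable_displ a + yc) (slope yslope a z).
Proof.
have [r zr] := sball_zst.
have [dw dt] := (der_fser L_gt0 _ _ bw, der_fser L_gt0 _ _ bt).
have cs1 : continuous (slope yslope a z) := cont_LB r z zr _ (LB_slope L_gt0 _ _ der_yslope a).
have ds : der (fser (coef w) + a *: (sin \o fser (coef th)) + yc) (slope yslope a z).
  apply: derD der_yc'; apply: derD dw _; apply: derZ.
  exact: der_comp (fun x => is_derive_sin x) dt.
have msin : measurable_fun D (sin \o th).
  by apply: cont_comp_meas; [exact: continuous_sin|exact: L2_meas (H2H10_L2 _ ht)].
have hsin : L2 L (sin \o th).
  by apply: (bounded_L2 L_gt0 _ 1) => // x _; rewrite ler_norml sin_geN1 sin_le1.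
have hyc := cont_L2 L_gt0 _ cyc.
have hL : L2 L (cable_displ a + yc).
  by apply: L2D => //; apply: L2D; [exact: H2H10_L2|exact: L2Z].
have hL' := cont_L2 L_gt0 _ (der_cont _ _ ds).
apply: (weak_deriv_ae L_gt0 _ _ _ hL' hL _ (weak_deriv_classical L_gt0 _ _ ds cs1)).
have e1 := fser_coef L_gt0 _ hw; have e2 := fser_coef L_gt0 _ ht.
apply: ae_eqD; last exact: ae_eq_refl.
apply: ae_eqD; first exact: ae_eq_sym.
by apply: ae_eqZ; apply: ae_comp; exact: ae_eq_sym.
Qed.

Lemma Gam_elong a : Gam (cable_displ a) = elong (L := L) yslope a z.
Proof.
have h := weak_deriv_cable a; have [hs _] := h.
have hd := wD_L2 _ _ h; have e := wD_ae L_gt0 _ _ h.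
have cgg : continuous (@gg R) by exact: lip1_cont lip1_gg.
have my : measurable_fun D (gg \o yslope).
  by apply: cont_comp_meas => //; apply: cont_meas.
apply: (Rint_ae ((gg \o wD L (cable_displ a + yc)) - (gg \o yslope)) ((gg \o slope yslope a z) - (gg \o yslope))).
- by apply: measurable_funB => //; apply: cont_comp_meas => //; exact: L2_meas.
- by apply: measurable_funB => //; apply: cont_comp_meas => //; exact: L2_meas.
- by apply: ae_eqB; [exact: ae_comp|exact: ae_eq_refl].
Qed.

Definition hgen a : R -> R := fun x =>
  - (Hc * xi L M g y0 f x + stiff * Gam (cable_displ a)) * chi (cable_displ a) x.

Lemma h_alphaE : h_alpha L l M g A Ec y0 f w th = hgen l.
Proof. by []. Qed.

Lemma h_betaE : h_beta L l M g A Ec y0 f w th = hgen (- l).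
Proof.
have e : w - l *: (sin \o th) = cable_displ (- l) by rewrite /cable_displ scaleNr.
by apply/funext => x; rewrite /h_beta e.
Qed.

Lemma hgen_ae a : ae_eq mu D (hgen a) (hh (L := L) stiff weight yslope a z).
Proof.
have h := weak_deriv_cable a; have := wD_ae L_gt0 _ _ h; apply: filterS => x hx Dx.
rewrite /hgen Gam_elong /chi hx// mulNr.
by [].
Qed.

Lemma hh_L2 a : L2 L (hh (L := L) stiff weight yslope a z).
Proof.
have [r zr] := sball_zst.
exact: cont_L2 L_gt0 _ (cont_LB r z zr _ (LB_hh L_gt0 stiff _ _ _ _ der_weight der_yslope a)).
Qed.

Lemma hgen_L2 a : L2 L (hgen a).
Proof.
apply: L2_ae (hh_L2 a); last by apply: ae_eq_sym; exact: hgen_ae.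
have h := weak_deriv_cable a; have hd := wD_L2 _ _ h.
apply: measurable_funM.
  have -> : (fun x => - (Hc * xi L M g y0 f x + stiff * Gam (cable_displ a))) =
      -1 *: (weight + cst (stiff * Gam (cable_displ a))).
    by rewrite scaleN1r; apply/funext => x.
  apply: cont_meas; apply: contZ; apply: contD; last exact: cont_cst.
  exact: (der_cont _ _ der_weight).
exact: (cont_comp_meas _ _ (lip1_cont _ lip1_ss) (L2_meas _ hd)).
Qed.

Local Notation Fw := (Fw (L := L) l stiff (M * g) weight yslope).
Local Notation Fth := (Fth (L := L) l stiff weight yslope).

(** Brings the right-hand side of the weak formulation to the mode-by-mode form in which it is
    compared with the oscillators. *)
Lemma rhs_w phi : H2H10 L phi -> \sum_(k < n) coef phi k / kap k ^+ 2 * Fw z k @[n --> \oo] -->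
  ip (h_alpha L l M g A Ec y0 f w th + h_beta L l M g A Ec y0 f w th) (wD L phi) + ip (cst (M * g)) phi.
Proof.
move=> hp; have [r zr] := sball_zst; have hb := coef_bnd L_gt0 _ hp.
have := pairing_w L_gt0 l stiff (M * g) _ _ _ _ der_weight der_yslope r z zr _ _ hb.
congr (_ --> _); rewrite h_alphaE h_betaE.
have l1 := hgen_L2 l; have l2 := hgen_L2 (- l); have l3 := hh_L2 l; have l4 := hh_L2 (- l).
congr (_ + _); apply: ip2_ae => //.
- exact: fser'_L2 hb.
- exact: H2H10_L2_1.
- by apply: ae_eqD; apply: ae_eq_sym; exact: hgen_ae.
- by apply: ae_eq_sym; exact: wD_coef.
- by apply: cont_L2 => //; exact: cont_cst.
- by apply: cont_L2 => //; exact: cont_cst.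
- exact: fser_L2 hb.
- exact: H2H10_L2.
- exact: ae_eq_refl.
- by apply: ae_eq_sym; exact: fser_coef.
Qed.

(** The derivative of $\psi \cos\theta$ is computed on C^1 representatives and transferred to [wD]
    almost everywhere. *)
Lemma rhs_th psi : H2H10 L psi -> \sum_(k < n) coef psi k / kap k ^+ 2 * Fth z k @[n --> \oo] -->
  l * ip (h_alpha L l M g A Ec y0 f w th - h_beta L l M g A Ec y0 f w th) (wD L (psi * (cos \o th))).
Proof.
move=> hp; have [r zr] := sball_zst; have hb := coef_bnd L_gt0 _ hp.
have := pairing_th L_gt0 l stiff _ _ _ _ der_weight der_yslope r z zr _ _ hb.
congr (_ --> _); rewrite h_alphaE h_betaE.
have l1 := hgen_L2 l; have l2 := hgen_L2 (- l); have l3 := hh_L2 l; have l4 := hh_L2 (- l).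
set X := _ * _ - _.
have [dp dt] := (der_fser L_gt0 _ _ hb, der_fser L_gt0 _ _ bt).
have [cp cp'] := (fser_cont L_gt0 _ _ hb, fser'_cont L_gt0 _ _ hb).
have ct' := fser'_cont L_gt0 _ _ bt.
have ccos := cont_cos_th _ _ zr; have csin := cont_sin_th _ _ zr.
have cX : continuous X.
  by apply: contB; apply: contM => //; apply: contM.
have dX : der (fser (coef psi) * (cos \o fser (coef th))) X.
  have h := derM _ _ _ _ dp (der_comp _ _ _ _ (fun x => is_derive_cos x) dt).
  move=> x; have := h x; congr (is_derive _ _ _ _).
  rewrite -[LHS]/(fser (coef psi) x * (- sin (fser (coef th) x) * fser' (coef th) x)
    + cos (fser (coef th) x) * fser' (coef psi) x).
  rewrite -[RHS]/(cos (fser (coef th) x) * fser' (coef psi) x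
    - sin (fser (coef th) x) * (fser (coef psi) x * fser' (coef th) x)).
  by move: (fser _ x) (fser' _ x) (fser' _ x) (fser _ x) => *; ring.
have mcos : measurable_fun D (cos \o th).
  by apply: cont_comp_meas; [exact: continuous_cos|exact: L2_meas (H2H10_L2 _ ht)].
have eX : ae_eq mu D (fser (coef psi) * (cos \o fser (coef th))) (psi * (cos \o th)).
  by apply: ae_eqM; [|apply: ae_comp]; apply: ae_eq_sym; exact: fser_coef.
have hL' := cont_L2 L_gt0 _ (der_cont _ _ dX).
have hL : L2 L (psi * (cos \o th)).
  apply: L2_ae eX hL'; apply: measurable_funM => //; exact: L2_meas (H2H10_L2 _ hp).
have hwd := weak_deriv_ae L_gt0 _ _ _ hL' hL eX (weak_deriv_classical L_gt0 _ _ dX cX).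
congr (_ * _); apply: ip2_ae => //.
- exact: cont_L2.
- exact: wD_L2 hwd.
- by apply: ae_eqB; apply: ae_eq_sym; exact: hgen_ae.
- by apply: ae_eq_sym; exact: wD_ae.
Qed.

End cable_force.

End physical_model.

(** * Curves of coordinates for each unknown *)

Section curve_components.
Context {R : realType}.
Implicit Types (q r : R -> nat -> R) (c a b : nat -> R).

Definition bnds q := forall t : R, 0 <= t -> exists C, bnd (q t) C.

Lemma bnds_dom q r K : 0 <= K -> (forall t k, 0 <= t -> `|r t k| <= K * `|q t k|) -> bnds q -> bnds r.
Proof. by move=> K0 h hq t t0; have [C hC] := hq t t0; exists (K ^+ 2 * C); apply: bnd_dom hC => // k; exact: h. Qed.

Lemma bcont_dom q r K : 0 <= K ->
  (forall s t k, 0 <= s -> 0 <= t -> `|r s k - r t k| <= K * `|q s k - q t k|) -> bcont q -> bcont r.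
Proof.
move=> K0 h hq t e t0 e0; have e1 : 0 < e / (K ^+ 2 + 1) by rewrite divr_gt0// ltr_wpDl ?sqr_ge0.
have [d d0 hd] := hq t _ t0 e1; exists d => // s s0 sd.
apply: (bnd_le _ (K ^+ 2 * (e / (K ^+ 2 + 1)))).
  rewrite mulrCA ger_pMr// ler_pdivrMr ?mul1r ?lerDl//.
  by rewrite ltr_wpDl ?sqr_ge0.
by apply: (bnd_dom _ (q s - q t)) => // [k|]; [exact: h|exact: hd].
Qed.

Lemma bnds_sub (i : nat -> nat) q : (forall a C, bnd a C -> bnd (fun k => a (i k)) C) ->
  bnds q -> bnds (fun t k => q t (i k)).
Proof. by move=> hi hq t t0; have [C hC] := hq t t0; exists C; exact: hi hC. Qed.

Lemma bcont_sub (i : nat -> nat) q : (forall a C, bnd a C -> bnd (fun k => a (i k)) C) ->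
  bcont q -> bcont (fun t k => q t (i k)).
Proof.
move=> hi hq t e t0 e0; have [d d0 hd] := hq t e t0 e0; exists d => // s s0 sd.
exact: hi _ _ (hd s s0 sd).
Qed.

Lemma bnds_add q r : bnds q -> bnds r -> bnds (fun t => q t + r t).
Proof.
move=> hq hr t t0; have [C h1] := hq t t0; have [C' h2] := hr t t0.
by exists (2 * C + 2 * C'); exact: bndD.
Qed.

Lemma bcont_add q r : bcont q -> bcont r -> bcont (fun t => q t + r t).
Proof.
move=> hq hr t e t0 e0; have e4 : 0 < e / 4 by rewrite divr_gt0.
have [d d0 hd] := hq t _ t0 e4; have [d' d'0 hd'] := hr t _ t0 e4.
exists (Num.min d d'); first by rewrite lt_min d0.
move=> s s0; rewrite lt_min => /andP[sd sd'].
have := bndD _ _ _ _ (hd s s0 sd) (hd' s s0 sd').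
have -> : 2 * (e / 4) + 2 * (e / 4) = e by field.
by congr (bnd _ _); rewrite opprD addrACA.
Qed.

End curve_components.

Section component.
Context {R : realType} {L : R}.
Hypothesis L_gt0 : 0 < L.
Local Notation kap := (kap (L := L)).
Variables (om : nat -> R) (U U' f : R -> nat -> R) (i : nat -> nat) (s K1 K2 : R).
Hypothesis om_gt0 : forall j, 0 < om j.
Hypothesis hi : forall (a : nat -> R) C, bnd a C -> bnd (fun k => a (i k)) C.
Hypothesis K1_ge0 : 0 <= K1.
Hypothesis K2_ge0 : 0 <= K2.
Hypothesis hK1 : forall k, kap k ^+ 2 <= K1 * om (i k).
Hypothesis hK2 : forall k, om (i k) <= K2 * kap k ^+ 2.
Hypothesis U_bnd : bnds (fun t => wt om (U t)).
Hypothesis U_cont : bcont (fun t => wt om (U t)).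
Hypothesis U'_bnd : bnds U'.
Hypothesis U'_cont : bcont U'.
Hypothesis f_bnd : bnds f.
Hypothesis f_cont : bcont f.
Hypothesis dU : forall j (t : R), 0 <= t -> is_derive t (1 : R) (U ^~ j) (U' t j).
Hypothesis dU' : forall j (t : R), 0 <= t -> is_derive t (1 : R) (U' ^~ j) (f t j - om j ^+ 2 * U t j).

(** [i] selects the even or the odd coordinates and s is [cw] or [cth], so one argument serves both
    unknowns; [hK1] and [hK2] make the frequencies comparable to [kap k ^+ 2]. *)
Definition pos_c t k := s * U t (i k).
Definition vel_c t k := s * U' t (i k).
Definition acc_c t k := s * (f t (i k) - om (i k) ^+ 2 * U t (i k)).

Let k0 k : 0 < kap k := kap_gt0 L_gt0 k.

Let pos_le x k : `|kap k ^+ 2 * (s * x)| <= `|s| * K1 * `|om (i k) * x|.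
Proof.
have := hK1 k; have := sqr_ge0 (kap k); move: (kap k ^+ 2) (om (i k)) (om_gt0 (i k)) => z w w0 z0 zw.
rewrite !normrM (ger0_norm z0) (ger0_norm (ltW w0)).
have := ler_wpM2r (normr_ge0 x) (ler_wpM2l (normr_ge0 s) zw); lra.
Qed.

Let low_le x k : `|s * x / kap k ^+ 2| <= `|s| * (kap 0)^-1 ^+ 2 * `|x|.
Proof.
have : (kap k ^+ 2)^-1 <= (kap 0)^-1 ^+ 2.
  rewrite exprVn lef_pV2 ?posrE ?exprn_gt0//.
  by rewrite ler_pXn2r ?nnegrE ?(ltW (k0 _))//; exact: kap_le.
have : 0 <= (kap k ^+ 2)^-1 by rewrite invr_ge0 sqr_ge0.
move: (kap k ^+ 2)^-1 ((kap 0)^-1 ^+ 2) => z w z0 zw.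
rewrite !normrM (ger0_norm z0).
have := ler_wpM2r (normr_ge0 x) (ler_wpM2l (normr_ge0 s) zw); lra.
Qed.

Let mid_le x k : `|s * (om (i k) ^+ 2 * x) / kap k ^+ 2| <= `|s| * K2 * `|om (i k) * x|.
Proof.
have : om (i k) / kap k ^+ 2 <= K2 by rewrite ler_pdivrMr ?exprn_gt0.
have : 0 <= (kap k ^+ 2)^-1 by rewrite invr_ge0 sqr_ge0.
move: (kap k ^+ 2)^-1 (om (i k)) (om_gt0 (i k)) => z w w0 z0 zw.
rewrite expr2 !normrM (ger0_norm z0) (ger0_norm (ltW w0)).
have h : 0 <= `|s| * (w * `|x|) by rewrite !mulr_ge0// ltW.
by have := ler_wpM2l h zw; lra.
Qed.

Lemma pos_c_bnd : bnds (fun t k => kap k ^+ 2 * pos_c t k).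
Proof.
apply: (bnds_dom (fun t k => wt om (U t) (i k)) _ (`|s| * K1)); first by rewrite mulr_ge0.
  by move=> x k _; exact: pos_le.
exact: (bnds_sub i _ hi U_bnd).
Qed.

Lemma pos_c_cont : bcont (fun t k => kap k ^+ 2 * pos_c t k).
Proof.
apply: (bcont_dom (fun t k => wt om (U t) (i k)) _ (`|s| * K1)); first by rewrite mulr_ge0.
  by move=> x y k _ _; rewrite /pos_c /wt -!mulrBr; exact: pos_le.
exact: (bcont_sub i _ hi U_cont).
Qed.

Lemma vel_c_bnd : bnds vel_c.
Proof.
apply: (bnds_dom (fun t k => U' t (i k)) _ `|s|) => //; last exact: (bnds_sub i _ hi U'_bnd).
by move=> x k _; rewrite normrM.
Qed.

Lemma vel_c_cont : bcont vel_c.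
Proof.
apply: (bcont_dom (fun t k => U' t (i k)) _ `|s|) => //; last exact: (bcont_sub i _ hi U'_cont).
by move=> x y k _ _; rewrite /vel_c -mulrBr normrM.
Qed.

Let accE : (fun t k => acc_c t k / kap k ^+ 2) =
  (fun t => (fun k => s * f t (i k) / kap k ^+ 2) + (fun k => - (s * (om (i k) ^+ 2 * U t (i k)) / kap k ^+ 2))).
Proof. by apply/funext => t; apply/funext => k; rewrite [RHS]/GRing.add/= /acc_c mulrBr mulrBl. Qed.

Lemma acc_c_bnd : bnds (fun t k => acc_c t k / kap k ^+ 2).
Proof.
rewrite accE; apply: bnds_add.
  apply: (bnds_dom (fun t k => f t (i k)) _ (`|s| * (kap 0)^-1 ^+ 2)).
  - by rewrite mulr_ge0 ?sqr_ge0.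
  - by move=> x k _; exact: low_le.
  - exact: (bnds_sub i _ hi f_bnd).
apply: (bnds_dom (fun t k => wt om (U t) (i k)) _ (`|s| * K2)).
- by rewrite mulr_ge0.
- by move=> x k _; rewrite normrN; exact: mid_le.
- exact: (bnds_sub i _ hi U_bnd).
Qed.

Lemma acc_c_cont : bcont (fun t k => acc_c t k / kap k ^+ 2).
Proof.
rewrite accE; apply: bcont_add.
  apply: (bcont_dom (fun t k => f t (i k)) _ (`|s| * (kap 0)^-1 ^+ 2)).
  - by rewrite mulr_ge0 ?sqr_ge0.
  - by move=> x y k _ _; rewrite -mulrBl -mulrBr; exact: low_le.
  - exact: (bcont_sub i _ hi f_cont).
apply: (bcont_dom (fun t k => wt om (U t) (i k)) _ (`|s| * K2)).
- by rewrite mulr_ge0.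
- by move=> x y k _ _; rewrite -opprD normrN -mulrBl -!mulrBr; exact: mid_le.
- exact: (bcont_sub i _ hi U_cont).
Qed.

Lemma pos_c_der j (t : R) : 0 <= t -> is_derive t (1 : R) (pos_c ^~ j) (vel_c t j).
Proof. by move=> t0; exact: (is_deriveZ s (dU (i j) t t0)). Qed.

Lemma vel_c_der j (t : R) : 0 <= t -> is_derive t (1 : R) (vel_c ^~ j) (acc_c t j).
Proof. by move=> t0; exact: (is_deriveZ s (dU' (i j) t t0)). Qed.

End component.

(** * One-sided derivatives on a compact interval *)

Section one_sided_derivatives.
Context {R : realType}.
Implicit Types (p q : R -> R).

(* Derivative along [0, tau], one-sided at the end points. *)
Definition wder (tau : R) p p' := forall t e : R, 0 <= t <= tau -> 0 < e ->
  exists2 d : R, 0 < d & forall s : R, 0 <= s <= tau -> `|s - t| < d ->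
    `|p s - p t - p' t * (s - t)| <= e * `|s - t|.

Lemma wderZ tau (c : R) p p' : wder tau p p' -> wder tau (fun t => c * p t) (fun t => c * p' t).
Proof.
move=> h t e tT e0; have c0 : 0 < `|c| + 1 by rewrite ltr_wpDl.
have [d d0 hd] := h t _ tT (divr_gt0 e0 c0); exists d => // s sT sd.
have -> : c * p s - c * p t - c * p' t * (s - t) = c * (p s - p t - p' t * (s - t)) by ring.
rewrite normrM; apply: le_trans (ler_wpM2l (normr_ge0 c) (hd s sT sd)) _.
rewrite mulrA; apply: ler_wpM2r => //; rewrite mulrCA ger_pMr// ler_pdivrMr//.
by rewrite mul1r lerDl.
Qed.

Lemma wder_uniq tau p p' q t : 0 < tau -> wder tau p p' -> wder tau p q -> 0 <= t <= tau -> p' t = q t.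
Proof.
move=> tau0 h1 h2 tT; apply/eqP; rewrite -subr_eq0 -normr_le0; apply/ler_addgt0Pr => e e0.
rewrite add0r; have e2 : 0 < e / 2 by rewrite divr_gt0.
have [d d0 hd] := h1 t _ tT e2; have [d' d'0 hd'] := h2 t _ tT e2.
(* A nearby point of the interval: to the right of t in its first half, to the left in its second
   half. *)
have [s [sT st sd sd']] : exists s, [/\ 0 <= s <= tau, s != t, `|s - t| < d & `|s - t| < d'].
  pose x := Num.min (tau / 2) (Num.min d d' / 2).
  have x0 : 0 < x by rewrite lt_min divr_gt0//= divr_gt0// lt_min d0.
  have xt : x <= tau / 2 by rewrite ge_min lexx.
  have xm : x <= Num.min d d' / 2 by rewrite ge_min lexx orbT.
  have m0 : 0 < Num.min d d' by rewrite lt_min d0.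
  have md : Num.min d d' <= d by rewrite ge_min lexx.
  have md' : Num.min d d' <= d' by rewrite ge_min lexx orbT.
  move: (Num.min d d') x x0 xt xm m0 md md' => m x x0 xt xm m0 md md'.
  have xd : x < d by lra.
  have xd' : x < d' by lra.
  case/andP: tT => t0 tT; have [th|th] := leP t (tau / 2).
    exists (t + x); split; first by apply/andP; split; lra.
    - by rewrite -subr_eq0 addrAC subrr add0r gt_eqF.
    - by rewrite addrAC subrr add0r gtr0_norm.
    - by rewrite addrAC subrr add0r gtr0_norm.
  exists (t - x); split; first by apply/andP; split; lra.
  - by rewrite -subr_eq0 addrAC subrr add0r oppr_eq0 gt_eqF.
  - by rewrite addrAC subrr add0r normrN gtr0_norm.
  - by rewrite addrAC subrr add0r normrN gtr0_norm.
have st0 : 0 < `|s - t| by rewrite normr_gt0 subr_eq0.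
rewrite -(ler_pM2r st0) -normrM.
have -> : (p' t - q t) * (s - t) = (p s - p t - q t * (s - t)) - (p s - p t - p' t * (s - t)) by ring.
apply: le_trans (ler_normB _ _) _; apply: le_trans (lerD (hd' s sT sd') (hd s sT sd)) _.
by rewrite -mulrDl -splitr.
Qed.

Lemma wder_within tau p p' : wder tau p p' -> {within `[0, tau], continuous p}.
Proof.
move=> h; apply/subspace_continuousP => t; rewrite /= in_itv/= => tT; apply/cvgrPdist_le => e e0.
have [d d0 hd] := h t 1 tT ltr01; rewrite near_withinE; apply/nbhs_ballP.
have K0 : 0 < `|p' t| + 1 by rewrite ltr_wpDl.
exists (Num.min d (e / (`|p' t| + 1))); first by rewrite /= lt_min d0 divr_gt0.
move=> s; rewrite /ball/= distrC lt_min => /andP[sd se]; rewrite in_itv/= => sT.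
rewrite distrC; have -> : p s - p t = (p s - p t - p' t * (s - t)) + p' t * (s - t) by ring.
apply: le_trans (ler_normD _ _) _; rewrite normrM.
apply: le_trans (lerD (hd s sT sd) (lexx _)) _; rewrite -mulrDl addrC.
by rewrite -ler_pdivlMl// mulrC ltW.
Qed.

Lemma wder_derive tau p p' t : wder tau p p' -> 0 < t < tau -> is_derive t (1 : R) p (p' t).
Proof.
move=> h /andP[t0 tT]; apply: is_derive_eps => e e0.
have tT' : 0 <= t <= tau by rewrite !ltW.
have [d d0 hd] := h t e tT' e0; near=> s.
apply: hd.
  by apply/andP; split; apply: ltW; near: s; [exact: lt_nbhsr|exact: lt_nbhsl].
by near: s; exact: near_dist.
Unshelve. all: by end_near. Qed.

Lemma quot_wder (I : set R) (tau : R) p p' : (forall t, 0 <= t <= tau -> I t) ->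
  (forall t, I t -> forall e : R, 0 < e -> exists2 d : R, 0 < d & forall s, I s -> s != t -> `|s - t| < d ->
     `|(s - t)^-1 * (p s - p t) - p' t| <= e) -> wder tau p p'.
Proof.
move=> hI h t e tT e0; have [d d0 hd] := h t (hI t tT) e e0; exists d => // s sT sd.
have [->|st] := eqVneq s t; first by rewrite !subrr mulr0 subr0 normr0 mulr0.
have st0 : s - t != 0 by rewrite subr_eq0.
have -> : p s - p t - p' t * (s - t) = ((s - t)^-1 * (p s - p t) - p' t) * (s - t) by field.
by rewrite normrM; apply: ler_wpM2r => //; exact: hd (hI s sT) st sd.
Qed.

End one_sided_derivatives.

(** * Testing with single sines *)

Section evaluation.
Context {R : realType} {L : R}.
Hypothesis L_gt0 : 0 < L.
Local Notation ip := (ip2 L).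
Local Notation nrm := (norm2 L).
Local Notation es := (es (L := L)).
Local Notation kap := (kap (L := L)).
Local Notation sc := (sc (L := L)).
Local Notation fser := (fser (L := L)).
Local Notation coef := (coef (L := L)).

(** Coefficients of minus the second derivative of [es k]; testing with that sine collapses a series
    to one term. *)
Definition kdelta k j : R := if j == k then kap k ^+ 2 else 0.

Lemma sum_kdelta (a : nat -> R) k n : (k < n)%N -> \sum_(j < n) a j * kdelta k j = a k * kap k ^+ 2.
Proof.
move=> kn; rewrite (bigD1 (Ordinal kn))//= /kdelta eqxx big1 ?addr0// => j jk.
by rewrite ifN ?mulr0//; apply: contra jk => /eqP jk; apply/eqP/val_inj.
Qed.

Lemma cvg_kdelta (a : nat -> R) k : \sum_(j < n) a j * kdelta k j @[n --> \oo] --> a k * kap k ^+ 2.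
Proof. by apply: (cvg_near_cst (a k * kap k ^+ 2)); exists k.+1 => // n /= kn; exact: sum_kdelta. Qed.

Lemma bnd_kdelta k : bnd (kdelta k) (kap k ^+ 2 * kap k ^+ 2).
Proof.
move=> n; have [kn|nk] := ltnP k n.
  under eq_bigr do rewrite expr2.
  by rewrite sum_kdelta// /kdelta eqxx.
rewrite big1; first by apply: mulr_ge0; exact: sqr_ge0.
move=> j _; by rewrite /kdelta ifN ?expr0n// neq_ltn (leq_trans (ltn_ord j) nk).
Qed.

Lemma fser_kdelta k : fser (kdelta k) = es k.
Proof.
apply/funext => x; apply: cvg_lim => //; apply: (cvg_near_cst (es k x)); exists k.+1 => // n /= kn.
rewrite /ssum big_mkord; under eq_bigr do rewrite mulrC.
by rewrite (sum_kdelta (fun i => sin_k (L := L) i x))// /sin_k divfK// gt_eqF// exprn_gt0// kap_gt0.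
Qed.

Lemma es_H2H10 k : H2H10 L (es k).
Proof. by rewrite -fser_kdelta; exact: fser_H2H10 (bnd_kdelta k). Qed.

Lemma coef_es k : coef (es k) = kdelta k.
Proof. by rewrite -fser_kdelta; apply/funext => j; exact: coef_fser (bnd_kdelta k). Qed.

Lemma Hstar_lin (a : R) F F' : Hstar L F -> Hstar L F' -> Hstar L (a *: F + F').
Proof.
move=> [h [C hC]] [h' [C' hC']]; split=> [c u v hu hv|].
  by rewrite !fctE /GRing.scale/= h// h'//; ring.
exists (`|a| * C + C') => u hu; rewrite mulrDl.
apply: le_trans (ler_normD _ _) _; apply: lerD; last exact: hC'.
by rewrite normrM -mulrA; apply: ler_wpM2l => //; exact: hC.
Qed.

(** The multiple [c *: es k] lies in the unit ball of the H^2 norm; L + 1 bounds the square root of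
    L / 2 in the exact norm. *)
Lemma star_eval k : exists2 C : R, 0 <= C & forall F, Hstar L F -> `|F (es k)| <= C * `|normstar L F|.
Proof.
have k0 := kap_gt0 L_gt0 k; have k20 : 0 < kap k ^+ 2 by rewrite exprn_gt0.
pose c := (kap k ^+ 2 * (L + 1))^-1; have c0 : 0 < c by rewrite invr_gt0 mulr_gt0// addr_gt0.
exists c^-1 => [|F hF]; first by rewrite invr_ge0 ltW.
have hb := bndZ c _ _ (bnd_kdelta k).
have E : c *: es k = fser (c *: kdelta k) by rewrite (fserZ L_gt0 _ _ _ (bnd_kdelta k)) fser_kdelta.
have hH : H2H10 L (c *: es k) by rewrite E; exact: fser_H2H10 hb.
have n1 : normH2 L (c *: es k) <= 1.
  rewrite -(@ler_pXn2r _ 2)// ?nnegrE ?normH2_ge0// normH2_sqr// expr1n E.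
  have -> : coef (fser (c *: kdelta k)) = c *: kdelta k by apply/funext => j; exact: coef_fser hb.
  have L2 : 0 <= L / 2 by rewrite divr_ge0// ltW.
  apply: le_trans (ler_wpM2l L2 (sqn_le _ _ hb)) _.
  have -> : L / 2 * (c ^+ 2 * (kap k ^+ 2 * kap k ^+ 2)) = L / (2 * (L + 1) ^+ 2).
    rewrite /c; field; rewrite !gt_eqF ?addr_gt0//.
  rewrite ler_pdivrMr ?mulr_gt0 ?exprn_gt0 ?addr_gt0// mul1r; have := L_gt0; nra.
have [hlin [C hC]] := hF.
have Fc : F (c *: es k) = c * F (es k).
  by have := hlin c _ _ (es_H2H10 k) (H2H10_0 L_gt0); rewrite addr0 (Hstar_0 L_gt0 _ hF) addr0.
have : `|F (c *: es k)| <= normstar L F.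
  apply: ub_le_sup; last by exists (c *: es k).
  exists `|C| => _ [u [hu u1 ->]]; apply: le_trans (hC u hu) _.
  apply: le_trans (ler_wpM2r (normH2_ge0 _) (ler_norm C)) _.
  by rewrite -[leRHS]mulr1; apply: ler_wpM2l.
rewrite Fc normrM (ger0_norm (ltW c0)) => h.
by rewrite ler_pdivlMl//; apply: le_trans h (ler_norm _).
Qed.

Lemma star_wder (I : set R) (tau : R) (F F' : R -> (R -> R) -> R) k : (forall t, 0 <= t <= tau -> I t) ->
  time_deriv (Hstar L) (normstar L) I F F' -> wder tau (fun t => F t (es k)) (fun t => F' t (es k)).
Proof.
move=> hI [h1 h2 h3]; apply: (quot_wder I) => // t It e e0; have [C C0 hC] := star_eval k.
have e1 : 0 < e / (C + 1) by rewrite divr_gt0// ltr_wpDl.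
have [d d0 hd] := within'_cvg0 _ _ _ (h3 t It) _ e1; exists d => // s Is st sd.
have hs : Hstar L ((s - t)^-1 *: (F s - F t) - F' t).
  have a1 := Hstar_lin (-1) _ _ (h1 t It) (h1 s Is); have a2 := Hstar_lin (s - t)^-1 _ 0 a1.
  have z0 : Hstar L (0 : (R -> R) -> R).
    by split=> [a u v _ _|]; [rewrite mulr0 addr0|exists 0 => u _; rewrite normr0 mul0r].
  have := Hstar_lin (-1) _ _ (h2 t It) (a2 z0).
  by rewrite !scaleN1r addr0 addrC [- F t + F s]addrC.
have := hC _ hs; move=> h; apply: le_trans h _.
apply: le_trans (ler_wpM2l C0 (hd s Is st sd)) _.
by rewrite mulrCA ger_pMr// ler_pdivrMr ?ltr_wpDl// mul1r lerDl.
Qed.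

Lemma L2_wder (I : set R) (tau : R) (u u' : R -> R -> R) k : (forall t, 0 <= t <= tau -> I t) ->
  time_deriv (L2 L) nrm I u u' -> wder tau (fun t => ip (u t) (es k)) (fun t => ip (u' t) (es k)).
Proof.
move=> hI [h1 h2 h3]; apply: (quot_wder I) => // t It e e0.
have he := L2_es L_gt0 k; have n0 : 0 <= nrm (es k) by exact: norm2_ge0.
have e1 : 0 < e / (nrm (es k) + 1) by rewrite divr_gt0// ltr_wpDl.
have [d d0 hd] := within'_cvg0 _ _ _ (h3 t It) _ e1; exists d => // s Is st sd.
have l1 := h1 t It; have l2 := h1 s Is; have l3 := h2 t It; have l4 := L2B _ _ l2 l1; have l5 := L2Z (s - t)^-1 _ l4.
rewrite -ip2Bl// -ip2Zl// -ip2Bl//.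
apply: le_trans (ip2_CS _ _ (L2B _ _ l5 l3) he) _.
have := hd s Is st sd; rewrite ger0_norm ?norm2_ge0// => h.
apply: le_trans (ler_wpM2r n0 h) _.
by rewrite mulrAC -mulrA ger_pMr// ler_pdivrMr ?ltr_wpDl// mul1r lerDl.
Qed.

End evaluation.

(** * Uniqueness for the oscillator system *)

Section ode_uniqueness.
Context {R : realType}.
Variables (om : nat -> R) (F : (nat -> R) -> nat -> R).
Local Notation wt := (wt om).
Hypothesis om_gt0 : forall j, 0 < om j.
Hypothesis F_loc : forall r : R, exists2 C : R, 0 <= C & forall u v d,
  bnd (wt u) r -> bnd (wt v) r -> bnd (wt (u - v)) d -> bnd (F u - F v) (C * d).
Variables (tau : R) (U U' V V' : R -> nat -> R) (B : R).
Hypothesis tau_gt0 : 0 < tau.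
Hypothesis U_cont : forall j, {within `[0, tau], continuous U ^~ j}.
Hypothesis U'_cont : forall j, {within `[0, tau], continuous U' ^~ j}.
Hypothesis V_cont : forall j, {within `[0, tau], continuous V ^~ j}.
Hypothesis V'_cont : forall j, {within `[0, tau], continuous V' ^~ j}.
Hypothesis dU : forall j (t : R), 0 < t < tau -> is_derive t (1 : R) (U ^~ j) (U' t j).
Hypothesis dV : forall j (t : R), 0 < t < tau -> is_derive t (1 : R) (V ^~ j) (V' t j).
Hypothesis dU' : forall j (t : R), 0 < t < tau ->
  is_derive t (1 : R) (U' ^~ j) (F (U t) j - om j ^+ 2 * U t j).
Hypothesis dV' : forall j (t : R), 0 < t < tau ->
  is_derive t (1 : R) (V' ^~ j) (F (V t) j - om j ^+ 2 * V t j).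
Hypothesis U_bnd : forall t, 0 <= t <= tau -> bnd (wt (U t)) B.
Hypothesis V_bnd : forall t, 0 <= t <= tau -> bnd (wt (V t)) B.
Hypothesis UV0 : U 0 = V 0 /\ U' 0 = V' 0.

Lemma ode_unique : U tau = V tau.
Proof.
(* As in the Picard iteration, this [La] lets one application of the energy estimate divide the
   bound by 16; the starting bound comes from the energy bound B of both solutions. *)
have [C C0 hC] := F_loc B; pose La := 4 * (C + 1); have La0 : 0 < La by rewrite mulr_gt0// ltr_wpDl.
have h0 : 0 <= (0 : R) <= tau by rewrite lexx ltW.
have B0 := bnd_ge0 _ _ (U_bnd _ h0).
have ratio : C / La ^+ 2 <= 16^-1.
  rewrite ler_pdivrMr ?exprn_gt0// /La exprMn mulrA.
  have -> : 16^-1 * (4 : R) ^+ 2 = 1 by field.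
  by rewrite mul1r; nra.
have d1 j s : 0 < s < tau -> is_derive s (1 : R) (fun s => (U s - V s) j) ((U' s - V' s) j).
  by move=> sT; exact: (is_deriveB (dU j s sT) (dV j s sT)).
have d2 j s : 0 < s < tau -> is_derive s (1 : R) (fun s => (U' s - V' s) j)
    ((F (U s) - F (V s)) j - om j ^+ 2 * (U s - V s) j).
  move=> sT; apply: (is_derive_eq (is_deriveB (dU' j s sT) (dV' j s sT))); rewrite !fctE; ring.
have step q : 0 <= q -> (forall t, 0 <= t <= tau -> bnd (wt (U t - V t)) (q * expR (2 * La * t))) ->
    forall t, 0 <= t <= tau -> bnd (wt (U t - V t)) (q / 16 * expR (2 * La * t)).
  move=> q0 hq t tT; apply: (bnd_wt_en om _ (U' t - V' t)) => n.
  have h : en om (U t - V t) (U' t - V' t) n <= (0 + C * q / La ^+ 2) * expR (2 * La * t).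
    apply: (energy_le om tau (fun s => U s - V s) (fun s => U' s - V' s) (fun s => F (U s) - F (V s))
      (fun j => withinB _ _ _ (U_cont j) (V_cont j)) (fun j => withinB _ _ _ (U'_cont j) (V'_cont j))
      d1 d2 La 0 (C * q) La0 (mulr_ge0 C0 q0)) => //.
    - by move=> k; rewrite UV0.1 UV0.2 !subrr /en big1// => j _; rewrite expr0n mulr0 expr0n addr0.
    - move=> s /andP[s0 sT]; have sI : 0 <= s <= tau by rewrite !ltW.
      by rewrite -mulrA; apply: hC; [exact: U_bnd|exact: V_bnd|exact: hq].
  apply: le_trans h _; rewrite add0r; apply: ler_wpM2r; first exact: expR_ge0.
  by rewrite mulrAC [leRHS]mulrC; apply: ler_wpM2r.
have iter n : forall t, 0 <= t <= tau -> bnd (wt (U t - V t)) ((2 * B + 2 * B) / 16 ^+ n * expR (2 * La * t)).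
  elim: n => [|n ih] t tT.
    have [t0 _] := andP tT; rewrite expr0 divr1 wtB.
    apply: bnd_le (bndB _ _ _ _ (U_bnd t tT) (V_bnd t tT)).
    by rewrite ler_peMr ?addr_ge0 ?mulr_ge0// -expR0 ler_expR mulr_ge0// mulr_ge0// ltW.
  rewrite exprSr invfM mulrA; apply: step => //.
  by rewrite divr_ge0 ?exprn_ge0// addr_ge0 ?mulr_ge0.
have tT : 0 <= tau <= tau by rewrite lexx ltW.
apply/funext => j; apply/eqP; rewrite -subr_eq0.
have : (om j * (U tau - V tau) j) ^+ 2 <= 0.
  have c : (2 * B + 2 * B) / 16 ^+ n * expR (2 * La * tau) @[n --> \oo] --> 0.
    rewrite -[X in _ --> X](mul0r (expR (2 * La * tau))); apply: cvgM; last exact: cvg_cst.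
    exact: pow16_cvg0.
  rewrite -(cvg_lim (@Rhausdorff R) c); apply: limr_ge; first by apply/cvg_ex; exists 0.
  by apply: nearW => n; exact: (bnd_comp _ _ j (iter n tau tT)).
by rewrite exprn_even_le0//= mulf_eq0 gt_eqF//=.
Qed.

End ode_uniqueness.

(** * Existence and uniqueness of weak solutions *)

Section well_posedness.
Context {R : realType}.
Variables (L l M g E I J G K A Ec y0 f : R).
Hypothesis L_gt0 : 0 < L.
Hypothesis l_gt0 : 0 < l.
Hypothesis M_gt0 : 0 < M.
Hypothesis g_gt0 : 0 < g.
Hypothesis E_gt0 : 0 < E.
Hypothesis I_gt0 : 0 < I.
Hypothesis J_gt0 : 0 < J.
Hypothesis G_gt0 : 0 < G.
Hypothesis K_gt0 : 0 < K.
Hypothesis A_gt0 : 0 < A.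
Hypothesis Ec_gt0 : 0 < Ec.
Hypothesis f_gt0 : 0 < f.
Local Notation mu := (@lebesgue_measure R).
Local Notation D := (`]0, L[%classic : set R).
Local Notation ip := (ip2 L).
Local Notation es := (es (L := L)).
Local Notation cs := (cs (L := L)).
Local Notation kap := (kap (L := L)).
Local Notation sc := (sc (L := L)).
Local Notation fser := (fser (L := L)).
Local Notation coef := (coef (L := L)).
Local Notation psum := (psum (L := L)).
Local Notation om := (om (L := L) M l (E * I) (E * J) (G * K)).
Local Notation omw := (omw (L := L) M (E * I)).
Local Notation omth := (omth (L := L) M l (E * J) (G * K)).
Local Notation Omth := (Omth (L := L) M l (E * J) (G * K)).
Local Notation cw := (cw (L := L) M).
Local Notation cth := (cth (L := L) M l).
Local Notation aw := (aw (L := L) M).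
Local Notation ath := (ath (L := L) M l).
Local Notation stiff := (stiff L M g A Ec y0 f).
Local Notation weight := (weight L M g y0 f).
Local Notation yslope := (yslope L M g y0 f).
Local Notation FF := (FF (L := L) M l stiff (M * g) weight yslope).
Local Notation Fw := (Fw (L := L) l stiff (M * g) weight yslope).
Local Notation Fth := (Fth (L := L) l stiff weight yslope).
Local Notation zst := (zst L).
Local Notation wt := (wt om).
Implicit Types (u v w th phi psi : R -> R) (a b : nat -> R).

Let EI_gt0 : 0 < E * I := mulr_gt0 E_gt0 I_gt0.
Let EJ_gt0 : 0 < E * J := mulr_gt0 E_gt0 J_gt0.
Let GK_gt0 : 0 < G * K := mulr_gt0 G_gt0 K_gt0.
Let omp := om_gt0 L_gt0 M l _ _ _ M_gt0 l_gt0 EI_gt0 EJ_gt0 GK_gt0.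
Let cwp : 0 < cw := cw_gt0 L_gt0 M M_gt0.
Let cthp : 0 < cth := cth_gt0 L_gt0 M l M_gt0 l_gt0.
Let kp k : 0 < kap k := kap_gt0 L_gt0 k.
Let dW := der_weight L M g y0 f L_gt0 M_gt0 g_gt0 f_gt0.
Let cW' := cont_weight' L M g y0 f L_gt0 M_gt0 g_gt0 f_gt0.
Let dY := der_yslope L M g y0 f L_gt0 M_gt0 g_gt0 f_gt0.
Let cY := cont_ycurv (R := R) L M g f.

(* Coordinates of the pair (w, theta) with sine coefficients a and b. *)
Definition crd a b j : R := if odd j then b j./2 / cth else a j./2 / cw.

Lemma crd_even a b k : crd a b k.*2 = a k / cw.
Proof. by rewrite /crd odd_double doubleK. Qed.

Lemma crd_odd a b k : crd a b k.*2.+1 = b k / cth.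
Proof. by rewrite /crd /= odd_double /= uphalf_double. Qed.

Lemma om_even k : om k.*2 = omw k.
Proof. by rewrite /om odd_double doubleK. Qed.

Lemma om_odd k : om k.*2.+1 = omth k.
Proof. by rewrite /om /= odd_double /= uphalf_double. Qed.

Lemma FF_even (u : nat -> R) k : FF u k.*2 = cw * Fw (st (L := L) M l u) k.
Proof. by rewrite /FF odd_double doubleK. Qed.

Lemma FF_odd (u : nat -> R) k : FF u k.*2.+1 = cth * Fth (st (L := L) M l u) k.
Proof. by rewrite /FF /= odd_double /= uphalf_double. Qed.

Lemma aw_crd a b : aw (crd a b) = (fun k => kap k ^+ 2 * a k).
Proof.
apply/funext => k; rewrite /aw crd_even; have := cwp; move: cw => c c0; field.
by rewrite gt_eqF.
Qed.

Lemma ath_crd a b : ath (crd a b) = (fun k => kap k ^+ 2 * b k).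
Proof.
apply/funext => k; rewrite /ath crd_odd; have := cthp; move: cth => c c0; field.
by rewrite gt_eqF.
Qed.

Lemma st_crd w th : st (L := L) M l (crd (sc w) (sc th)) = zst w th.
Proof. by rewrite /st aw_crd ath_crd. Qed.

(** Comparison in the direction opposite to [Aw] and [Ath]: the energy norm is controlled by the
    coefficients of w_xx and theta_xx. *)
Definition Kwt : R := (Num.sqrt (E * I / M) / cw) ^+ 2 + (Omth / cth) ^+ 2.

Lemma bnd_wt_crd (u : nat -> R) C : bnd (aw u) C -> bnd (ath u) C -> bnd (wt u) (Kwt * C).
Proof.
move=> ha hb; rewrite mulrDl; apply: bnd_interleave.
  apply: bnd_dom ha => [|k]; first by rewrite divr_ge0 ?sqrtr_ge0.
  rewrite /evens /wt om_even /omw /aw; have := cwp; have := sqrtr_ge0 (E * I / M).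
  move: (Num.sqrt _) cw (kap k ^+ 2) (u k.*2) => s c x y s0 c0.
  rewrite !normrM (ger0_norm s0) (ger0_norm (ltW c0)) le_eqVlt; apply/orP; left; apply/eqP; field.
  by rewrite gt_eqF.
apply: bnd_dom hb => [|k]; first by rewrite divr_ge0 ?sqrtr_ge0.
rewrite /odds /wt om_odd /ath.
have := omth_le L_gt0 M l (E * J) (G * K) M_gt0 GK_gt0 k.
have := omth_gt0 L_gt0 M l _ _ M_gt0 l_gt0 EJ_gt0 GK_gt0 k.
have := cthp; have := sqr_ge0 (kap k).
move: (kap k ^+ 2) cth (u k.*2.+1) (omth k) Omth => x c y o O x0 c0 o0 h.
rewrite !normrM (ger0_norm (ltW o0)) (ger0_norm (ltW c0)) (ger0_norm x0).
have -> : O / c * (c * x * `|y|) = O * x * `|y| by field; rewrite gt_eqF.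
by apply: ler_wpM2r.
Qed.

Lemma sc_ae u v : L2 L u -> L2 L v -> (forall k, sc u k = sc v k) -> ae_eq mu D u v.
Proof.
move=> hu hv h; apply: ae_eqB0; apply: sine_complete => //.
by move=> j; rewrite ip2Bl// !scE// h subrr.
Qed.

Lemma ip_sc_cvg u v : L2 L u -> L2 L v ->
  \sum_(k < n) L / 2 * (sc u k * sc v k) @[n --> \oo] --> ip u v.
Proof.
move=> hu hv; have h1 : ip (psum (sc u) n) v @[n --> \oo] --> ip u v.
  by apply: L2_cvg_ip => //; under eq_fun do rewrite norm2BC; exact: psum_cvg.
suff <- : (fun n => ip (psum (sc u) n) v) = (fun n => \sum_(k < n) L / 2 * (sc u k * sc v k)) by [].
by apply/funext => n; rewrite ip2C ip_psumr// big_distrr.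
Qed.

Lemma global_coords (u0 u1 : nat -> R) C0 C1 : bnd (wt u0) C0 -> bnd u1 C1 ->
  exists U U' : R -> nat -> R,
  [/\ U 0 = u0 /\ U' 0 = u1,
   (forall j (t : R), 0 <= t -> is_derive t (1 : R) (U ^~ j) (U' t j)) /\
   (forall j (t : R), 0 <= t -> is_derive t (1 : R) (U' ^~ j) (FF (U t) j - om j ^+ 2 * U t j)),
   bnds (fun t => wt (U t)) /\ bcont (fun t => wt (U t)),
   bnds U' /\ bcont U' &
   bnds (fun t => FF (U t)) /\ bcont (fun t => FF (U t))].
Proof.
move=> h0 h1.
have FFl := FF_loc L_gt0 M l _ _ _ M_gt0 l_gt0 EI_gt0 EJ_gt0 GK_gt0 stiff (M * g) _ _ _ _ dW cW' dY cY.
have [CF hF] := FF_0 L_gt0 M l _ _ _ M_gt0 l_gt0 EI_gt0 EJ_gt0 GK_gt0 stiff (M * g) _ _ _ _ dW cW' dY cY.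
have st0 := stiff_ge0 L M g A Ec y0 f A_gt0 Ec_gt0.
have Pt := potential_taylor L_gt0 M l _ _ _ M_gt0 l_gt0 EI_gt0 EJ_gt0 GK_gt0 stiff (M * g) _ _ _ _ st0 dW dY.
have [c1 c10 Pc] := potential_coer L_gt0 M l _ _ _ M_gt0 l_gt0 EI_gt0 EJ_gt0 GK_gt0 stiff (M * g) _ yslope st0
  (weight_ge0 L M g y0 f L_gt0 M_gt0 g_gt0 f_gt0).
have u01 n : en om u0 u1 n <= C1 + C0.
  by rewrite /en big_split/=; apply: lerD; [exact: h1|exact: h0].
have [U [U' [B [Ui dU dU' UB Uc]]]] := global_sol om omp FF _ CF 0 c1 FFl hF Pt (lexx 0) c10 Pc u0 u1 _ u01.
have pt (t : R) : 0 <= t -> -1 < t by move=> t0; lra.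
have VB t : 0 <= t -> bnd (wt (U t)) B by move=> t0; apply: (bnd_wt_en om _ (U' t)) => n; exact: UB.
have V'B t : 0 <= t -> bnd (U' t) B by move=> t0; apply: (bnd_vel_en om (U t)) => n; exact: UB.
have Vc : bcont (fun t => wt (U t)).
  move=> t e t0 e0; have [d d0 hd] := Uc t e t0 e0; exists d => // s s0 sd.
  by rewrite -wtB; apply: (bnd_wt_en om _ (U' s - U' t)) => n; exact: hd.
exists U, U'; split => //.
- split=> j t t0; first by apply: dU; exact: pt.
  by have := dU' j t (pt t t0); rewrite pos_id.
- by split => // t t0; exists B; exact: VB.
- split; first by move=> t t0; exists B; exact: V'B.
  move=> t e t0 e0; have [d d0 hd] := Uc t e t0 e0; exists d => // s s0 sd.
  by apply: (bnd_vel_en om (U s - U t)) => n; exact: hd.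
have [C C_ge0 hC] := FFl B; split.
  have z0 : bnd (wt 0) B.
    by apply: (bnd_le _ 0); [exact: bnd_ge0 (VB 0 (lexx 0))|move=> n; rewrite big1// => j _; rewrite /wt mulr0 expr0n].
  move=> t t0; exists (2 * (C * B) + 2 * CF); rewrite -[FF _](subrK (FF 0)).
  by apply: bndD => //; apply: hC => //; [exact: VB|rewrite subr0; exact: VB].
move=> t e t0 e0; have e1 : 0 < e / (C + 1) by rewrite divr_gt0// ltr_wpDl.
have [d d0 hd] := Vc t _ t0 e1; exists d => // s s0 sd.
apply: (bnd_le _ (C * (e / (C + 1)))).
  by rewrite mulrCA ger_pMr// ler_pdivrMr ?ltr_wpDl// mul1r lerDl.
by apply: hC; [exact: VB|exact: VB|rewrite wtB; exact: hd].
Qed.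

Lemma ipH2_cvg u phi : H2H10 L u -> H2H10 L phi ->
  \sum_(k < n) L / 2 * (coef u k * coef phi k) @[n --> \oo] --> ipH2 L u phi.
Proof.
move=> hu hp; have h1 := H2H10_L2_2 _ hu; have h2 := H2H10_L2_2 _ hp.
have := ip_sc_cvg _ _ h1 h2.
suff -> : (fun n => \sum_(k < n) L / 2 * (sc (wD L (wD L u)) k * sc (wD L (wD L phi)) k)) =
  (fun n => \sum_(k < n) L / 2 * (coef u k * coef phi k)) by [].
apply/funext => n; apply: eq_bigr => k _.
have a := sc_wD2E L_gt0 _ k hu; have b := sc_wD2E L_gt0 _ k hp.
exact: (congr1 (fun z => L / 2 * z) (etrans (congr2 *%R a b) (mulrNN _ _))).
Qed.

Lemma ipH1_cvg u phi : H2H10 L u -> H2H10 L phi ->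
  \sum_(k < n) L / 2 * (sc u k * coef phi k) @[n --> \oo] --> ipH1 L u phi.
Proof.
move=> hu hp; have h1 := H2H10_L2_1 _ hu; have hb := coef_bnd L_gt0 _ hp.
have h2 := fser'_L2 L_gt0 _ _ hb; have h3 := H2H10_L2_1 _ hp.
have -> : ipH1 L u phi = ip (wD L u) (fser' (L := L) (coef phi)).
  by apply: ip2_ae => //; [exact: ae_eq_refl|exact: wD_coef].
have := ip_fser'_cvg L_gt0 _ _ _ h1 hb.
suff -> : (fun n => \sum_(k < n) coef phi k / kap k ^+ 2 * ip (wD L u) (kap k *: cs k)) =
  (fun n => \sum_(k < n) L / 2 * (sc u k * coef phi k)) by [].
apply/funext => n; apply: eq_bigr => k _; have k0 := kp k; have hcs := L2_cs L_gt0 k.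
by rewrite ip2Zr// ip_wD_cs// scE//; field; rewrite gt_eqF.
Qed.

Lemma accel_cvg (p'' : R -> nat -> R) (t : R) phi :
  (forall t : R, 0 <= t -> exists C, bnd (fun k => p'' t k / kap k ^+ 2) C) -> 0 <= t -> H2H10 L phi ->
  \sum_(k < n) L / 2 * (p'' t k / kap k ^+ 2 * coef phi k) @[n --> \oo] --> accel (L := L) p'' t phi.
Proof.
move=> hb t0 hp; have [h1 c1] := accelP L_gt0 p'' hb t t0; have h2 := H2H10_L2_2 _ hp.
have := ip_sc_cvg _ _ h1 h2.
suff -> : (fun n => \sum_(k < n) L / 2 * (sc (rf (L := L) (- (fun k => p'' t k / kap k ^+ 2))) k * sc (wD L (wD L phi)) k)) =
  (fun n => \sum_(k < n) L / 2 * (p'' t k / kap k ^+ 2 * coef phi k)) by [].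
apply/funext => n; apply: eq_bigr => k _.
have b := sc_wD2E L_gt0 _ k hp.
exact: (congr1 (fun z => L / 2 * z) (etrans (congr2 *%R (c1 k) b) (mulrNN _ _))).
Qed.

Lemma cw_sqr : cw ^+ 2 = 2 / (L * M).
Proof. by rewrite sqr_sqrtr// divr_ge0// mulr_ge0// ltW. Qed.

Lemma cth_sqr : cth ^+ 2 = 6 / (L * M * l ^+ 2).
Proof. by rewrite sqr_sqrtr// divr_ge0// mulr_ge0 ?sqr_ge0// mulr_ge0// ltW. Qed.

Lemma omw_sqr k : omw k ^+ 2 = E * I / M * kap k ^+ 4.
Proof. by rewrite exprMn sqr_sqrtr ?divr_ge0 ?(ltW EI_gt0) ?(ltW M_gt0)// -exprM. Qed.

Lemma omth_sqr k : omth k ^+ 2 = 3 / (M * l ^+ 2) * (E * J * kap k ^+ 4 + G * K * kap k ^+ 2).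
Proof.
rewrite sqr_sqrtr//; apply: mulr_ge0; first by rewrite divr_ge0// mulr_ge0 ?sqr_ge0// ltW.
by apply: addr_ge0; apply: mulr_ge0; rewrite ?exprn_ge0 ?(ltW (kp k)) ?(ltW EJ_gt0) ?(ltW GK_gt0).
Qed.

(** The scaling makes $M (L/2) c^2 = 1$, and the frequency term of the acceleration cancels the
    bending term. *)
Lemma term_w (c k X y q : R) : 0 < k -> c ^+ 2 = 2 / (L * M) ->
  M * (L / 2 * (c * (c * X - E * I / M * k ^+ 4 * y) / k ^+ 2 * q)) + E * I * (L / 2 * (k ^+ 2 * (c * y) * q)) =
  q / k ^+ 2 * X.
Proof.
move=> k0 hc; transitivity (M * L / 2 * c ^+ 2 * (q / k ^+ 2 * X)).
  by field; rewrite !gt_eqF.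
by rewrite hc; field; rewrite !gt_eqF.
Qed.

Lemma term_th (c k X y q : R) : 0 < k -> c ^+ 2 = 6 / (L * M * l ^+ 2) ->
  M * l ^+ 2 / 3 * (L / 2 * (c * (c * X - 3 / (M * l ^+ 2) * (E * J * k ^+ 4 + G * K * k ^+ 2) * y) / k ^+ 2 * q))
   + E * J * (L / 2 * (k ^+ 2 * (c * y) * q)) + G * K * (L / 2 * (c * y * q)) = q / k ^+ 2 * X.
Proof.
move=> k0 hc; transitivity (M * l ^+ 2 / 3 * L / 2 * c ^+ 2 * (q / k ^+ 2 * X)).
  by field; rewrite !gt_eqF.
by rewrite hc; field; rewrite !gt_eqF.
Qed.

Lemma cvg_comb3 (a b c X Y Z : R) (x y z : nat -> R) : x n @[n --> \oo] --> X ->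
  y n @[n --> \oo] --> Y -> z n @[n --> \oo] --> Z ->
  a * x n + b * y n + c * z n @[n --> \oo] --> a * X + b * Y + c * Z.
Proof.
by move=> hx hy hz; apply: cvgD; [apply: cvgD|]; apply: cvgM => //; exact: cvg_cst.
Qed.

(** Both sides of each weak equation are limits of partial sums in the sine coefficients of the test
    function, and these sums agree term by term by [term_w] and [term_th]. *)
Lemma existence (T : \bar R) (w0 th0 w1 th1 : R -> R) :
  H2H10 L w0 -> H2H10 L th0 -> L2 L w1 -> L2 L th1 ->
  exists w th : R -> R -> R, [/\ weak_solution L l M g E I J G K A Ec y0 f T w th,
    initial_conditions L T w w0 w1 & initial_conditions L T th th0 th1].
Proof.
move=> hw0 ht0 hw1 ht1.
have b1 : bnd (crd (sc w1) (sc th1)) ((cw^-1) ^+ 2 * (2 / L * ip w1 w1) + (cth^-1) ^+ 2 * (2 / L * ip th1 th1)).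
  have c1 : bnd (sc w1) (2 / L * ip w1 w1) by move=> n; exact: bessel.
  have c2 : bnd (sc th1) (2 / L * ip th1 th1) by move=> n; exact: bessel.
  apply: bnd_interleave.
    by move: (bndZ cw^-1 _ _ c1); congr (bnd _ _); apply/funext => k; rewrite /evens crd_even [RHS]mulrC.
  by move: (bndZ cth^-1 _ _ c2); congr (bnd _ _); apply/funext => k; rewrite /odds crd_odd [RHS]mulrC.
have b0 : exists C, bnd (wt (crd (sc w0) (sc th0))) C.
  have [C1 c1] : exists C, bnd (coef w0) C by eexists; exact: coef_bnd.
  have [C2 c2] : exists C, bnd (coef th0) C by eexists; exact: coef_bnd.
  have p1 : 0 <= C1 := bnd_ge0 _ _ c1; have p2 : 0 <= C2 := bnd_ge0 _ _ c2.
  exists (Kwt * (C1 + C2)); apply: bnd_wt_crd; rewrite ?aw_crd ?ath_crd.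
    by apply: bnd_le c1; rewrite lerDl.
  by apply: bnd_le c2; rewrite lerDr.
have [C0 {}b0] := b0.
have [U [U' [[U0 U'0] [dU dU'] [Ub Uc] [U'b U'c] [Fb Fc]]]] := global_coords _ _ _ _ b0 b1.
pose oi := fun k => k.*2.+1.
have hei (a : nat -> R) C : bnd a C -> bnd (fun k => a k.*2) C by exact: bnd_evens.
have hoi (a : nat -> R) C : bnd a C -> bnd (fun k => a (oi k)) C by exact: bnd_odds.
have sE : 0 < Num.sqrt (E * I / M) by rewrite sqrtr_gt0 divr_gt0.
have sT : 0 < Num.sqrt (3 * (E * J) / (M * l ^+ 2)).
  by rewrite sqrtr_gt0 divr_gt0 ?mulr_gt0 ?exprn_gt0.
have k1w k : kap k ^+ 2 <= (Num.sqrt (E * I / M))^-1 * om k.*2.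
  by rewrite om_even mulrA mulVf ?gt_eqF// mul1r.
have k2w k : om k.*2 <= Num.sqrt (E * I / M) * kap k ^+ 2 by rewrite om_even.
have k1t k : kap k ^+ 2 <= (Num.sqrt (3 * (E * J) / (M * l ^+ 2)))^-1 * om (oi k).
  by rewrite om_odd ler_pdivlMl//; exact: omth_ge.
have k2t k : om (oi k) <= Omth * kap k ^+ 2 by rewrite om_odd; exact: omth_le.
have e1 := ltW sE; have e2 : 0 <= (Num.sqrt (E * I / M))^-1 by rewrite invr_ge0.
have e3 : 0 <= (Num.sqrt (3 * (E * J) / (M * l ^+ 2)))^-1 by rewrite invr_ge0 ltW.
have e4 : 0 <= Omth by exact: sqrtr_ge0.
pose F t := FF (U t).
have pb := pos_c_bnd om U double cw _ omp hei e2 k1w Ub.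
have pc := pos_c_cont om U double cw _ omp hei e2 k1w Uc.
have vb := vel_c_bnd U' double cw hei U'b.
have vc := vel_c_cont U' double cw hei U'c.
have ab := acc_c_bnd L_gt0 om U F double cw _ omp hei e1 k2w Ub Fb.
have ac := acc_c_cont L_gt0 om U F double cw _ omp hei e1 k2w Uc Fc.
have dp := pos_c_der U U' double cw dU.
have dv := vel_c_der om U U' F double cw dU'.
have pb' := pos_c_bnd om U oi cth _ omp hoi e3 k1t Ub.
have pc' := pos_c_cont om U oi cth _ omp hoi e3 k1t Uc.
have vb' := vel_c_bnd U' oi cth hoi U'b.
have vc' := vel_c_cont U' oi cth hoi U'c.
have ab' := acc_c_bnd L_gt0 om U F oi cth _ omp hoi e4 k2t Ub Fb.
have ac' := acc_c_cont L_gt0 om U F oi cth _ omp hoi e4 k2t Uc Fc.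
have dp' := pos_c_der U U' oi cth dU.
have dv' := vel_c_der om U U' F oi cth dU'.
pose w := displ (L := L) (pos_c U double cw); pose th := displ (L := L) (pos_c U oi cth).
have wH t : 0 <= t -> H2H10 L (w t) by exact: displ_H2H10.
have tH t : 0 <= t -> H2H10 L (th t) by exact: displ_H2H10.
have scw t k : 0 <= t -> sc (w t) k = cw * U t k.*2 by move=> t0; exact: (sc_displ L_gt0 _ pb).
have sct t k : 0 <= t -> sc (th t) k = cth * U t k.*2.+1 by move=> t0; exact: (sc_displ L_gt0 _ pb').
have crdE t : 0 <= t -> crd (sc (w t)) (sc (th t)) = U t.
  move=> t0; apply/funext => j; rewrite /crd; have := odd_double_half j.
  have cancel (c x : R) : 0 < c -> c * x / c = x by move=> c0; rewrite mulrC mulKf ?gt_eqF.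
  case: ifP => oj hj; rewrite -[in RHS]hj.
  - by rewrite (sct _ _ t0) (cancel _ _ cthp).
  - by rewrite (scw _ _ t0) (cancel _ _ cwp).
have zE t : 0 <= t -> zst (w t) (th t) = st (L := L) M l (U t) by move=> t0; rewrite -st_crd crdE.
exists w, th; split.
- split; [exact: (XT_displ L_gt0 T _ _ _ pb vb ab pc vc ac dp dv)|exact: (XT_displ L_gt0 T _ _ _ pb' vb' ab' pc' vc' ac' dp' dv')|].
  exists (accel (L := L) (acc_c om U F double cw)), (accel (L := L) (acc_c om U F oi cth)).
  split; [exact: (displ_tt L_gt0 T _ _ _ pb vb ab vc ac dp dv)|exact: (displ_tt L_gt0 T _ _ _ pb' vb' ab' vc' ac' dp' dv')|].
  move=> phi psi hp hq t /ltW t0 _; split.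
    have r1 := rhs_w L l M g A Ec y0 f L_gt0 M_gt0 g_gt0 f_gt0 _ _ (wH t t0) (tH t t0) phi hp.
    have r2 := accel_cvg _ t _ ab t0 hp; have r3 := ipH2_cvg _ _ (wH t t0) hp.
    have r4 : M * \sum_(k < n) L / 2 * (acc_c om U F double cw t k / kap k ^+ 2 * coef phi k) +
      E * I * \sum_(k < n) L / 2 * (coef (w t) k * coef phi k) @[n --> \oo] -->
      M * accel (L := L) (acc_c om U F double cw) t phi + E * I * ipH2 L (w t) phi.
      by apply: cvgD; apply: cvgM => //; exact: cvg_cst.
    rewrite -(cvg_lim _ r4)// -(cvg_lim _ r1)//; congr (limn _); apply/funext => n.
    rewrite zE// !big_distrr -big_split/=; apply: eq_bigr => k _.
    rewrite /acc_c /F FF_even om_even omw_sqr /coef (scw _ _ t0).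
    exact: (term_w _ _ _ _ _ (kp k) cw_sqr).
  have r1 := rhs_th L l M g A Ec y0 f L_gt0 M_gt0 g_gt0 f_gt0 _ _ (wH t t0) (tH t t0) psi hq.
  have r2 := accel_cvg _ t _ ab' t0 hq; have r3 := ipH2_cvg _ _ (tH t t0) hq.
  have r5 := ipH1_cvg _ _ (tH t t0) hq.
  have r4 : M * l ^+ 2 / 3 * \sum_(k < n) L / 2 * (acc_c om U F oi cth t k / kap k ^+ 2 * coef psi k) +
    E * J * \sum_(k < n) L / 2 * (coef (th t) k * coef psi k) +
    G * K * \sum_(k < n) L / 2 * (sc (th t) k * coef psi k) @[n --> \oo] -->
    M * l ^+ 2 / 3 * accel (L := L) (acc_c om U F oi cth) t psi + E * J * ipH2 L (th t) psi + G * K * ipH1 L (th t) psi.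
    exact: (cvg_comb3 _ _ _ _ _ _ _ _ _ r2 r3 r5).
  rewrite -(cvg_lim _ r4)// -(cvg_lim _ r1)//; congr (limn _); apply/funext => n.
  rewrite zE// !big_distrr -!big_split/=; apply: eq_bigr => k _.
  rewrite /acc_c /F FF_odd om_odd omth_sqr /coef (sct _ _ t0).
  exact: (term_th _ _ _ _ _ (kp k) cth_sqr).
- split.
    rewrite /w /displ (_ : (fun k => _) = coef w0); first by apply: ae_eq_sym; exact: fser_coef.
    apply/funext => k; rewrite /pos_c U0 crd_even /coef; congr (_ * _).
    by rewrite mulrC divfK// gt_eqF.
  exists (veloc (L := L) (vel_c U' double cw)); first exact: (displ_deriv L_gt0 T _ _ pb vb vc dp).
  have [v1 v2] := velocP L_gt0 _ vb 0 (lexx 0).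
  by apply: sc_ae => // k; rewrite v2 /vel_c U'0 crd_even mulrC divfK// gt_eqF.
- split.
    rewrite /th /displ (_ : (fun k => _) = coef th0); first by apply: ae_eq_sym; exact: fser_coef.
    apply/funext => k; rewrite /pos_c U0 crd_odd /coef; congr (_ * _).
    by rewrite mulrC divfK// gt_eqF.
  exists (veloc (L := L) (vel_c U' oi cth)); first exact: (displ_deriv L_gt0 T _ _ pb' vb' vc' dp').
  have [v1 v2] := velocP L_gt0 _ vb' 0 (lexx 0).
  by apply: sc_ae => // k; rewrite v2 /vel_c U'0 crd_odd mulrC divfK// gt_eqF.
Qed.

Lemma kdelta_lim (y a : nat -> R) X k : (forall j, y j = a j * kdelta (L := L) k j) ->
  \sum_(j < n) y j @[n --> \oo] --> X -> a k * kap k ^+ 2 = X.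
Proof.
move=> h hX; have := cvg_kdelta (L := L) a k.
have -> : (fun n => \sum_(j < n) a j * kdelta (L := L) k j) = (fun n => \sum_(j < n) y j).
  by apply/funext => n; apply: eq_bigr => j _; rewrite h.
by move=> h'; exact: cvg_unique h' hX.
Qed.

(** Reads [term_w] backwards: the weak equation tested with one sine gives the acceleration of the
    scaled coordinate. *)
Lemma inv_w (c k X y W : R) : 0 < c -> 0 < k -> c ^+ 2 = 2 / (L * M) ->
  M * W + E * I * (L / 2 * (k ^+ 2 * y) * k ^+ 2) = X ->
  c * X - E * I / M * k ^+ 4 * (y / c) = 2 / L * W / c.
Proof.
move=> c0 k0 hc <-; apply: (mulIf (lt0r_neq0 c0)); rewrite divfK ?gt_eqF// mulrBl.
have -> : c * (M * W + E * I * (L / 2 * (k ^+ 2 * y) * k ^+ 2)) * c =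
  c ^+ 2 * (M * W + E * I * (L / 2 * (k ^+ 2 * y) * k ^+ 2)) by ring.
by rewrite hc; field; rewrite !gt_eqF.
Qed.

Lemma inv_th (c k X y W : R) : 0 < c -> 0 < k -> c ^+ 2 = 6 / (L * M * l ^+ 2) ->
  M * l ^+ 2 / 3 * W + E * J * (L / 2 * (k ^+ 2 * y) * k ^+ 2) + G * K * (L / 2 * y * k ^+ 2) = X ->
  c * X - 3 / (M * l ^+ 2) * (E * J * k ^+ 4 + G * K * k ^+ 2) * (y / c) = 2 / L * W / c.
Proof.
move=> c0 k0 hc <-; apply: (mulIf (lt0r_neq0 c0)); rewrite divfK ?gt_eqF// mulrBl.
set Y := _ + _ + _; have -> : c * Y * c = c ^+ 2 * Y by ring.
by rewrite hc /Y; field; rewrite !gt_eqF.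
Qed.

Section coordinates_of_solution.
Variables (T : \bar R) (tau : R) (w th : R -> R -> R) (w0 th0 w1 th1 : R -> R).
Hypothesis tau_gt0 : 0 < tau.
Hypothesis tauT : (tau%:E <= T)%E.
Hypothesis hsol : weak_solution L l M g E I J G K A Ec y0 f T w th.
Hypothesis hw : initial_conditions L T w w0 w1.
Hypothesis hth : initial_conditions L T th th0 th1.
Hypothesis hw0 : H2H10 L w0.
Hypothesis hth0 : H2H10 L th0.
Hypothesis hw1 : L2 L w1.
Hypothesis hth1 : L2 L th1.

Let U t := crd (sc (w t)) (sc (th t)).

Lemma time_intervalP t : 0 <= t <= tau -> time_interval T t.
Proof. by move=> /andP[t0 tT]; split => //; apply: le_trans tauT; rewrite lee_fin. Qed.

(** The equation involves the time derivative in the dual, the initial condition the one in L^2.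
    Tested with a sine, both are derivatives of the same scalar function and therefore agree at
    0. *)
Lemma sc_wder (v : R -> R -> R) (v0 v1 : R -> R) (vtt : R -> (R -> R) -> R) :
  XT L T v -> initial_conditions L T v v0 v1 -> L2 L v0 -> L2 L v1 -> Hstar_tt_deriv L T v vtt ->
  exists V : R -> nat -> R, [/\ forall k, wder tau (fun t => sc (v t) k) (fun t => V t k),
    forall k, wder tau (fun t => V t k) (fun t => 2 / L * vtt t (es k)),
    forall k, sc (v 0) k = sc v0 k & forall k, V 0 k = sc v1 k].
Proof.
move=> [[[vH _] _] _ _] [e0 [vt hvt e1]] hv0 hv1 [F h1 h2].
have zI : time_interval T 0 by apply: time_intervalP; rewrite lexx ltW.
exists (fun t k => 2 / L * F t (es k)); split=> k.
- exact: (wderZ tau (2 / L) _ _ (star_wder L_gt0 _ tau _ _ k time_intervalP h1)).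
- exact: (wderZ tau (2 / L) _ _ (star_wder L_gt0 _ tau _ _ k time_intervalP h2)).
- by congr (_ * _); apply: ip2_ae => //; [exact: H2H10_L2 (vH _ zI)|exact: ae_eq_refl].
- have hT : 0 <= (0 : R) <= tau by rewrite lexx ltW.
  rewrite -[RHS]/(2 / L * ip v1 (es k)); congr (_ * _).
  rewrite (wder_uniq _ _ _ _ _ tau_gt0 (star_wder L_gt0 _ tau _ _ k time_intervalP h1)
    (L2_wder L_gt0 _ tau _ _ k time_intervalP hvt) hT).
  case: hvt => _ hvt _; apply: ip2_ae => //; [exact: hvt|exact: ae_eq_refl].
Qed.

(** Being a choice, [wD] is linear only up to null sets, so the linearity of the second derivative
    is used through sine coefficients. *)
Lemma coef_dist (v : R -> R -> R) s t : H2H10 L (v s) -> H2H10 L (v t) ->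
  bnd (coef (v s) - coef (v t)) (2 / L * normH2 L (v s - v t) ^+ 2).
Proof.
move=> hs ht; have h := H2H10_lin L_gt0 (-1) _ _ ht hs; have [l1 _] := h.
have l2 := wD_L2 _ _ h; have e := wD_ae L_gt0 _ _ h.
have -> : v s - v t = -1 *: v t + v s by rewrite scaleN1r addrC.
move=> n; have := bessel L_gt0 _ n l2; rewrite -norm2_sqr.
apply: le_trans; rewrite le_eqVlt; apply/orP; left; apply/eqP; apply: eq_bigr => k _.
transitivity ((- (coef (v s) k - coef (v t) k)) ^+ 2); first by rewrite sqrrN.
congr (_ ^+ 2); have -> : sc (wD L (wD L (-1 *: v t + v s))) k =
    sc (-1 *: wD L (wD L (v t)) + wD L (wD L (v s))) k.
  by congr (_ * _); apply: ip2_ae => //; exact: ae_eq_refl.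
have l3 := H2H10_L2_2 _ ht; have l4 := H2H10_L2_2 _ hs.
have a := sc_wD2E L_gt0 _ k ht; have b := sc_wD2E L_gt0 _ k hs.
rewrite (sc_lin L_gt0 _ _ _ k l3 l4); apply: esym.
apply: (etrans (congr2 (fun x y => -1 * x + y) a b)).
by move: (coef (v s) k) (coef (v t) k) => x y; ring.
Qed.

(** The H^2 norm is continuous in time, hence bounded on the compact [0, tau]; this supplies the
    energy bound from which uniqueness starts. *)
Lemma coef_bounded (v : R -> R -> R) : XT L T v ->
  exists C, forall t, 0 <= t <= tau -> bnd (coef (v t)) C.
Proof.
move=> [[[vH vc] _] _ _].
pose q t := Num.sqrt (sqn (coef (v t))).
have hv t : 0 <= t <= tau -> H2H10 L (v t) by move=> tT; apply: vH; exact: time_intervalP.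
have hb t : 0 <= t <= tau -> bnd (coef (v t)) (sqn (coef (v t))).
  by move=> tT; exact: bnd_sqn (coef_bnd L_gt0 _ (hv t tT)).
have lip s t : 0 <= s <= tau -> 0 <= t <= tau ->
    `|q s - q t| <= Num.sqrt (2 / L * normH2 L (v s - v t) ^+ 2).
  move=> sT tT; have hd := coef_dist v s t (hv s sT) (hv t tT).
  apply/ler_normlP; split; rewrite /q.
    rewrite opprB lerBlDl; exact: (sqn_mink _ _ _ _ (hb s sT) hd).
  rewrite lerBlDl; apply: (sqn_mink _ _ _ _ (hb t tT)).
  have -> : coef (v t) - coef (v s) = - (coef (v s) - coef (v t)) by rewrite opprB.
  exact: bndN.
have cq : {within `[0, tau], continuous q}.
  apply/subspace_continuousP => t; rewrite /= in_itv/= => tT; apply/cvgrPdist_le => e e0.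
  have k0 : 0 < Num.sqrt (2 / L) by rewrite sqrtr_gt0 divr_gt0.
  have [d d0 hd] := within_cvg0 _ _ _ (vc t (time_intervalP t tT)) _ (divr_gt0 e0 k0).
  rewrite near_withinE; apply/nbhs_ballP; exists d => // s; rewrite /ball/= distrC => sd.
  rewrite in_itv/= => sT; rewrite distrC; apply: le_trans (lip s t sT tT) _.
  rewrite sqrtrM ?divr_ge0 ?(ltW L_gt0)// sqrtr_sqr mulrC -ler_pdivlMr//.
  by apply: hd => //; exact: time_intervalP.
have [c cT hc] := EVT_max (ltW tau_gt0) cq.
exists (q c ^+ 2) => t tT; apply: bnd_le (hb t tT).
have hq := sqn_ge0 _ _ (coef_bnd L_gt0 _ (hv t tT)).
rewrite -(sqr_sqrtr hq) ler_pXn2r ?nnegrE ?sqrtr_ge0//.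
by apply: hc; rewrite in_itv.
Qed.

Lemma solution_coords : exists U' : R -> nat -> R,
  [/\ U 0 = crd (sc w0) (sc th0) /\ U' 0 = crd (sc w1) (sc th1),
   (forall j, {within `[0, tau], continuous U ^~ j}) /\ (forall j, {within `[0, tau], continuous U' ^~ j}),
   forall j (t : R), 0 < t < tau -> is_derive t (1 : R) (U ^~ j) (U' t j),
   forall j (t : R), 0 < t < tau -> is_derive t (1 : R) (U' ^~ j) (FF (U t) j - om j ^+ 2 * U t j) &
   exists C, forall t, 0 <= t <= tau -> bnd (wt (U t)) C].
Proof.
have [hX hX' [wtt [thtt [d1 d2 heq]]]] := hsol.
have [V [v1 v2 v3 v4]] := sc_wder _ _ _ _ hX hw (H2H10_L2 _ hw0) hw1 d1.
have [V' [v1' v2' v3' v4']] := sc_wder _ _ _ _ hX' hth (H2H10_L2 _ hth0) hth1 d2.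
have wH t : 0 <= t <= tau -> H2H10 L (w t).
  by move=> tT; case: hX => [[[h _] _] _ _]; apply: h; exact: time_intervalP.
have tH t : 0 <= t <= tau -> H2H10 L (th t).
  by move=> tT; case: hX' => [[[h _] _] _ _]; apply: h; exact: time_intervalP.
pose U' t := crd (V t) (V' t).
pose U'' t := crd (fun k => 2 / L * wtt t (es k)) (fun k => 2 / L * thtt t (es k)).
have dcrd (a a' b b' : R -> nat -> R) : (forall k, wder tau (fun t => a t k) (fun t => a' t k)) ->
    (forall k, wder tau (fun t => b t k) (fun t => b' t k)) ->
    forall j, wder tau (fun t => crd (a t) (b t) j) (fun t => crd (a' t) (b' t) j).
  have mC (c : R) (x : R -> R) : (fun t => x t * c) = (fun t => c * x t) by apply/funext => ?; rewrite mulrC.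
  move=> ha hb j; rewrite /crd; case: (odd j).
    rewrite (mC _ (fun t => b t j./2)) (mC _ (fun t => b' t j./2)); exact: wderZ.
  rewrite (mC _ (fun t => a t j./2)) (mC _ (fun t => a' t j./2)); exact: wderZ.
have D1 j : wder tau (U ^~ j) (U' ^~ j).
  exact: (dcrd (fun t => sc (w t)) V (fun t => sc (th t)) V' v1 v1' j).
have D2 j : wder tau (U' ^~ j) (U'' ^~ j).
  exact: (dcrd V (fun t k => 2 / L * wtt t (es k)) V' (fun t k => 2 / L * thtt t (es k)) v2 v2' j).
exists U'; split.
- split; first by rewrite /U; congr (crd _ _); apply/funext => k; [exact: v3|exact: v3'].
  by rewrite /U'; congr (crd _ _); apply/funext => k; [exact: v4|exact: v4'].
- by split=> j; [exact: wder_within (D1 j)|exact: wder_within (D2 j)].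
- by move=> j t tT; exact: (wder_derive _ _ _ _ (D1 j)).
- move=> j t tT; have [t0 tT'] := andP tT; have tT2 : 0 <= t <= tau by rewrite !ltW.
  suff -> : FF (U t) j - om j ^+ 2 * U t j = U'' t j by exact: (wder_derive _ _ _ _ (D2 j)).
  have tlt : (t%:E < T)%E by apply: lt_le_trans tauT; rewrite lte_fin.
  have stE : st (L := L) M l (U t) = zst (w t) (th t) by exact: st_crd.
  have [wt' tt'] := (wH t tT2, tH t tT2).
  (* Both equations are tested with the same sine; the parity of j decides which of them determines
     the coordinate. *)
  have := odd_double_half j; set k := j./2; have hk := es_H2H10 L_gt0 k.
  have [e1 e2] := heq _ _ hk hk t t0 tlt; move: e1 e2.
  have r1 := rhs_w L l M g A Ec y0 f L_gt0 M_gt0 g_gt0 f_gt0 _ _ wt' tt' _ hk.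
  have r2 := rhs_th L l M g A Ec y0 f L_gt0 M_gt0 g_gt0 f_gt0 _ _ wt' tt' _ hk.
  have r3 := ipH2_cvg _ _ wt' hk; have r4 := ipH2_cvg _ _ tt' hk; have r5 := ipH1_cvg _ _ tt' hk.
  rewrite coef_es// in r1 r2 r3 r4 r5; rewrite -stE in r1 r2.
  have swap (x y z : R) : x / y * z = z / y * x by rewrite mulrAC (mulrC x) mulrAC.
  have s1 := kdelta_lim _ (fun j => Fw (st (L := L) M l (U t)) j / kap j ^+ 2) _ k (fun i => swap _ _ _) r1.
  have s2 := kdelta_lim _ (fun j => Fth (st (L := L) M l (U t)) j / kap j ^+ 2) _ k (fun i => swap _ _ _) r2.
  have s3 := kdelta_lim _ (fun j => L / 2 * coef (w t) j) _ k (fun i => mulrA _ _ _) r3.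
  have s4 := kdelta_lim _ (fun j => L / 2 * coef (th t) j) _ k (fun i => mulrA _ _ _) r4.
  have s5 := kdelta_lim _ (fun j => L / 2 * sc (th t) j) _ k (fun i => mulrA _ _ _) r5.
  have k0 := kp k; have k2 : kap k ^+ 2 != 0 by rewrite gt_eqF// exprn_gt0.
  rewrite -s1 -s2 -s3 -s4 -s5 => e1 e2.
  rewrite divfK// in e1; rewrite divfK// in e2.
  case: (odd j); rewrite ?add1n ?add0n => <-.
    rewrite FF_odd om_odd omth_sqr /U /U'' !crd_odd; exact: (inv_th _ _ _ _ _ cthp k0 cth_sqr e2).
  rewrite FF_even om_even omw_sqr /U /U'' !crd_even; exact: (inv_w _ _ _ _ _ cwp k0 cw_sqr e1).
- have [C hC] := coef_bounded _ hX; have [C' hC'] := coef_bounded _ hX'.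
  have h0 : 0 <= (0 : R) <= tau by rewrite lexx ltW.
  have C0 := bnd_ge0 _ _ (hC _ h0); have C'0 := bnd_ge0 _ _ (hC' _ h0).
  exists (Kwt * (C + C')) => t tT; apply: bnd_wt_crd; rewrite ?aw_crd ?ath_crd.
    by apply: bnd_le (hC t tT); rewrite lerDl.
  by apply: bnd_le (hC' t tT); rewrite lerDr.
Qed.

End coordinates_of_solution.

Lemma uniqueness (T : \bar R) (w th w' th' : R -> R -> R) (w0 th0 w1 th1 : R -> R) :
  H2H10 L w0 -> H2H10 L th0 -> L2 L w1 -> L2 L th1 ->
  weak_solution L l M g E I J G K A Ec y0 f T w th ->
  initial_conditions L T w w0 w1 -> initial_conditions L T th th0 th1 ->
  weak_solution L l M g E I J G K A Ec y0 f T w' th' ->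
  initial_conditions L T w' w0 w1 -> initial_conditions L T th' th0 th1 ->
  forall t, time_interval T t -> ae_eq mu D (w' t) (w t) /\ ae_eq mu D (th' t) (th t).
Proof.
move=> hw0 hth0 hw1 hth1 hsol hw hth hsol' hw' hth' t tT.
have [t0 tT'] := tT.
(* [ode_unique] works on an interval of positive length; at t = 0 both solutions equal the initial
   data a.e. *)
have [->|tn0] := eqVneq t 0.
  have [[a _] [b _]] := (hw, hth); have [[a' _] [b' _]] := (hw', hth').
  by split; [exact: (ae_eq_trans a' (ae_eq_sym a))|exact: (ae_eq_trans b' (ae_eq_sym b))].
have t_gt0 : 0 < t by rewrite lt_def tn0.
have [V [[i1 i1'] [c1 c1'] d1 d1' [C hC]]] := solution_coords T t w th w0 th0 w1 th1 t_gt0 tT' hsol hw hth hw0 hth0 hw1 hth1.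
have [V' [[i2 i2'] [c2 c2'] d2 d2' [C' hC']]] := solution_coords T t w' th' w0 th0 w1 th1 t_gt0 tT' hsol' hw' hth' hw0 hth0 hw1 hth1.
have FFl := FF_loc L_gt0 M l _ _ _ M_gt0 l_gt0 EI_gt0 EJ_gt0 GK_gt0 stiff (M * g) _ _ _ _ dW cW' dY cY.
have h0 : 0 <= (0 : R) <= t by rewrite lexx ltW.
have C0 := bnd_ge0 _ _ (hC _ h0); have C'0 := bnd_ge0 _ _ (hC' _ h0).
have B1 s : 0 <= s <= t -> bnd (wt (crd (sc (w s)) (sc (th s)))) (C + C').
  by move=> sT; apply: bnd_le (hC s sT); rewrite lerDl.
have B2 s : 0 <= s <= t -> bnd (wt (crd (sc (w' s)) (sc (th' s)))) (C + C').
  by move=> sT; apply: bnd_le (hC' s sT); rewrite lerDr.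
have eq : crd (sc (w t)) (sc (th t)) = crd (sc (w' t)) (sc (th' t)).
  apply: (ode_unique om FF omp FFl t (fun s => crd (sc (w s)) (sc (th s))) V
    (fun s => crd (sc (w' s)) (sc (th' s))) V' (C + C') t_gt0 c1 c1' c2 c2' d1 d2 d1' d2' B1 B2).
  by split; [rewrite i1 i2|rewrite i1' i2'].

have hH (v : R -> R -> R) : XT L T v -> L2 L (v t) by move=> [[[h _] _] _ _]; exact: H2H10_L2 (h t tT).
have [x1 x2 _] := hsol; have [x1' x2' _] := hsol'.
have div_inj (c x y : R) : 0 < c -> x / c = y / c -> x = y.
  by move=> c0; apply: mulIf; rewrite invr_neq0// gt_eqF.
split; apply: sc_ae; do ?exact: hH; move=> k.
- by have := congr1 (fun u : nat -> R => u k.*2) eq; rewrite !crd_even => /(div_inj _ _ _ cwp) ->.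
- by have := congr1 (fun u : nat -> R => u k.*2.+1) eq; rewrite !crd_odd => /(div_inj _ _ _ cthp) ->.
Qed.

End well_posedness.
Theorem theorem1 (R : realType) (L l M g E I J G K A Ec y0 f : R)
  (hL : 0 < L) (hl : 0 < l) (hM : 0 < M) (hg : 0 < g) (hE : 0 < E) (hI : 0 < I)
  (hJ : 0 < J) (hG : 0 < G) (hK : 0 < K) (hA : 0 < A) (hEc : 0 < Ec)
  (hy0 : 0 < y0) (hf : 0 < f) (T : \bar R) (hT : (0 < T)%E)
  (w0 th0 w1 th1 : R -> R)
  (hw0 : H2H10 L w0) (hth0 : H2H10 L th0) (hw1 : L2 L w1) (hth1 : L2 L th1) :
  let sol w th :=
    [/\ weak_solution L l M g E I J G K A Ec y0 f T w th,
        initial_conditions L T w w0 w1 & initial_conditions L T th th0 th1] in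
  exists w th : R -> R -> R, sol w th /\
    forall w' th' : R -> R -> R, sol w' th' ->
      forall t : R, time_interval T t ->
        ae_eq (@lebesgue_measure R) `]0, L[%classic (w' t) (w t) /\
        ae_eq (@lebesgue_measure R) `]0, L[%classic (th' t) (th t).
Proof.
move=> sol.
have [w [th [h1 h2 h3]]] := existence L l M g E I J G K A Ec y0 f hL hl hM hg hE hI hJ hG hK hA hEc hf
  T w0 th0 w1 th1 hw0 hth0 hw1 hth1.
exists w, th; split=> // w' th' [h1' h2' h3'].
exact: (uniqueness L l M g E I J G K A Ec y0 f hL hl hM hg hE hI hJ hG hK hf
  T w th w' th' w0 th0 w1 th1).
Qed.
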